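(* Let $\tau=(\tau_1,\dots,\tau_m)$ with $\tau_k\ge0$ be fixed (with $\tau_k>0$ and $\nu_k\neq0$ for at least one $k$) and set $x=\frac1{\dim\mathfrak g}\sum_{k=1}^m\tau_kc_2(\nu_k)$. As $\epsilon\to0$ with $N_k=\tau_k/\epsilon$, the Plancherel measure $$p^{(N)}_\lambda(0)=\frac{m_\lambda(\{V_{\nu_k}\},\{N_k\})\,\dim V_\lambda}{\prod_k(\dim V_{\nu_k})^{N_k}},$$ with $\lambda=\sqrt{\frac{x}{\epsilon}}\,a$, converges weakly to the probability measure $p(a)\,da$ on the closed dominant Weyl chamber $\mathfrak h^*_{\ge0}$ with density $$p(a)=\frac{\sqrt{\det B}}{(2\pi)^{r/2}}\prod_{\alpha\in\Delta_+}\frac{(a,\alpha)^2}{(\rho,\alpha)}\;e^{-\frac12\sum_{b,c}a_bB_{bc}a_c}.$$ That is, for every bounded continuous function $h$ on $\mathfrak h^*_{\ge0}$ and every sequence $\epsilon_n>0$, $\epsilon_n\to0$, such that $N_k=\tau_k/\epsilon_n$ are integers for all $k,n$, $$\sum_\lambda h\Big(\sqrt{\tfrac{\epsilon_n}{x}}\,\lambda\Big)p^{(N)}_\lambda(0)\ \longrightarrow\ \int_{\mathfrak h^*_{\ge0}}h(a)\,p(a)\,da_1\cdots da_r .$$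
   Context: $\mathfrak g$ is a simple (complex, finite-dimensional) Lie algebra of rank $r$; $\mathfrak h^*_{\mathbb R}$ is the real span of the roots; $(\cdot,\cdot)$ is the Killing form (and the induced form on $\mathfrak h^*_{\mathbb R}$). $\alpha_1,\dots,\alpha_r$ are the simple roots, $\Delta_+$ the positive roots, $\rho=\frac12\sum_{\alpha\in\Delta_+}\alpha$. Elements of $\mathfrak h^*_{\mathbb R}\simeq\mathbb R^r$ are written in the basis of simple roots, $a=\sum_ba_b\alpha_b$, and $da=da_1\cdots da_r$ is Lebesgue measure in these coordinates; $B_{ab}=(\alpha_a,\alpha_b)$. $\mathfrak h^*_{\ge0}=\{a:(a,\alpha_b)\ge0,\ b=1,\dots,r\}$ is the closed dominant Weyl chamber. $V_\lambda$ is the irreducible finite-dimensional module with highest weight $\lambda$; $\nu_1,\dots,\nu_m$ are fixed dominant integral weights; $m_\lambda(\{V_{\nu_k}\},\{N_k\})$ is the multiplicity of $V_\lambda$ in $\bigotimes_{k=1}^mV_{\nu_k}^{\otimes N_k}$; the sum over $\lambda$ runs over highest weights of irreducible components of this tensor product. $c_2(\nu)$ is the scalar by which the Casimir element $c_2=\sum_{i,j}Q^{ij}e_ie_j$ acts on $V_\nu$, where $(e_i)$ is a basis of $\mathfrak g$, $Q_{ij}=\mathrm{tr}_{\mathrm{ad}}(e_ie_j)$ is the Killing form and $(Q^{ij})$ is its inverse matrix. *)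

(* Defs.v *)
From HB Require Import structures.
From mathcomp Require Import all_boot all_order all_algebra.
From mathcomp Require Import ring mxtens complex.
From mathcomp Require Import all_classical all_reals all_analysis.
Set Implicit Arguments.
Unset Strict Implicit.
Unset Printing Implicit Defensive.
Import Order.TTheory GRing.Theory Num.Theory.
Import numFieldNormedType.Exports.
Local Open Scope classical_set_scope.
Local Open Scope ring_scope.

Definition rV_display : measure_display. Proof. exact. Qed.

Section measurable_rV.
Variables (R : realType) (n : nat).

Let coord (i : 'I_n) (v : 'rV[R]_n) : measurableTypeR R := v ord0 i.

Let rV_set0 : g_sigma_preimage coord set0.
Proof. exact: sigma_algebra0. Qed.

Let rV_setC A : g_sigma_preimage coord A -> g_sigma_preimage coord (~` A).
Proof. exact: sigma_algebraC. Qed.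

Let rV_bigcup (F : _^nat) : (forall i, g_sigma_preimage coord (F i)) ->
  g_sigma_preimage coord (\bigcup_i F i).
Proof. exact: sigma_algebra_bigcup. Qed.

HB.instance Definition _ := @isMeasurable.Build rV_display
  'rV[R]_n (g_sigma_preimage coord) rV_set0 rV_setC rV_bigcup.

Lemma measurable_rV_coord (i : 'I_n) :
  measurable_fun [set: 'rV[R]_n] (fun v => v ord0 i : measurableTypeR R).
Proof.
move=> _ Y mY; rewrite setTI; apply: sub_sigma_algebra => /=.
rewrite -bigcup_seq/=; exists i => /=; first by rewrite mem_index_enum.
by exists Y => //; rewrite setTI.
Qed.

Lemma measurable_fun_rV d (T : measurableType d) (f : T -> 'rV[R]_n) :
  (forall i,
    measurable_fun [set: T] (fun x => f x ord0 i : measurableTypeR R)) ->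
  measurable_fun [set: T] f.
Proof.
move=> mf _ Y; rewrite setTI => mY.
pose S := [set A : set 'rV[R]_n | measurable (f @^-1` A)].
suff: g_sigma_preimage coord `<=` S by apply.
apply: smallest_sub.
  split => //=; first by rewrite /S /= preimage_set0.
  - by move=> A; rewrite /S /= setTD preimage_setC => /measurableC.
  - by move=> F mF; rewrite /S /= preimage_bigcup; exact: bigcupT_measurable.
rewrite -bigcup_seq; apply: bigcup_sub => i _ A [B mB <-].
by rewrite /S /= setTI -comp_preimage -[X in measurable X]setTI; exact: mf.
Qed.

End measurable_rV.

Section lebesgue_rV.
Context {R : realType}.

Definition rV_cons n (p : measurableTypeR R * 'rV[R]_n) : 'rV[R]_n.+1 :=
  row_mx (p.1%:M : 'rV[R]_1) p.2.

(* image of the product measure under (x, v) |-> (x, v_0, ..., v_(n-1)) *)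
Fixpoint lebesgue_rV n : set 'rV[R]_n -> \bar R :=
  match n with
  | 0 => @dirac _ 'rV[R]_0 0 R
  | n.+1 => pushforward (lebesgue_measure \x @lebesgue_rV n)%E (@rV_cons n)
  end.

Lemma measurable_rV_cons n : measurable_fun setT (@rV_cons n).
Proof.
apply: measurable_fun_rV => i; have [j ->|j ->] := split_ordP (i : 'I_(1 + n)).
- rewrite (_ : (fun _ => _) = fst); first exact: measurable_fst.
  apply/funext => p; rewrite /rV_cons (row_mxEl (p.1%:M : 'rV_1)).
  by rewrite mxE (ord1 j) eqxx.
- rewrite (_ : (fun _ => _) =
    (fun v : 'rV[R]_n => v ord0 j : measurableTypeR R) \o snd).
    exact: measurableT_comp (measurable_rV_coord j) measurable_snd.
  by apply/funext => p; rewrite /rV_cons (row_mxEr (p.1%:M : 'rV_1)).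
Qed.

Section cons_measure.
Variables (n : nat) (m : {sigma_finite_measure set 'rV[R]_n -> \bar R}).

Definition cons_measure : set 'rV[R]_n.+1 -> \bar R :=
  pushforward (lebesgue_measure \x m)%E (@rV_cons n).

Let mf := @measurable_rV_cons n.

Let cons_measure0 : cons_measure set0 = 0%E.
Proof. exact: measure0. Qed.

Let cons_measure_ge0 A : (0 <= cons_measure A)%E.
Proof. exact: measure_ge0. Qed.

Let cons_measure_sigma_additive : semi_sigma_additive cons_measure.
Proof. exact: measure_semi_sigma_additive. Qed.

HB.instance Definition _ := isMeasure.Build _ _ _ cons_measure
  cons_measure0 cons_measure_ge0 cons_measure_sigma_additive.

Let cons_measure_sigma_finite : sigma_finite setT cons_measure.
Proof.
have /sigma_finiteP[F [FT ndF Foo]] := sigma_finiteT (@lebesgue_measure R).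
have /sigma_finiteP[G [GT ndG Goo]] := sigma_finiteT m.
pose uncons (v : 'rV[R]_n.+1) : (measurableTypeR R * 'rV[R]_n)%type :=
  (v ord0 ord0, rsubmx (v : 'rV_(1 + n))).
have consK : cancel (@rV_cons n) uncons.
  move=> [x v]; rewrite /uncons /rV_cons (row_mxKr (x%:M : 'rV_1)); congr pair.
  transitivity ((row_mx (x%:M : 'rV_1) v) ord0 (lshift n ord0)).
    by congr (_ _ _); exact: val_inj.
  by rewrite row_mxEl mxE.
have unconsK : cancel uncons (@rV_cons n).
  move=> v; rewrite /uncons /rV_cons -[RHS](@hsubmxK _ _ 1 n).
  apply: (congr1 (fun a : 'rV_1 => row_mx a (rsubmx (v : 'rV_(1 + n))))).
  by apply/rowP => i; rewrite !mxE (ord1 i) eqxx mulr1n; congr (v _ _);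
    exact: val_inj.
have muncons : measurable_fun setT uncons.
  apply: measurable_fun_pair; first exact: measurable_rV_coord.
  apply: measurable_fun_rV => i; under eq_fun do rewrite /= mxE.
  exact: measurable_rV_coord.
exists (fun k => uncons @^-1` (F k `*` G k)).
  rewrite -preimage_bigcup [X in _ @^-1` X](_ : _ = setT) ?preimage_setT//.
  rewrite -subTset => -[x v] _.
  have [i _ Fix] : (\bigcup_k F k) x by rewrite -FT.
  have [j _ Gjv] : (\bigcup_k G k) v by rewrite -GT.
  exists (maxn i j) => //; split => /=.
  - by move: x Fix; exact/subsetPset/ndF/leq_maxl.
  - by move: v Gjv; exact/subsetPset/ndG/leq_maxr.
move=> k; have [mFk Fkoo] := Foo k; have [mGk Gkoo] := Goo k; split.
  rewrite -[X in measurable X]setTI; apply: muncons => //.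
  exact: measurableX.
rewrite /cons_measure /pushforward -comp_preimage (_ : _ \o _ = id).
  by rewrite preimage_id product_measure1E// lte_mul_pinfty// ge0_fin_numE.
by apply/funext => p /=; rewrite consK.
Qed.

HB.instance Definition _ := Measure_isSigmaFinite.Build _ _ _ cons_measure
  cons_measure_sigma_finite.

End cons_measure.

Lemma lebesgue_rV_sfm n :
  exists m : {sigma_finite_measure set 'rV[R]_n -> \bar R},
    @lebesgue_rV n = m.
Proof.
elim: n => [|n [m mE]] /=; first by exists (@dirac _ 'rV[R]_0 0 R).
by rewrite mE; exists (cons_measure m).
Qed.

Section instances.
Variable n : nat.
Let l0 : @lebesgue_rV n set0 = 0%E.
Proof. by have [m ->] := lebesgue_rV_sfm n. Qed.
Let l_ge0 A : (0 <= @lebesgue_rV n A)%E.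
Proof. by have [m ->] := lebesgue_rV_sfm n. Qed.
Let l_sigma_additive : semi_sigma_additive (@lebesgue_rV n).
Proof.
by have [m ->] := lebesgue_rV_sfm n; exact: measure_semi_sigma_additive.
Qed.
HB.instance Definition _ := isMeasure.Build _ _ _ (@lebesgue_rV n)
  l0 l_ge0 l_sigma_additive.
Let l_sigma_finite : sigma_finite setT (@lebesgue_rV n).
Proof. by have [m ->] := lebesgue_rV_sfm n; exact: sigma_finiteT. Qed.
HB.instance Definition _ := Measure_isSigmaFinite.Build _ _ _ (@lebesgue_rV n)
  l_sigma_finite.
End instances.
End lebesgue_rV.

Arguments lebesgue_rV {R} n _.

HB.mixin Record isLieAlgebra (F : fieldType) g of Vector F g := {
  lie : g -> g -> g;
  lie_linearl : forall y, linear (lie^~ y);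
  lie_linearr : forall x, linear (lie x);
  liexx : forall x, lie x x = 0;
  lie_jacobi : forall x y z,
    lie x (lie y z) + lie y (lie z x) + lie z (lie x y) = 0
}.

#[short(type="lieAlgebraType")]
HB.structure Definition LieAlgebra (F : fieldType) :=
  {g of isLieAlgebra F g & Vector F g}.

Section LieTheory.
Context {F : fieldType} {g : lieAlgebraType F}.

Definition lie_ideal (I : {vspace g}) : Prop :=
  forall x y, y \in I -> lie x y \in I.

Definition ad (x : g) : 'End(g) := linfun (lie x).

Definition killing (x y : g) : F :=
  \tr (passmx.mxof (vbasis {:g}) (vbasis {:g}) (ad x \o ad y)%VF).

(* For semisimple g: abelian, self-centralizing, acting diagonalizably on g. *)
Definition cartan_subalgebra (h : {vspace g}) : Prop :=
  [/\ forall x y, x \in h -> y \in h -> lie x y = 0,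
      forall x, (forall y, y \in h -> lie x y = 0) -> x \in h
    & forall x, x \in h ->
        exists2 e : (\dim {:g}).-tuple g, basis_of {:g} e &
          forall i, exists c : F, lie x (tnth e i) = c *: tnth e i].

(* A representation is given by matrices acting on column vectors. *)
Record lierep := LieRep {
  rdim : nat;
  rmx :> g -> 'M[F]_rdim;
  rmx_linear : linear rmx;
  rmx_lie : forall x y, rmx (lie x y) = rmx x *m rmx y - rmx y *m rmx x
}.

Definition rep_irreducible (V : lierep) : Prop :=
  (0 < rdim V)%N /\
  forall U : {vspace 'cV[F]_(rdim V)},
    (forall x v, v \in U -> V x *m v \in U) -> U = 0%VS \/ U = fullv.

Definition rep_iso (V W : lierep) : Prop :=
  exists (A : 'M[F]_(rdim W, rdim V)) (B : 'M[F]_(rdim V, rdim W)),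
    [/\ A *m B = 1%:M, B *m A = 1%:M & forall x, A *m V x = W x *m A].

Section zero.
Variable n : nat.
Let z (x : g) : 'M[F]_n := 0.
Let z_linear : linear z.
Proof. by move=> a x y; rewrite /z scaler0 addr0. Qed.
Let z_lie x y : z (lie x y) = z x *m z y - z y *m z x.
Proof. by rewrite /z mul0mx subrr. Qed.
Definition rep_zero := LieRep z_linear z_lie.
End zero.

Section dsum.
Variables V W : lierep.
Let s x := block_mx (V x) 0 0 (W x).
Let s_linear : linear s.
Proof.
move=> a x y; rewrite /s !rmx_linear scale_block_mx add_block_mx.
by rewrite !scaler0 !addr0.
Qed.
Let s_lie x y : s (lie x y) = s x *m s y - s y *m s x.
Proof.
rewrite /s !mulmx_block opp_block_mx add_block_mx !rmx_lie.
by rewrite !(mul0mx, mulmx0, addr0, add0r, subrr, oppr0).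
Qed.
Definition rep_dsum := LieRep s_linear s_lie.
End dsum.

Section tens.
Variables V W : lierep.
Let t x : 'M[F]_(rdim V * rdim W) :=
  V x *t 1%:M + 1%:M *t W x.
Let t_linear : linear t.
Proof.
move=> a x y; rewrite /t !rmx_linear; apply/matrixP => i j; rewrite !mxE.
by ring.
Qed.
Let t_lie x y : t (lie x y) = t x *m t y - t y *m t x.
Proof.
have comm k (A B C D : 'M[F]_k) : A *m D = D *m A -> B *m C = C *m B ->
    (A + B) *m (C + D) - (C + D) *m (A + B) =
    (A *m C - C *m A) + (B *m D - D *m B).
  move=> AD BC; rewrite mulmxDl !mulmxDr !mulmxDl AD BC.
  move: (A *m C) (D *m A) (C *m B) (B *m D) (C *m A) (D *m B).
  by move=> a b c d e f; apply/matrixP => i j; rewrite !mxE; ring.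
rewrite /t comm ?tensmx_mul ?mulmx1 ?mul1mx// !rmx_lie.
by apply/matrixP => i j; rewrite !mxE; ring.
Qed.
Definition rep_tens := LieRep t_linear t_lie.
End tens.

(* rep_zero 0 is the zero representation, rep_zero 1 the trivial one. *)
Definition rep_decomposition (W : lierep) (s : seq lierep) : Prop :=
  all (fun U => `[< rep_irreducible U >]) s /\
  rep_iso W (foldr rep_dsum (rep_zero 0) s).

(* Number of summands isomorphic to V in a decomposition of W into
   irreducibles; for semisimple g a decomposition exists and the number does
   not depend on it. *)
Definition multiplicity (V W : lierep) : nat :=
  xget 0%N [set k | exists2 s, rep_decomposition W s &
                      k = count (fun U => `[< rep_iso U V >]) s].

Definition rep_tensor m (V : 'I_m -> lierep) (N : 'I_m -> nat) : lierep :=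
  \big[rep_tens/rep_zero 1]_(k < m) iter (N k) (rep_tens (V k)) (rep_zero 1).

Definition killing_gram : 'M[F]_(\dim {:g}) :=
  \matrix_(i, j) killing (vbasis {:g})`_i (vbasis {:g})`_j.

Definition casimir (V : lierep) : 'M[F]_(rdim V) :=
  \sum_i \sum_j invmx killing_gram i j *:
    (V (vbasis {:g})`_i *m V (vbasis {:g})`_j).

(* For irreducible V the set is a singleton, by Schur's lemma. *)
Definition casimir_scalar (V : lierep) : F :=
  xget 0 [set c | casimir V = c%:M].

Section Roots.
Context {h : {vspace g}}.

Definition cartan_dual := 'Hom(subvs_of h, F^o).

Definition in_root_space (lam : cartan_dual) (x : g) : Prop :=
  forall H : subvs_of h, lie (vsval H) x = (lam H : F) *: x.

Definition is_root (lam : cartan_dual) : Prop :=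
  lam != 0 /\ exists2 x, x != 0 & in_root_space lam x.

Definition simple_roots r (alpha : r.-tuple cartan_dual) : Prop :=
  [/\ basis_of fullv alpha,
      forall b, is_root (tnth alpha b)
    & forall lam, is_root lam -> exists n : 'I_r -> nat,
        lam = \sum_b tnth alpha b *+ n b \/
        lam = - \sum_b tnth alpha b *+ n b].

(* the element of h representing lam through the Killing form *)
Definition killing_dual (lam : cartan_dual) : subvs_of h :=
  xget 0 [set t | forall H, killing (vsval t) (vsval H) = lam H].

Definition dual_form (lam mu : cartan_dual) : F :=
  killing (vsval (killing_dual lam)) (vsval (killing_dual mu)).

End Roots.
End LieTheory.

Arguments lierep {F} g.
Arguments cartan_dual {F g} h.

Definition simple_lie_algebra (F : fieldType) (g : lieAlgebraType F) : Prop :=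
  (exists x y : g, lie x y != 0) /\
  forall I : {vspace g}, lie_ideal I -> I = 0%VS \/ I = fullv.

(* The real span of the roots, in coordinates: a : 'rV[R]_r stands for
   \sum_b a_b alpha_b. The form is real-valued there, so Re loses nothing. *)
Section RealSpan.
Context {R : realType} {g : lieAlgebraType R[i]} {h : {vspace g}} {r : nat}.
Variable alpha : r.-tuple (cartan_dual h).
Implicit Type a : 'rV[R]_r.

Definition root_comb a : cartan_dual h :=
  \sum_b (a 0 b)%:C%C *: tnth alpha b.

Definition form a (b : 'rV[R]_r) : R :=
  complex.Re (dual_form (root_comb a) (root_comb b)).

Definition simple_coord (b : 'I_r) : 'rV[R]_r := delta_mx 0 b.

Definition gram : 'M[R]_r :=
  \matrix_(b, c) form (simple_coord b) (simple_coord c).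

Definition positive_roots : set 'rV[R]_r :=
  [set a | is_root (root_comb a) /\ forall b, 0 <= a 0 b].

Definition rho : 'rV[R]_r := 2^-1 *: \sum_(a \in positive_roots) a.

Definition dominant_chamber : set 'rV[R]_r :=
  [set a | forall b, 0 <= form a (simple_coord b)].

Definition dominant_integral a : Prop :=
  forall b, 2 * form a (simple_coord b) /
    form (simple_coord b) (simple_coord b) \is a Num.nat.

(* V has a maximal vector of weight lam; for irreducible V, lam is unique. *)
Definition highest_weight (V : lierep g) (lam : 'rV[R]_r) : Prop :=
  exists v : 'cV[R[i]]_(rdim V),
    [/\ v != 0,
        forall H : subvs_of h,
          V (vsval H) *m v = (root_comb lam H : R[i]) *: v
      & forall a x, positive_roots a -> in_root_space (root_comb a) x ->
          V x *m v = 0].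

Definition component_weights (W : lierep g) : set 'rV[R]_r :=
  [set lam | exists U : lierep g,
    [/\ rep_irreducible U, highest_weight U lam & (0 < multiplicity U W)%N]].

Definition plancherel (V : 'rV[R]_r -> lierep g) m (nu : 'I_m -> 'rV[R]_r)
    (N : 'I_m -> nat) (lam : 'rV[R]_r) : R :=
  (multiplicity (V lam) (rep_tensor (V \o nu) N))%:R * (rdim (V lam))%:R /
  \prod_(k < m) (rdim (V (nu k)))%:R ^+ N k.

Definition limit_density a : R :=
  Num.sqrt (\det gram) / (2 * pi) `^ (r%:R / 2) *
  (\big[*%R/1]_(b \in positive_roots) (form a b ^+ 2 / form rho b)) *
  expR (- (\sum_b \sum_c a 0 b * gram b c * a 0 c) / 2).

End RealSpan.

(* Main.v *)
Require Import Defs.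
From HB Require Import structures.
From mathcomp Require Import all_boot all_order all_algebra.
From mathcomp Require Import zify ring lra mxtens complex.
From mathcomp Require Import all_classical all_reals all_analysis measurable_realfun.
Set Implicit Arguments.
Unset Strict Implicit.
Unset Printing Implicit Defensive.
Import Order.TTheory GRing.Theory Num.Theory.
Import numFieldNormedType.Exports.
Import passmx.
Local Open Scope classical_set_scope.
Local Open Scope ring_scope.

(* Write u_n for the alternating sum over sign choices of the weight
   multiplicities of W_n = V^N shifted by rho; it is antisymmetric under simple
   reflections, and on the strictly dominant chamber u_n(lambda + rho) is the
   multiplicity of V_lambda (a Freudenthal-type recursion replaces the Weyl
   character formula). Since dim V_lambda is proportional to
   p(lambda + rho), p being the product of the positive roots, the Plancherel
   measure is, up to the shift by rho, u_n p restricted to the chamber. Replacing p by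
   half_sinh, the product of 2 sinh(alpha/2), which dominates p on the chamber,
   gives a positive measure on the whole space whose exponential transforms are
   finite alternating sums of products of characters of the V_nu; they converge
   because the weights of V_nu have mean 0 and a covariance proportional to the
   Killing form, with factor the Casimir scalar. The limit is the transform of
   half_sinh * p * Gaussian, so a Levy argument (trigonometric approximation,
   exponential moments for the tails) gives weak convergence. Cutoffs near the
   walls, where p vanishes, transfer it to the chamber; as the Plancherel masses add
   up to 1, no mass is lost, which also yields the normalization of p without
   evaluating the integral. *)

(** * Root systems and alternating sums *)

Section BilinearForm.
Context {R : realFieldType} {r : nat}.
Variable B : 'M[R]_r.
Implicit Types a b c : 'rV[R]_r.

(** The weight [half_sinh] is chosen because it is itself a signed sum of exponentials: multiplied
    by a wave it stays among waves, so its transform involves only values of characters, whereas p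
    would bring in their derivatives. The Weyl group enters through words in the simple reflections,
    and alternating sums run over the 2^|Pos| terms of the expanded denominator. What is kept of the
    denominator identity is that after cancellation these terms lie on the orbit of rho, so that
    (y,y) is constant under a signed sum. This fact serves twice: it turns the Casimir identity into
    an eigenvalue equation that fixes the alternating sum on the open chamber, and it makes the
    Gaussian transform factor over the roots. The order of the group drops out by comparing sizes of
    orbits. On the Lie side, weights are real row vectors embedded in the dual of h by a field
    morphism from an ordered field, so positivity of the form comes from sums of squares; and
    maximal vectors are taken modulo a submodule, so that complete reducibility is argued inside one
    module. *)

Definition bform a b : R := (a *m B *m b^T) 0 0.

Lemma bformDl a b c : bform (a + b) c = bform a c + bform b c.
Proof. by rewrite /bform !mulmxDl mxE. Qed.

Lemma bformDr a b c : bform a (b + c) = bform a b + bform a c.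
Proof. by rewrite /bform linearD mulmxDr mxE. Qed.

Lemma bformZl k a b : bform (k *: a) b = k * bform a b.
Proof. by rewrite /bform -!scalemxAl mxE. Qed.

Lemma bformZr k a b : bform a (k *: b) = k * bform a b.
Proof. by rewrite /bform linearZ /= -!scalemxAr mxE. Qed.

Lemma bformNl a b : bform (- a) b = - bform a b.
Proof. by rewrite -scaleN1r bformZl mulN1r. Qed.

Lemma bformNr a b : bform a (- b) = - bform a b.
Proof. by rewrite -scaleN1r bformZr mulN1r. Qed.

Lemma bform0l a : bform 0 a = 0.
Proof. by rewrite -(scale0r (0 : 'rV[R]_r)) bformZl mul0r. Qed.

Lemma bform0r a : bform a 0 = 0.
Proof. by rewrite -(scale0r (0 : 'rV[R]_r)) bformZr mul0r. Qed.

Lemma bform_suml I (s : seq I) (P : pred I) (f : I -> 'rV[R]_r) a :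
  bform (\sum_(i <- s | P i) f i) a = \sum_(i <- s | P i) bform (f i) a.
Proof. by elim/big_rec2: _ => [|i y1 y2 _ <-]; rewrite ?bform0l// bformDl. Qed.

Lemma bform_sumr I (s : seq I) (P : pred I) (f : I -> 'rV[R]_r) a :
  bform a (\sum_(i <- s | P i) f i) = \sum_(i <- s | P i) bform a (f i).
Proof. by elim/big_rec2: _ => [|i y1 y2 _ <-]; rewrite ?bform0r// bformDr. Qed.

Lemma bformC a b : B^T = B -> bform a b = bform b a.
Proof. by move=> BT; rewrite /bform -[in LHS](trmxK (a *m B *m b^T)) mxE !trmx_mul trmxK BT mulmxA. Qed.

Lemma bformE a b : bform a b = \sum_i \sum_j a 0 i * B i j * b 0 j.
Proof.
rewrite [RHS]exchange_big /bform mxE; apply: eq_bigr => j _ /=.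
by rewrite [X in X * _]mxE mulr_suml; apply: eq_bigr => i _; rewrite mxE.
Qed.

End BilinearForm.

(** * Signed sums over the terms of an expanded product *)

Section SignedSum.
Context {R : realFieldType} {r : nat}.
Implicit Types (S : seq 'rV[R]_r) (a b x : 'rV[R]_r).

(* Pairing of a function with the expanded product over b in S of e^(b/2) - e^(-b/2). *)
Fixpoint dsum {A : zmodType} S (q : 'rV[R]_r -> A) : A :=
  if S is b :: S' then
    dsum S' (fun x => q (x + 2^-1 *: b)) - dsum S' (fun x => q (x - 2^-1 *: b))
  else q 0.

Definition half_sum S : 'rV[R]_r := 2^-1 *: \sum_(b <- S) b.

Lemma half_sum_cons b S : half_sum (b :: S) = half_sum S + 2^-1 *: b.
Proof. by rewrite /half_sum big_cons scalerDr addrC. Qed.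

Lemma eq_dsum {A : zmodType} S (q q' : 'rV[R]_r -> A) : q =1 q' -> dsum S q = dsum S q'.
Proof. by move=> qq; congr dsum; apply/funext. Qed.

Lemma dsum0 {A : zmodType} S : dsum S (fun _ => 0 : A) = 0.
Proof. by elim: S => //= b S IH; rewrite IH subrr. Qed.

Lemma dsumD {A : zmodType} S (q q' : 'rV[R]_r -> A) :
  dsum S (fun x => q x + q' x) = dsum S q + dsum S q'.
Proof. by elim: S q q' => //= b S IH q q'; rewrite !IH opprD addrACA. Qed.

Lemma dsum_sum {A : zmodType} S I (s : seq I) (P : pred I) (q : I -> 'rV[R]_r -> A) :
  dsum S (fun x => \sum_(i <- s | P i) q i x) = \sum_(i <- s | P i) dsum S (q i).
Proof.
elim: s => [|i s IH]; first by under eq_dsum do rewrite big_nil; rewrite big_nil dsum0.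
under eq_dsum do rewrite big_cons; rewrite big_cons.
by case: ifP => // _; rewrite dsumD IH.
Qed.

Lemma dsum_morph {A A' : zmodType} S (f : {additive A -> A'}) (q : 'rV[R]_r -> A) :
  f (dsum S q) = dsum S (f \o q).
Proof. by elim: S q => //= b S IH q; rewrite raddfB !IH. Qed.

Lemma dsumMl {A : pzRingType} S (k : A) (q : 'rV[R]_r -> A) :
  dsum S (fun x => k * q x) = k * dsum S q.
Proof. by elim: S q => //= b S IH q; rewrite mulrBr -!IH. Qed.

Lemma dsumMr {A : pzRingType} S (k : A) (q : 'rV[R]_r -> A) :
  dsum S (fun x => q x * k) = dsum S q * k.
Proof. by elim: S q => //= b S IH q; rewrite mulrBl -!IH. Qed.

Lemma dsumN {A : zmodType} S (q : 'rV[R]_r -> A) : dsum S (fun x => - q x) = - dsum S q.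
Proof. by elim: S q => //= b S IH q; rewrite !IH opprD. Qed.

Lemma perm_dsum {A : zmodType} S S' (q : 'rV[R]_r -> A) : perm_eq S S' -> dsum S q = dsum S' q.
Proof.
have cat1 b s1 s2 (p : 'rV[R]_r -> A) : dsum (s1 ++ b :: s2) p = dsum (b :: s1 ++ s2) p.
  have E (s : seq 'rV[R]_r) (p' : 'rV[R]_r -> A) (u v : 'rV[R]_r) :
      dsum s (fun x => p' (x + u + v)) = dsum s (fun x => p' (x + v + u)).
    by apply: eq_dsum => x; rewrite addrAC.
  elim: s1 p => //= c s1 IH p; rewrite !IH /= (E _ _ (2^-1 *: b) (2^-1 *: c)).
  rewrite (E _ _ (- (2^-1 *: b)) (2^-1 *: c)) (E _ _ (2^-1 *: b) (- (2^-1 *: c))).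
  rewrite (E _ _ (- (2^-1 *: b)) (- (2^-1 *: c))) !opprB -!addrA; congr (_ + _).
  by rewrite addrCA [RHS]addrCA; congr (_ + _); rewrite addrC.
elim: S S' q => [|b S IH] S' q pS.
  by have /perm_nilP -> : perm_eq S' [::] by rewrite perm_sym.
have bS' : b \in S' by rewrite -(perm_mem pS) mem_head.
have [s1 [s2 S'E]] : exists s1 s2, S' = s1 ++ b :: s2 by case/splitPr: bS' => s1 s2; exists s1, s2.
have pS' : perm_eq S (s1 ++ s2).
  by move: pS; rewrite S'E perm_sym perm_catC cat_cons perm_cons perm_catC perm_sym.
by rewrite S'E cat1 /= !(IH (s1 ++ s2)).
Qed.

(** Only the choice of all plus signs reaches the height of [half_sum S]. Any other exponent loses
    the height of some element of [S], which is positive, so [q] vanishes there. *)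
Lemma dsum_top (hgt : 'rV[R]_r -> R) S (q : 'rV[R]_r -> R) :
  {morph hgt : x y / x + y >-> x + y} -> (forall b, b \in S -> 0 < hgt b) ->
  (forall x, hgt x < hgt (half_sum S) -> q x = 0) -> dsum S q = q (half_sum S).
Proof.
move=> hD; have h0 : hgt 0 = 0 by apply: (addrI (hgt 0)); rewrite -hD !addr0.
have hN x : hgt (- x) = - hgt x by apply/eqP; rewrite -addr_eq0 -hD addNr h0.
have hh x : hgt (2^-1 *: x) = 2^-1 * hgt x.
  have xx : x = 2^-1 *: x + 2^-1 *: x by rewrite -scalerDl -div1r -splitr scale1r.
  rewrite {2}xx hD; lra.
elim: S q => [|b S IH] q; first by rewrite /half_sum big_nil scaler0.
move=> Sp q0; have bp := Sp b (mem_head _ _).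
have {}Sp c : c \in S -> 0 < hgt c by move=> cS; apply: Sp; rewrite inE cS orbT.
have zero x : hgt x <= hgt (half_sum S) -> q (x - 2^-1 *: b) = 0.
  by move=> hx; apply: q0; rewrite half_sum_cons !hD hN hh; lra.
rewrite /= !IH// ?half_sum_cons; first by rewrite zero// subr0.
  by move=> x hx; apply: zero; apply: ltW.
by move=> x hx; apply: q0; rewrite half_sum_cons !hD; lra.
Qed.

(** The exponents of the expansion are [half_sum S] minus the sum of the elements taken with a minus
    sign; a nonzero signed sum must see one of them. *)
Lemma dsum_neq0 S (q : 'rV[R]_r -> R) : dsum S q != 0 -> exists2 T : seq 'rV[R]_r,
  {subset T <= S} & q (half_sum S - \sum_(b <- T) b) != 0.
Proof.
elim: S q => [|b S IH] q /=.
  by move=> q0; exists [::] => //; rewrite /half_sum !big_nil scaler0 subrr.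
have [p0|pn0] := eqVneq (dsum S (fun x => q (x + 2^-1 *: b))) 0.
  rewrite p0 sub0r oppr_eq0 => /IH[T TS qT]; exists (b :: T).
    by move=> c; rewrite !inE => /orP[->//|/TS ->]; rewrite orbT.
  rewrite big_cons half_sum_cons (_ : _ - _ = half_sum S - \sum_(j <- T) j - 2^-1 *: b)//.
  by apply/rowP => i; rewrite !mxE; lra.
move=> _; have [T TS qT] := IH _ pn0; exists T.
  by move=> c /TS; rewrite inE => ->; rewrite orbT.
by rewrite half_sum_cons addrAC.
Qed.

(** On a multiplicative function the expansion folds back into the product it came from: the Weyl
    denominator in product form when [S] lists the positive roots. *)
Lemma dsum_exp {A : comPzRingType} S (f : 'rV[R]_r -> A) :
  {morph f : x y / x + y >-> x * y} -> f 0 = 1 ->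
  dsum S f = \prod_(b <- S) (f (2^-1 *: b) - f (- (2^-1 *: b))).
Proof.
move=> fD f0; elim: S => [|b S IH] /=; first by rewrite big_nil.
rewrite big_cons -IH mulrBl -!dsumMl.
by congr (_ - _); apply: eq_dsum => x; rewrite fD mulrC.
Qed.

(* Leibniz rule for the derivative in the direction dual to l. *)
Lemma dsum_leibniz (l : 'rV[R]_r -> R) S (q : 'rV[R]_r -> R) :
  {morph l : x y / x + y >-> x + y} -> uniq S ->
  dsum S (fun x => l x * q x) = \sum_(b <- S) 2^-1 * l b *
    (dsum (rem b S) (fun x => q (x + 2^-1 *: b)) + dsum (rem b S) (fun x => q (x - 2^-1 *: b))).
Proof.
move=> lD; have l0 : l 0 = 0 by apply: (addrI (l 0)); rewrite -lD !addr0.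
have lN x : l (- x) = - l x by apply/eqP; rewrite -addr_eq0 -lD addNr l0.
have lh x : l (2^-1 *: x) = 2^-1 * l x.
  have xx : x = 2^-1 *: x + 2^-1 *: x by rewrite -scalerDl -div1r -splitr scale1r.
  rewrite {2}xx lD; lra.
elim: S q => [|b S IH] q; first by rewrite /= big_nil l0 mul0r.
move=> /= /andP[bS uS]; rewrite big_cons /= eqxx.
under eq_dsum do rewrite lD lh mulrDl.
rewrite dsumD dsumMl IH//.
under [X in _ - X]eq_dsum do rewrite lD lN lh mulrBl.
rewrite dsumD dsumN dsumMl IH//.
rewrite [X in _ = _ + X](eq_big_seq (fun c => 2^-1 * l c * (dsum (rem c S) (fun x => q (x + 2^-1 *: c + 2^-1 *: b))
   + dsum (rem c S) (fun x => q (x - 2^-1 *: c + 2^-1 *: b))) -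
   2^-1 * l c * (dsum (rem c S) (fun x => q (x + 2^-1 *: c - 2^-1 *: b))
   + dsum (rem c S) (fun x => q (x - 2^-1 *: c - 2^-1 *: b)))) _) /=; last first.
  move=> c cS; case: ifP => [/eqP bc|_]; first by move: bS; rewrite bc cS.
  rewrite -mulrBr; congr (_ * _); rewrite /= opprD addrACA.
  by congr (_ + _); [congr (_ + _)|congr (- _ - _)]; apply: eq_dsum => x; rewrite addrAC.
rewrite sumrB.
set X1 := \sum_(i <- S) _; set X2 := \sum_(i <- S) _.
ring.
Qed.

End SignedSum.

(** * Simple reflections, chambers and antisymmetric functions *)

Section RootSystem.
Context {R : realFieldType} {r : nat}.
Variables (B : 'M[R]_r) (Pos : seq 'rV[R]_r).
Local Notation fm := (bform B).
Local Notation sr b := (delta_mx 0 b : 'rV[R]_r).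
Implicit Types (x a : 'rV[R]_r) (b : 'I_r).

Definition refl b x : 'rV[R]_r := x - (2 * (fm x (sr b)) / (fm (sr b) (sr b))) *: sr b.

Hypothesis Bsym : B^T = B.
Hypothesis Bpos : forall a, a != 0 -> 0 < (fm a a).
Hypothesis Pos_uniq : uniq Pos.
Hypothesis Pos_neq0 : forall x, x \in Pos -> x != 0.
Hypothesis Pos_ge0 : forall x b, x \in Pos -> 0 <= x 0 b.
Hypothesis simple_Pos : forall b, sr b \in Pos.
Hypothesis refl_Pos : forall b x, x \in Pos -> x != sr b -> refl b x \in Pos.
Hypothesis Pos_int : forall b x, x \in Pos ->
  exists z : int, 2 * (fm x (sr b)) / (fm (sr b) (sr b)) = z%:~R.

Local Notation rho := (half_sum Pos).

Let formC a a' : (fm a a') = (fm a' a). Proof. exact: bformC. Qed.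

Let sr_gt0 b : 0 < (fm (sr b) (sr b)).
Proof.
by apply: Bpos; apply/eqP => /rowP/(_ b)/eqP; rewrite !mxE !eqxx oner_eq0.
Qed.

Let sr_neq0 b : (fm (sr b) (sr b)) != 0. Proof. by rewrite gt_eqF. Qed.

Lemma reflD b x a : refl b (x + a) = refl b x + refl b a.
Proof.
by rewrite /refl bformDl mulrDr mulrDl scalerDl opprD addrACA.
Qed.

Lemma reflZ b k x : refl b (k *: x) = k *: refl b x.
Proof. by rewrite /refl bformZl scalerBr scalerA; congr (_ - _ *: _); ring. Qed.

Lemma reflN b x : refl b (- x) = - refl b x.
Proof. by rewrite -scaleN1r reflZ scaleN1r. Qed.

Lemma refl_simple b : refl b (sr b) = - sr b.
Proof. by rewrite /refl mulfK// scaler_nat mulr2n opprD addNKr. Qed.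

Lemma reflK b : involutive (refl b).
Proof.
move=> x; rewrite {1}/refl; set k := 2 * (fm x (sr b)) / (fm (sr b) (sr b)).
have -> : (fm (refl b x) (sr b)) = - (fm x (sr b)).
  by rewrite /refl bformDl bformNl bformZl divfK//; ring.
by rewrite /refl mulrN mulNr scaleNr opprK subrK.
Qed.

Lemma refl_form b x a : (fm (refl b x) (refl b a)) = (fm x a).
Proof.
rewrite /refl !(bformDl, bformDr, bformNl, bformNr, bformZl, bformZr) (formC (sr b) a).
by field; exact: sr_neq0.
Qed.

Lemma refl_formC b x a : (fm (refl b x) a) = (fm x (refl b a)).
Proof. by rewrite -(refl_form b) reflK. Qed.

(** The image avoids [sr b], because only [- sr b] is sent there and it is not positive. An
    injective map of a finite list into itself is then a permutation. *)
Lemma perm_refl b : perm_eq [seq refl b x | x <- rem (sr b) Pos] (rem (sr b) Pos).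
Proof.
have u1 : uniq [seq refl b x | x <- rem (sr b) Pos].
  by rewrite map_inj_uniq ?rem_uniq//; exact: inv_inj (reflK b).
have sub : {subset [seq refl b x | x <- rem (sr b) Pos] <= rem (sr b) Pos}.
  move=> z /mapP[x]; rewrite mem_rem_uniq// inE => /andP[xb xP] ->.
  rewrite mem_rem_uniq// inE /= refl_Pos// andbT.
  apply/eqP => /(congr1 (refl b)); rewrite reflK refl_simple => xE.
  have := Pos_ge0 b xP; rewrite xE !mxE !eqxx /= oppr_ge0 => /le_lt_trans/(_ ltr01).
  by rewrite ltxx.
have [|_ E] := uniq_min_size u1 sub; first by rewrite size_map.
by apply: uniq_perm; rewrite ?rem_uniq.
Qed.

Lemma dsum_map {A : zmodType} b S (q : 'rV[R]_r -> A) :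
  dsum [seq refl b x | x <- S] q = dsum S (q \o refl b).
Proof.
elim: S q => [|c S IH] q /=; first by rewrite /refl bform0l mulr0 mul0r scale0r subr0.
by rewrite !IH; congr (_ - _); apply: eq_dsum => x /=; rewrite reflD ?reflN reflZ.
Qed.

(** The reflection permutes the factors belonging to the roots other than [sr b] and reverses the
    sign of the factor of [sr b]. *)
Lemma dsum_refl {A : zmodType} b (q : 'rV[R]_r -> A) :
  dsum Pos (q \o refl b) = - dsum Pos q.
Proof.
have PE : perm_eq Pos (sr b :: rem (sr b) Pos) by exact: perm_to_rem.
rewrite !(perm_dsum _ PE) /= opprB.
rewrite -[X in _ = X - _](perm_dsum _ (perm_refl b)) -[X in _ = _ - X](perm_dsum _ (perm_refl b)).
rewrite !dsum_map; congr (_ - _); apply: eq_dsum => x /=;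
  by rewrite reflD ?reflN reflZ refl_simple ?scalerN ?opprK.
Qed.

(** As the other positive roots are permuted, [refl b] lowers [rho] by exactly [sr b]; pairing this
    with [sr b] gives the value. *)
Lemma rho_simple b : (fm rho (sr b)) = (fm (sr b) (sr b)) / 2.
Proof.
have PE : perm_eq Pos (sr b :: rem (sr b) Pos) by exact: perm_to_rem.
have rhoE : rho = 2^-1 *: sr b + 2^-1 *: \sum_(x <- rem (sr b) Pos) x.
  by rewrite /half_sum (perm_big _ PE) big_cons scalerDr.
have : refl b rho = rho - sr b.
  rewrite {1}rhoE reflD !reflZ refl_simple.
  have -> : refl b (\sum_(x <- rem (sr b) Pos) x) = \sum_(x <- rem (sr b) Pos) x.
    rewrite -[RHS](perm_big _ (perm_refl b)) big_map.
    elim/big_rec2: _ => [|x y1 y2 _ <-]; last by rewrite reflD.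
    by rewrite /refl bform0l mulr0 mul0r scale0r subr0.
  by rewrite rhoE; apply/rowP => i; rewrite !mxE; lra.
move=> /(congr1 (fun v => (fm v (sr b)))).
rewrite refl_formC refl_simple bformNr bformDl bformNl.
lra.
Qed.

Definition sdom x := forall b, 0 < (fm x (sr b)).
Definition dom x := forall b, 0 <= (fm x (sr b)).

Lemma form_simple x a : (fm x a) = \sum_b a 0 b * (fm x (sr b)).
Proof.
rewrite {1}(row_sum_delta a) formC bform_suml; apply: eq_bigr => b _.
by rewrite bformZl formC.
Qed.

Lemma dom_Pos_ge0 x a : dom x -> a \in Pos -> 0 <= (fm x a).
Proof.
by move=> dx aP; rewrite form_simple sumr_ge0// => b _; rewrite mulr_ge0// Pos_ge0.
Qed.

Lemma sdom_dom x : sdom x -> dom x. Proof. by move=> sx b; apply: ltW. Qed.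

Lemma sdom_Pos_gt0 x a : sdom x -> a \in Pos -> 0 < (fm x a).
Proof.
move=> sx aP; rewrite lt0r dom_Pos_ge0 ?andbT//; last exact: sdom_dom.
rewrite form_simple psumr_eq0 => [|b _]; last by rewrite mulr_ge0 ?Pos_ge0// ltW.
apply: contra (Pos_neq0 aP) => /allP a0; apply/eqP/rowP => b; rewrite mxE.
by have := a0 b (mem_index_enum _); rewrite mulf_eq0 (gt_eqF (sx b)) orbF => /eqP.
Qed.

Lemma rho_sdom : sdom rho.
Proof. by move=> b; rewrite rho_simple divr_gt0. Qed.

(** A Weyl group element is encoded as a word in the simple reflections; the parity of the length of
    the word plays the role of its sign. *)
Definition act (w : seq 'I_r) x := foldr refl x w.

Lemma act_form w x a : (fm (act w x) (act w a)) = (fm x a).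
Proof. by elim: w => //= b w IH; rewrite refl_form. Qed.

Lemma act_cat w w' x : act (w ++ w') x = act w (act w' x).
Proof. by rewrite /act foldr_cat. Qed.

Lemma act_rev w x : act (rev w) (act w x) = x.
Proof.
elim: w => //= b w IH; rewrite rev_cons -cats1 act_cat /= reflK; exact: IH.
Qed.

Lemma act_revK w x : act w (act (rev w) x) = x.
Proof. by rewrite -{1}(revK w) act_rev. Qed.

Lemma act_Pos w b : act w (sr b) \in Pos \/ - act w (sr b) \in Pos.
Proof.
suff H x : x \in Pos \/ - x \in Pos -> act w x \in Pos \/ - act w x \in Pos.
  by apply: H; left.
elim: w => //= c w IH /IH{IH}; set z := act w x.
have aux u : u \in Pos -> refl c u \in Pos \/ - refl c u \in Pos.
  move=> uP; have [->|uc] := eqVneq u (sr c); last by left; exact: refl_Pos.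
  by right; rewrite refl_simple opprK.
by case=> [/aux//|/aux]; rewrite reflN opprK => -[]; [right|left].
Qed.

Definition antisym (u : 'rV[R]_r -> R) := forall b x, u (refl b x) = - u x.

Lemma antisym_act u w x : antisym u -> u (act w x) = (-1) ^+ size w * u x.
Proof.
by move=> ua; elim: w => [|b w IH] /=; rewrite ?mul1r// ua IH exprS mulN1r mulNr.
Qed.

Lemma antisym_act_eq0 u w x : antisym u -> (u (act w x) == 0) = (u x == 0).
Proof. by move=> ua; rewrite antisym_act// mulf_eq0 signr_eq0. Qed.

Let hgt x : R := \sum_b x 0 b.

Let hgtD : {morph hgt : x a / x + a >-> x + a}.
Proof. by move=> x a; rewrite /hgt -big_split; apply: eq_bigr => b _; rewrite mxE. Qed.

Let hgtZ k x : hgt (k *: x) = k * hgt x.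
Proof. by rewrite /hgt mulr_sumr; apply: eq_bigr => b _; rewrite mxE. Qed.

Let hgt_sr b : hgt (sr b) = 1.
Proof.
rewrite /hgt (bigD1 b) //= big1 ?addr0 => [|c cb]; rewrite !mxE ?eqxx//=.
by rewrite (negPf cb).
Qed.

Let hgt_Pos x : x \in Pos -> 0 < hgt x.
Proof.
move=> xP; rewrite lt0r sumr_ge0 ?andbT => [|b _]; last exact: Pos_ge0.
rewrite /hgt psumr_eq0 => [|b _]; last exact: Pos_ge0.
apply: contra (Pos_neq0 xP) => /allP a0; apply/eqP/rowP => b; rewrite mxE.
by have /eqP := a0 b (mem_index_enum _).
Qed.

Lemma count_lt (T : eqType) (p q : pred T) (s : seq T) z0 : (forall z, p z -> q z) ->
  z0 \in s -> q z0 -> ~~ p z0 -> (count p s < count q s)%N.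
Proof.
move=> pq + qz pz; elim: s => // z s IH; rewrite inE => /orP[/eqP <-|/IH H] /=.
  by rewrite qz (negPf pz) add0n add1n ltnS sub_count.
by rewrite -addnS leq_add//; case: (p z) (pq z) => // ->.
Qed.

(** Reflecting in a simple root on which [x] is negative raises the height and keeps [u] nonzero, so
    the climb stops inside the finite list [S]. It cannot stop on a wall, where antisymmetry forces
    [u x = 0]. *)
Lemma to_sdom u (S : seq 'rV[R]_r) x : antisym u -> (forall z, u z != 0 -> z \in S) ->
  u x != 0 -> exists w, sdom (act w x).
Proof.
move=> ua uS; have [n] := ubnP (count (fun z => hgt x < hgt z) S).
elim: n x => // n IH x cn ux; have [sx|] := pselect (sdom x); first by exists [::].
move=> /existsNP[b /negP]; rewrite -leNgt le_eqVlt => /orP[/eqP x0|xneg].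
  have := ua b x; rewrite /refl x0 mulr0 mul0r scale0r subr0 => /eqP.
  by rewrite -subr_eq0 opprK -mulr2n mulrn_eq0 (negPf ux).
have ub : u (refl b x) != 0 by rewrite ua oppr_eq0.
have hb : hgt x < hgt (refl b x).
  rewrite /refl -scaleNr hgtD hgtZ hgt_sr mulr1 ltrDl oppr_gt0.
  by rewrite pmulr_llt0 ?invr_gt0// pmulr_rlt0.
have [|w sw] := IH (refl b x) _ ub.
  apply: (@leq_trans (count (fun z => hgt x < hgt z) S)); last by rewrite -ltnS.
  apply: (@count_lt _ _ _ _ (refl b x)) => [z||//|]; [exact: lt_trans|exact: uS|].
  by rewrite ltxx.
by exists (rcons w b); rewrite -cats1 act_cat.
Qed.

Definition alt_sum (m : 'rV[R]_r -> R) x := dsum Pos (fun y => m (x - y)).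

Lemma alt_sum_antisym m : (forall b x, m (refl b x) = m x) -> antisym (alt_sum m).
Proof.
move=> mr b x; rewrite /alt_sum -(dsum_refl b); apply: eq_dsum => y /=.
by rewrite -{1}(reflK b y) -reflN -reflD mr.
Qed.

Lemma alt_sum_supp m x : alt_sum m x != 0 ->
  exists2 T : seq 'rV[R]_r, {subset T <= Pos} & m (x - (rho - \sum_(c <- T) c)) != 0.
Proof. exact: dsum_neq0. Qed.

Lemma sum_Pos_ge0 (T : seq 'rV[R]_r) b : {subset T <= Pos} -> 0 <= (\sum_(c <- T) c) 0 b.
Proof.
move=> TP; rewrite summxE big_seq; apply: sumr_ge0 => c cT.
by apply: Pos_ge0; apply: TP.
Qed.

(** The support of [m] lies below [lam] in every coordinate, so only the top exponent [rho] of the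
    denominator can reach [lam + rho]. *)
Lemma alt_sum_top m (lam : 'rV[R]_r) : (forall x, m x != 0 -> forall b, x 0 b <= lam 0 b) ->
  alt_sum m (lam + rho) = m lam.
Proof.
move=> mlam; rewrite /alt_sum (dsum_top (hgt := hgt))//; first by rewrite addrK.
move=> x hx; apply/eqP; apply: contraLR hx => /mlam xlam; rewrite -leNgt.
rewrite /hgt; apply: ler_sum => b _.
by have := xlam b; rewrite !mxE; lra.
Qed.

Let delta0 x : R := (x == 0)%:R.

Let delta0P x : delta0 x != 0 -> x = 0.
Proof. by rewrite /delta0; have [->|_] := eqVneq x 0; rewrite ?mulr0n ?eqxx. Qed.

Let refl0 b x : (refl b x == 0) = (x == 0).
Proof.
have r0 : refl b 0 = 0 by rewrite /refl bform0l mulr0 mul0r scale0r subr0.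
by rewrite -{1}r0 (inj_eq (inv_inj (reflK b))).
Qed.

(** The net coefficients of the denominator after cancellation. Written as a convolution with a
    point mass at 0, they form an antisymmetric function to which [to_sdom] applies. *)
Definition weyl_denom x : R := alt_sum delta0 x.

Lemma weyl_denom_antisym : antisym weyl_denom.
Proof. by apply: alt_sum_antisym => b x; rewrite /delta0 refl0. Qed.

Lemma weyl_denom_rho : weyl_denom rho = 1.
Proof.
rewrite /weyl_denom -[rho in alt_sum _ rho]add0r alt_sum_top /delta0 ?eqxx// => x.
by have [->|/negPf x0] := eqVneq x 0; rewrite ?x0 ?eqxx.
Qed.

Lemma weyl_denom_supp x : weyl_denom x != 0 ->
  exists2 T : seq 'rV[R]_r, {subset T <= Pos} & x = rho - \sum_(c <- T) c.
Proof.
move=> /alt_sum_supp[T TP] /delta0P/eqP xT.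
by exists T => //; apply/eqP; rewrite -subr_eq0.
Qed.

Lemma form_posr x (k : 'rV[R]_r) : (forall b, 0 <= (fm x (sr b))) -> (forall b, 0 <= k 0 b) -> 0 <= (fm x k).
Proof. by move=> xb kb; rewrite form_simple sumr_ge0// => b _; rewrite mulr_ge0. Qed.

Lemma form_le0 x : (fm x x) <= 0 -> x = 0.
Proof. by move=> xx; apply/eqP/negPn/negP => /Bpos; rewrite ltNge xx. Qed.

(** Write x = rho - k with k a sum of positive roots. For each simple root, 1 minus an integer is
    positive, so k pairs nonpositively with all simple roots; as its coordinates are nonnegative,
    (k,k) <= 0 and k = 0. *)
Lemma weyl_denom_sdom x : weyl_denom x != 0 -> sdom x -> x = rho.
Proof.
move=> /weyl_denom_supp[T TP xE] sx; set k := \sum_(c <- T) c in xE.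
have zkP b : exists z : int, 2 * (fm k (sr b)) / (fm (sr b) (sr b)) = z%:~R.
  rewrite /k; elim: T TP {xE k} => [|c T IH] TP.
    by exists 0; rewrite big_nil bform0l mulr0 mul0r.
  have [|z zE] := IH; first by move=> d dT; apply: TP; rewrite inE dT orbT.
  have [z' z'E] := Pos_int b (TP c (mem_head _ _)); exists (z' + z).
  by rewrite big_cons bformDl mulrDr mulrDl zE z'E rmorphD.
have [zk zkE] := choice zkP.
have kneg b : 0 <= (fm (- k) (sr b)).
  have : 0 < 2 * (fm x (sr b)) / (fm (sr b) (sr b)) by rewrite divr_gt0// mulr_gt0.
  rewrite xE bformDl bformNl rho_simple mulrDr mulrDl mulrN mulNr zkE.
  rewrite mulrCA mulfV ?pnatr_eq0// mulr1 mulfV// subr_gt0.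
  rewrite -[X in _ < X](mulr1z 1) ltr_int => zb.
  suff : 0 <= - (2 * (fm k (sr b)) / (fm (sr b) (sr b))).
    by rewrite ?bformNl !oppr_ge0 pmulr_lle0 ?invr_gt0// pmulr_rle0.
  by rewrite zkE -rmorphN ler0z oppr_ge0 -ltzD1 add0r.
suff k0 : k = 0 by rewrite xE k0 subr0.
apply: form_le0; rewrite -oppr_ge0 -bformNl; apply: form_posr => // b.
exact: sum_Pos_ge0.
Qed.

(** The exponents of all sign choices before cancellation, with repetitions: a finite set on which
    every signed sum over [S] is supported. *)
Fixpoint dpts (S : seq 'rV[R]_r) : seq 'rV[R]_r :=
  if S is b :: S' then [seq x + 2^-1 *: b | x <- dpts S'] ++ [seq x - 2^-1 *: b | x <- dpts S']
  else [:: 0].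

Lemma eq_dsum_pts {A : zmodType} S (q q' : 'rV[R]_r -> A) :
  {in dpts S, q =1 q'} -> dsum S q = dsum S q'.
Proof.
elim: S q q' => [|b S IH] q q' qq /=; first by apply: qq; rewrite mem_head.
by congr (_ - _); apply: IH => x xS; apply: qq; rewrite mem_cat; apply/orP; [left|right];
  apply/mapP; exists x.
Qed.

(** The denominator times the sum of the exponentials of [wts] is paired with [q] in two ways: term
    by term, and after collecting equal exponents. The set [U] only has to contain all exponents
    that occur. *)
Lemma alt_sum_pairing (wts U : seq 'rV[R]_r) (q : 'rV[R]_r -> R) :
  uniq U -> (forall v y, v \in wts -> y \in dpts Pos -> v + y \in U) ->
  \sum_(v <- wts) dsum Pos (fun y => q (v + y)) =
  \sum_(x <- U) alt_sum (fun z => (count_mem z wts)%:R) x * q x.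
Proof.
move=> uU wU.
transitivity (\sum_(v <- wts) \sum_(x <- U) dsum Pos (fun y => (x - y == v)%:R) * q x).
  apply: eq_big_seq => v vw; under eq_bigr do rewrite -dsumMr.
  rewrite -dsum_sum; apply: eq_dsum_pts => y yP.
  rewrite (bigD1_seq (v + y)) ?wU//= addrK eqxx mul1r big1 ?addr0// => x xv.
  by rewrite subr_eq (negPf xv) mul0r.
rewrite exchange_big; apply: eq_bigr => x _; rewrite -mulr_suml; congr (_ * _).
rewrite -dsum_sum; apply: eq_dsum => y.
rewrite -sum1_count natr_sum [RHS]big_mkcond /=; apply: eq_bigr => v _.
by rewrite [v == _]eq_sym; case: eqP.
Qed.

Lemma dsum_weyl_denom (q : 'rV[R]_r -> R) :
  dsum Pos q = \sum_(x <- undup (dpts Pos)) weyl_denom x * q x.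
Proof.
have E : alt_sum (fun z => (count_mem z [:: 0])%:R) = weyl_denom.
  by apply/funext => x; apply: eq_dsum => y; rewrite /= addn0 eq_sym.
rewrite -E -(@alt_sum_pairing [:: 0])// ?undup_uniq// ?big_seq1.
  by apply: eq_dsum => y; rewrite add0r.
by move=> v y; rewrite inE => /eqP ->; rewrite add0r mem_undup.
Qed.

Lemma weyl_denom_dpts x : weyl_denom x != 0 -> x \in dpts Pos.
Proof.
apply: contraR => xP; apply/eqP; rewrite /weyl_denom /alt_sum.
rewrite (eq_dsum_pts (q' := fun=> 0)) ?dsum0// => y yP; rewrite /delta0 subr_eq0.
by case: eqP => // xy; rewrite xy yP in xP.
Qed.

Lemma weyl_denom_orbit x : weyl_denom x != 0 -> exists w, x = act w rho.
Proof.
move=> dx; have [w sw] := to_sdom weyl_denom_antisym weyl_denom_dpts dx.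
exists (rev w); rewrite -(weyl_denom_sdom _ sw) ?act_rev//.
by rewrite antisym_act_eq0//; exact: weyl_denom_antisym.
Qed.

(** After cancellation all exponents lie on the orbit of [rho], where the norm is constant; a
    function of the norm therefore leaves the signed sum as a scalar. *)
Lemma dsum_norm (phi : R -> R) (q : 'rV[R]_r -> R) :
  dsum Pos (fun x => phi (fm x x) * q x) = phi (fm rho rho) * dsum Pos q.
Proof.
rewrite !dsum_weyl_denom mulr_sumr; apply: eq_bigr => x _; rewrite mulrCA.
have [->|/weyl_denom_orbit[w ->]] := eqVneq (weyl_denom x) 0; first by rewrite !mul0r !mulr0.
by rewrite act_form.
Qed.

Section Freudenthal.
Variables (m : 'rV[R]_r -> R) (T : 'rV[R]_r -> 'rV[R]_r -> R) (c : R).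
Hypothesis hT : forall a x, a \in Pos -> T a x - T a (x + a) = (fm x a) * m x.
Hypothesis hc : forall x, c * m x = (fm x x) * m x + \sum_(a <- Pos) (T a x + T a (x + a)).

(** Read [m] as the weight multiplicities of a module on which the Casimir element acts by [c], and
    [T a x] as the trace of e_a f_a on the weight space of x. Multiplication by the denominator
    turns the root terms of the Casimir identity into a first-order term, which completes (x-y,x-y)
    to (x,x) - (y,y). The convolution thus lives on the sphere (x,x) = c + (rho,rho). *)
Lemma alt_sum_freudenthal x : ((fm x x) - (c + (fm rho rho))) * alt_sum m x = 0.
Proof.
have C1 : c * alt_sum m x = dsum Pos (fun y => (fm (x - y) (x - y)) * m (x - y)) +
    \sum_(a <- Pos) dsum Pos (fun y => T a (x - y) + T a (x - y + a)).
  by rewrite /alt_sum -dsumMl -dsum_sum -dsumD; apply: eq_dsum => y; exact: hc.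
pose Q a y := (fm (x - y) a) * m (x - y).
(* The factor of [a] is a difference, so [T a z + T a (z + a)] telescopes to a difference of [T a]
   over the distance 2a, that is, to two values of [Q a] by [hT]. *)
have C2 a : a \in Pos -> dsum Pos (fun y => T a (x - y) + T a (x - y + a)) =
    dsum (rem a Pos) (fun y => Q a (y + 2^-1 *: a)) + dsum (rem a Pos) (fun y => Q a (y - 2^-1 *: a)).
  move=> aP; rewrite (perm_dsum _ (perm_to_rem aP)) /= -dsumN -!dsumD.
  apply: eq_dsum => y; rewrite /Q -!hT//.
  have -> : x - (y + 2^-1 *: a) + a = x - (y - 2^-1 *: a) by apply/rowP => i; rewrite !mxE; lra.
  ring.
(* The Leibniz rule, summed over the coordinate directions, gives the same two values of [Q a] for
   the first-order term in [y]. *)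
have C3 : dsum Pos (fun y => (fm (x - y) y) * m (x - y)) = 2^-1 * \sum_(a <- Pos)
    (dsum (rem a Pos) (fun y => Q a (y + 2^-1 *: a)) + dsum (rem a Pos) (fun y => Q a (y - 2^-1 *: a))).
  have E y : (fm (x - y) y) * m (x - y) = \sum_b (fm (sr b) y) * ((x - y) 0 b * m (x - y)).
    rewrite formC form_simple mulr_suml; apply: eq_bigr => b _.
    by rewrite formC mulrA; congr (_ * _); rewrite mulrC.
  rewrite (eq_dsum _ E) dsum_sum.
  under eq_bigr => b _ do rewrite (dsum_leibniz (fun y => (x - y) 0 b * m (x - y)) (bformDr _ _) Pos_uniq).
  rewrite exchange_big mulr_sumr; apply: eq_bigr => a _.
  rewrite -!dsumD -dsumMl.
  under eq_bigr do rewrite -dsumD -dsumMl.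
  have QE z : Q a z = \sum_b (x - z) 0 b * (fm (sr b) a) * m (x - z).
    by rewrite /Q formC form_simple mulr_suml; apply: eq_bigr => b _; rewrite (formC a).
  rewrite -dsum_sum; apply: eq_dsum => y; rewrite !QE -big_split mulr_sumr.
  by apply: eq_bigr => b _ /=; ring.
(* (x-y,x-y) + 2(x-y,y) = (x,x) - (y,y), and [dsum_norm] replaces (y,y) by (rho,rho). *)
have C4 : dsum Pos (fun y => (fm (x - y) (x - y)) * m (x - y)) + 2 * dsum Pos (fun y => (fm (x - y) y) * m (x - y)) =
   ((fm x x) - (fm rho rho)) * alt_sum m x.
  rewrite mulrBl -[X in _ - X](dsum_norm id) /alt_sum -dsumMl -dsumN -dsumD -!dsumMl -dsumD.
  apply: eq_dsum => y; rewrite !(bformDl, bformDr, bformNl, bformNr) (formC y x); ring.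
have C1' : c * alt_sum m x = ((fm x x) - (fm rho rho)) * alt_sum m x.
  rewrite C1 -C4 C3 mulrA mulfV ?pnatr_eq0// mul1r; congr (_ + _).
  by apply: eq_big_seq => a /C2.
have -> : ((fm x x) - (c + (fm rho rho))) * alt_sum m x =
  ((fm x x) - (fm rho rho)) * alt_sum m x - c * alt_sum m x by ring.
by rewrite C1' subrr.
Qed.

End Freudenthal.

(** With k = lam + rho - x, which has nonnegative coordinates, equality of norms reads (lam + rho +
    x, k) = 0. The first argument is strictly dominant, so every coordinate of k vanishes. *)
Lemma alt_sum_sdom m (lam x : 'rV[R]_r) : dom lam ->
  (forall x, m x != 0 -> forall b, x 0 b <= lam 0 b) ->
  (forall x, ((fm x x) - (fm (lam + rho) (lam + rho))) * alt_sum m x = 0) ->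
  sdom x -> alt_sum m x != 0 -> x = lam + rho.
Proof.
move=> dlam mlam eig sx ux; have /eqP := eig x; rewrite mulf_eq0 (negPf ux) orbF => /eqP nx.
have [T TP /mlam xT] := alt_sum_supp ux.
pose k := lam + rho - x.
have kb b : 0 <= k 0 b.
  by have := xT b; have := sum_Pos_ge0 b TP; rewrite /k !mxE; lra.
have sb b : 0 < (fm (lam + rho + x) (sr b)).
  by rewrite !bformDl ltr_wpDl// addr_ge0 ?dlam// ltW// rho_sdom.
have k0 : (fm (lam + rho + x) k) = 0.
  rewrite /k !(bformDl, bformDr, bformNl, bformNr); move: nx.
  by rewrite !(bformDl, bformDr) (formC rho lam) (formC x lam) (formC x rho); lra.
move/eqP: k0; rewrite form_simple psumr_eq0 => [/allP kk|b _]; last by rewrite mulr_ge0// ltW.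
suff : k = 0 by move/eqP; rewrite subr_eq0 => /eqP.
apply/rowP => b; rewrite [RHS]mxE; have := kk b (mem_index_enum _).
by rewrite mulf_eq0 (gt_eqF (sb b)) orbF => /eqP.
Qed.

(** Up to the constant [root_prod rho], the dimension of the irreducible module of highest weight
    [x - rho]. *)
Definition root_prod x : R := \prod_(a <- Pos) (fm x a).

Lemma root_prod_antisym : antisym root_prod.
Proof.
move=> b x; have PE : perm_eq Pos (sr b :: rem (sr b) Pos) by exact: perm_to_rem.
rewrite /root_prod (perm_big _ PE) [in RHS](perm_big _ PE) /= !big_cons.
have -> : fm (refl b x) (sr b) = - fm x (sr b) by rewrite refl_formC refl_simple bformNr.
rewrite mulNr.
rewrite -(perm_big _ (perm_refl b)) big_map; congr (- (_ * _)).
by apply: eq_bigr => a _; rewrite refl_form.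
Qed.

Lemma root_prod_gt0 x : sdom x -> 0 < root_prod x.
Proof. by move=> sx; rewrite /root_prod big_seq prodr_gt0// => a; exact: sdom_Pos_gt0. Qed.

Section UniqueSdom.
Variables (u : 'rV[R]_r -> R) (S : seq 'rV[R]_r) (a : 'rV[R]_r).
Hypotheses (ua : antisym u) (uS : forall z, u z != 0 -> z \in S).
Hypotheses (sa : sdom a) (ua1 : u a = 1) (uniqa : forall x, u x != 0 -> sdom x -> x = a).

Lemma supp_orbit x : u x != 0 -> exists w, x = act w a.
Proof.
move=> ux; have [w sw] := to_sdom ua uS ux.
by exists (rev w); rewrite -(uniqa _ sw) ?act_rev// antisym_act_eq0.
Qed.

(** Along the orbit of [a] the signs of [u] and [q] cancel, so each point of the support contributes
    [q a]. *)
Lemma pairing_antisym q : antisym q -> uniq S ->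
  \sum_(x <- S) u x * q x = (count (fun x => u x != 0) S)%:R * q a.
Proof.
move=> qa _; rewrite -sum1_count natr_sum mulr_suml [RHS]big_mkcond /=.
apply: eq_bigr => x _; case: ifPn => [/supp_orbit[w ->]|/negPn/eqP ->]; last by rewrite mul0r.
by rewrite !antisym_act// ua1 mulr1 mulrA -expr2 sqrr_sign !mul1r.
Qed.

End UniqueSdom.

(** If w fixes the strictly dominant [a], its inverse sends simple roots to roots positive on [a],
    hence to positive roots. So w a' is strictly dominant, and it lies in the support of [u], where
    the only such point is [a']. *)
Lemma stab_transfer (u : 'rV[R]_r -> R) a a' w : antisym u -> sdom a -> sdom a' ->
  u a' = 1 -> (forall x, u x != 0 -> sdom x -> x = a') -> act w a = a -> act w a' = a'.
Proof.
move=> ua sa sa' ua1 uniq' wa; apply: uniq'; first by rewrite antisym_act_eq0// ua1 oner_eq0.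
move=> b; rewrite -(act_form (rev w)) act_rev.
have : 0 < (fm a (act (rev w) (sr b))) by rewrite -(act_form w) act_revK wa.
case: (act_Pos (rev w) b) => wP; first by rewrite (sdom_Pos_gt0 sa' wP).
by have := sdom_Pos_gt0 sa wP; rewrite bformNr oppr_gt0 => /lt_trans /[apply]; rewrite ltxx.
Qed.

(** The map w a -> w a' between two regular orbits is injective by [stab_transfer]. Used in both
    directions, it makes the group order cancel in the dimension formula. *)
Lemma supp_size_le (u u' : 'rV[R]_r -> R) (S S' : seq 'rV[R]_r) a a' :
  antisym u -> antisym u' -> uniq S ->
  (forall z, u z != 0 -> z \in S) -> (forall z, u' z != 0 -> z \in S') ->
  sdom a -> sdom a' -> u a = 1 -> u' a' = 1 ->
  (forall x, u x != 0 -> sdom x -> x = a) -> (forall x, u' x != 0 -> sdom x -> x = a') ->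
  (count (fun x => u x != 0%R) S <= count (fun x => u' x != 0%R) S')%N.
Proof.
move=> ua ua' US uS uS' sa sa' ua1 ua1' uq uq'.
have wP x : exists w, u x != 0 -> x = act w a.
  have [u0|/(supp_orbit ua uS uq)[w]] := eqVneq (u x) 0; first by exists [::].
  by exists w.
have [w wE] := choice wP.
rewrite -!size_filter -(size_map (fun x => act (w x) a')); apply: uniq_leq_size.
  rewrite map_inj_in_uniq ?filter_uniq// => x z; rewrite !mem_filter => /andP[ux _] /andP[uz _] E.
  rewrite (wE _ ux) (wE _ uz); have : act (rev (w z) ++ w x) a' = a' by rewrite act_cat E act_rev.
  move/(stab_transfer ua sa' sa ua1 uq); rewrite act_cat => /(congr1 (act (w z))).
  by rewrite act_revK.
move=> z /mapP[x]; rewrite mem_filter => /andP[ux _] ->; rewrite mem_filter.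
have u'n : u' (act (w x) a') != 0 by rewrite antisym_act_eq0// ua1' oner_eq0.
by rewrite u'n uS'.
Qed.

End RootSystem.

(** * Gaussian integrals *)

Section Gauss1.
Context {R : realType}.
Local Notation mu := (@lebesgue_measure R).
Local Notation T1 := (measurableTypeR R).
Implicit Types (y s t c : R).

Definition gauss1 (y : R) : R := expR (- (y ^+ 2 / 2)).

Lemma gauss1_ge0 y : 0 <= gauss1 y. Proof. exact: expR_ge0. Qed.

Lemma gauss1_shift s y : expR (s * y) * gauss1 y = expR (s ^+ 2 / 2) * gauss1 (y - s).
Proof. by rewrite /gauss1 -!expRD; congr expR; field. Qed.

Lemma gauss1_normal s y : gauss1 (y - s) = Num.sqrt (2 * pi) * normal_pdf s 1 y.
Proof.
rewrite normal_pdfE ?oner_eq0// /normal_peak /normal_fun expr1n mul1r (_ : pi *+ 2 = 2 * pi :> R) ?mulr_natl//.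
rewrite mulrA mulfV ?mul1r.
  by rewrite /gauss1 mulNr.
have h : 0 < 2 * pi :> R by rewrite mulr_gt0// pi_gt0.
by rewrite gt_eqF// sqrtr_gt0 -mulr_natl.
Qed.

Lemma integrable_gauss1 s c : mu.-integrable setT (EFin \o (fun y => c * (expR (s * y) * gauss1 y))).
Proof.
have -> : EFin \o (fun y => c * (expR (s * y) * gauss1 y)) =
    (fun y => (c * expR (s ^+ 2 / 2) * Num.sqrt (2 * pi))%:E * (normal_pdf s 1 y)%:E)%E.
  by apply/funext => y; rewrite /= gauss1_shift gauss1_normal -EFinM !mulrA.
by apply: integrableZl => //; exact: integrable_normal_pdf.
Qed.

Lemma integral_gauss1 s : \int[mu]_y (expR (s * y) * gauss1 y) = expR (s ^+ 2 / 2) * Num.sqrt (2 * pi).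
Proof.
rewrite /Rintegral; under eq_integral do rewrite gauss1_shift gauss1_normal mulrA EFinM.
rewrite integralZl//; last exact: integrable_normal_pdf.
by rewrite integral_normal_pdf mule1.
Qed.

(** A majorant of e^(2|y|), hence of 1, of |y| and of products of two factors e^|y|. As a sum of
    exponentials it is integrable against the Gaussian by completing the square. *)
Definition exp2 y := expR (2 * y) + expR (-2 * y).

Lemma exp2_abs y : expR (2 * `|y|) <= exp2 y.
Proof.
case: (lerP 0 y) => y0; rewrite /exp2.
  by rewrite ger0_norm// lerDl expR_ge0.
by rewrite ltr0_norm// mulrN -mulNr lerDr expR_ge0.
Qed.

Lemma exp2_ge1 y : 1 <= exp2 y.
Proof. by apply: le_trans (exp2_abs y); rewrite -expR0 ler_expR mulr_ge0. Qed.

Lemma exp2_norm y : `|y| <= exp2 y.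
Proof.
apply: le_trans (exp2_abs y); apply: le_trans (expR_ge1Dx _); have := normr_ge0 y; lra.
Qed.

Lemma integrable_exp2_gauss1 c : mu.-integrable setT (EFin \o (fun y => c * (exp2 y * gauss1 y))).
Proof.
have -> : EFin \o (fun y => c * (exp2 y * gauss1 y)) =
  ((EFin \o (fun y => (c * (expR (2 * y) * gauss1 y))%R)) \+ (EFin \o (fun y => (c * (expR (-2 * y) * gauss1 y))%R)))%E.
  by apply/funext => y /=; rewrite -EFinD mulrDl mulrDr.
by apply: integrableD => //; exact: integrable_gauss1.
Qed.

Lemma measurable_gauss1 : measurable_fun [set: T1] gauss1.
Proof.
apply: measurableT_comp => //; apply: measurableT_comp => //; exact: measurable_funM.
Qed.

Lemma le_integrable_R (f G : R -> R) : measurable_fun [set: T1] f -> (forall y, `|f y| <= G y) ->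
  mu.-integrable setT (EFin \o G) -> mu.-integrable setT (EFin \o f).
Proof.
move=> mf fG; apply: le_integrable => //; first exact/measurable_EFinP.
by move=> y _ /=; rewrite lee_fin (le_trans (fG y))// ler_norm.
Qed.

Lemma derive_under_integral (f df : R -> R -> R) (G : R -> R) (a e : R) : 0 < e ->
  (forall x, mu.-integrable setT (EFin \o f x)) ->
  (forall x y : R, is_derive x 1 (fun z : R => f z y) (df x y)) ->
  (forall x y, `|x - a| < e -> `|df x y| <= G y) -> mu.-integrable setT (EFin \o G) ->
  is_derive a 1 (fun x => \int[mu]_y f x y) (\int[mu]_y df a y).
Proof.
move=> e0 intf dfE dG iG.
have G0 y : 0 <= G y by apply: le_trans (dG a y _); rewrite // subrr normr0.
have aI : `]a - e, a + e[%classic a by rewrite /= in_itv /= gtrBl ltrDl e0.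
have pE x y : partial1of2 f x y = df x y.
  by rewrite partial1of2E; apply: derive_val.
have dG' x y : `]a - e, a + e[%classic x -> setT y -> `|partial1of2 f x y| <= G y.
  by rewrite /= in_itv /= => /andP[h1 h2] _; rewrite pE; apply: dG; rewrite ltr_norml; lra.
have der x y : `]a - e, a + e[%classic x -> setT y -> derivable (f ^~ y) x 1.
  by move=> _ _; exact: ex_derive.
have intf' x : `]a - e, a + e[%classic x -> mu.-integrable setT (EFin \o f x) by move=> _; exact: intf.
apply: DeriveDef.
  exact: (derivable_under_integral (@measurableT _ T1) aI intf' der G0 iG dG').
rewrite -derive1E (differentiation_under_integral (@measurableT _ T1) aI intf' der G0 iG dG').
by apply: eq_Rintegral => y _; rewrite pE.
Qed.

Lemma is_derive_cos_affine (c p q t : R) :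
  is_derive t 1 (fun z : R => c * cos (z * p + q)) (- (c * p * sin (t * p + q))).
Proof.
have h : is_derive t 1 (fun z : R => z * p + q) p by apply: is_derive_eq; rewrite /GRing.scale /=; ring.
have h2 : is_derive t 1 (cos \o (fun z : R => z * p + q)) (- sin (t * p + q) * p).
  exact: is_derive1_comp.
have -> : (fun z : R => c * cos (z * p + q)) = (cst c \* (cos \o (fun z : R => z * p + q))) by [].
by apply: is_derive_eq; rewrite /GRing.scale /=; ring.
Qed.

Lemma is_derive_gauss1_shift (y s : R) : is_derive s 1 (fun z : R => gauss1 (y + z)) (- (y + s) * gauss1 (y + s)).
Proof.
have h : is_derive s 1 (fun z : R => - ((y + z) ^+ 2 / 2)) (- (y + s)).
  by apply: is_derive_eq; rewrite /GRing.scale /=; field.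
have h2 : is_derive s 1 (expR \o (fun z : R => - ((y + z) ^+ 2 / 2))) (expR (- ((y + s) ^+ 2 / 2)) * - (y + s)).
  exact: is_derive1_comp.
by rewrite mulrC; exact: h2.
Qed.

Lemma measurable_cos_affine (p q : R) : measurable_fun [set: T1] (fun y => cos (p * y + q)).
Proof.
apply: measurableT_comp; first by apply: continuous_measurable_fun; exact: continuous_cos.
by apply: measurable_funD => //; exact: measurable_funM.
Qed.

Lemma integrable_gauss1_bounded (f : R -> R) c : measurable_fun [set: T1] f -> (forall y, `|f y| <= c * exp2 y) ->
  mu.-integrable setT (EFin \o (fun y => gauss1 y * f y)).
Proof.
move=> mf fc; apply: (@le_integrable_R _ (fun y => c * (exp2 y * gauss1 y))); last exact: integrable_exp2_gauss1.
  by apply: measurable_funM => //; exact: measurable_gauss1.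
by move=> y; rewrite normrM ger0_norm ?gauss1_ge0// mulrA mulrC ler_wpM2r// gauss1_ge0.
Qed.

(** The phase [q] closes the family under differentiation in [t], which multiplies the integrand by
    y and shifts [q] by a quarter period. *)
Definition cgauss (q t : R) := \int[mu]_y (gauss1 y * cos (t * y + q)).

Let norm_cos_le1 (z : R) : `|cos z| <= 1. Proof. by rewrite ler_norml cos_geN1 cos_le1. Qed.

Lemma integrable_cgauss q t : mu.-integrable setT (EFin \o (fun y => gauss1 y * cos (t * y + q))).
Proof.
apply: (@integrable_gauss1_bounded _ 1); first exact: measurable_cos_affine.
by move=> y; rewrite mul1r (le_trans (norm_cos_le1 _))// exp2_ge1.
Qed.

Lemma cos_sub_pihalf (z : R) : cos (z - pi / 2) = sin z.
Proof. by rewrite cosB cos_pihalf sin_pihalf mulr0 add0r mulr1. Qed.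

Lemma is_derive_cgauss q t :
  is_derive t 1 (cgauss q) (\int[mu]_y (- (gauss1 y * y * cos (t * y + (q - pi / 2))))).
Proof.
pose G y := 1 * (exp2 y * gauss1 y).
apply: (@derive_under_integral (fun t y => gauss1 y * cos (t * y + q))
  (fun t y => - (gauss1 y * y * cos (t * y + (q - pi / 2)))) G t 1) => //.
- by move=> x; exact: integrable_cgauss.
- move=> x y; rewrite addrA cos_sub_pihalf; exact: is_derive_cos_affine.
- move=> x y _; rewrite /G mul1r normrN !normrM ger0_norm ?gauss1_ge0// mulrAC -mulrA mulrC.
  rewrite ler_wpM2r ?gauss1_ge0//; apply: le_trans (exp2_norm y).
  by rewrite ler_piMl.
- exact: integrable_exp2_gauss1.
Qed.

(** Translation invariance of Lebesgue measure, through the substitution rule for nonnegative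
    integrands. *)
Lemma cgauss_shift q t s :
  \int[mu]_y (gauss1 (y + s) * cos (t * (y + s) + q)) = cgauss q t /\
  mu.-integrable setT (EFin \o (fun y => gauss1 (y + s) * cos (t * (y + s) + q))).
Proof.
(* Adding 1 to the cosine makes the integrand nonnegative; the added Gaussian is half of [f 0 0] and
   is subtracted at the end. *)
pose f t q (y : R) := gauss1 y * (1 + cos (t * y + q)).
have f0 t' q' y : 0 <= f t' q' y by rewrite mulr_ge0 ?gauss1_ge0// -lerBlDl sub0r cos_geN1.
have cf t' q' : continuous (f t' q').
  move=> y; apply/differentiable_continuous/derivable1_diffP.
  have h1 := is_derive_gauss1_shift 0 y; have h2 := is_derive_cos_affine 1 t' q' y.
  have -> : f t' q' = (fun z => gauss1 (0 + z)) * (cst 1 + (fun z : R => 1 * cos (z * t' + q'))).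
    by apply/funext => z; rewrite /f !fctE mul1r add0r (mulrC z).
  exact: ex_derive.
have const t' q' : (\int[mu]_y (f t' q' (y + s))%:E = \int[mu]_y (f t' q' y)%:E)%E.
  have D1 : (fun x : R => x + s)^`()%classic = cst 1.
    apply/funext => x; rewrite derive1E; have h : is_derive x 1 (fun z : R => z + s) 1 by apply: is_derive_eq; rewrite addr0.
    exact: derive_val.
  rewrite [RHS](@increasing_ge0_integration_by_substitutionT _ (fun x => x + s)).
  - by apply: eq_integral => y _; rewrite D1 /= mulr1.
  - by move=> x y xy; rewrite ltrD2r.
  - by rewrite D1 => ?; exact: cvg_cst.
  - by rewrite D1; exact: is_cvg_cst.
  - by rewrite D1; exact: is_cvg_cst.
  - by move=> x; exact: ex_derive.
  - exact: cvg_addrr_Ny.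
  - exact: cvg_addrr.
  - exact: cf.
  - by move=> x; exact: f0.
have mf t' q' : measurable_fun [set: T1] (fun y => f t' q' (y + s)).
  apply: (@measurableT_comp _ _ _ _ _ _ (f t' q') _ (fun y => y + s)); last exact: measurable_funD.
  exact: continuous_measurable_fun.
have intf t' q' : mu.-integrable setT (EFin \o f t' q').
  apply: (@integrable_gauss1_bounded _ 2); first by apply: measurable_funD => //; exact: measurable_cos_affine.
  move=> y; rewrite (le_trans (ler_normD _ _))// normr1; have := norm_cos_le1 (t' * y + q'); have := exp2_ge1 y; lra.
have intfs t' q' : mu.-integrable setT (EFin \o (fun y => f t' q' (y + s))).
  apply/integrableP; split; first exact/measurable_EFinP.
  under eq_integral do rewrite /= ger0_norm//.
  rewrite const; have /integrableP[_] := intf t' q'.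
  by under eq_integral do rewrite /= ger0_norm//.
have gE y : gauss1 y = 2^-1 * f 0 0 y by rewrite /f mul0r addr0 cos0; field.
have fE t' q' y : gauss1 y * cos (t' * y + q') = f t' q' y - 2^-1 * f 0 0 y by rewrite -gE /f; ring.
have i2 : mu.-integrable setT (EFin \o (fun y => 2^-1 * f 0 0 (y + s))) by exact: (integrableZl _ _ (intfs 0 0)).
have i2' : mu.-integrable setT (EFin \o (fun y => 2^-1 * f 0 0 y)) by exact: (integrableZl _ _ (intf 0 0)).
split.
  rewrite /cgauss; under eq_Rintegral do rewrite fE.
  under [RHS]eq_Rintegral do rewrite fE.
  rewrite !RintegralB// !RintegralZl//; congr (_ - _ * _); exact: (congr1 fine (const _ _)).
have := integrableB (@measurableT _ T1) (intfs t q) i2.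
by apply: eq_integrable => // y _ /=; rewrite -EFinB fE.
Qed.

(** Integration by parts in disguise: the integral of the translate by s does not depend on s, so
    its derivative at s = 0, computed under the integral sign, is zero. *)
Lemma cgauss_parts q t : \int[mu]_y (- (gauss1 y * y * cos (t * y + q))) =
  t * cgauss (q - pi / 2) t.
Proof.
pose f (s y : R) := gauss1 (y + s) * cos (t * (y + s) + q).
pose df (s y : R) := - (y + s) * gauss1 (y + s) * cos (t * (y + s) + q) -
   gauss1 (y + s) * (t * cos (t * (y + s) + (q - pi / 2))).
have dgoal : is_derive (0 : R) 1 (fun s => \int[mu]_y f s y) (\int[mu]_y df 0 y).
  pose K := 1 + `|t|.
  apply: (@derive_under_integral f df (fun y => K * (exp2 y * gauss1 y)) 0 1) => //.
  - by move=> s; have [] := cgauss_shift q t s.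
  - move=> s y; have h1 := is_derive_gauss1_shift y s.
    have h3 := is_derive_cos_affine 1 t (t * y + q) s.
    rewrite (_ : (fun z => f z y) = (fun z => gauss1 (y + z)) * (fun z : R => 1 * cos (z * t + (t * y + q)))).
      apply: is_derive_eq; rewrite /GRing.scale /= /df (_ : t * (y + s) + (q - pi / 2) = t * (y + s) + q - pi / 2) ?addrA// cos_sub_pihalf !mul1r.
      have -> : s * t + t * y + q = t * (y + s) + q by ring.
      by ring.
    by apply/funext => z; rewrite /f !fctE mul1r; congr (_ * cos _); ring.
  - move=> s y; rewrite subr0 => s1; rewrite /df.
    have e1 : gauss1 (y + s) <= expR `|y| * gauss1 y.
      rewrite /gauss1 -expRD ler_expR; have : - (y * s) <= `|y|.
        by rewrite (le_trans (ler_norm _))// normrN normrM ler_piMr// ltW.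
      have := sqr_ge0 s; rewrite !expr2; lra.
    have e2 : `|y + s| <= expR `|y|.
      apply: le_trans (expR_ge1Dx _); rewrite (le_trans (ler_normD _ _))//; lra.
    have e3 : expR `|y| * expR `|y| <= exp2 y.
      by rewrite -expRD (le_trans _ (exp2_abs y))// ler_expR; lra.
    have e4 : 1 <= expR `|y| by rewrite -expR0 ler_expR.
    have c1 := norm_cos_le1 (t * (y + s) + q).
    have c2 := norm_cos_le1 (t * (y + s) + (q - pi / 2)).
    rewrite (le_trans (ler_normB _ _))// !normrM normrN (ger0_norm (gauss1_ge0 _)).
    apply: (@le_trans _ _ (gauss1 (y + s) * (expR `|y| * (1 + `|t|)))).
      rewrite [X in X <= _](_ : _ = gauss1 (y + s) * (`|y + s| * `|cos (t * (y + s) + q)| + `|t| * `|cos (t * (y + s) + (q - pi / 2))|)); last by ring.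
      rewrite ler_wpM2l ?gauss1_ge0// [X in _ <= X]mulrDr mulr1 lerD//.
        by rewrite -[X in _ <= X]mulr1 ler_pM.
      by rewrite -[X in X <= _]mul1r ler_pM// ?mulr_ge0// ler_piMr.
    rewrite (le_trans (ler_wpM2r _ e1)) ?mulr_ge0 ?addr_ge0 ?expR_ge0//.
    rewrite [X in X <= _](_ : _ = (1 + `|t|) * ((expR `|y| * expR `|y|) * gauss1 y)); last by ring.
    by rewrite /K ler_wpM2l ?addr_ge0// ler_wpM2r ?gauss1_ge0.
  - exact: integrable_exp2_gauss1.
have d0 : \int[mu]_y df 0 y = 0.
  have E : (fun s => \int[mu]_y f s y) = cst (cgauss q t).
    by apply/funext => s; have [] := cgauss_shift q t s.
  have <- := @derive_val _ _ _ _ _ _ _ dgoal.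
  by rewrite E derive_cst.
have i2 : mu.-integrable setT (EFin \o (fun y => - (gauss1 y * y * cos (t * y + q)))).
  have -> : (fun y => - (gauss1 y * y * cos (t * y + q))) = (fun y => gauss1 y * (- (y * cos (t * y + q)))).
    by apply/funext => y; ring.
  apply: (@integrable_gauss1_bounded _ 1).
    apply: measurableT_comp => //; apply: measurable_funM => //; exact: measurable_cos_affine.
  by move=> y; rewrite mul1r normrN normrM (le_trans _ (exp2_norm y))// ler_piMr.
have i3 := integrable_cgauss (q - pi / 2) t.
have i4 : mu.-integrable setT (EFin \o (fun y => t * (gauss1 y * cos (t * y + (q - pi / 2))))) by exact: (integrableZl _ _ i3).
rewrite /cgauss -RintegralZl//; apply/eqP; rewrite -subr_eq0 -RintegralB// -[X in _ == X]d0; apply/eqP.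
by apply: eq_Rintegral => y _; rewrite /df !addr0; ring.
Qed.

Lemma is_derive_cgauss2 q t : is_derive t 1 (cgauss q) (- t * cgauss q t).
Proof.
apply: (is_derive_eq (is_derive_cgauss q t)); rewrite cgauss_parts mulNr -mulrN; congr (_ * _).
rewrite /cgauss -[RHS]mulN1r -RintegralZl//; last exact: integrable_cgauss.
apply: eq_Rintegral => y _; rewrite mulN1r -[RHS]mulrN; congr (_ * _).
by rewrite (_ : t * y + (q - pi / 2 - pi / 2) = t * y + q - pi); [rewrite cosB cospi sinpi; ring|field].
Qed.

(** The transform satisfies F' = - t F, so its product with e^(t^2/2) is constant and equals its
    value at 0. *)
Lemma cgaussE q t : cgauss q t = Num.sqrt (2 * pi) * (expR (- (t ^+ 2 / 2)) * cos q).
Proof.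
pose H (t : R) := cgauss q t * expR (t ^+ 2 / 2).
have dH s : is_derive s 1 H 0.
  have h1 := is_derive_cgauss2 q s.
  have h : is_derive s 1 (fun z : R => z ^+ 2 / 2) s by apply: is_derive_eq; rewrite /GRing.scale /=; field.
  have h2 : is_derive s 1 (expR \o (fun z : R => z ^+ 2 / 2)) (expR (s ^+ 2 / 2) * s) by exact: is_derive1_comp.
  have -> : H = cgauss q * (expR \o (fun z : R => z ^+ 2 / 2)) by [].
  by apply: is_derive_eq; rewrite /GRing.scale /=; ring.
have Hc : H t = H 0 by apply: (@is_derive_0_is_cst _ H).
have H0 : H 0 = Num.sqrt (2 * pi) * cos q.
  rewrite /H expr0n /= mul0r expR0 mulr1 /cgauss.
  under eq_Rintegral do rewrite mul0r add0r mulrC.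
  have i := integrable_gauss1 0 1; have := integral_gauss1 0; rewrite expr0n /= mul0r expR0 mul1r => I0.
  rewrite RintegralZl//; last by apply: eq_integrable i => // y _ /=; rewrite mul0r expR0 !mul1r.
  rewrite mulrC -I0; congr (_ * _); apply: eq_Rintegral => y _; by rewrite mul0r expR0 mul1r.
apply: (mulIf (lt0r_neq0 (expR_gt0 (t ^+ 2 / 2)))); rewrite -/(H t) Hc H0.
by rewrite -!mulrA (mulrC (cos q)) (mulrA (expR _)) -expRD addNr expR0 mul1r.
Qed.

End Gauss1.

(** * Gaussian integrals in several variables *)

Section GaussFormula.
Context {R : realType}.
Local Notation mu := (@lebesgue_measure R).
Local Notation T1 := (measurableTypeR R).

Lemma continuous_gauss1_cos (p q t u : R) : continuous (fun y : R => gauss1 y * (p + q * cos (t * y + u))).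
Proof.
move=> y; apply/differentiable_continuous/derivable1_diffP.
have h1 := is_derive_gauss1_shift 0 y; have h2 := is_derive_cos_affine q t u y.
have -> : (fun y : R => gauss1 y * (p + q * cos (t * y + u))) =
   (fun z => gauss1 (0 + z)) * (cst p + (fun z : R => q * cos (z * t + u))).
  by apply/funext => z; rewrite !fctE add0r (mulrC z).
exact: ex_derive.
Qed.

(** The condition |q| <= p keeps the integrands nonnegative, so substitution and iterated
    integration apply before integrability is known. *)
Lemma posr_cos (p q u : R) : `|q| <= p -> 0 <= p + q * cos u.
Proof.
move=> qp; have : `|q * cos u| <= p.
  by rewrite normrM (le_trans _ qp)// ler_piMr// ler_norml cos_geN1 cos_le1.
by rewrite ler_norml; lra.
Qed.

Lemma integral_gauss1_cos (p q t u : R) : `|q| <= p ->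
  (\int[mu]_y (gauss1 y * (p + q * cos (t * y + u)))%:E =
  (Num.sqrt (2 * pi) * (p + q * expR (- (t ^+ 2 / 2)) * cos u))%:E)%E.
Proof.
move=> qp; have i1 : mu.-integrable setT (EFin \o gauss1).
  have i := @integrable_gauss1 R 0 1; apply: eq_integrable i => // y _ /=; by rewrite mul0r expR0 !mul1r.
have i2 := integrable_cgauss u t.
have e1 : \int[mu]_y gauss1 y = Num.sqrt (2 * pi).
  have := integral_gauss1 (0 : R); rewrite expr0n /= mul0r expR0 mul1r => <-.
  by apply: eq_Rintegral => y _; rewrite mul0r expR0 mul1r.
have i1' : mu.-integrable setT (EFin \o (fun y => p * gauss1 y)) by exact: (integrableZl _ _ i1).
have i2' : mu.-integrable setT (EFin \o (fun y => q * (gauss1 y * cos (t * y + u)))) by exact: (integrableZl _ _ i2).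
have E y : gauss1 y * (p + q * cos (t * y + u)) = p * gauss1 y + q * (gauss1 y * cos (t * y + u)) by ring.
have i3 : mu.-integrable setT (EFin \o (fun y => gauss1 y * (p + q * cos (t * y + u)))).
  have := integrableD (@measurableT _ T1) i1' i2'.
  by apply: eq_integrable => // y _ /=; rewrite -EFinD E.
rewrite -[LHS]fineK; last exact: integrable_fin_num.
congr EFin; rewrite -[LHS]/(\int[mu]_y (gauss1 y * (p + q * cos (t * y + u)))).
under eq_Rintegral do rewrite E.
rewrite RintegralD// !RintegralZl// e1 -/(cgauss u t) cgaussE; ring.
Qed.

Lemma gauss1_formula (b c A D p q u : R) : 0 < b -> `|q| <= p ->
  (\int[mu]_y (expR (b * A * (y + c) - b * (y + c) ^+ 2 / 2) * (p + q * cos (b * D * (y + c) + u)))%:E =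
  (Num.sqrt (2 * pi) / Num.sqrt b * (expR (b * A ^+ 2 / 2) * (p + q * expR (- (b * D ^+ 2 / 2)) * cos (b * A * D + u))))%:E)%E.
Proof.
move=> b0 qp; pose s := Num.sqrt b; have s0 : 0 < s by rewrite sqrtr_gt0.
have sb : s ^+ 2 = b by rewrite sqr_sqrtr// ltW.
(* Completing the square recentres at [A - c], and the factor [sqrt b] normalizes the variance. *)
pose F (y : R) := s * (y + (c - A)); pose k := expR (b * A ^+ 2 / 2) / s.
have k0 : 0 < k by rewrite divr_gt0// expR_gt0.
pose G (v : R) := k * (gauss1 v * (p + q * cos (s * D * v + (b * A * D + u)))).
have hF (y : R) : is_derive y 1 F s.
  by apply: is_derive_eq; rewrite /GRing.scale /=; ring.
have F' : F^`()%classic = cst s.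
  by apply/funext => y; rewrite derive1E; apply: derive_val.
have FG y : expR (b * A * (y + c) - b * (y + c) ^+ 2 / 2) * (p + q * cos (b * D * (y + c) + u)) = G (F y) * s.
  rewrite /G /F /k.
  transitivity (expR (b * A ^+ 2 / 2) * gauss1 (s * (y + (c - A))) * (p + q * cos (s * D * (s * (y + (c - A))) + (b * A * D + u)))); last by field; rewrite gt_eqF.
  congr (_ * (p + q * cos _)); last by rewrite -sb; ring.
  by rewrite /gauss1 -expRD; congr expR; rewrite -sb; field.
have G0 v : 0 <= G v.
  by apply: mulr_ge0; [exact: ltW|apply: mulr_ge0; [exact: gauss1_ge0|exact: posr_cos]].
under eq_integral do rewrite FG.
have -> : (fun y => (G (F y) * s)%:E) = (fun y => (((G \o F) * F^`()%classic) y)%:E).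
  by apply/funext => y; rewrite F' !fctE.
rewrite -increasing_ge0_integration_by_substitutionT//.
- under eq_integral do rewrite EFinM.
  rewrite ge0_integralZl//; last 3 first.
  + apply/measurable_EFinP; apply: continuous_measurable_fun; exact: continuous_gauss1_cos.
  + by move=> v _; rewrite lee_fin mulr_ge0 ?gauss1_ge0 ?posr_cos.
  + by rewrite lee_fin ltW.
  rewrite integral_gauss1_cos// -EFinM; congr EFin; rewrite /k.
  rewrite exprMn sb; rewrite -/s; field; exact: lt0r_neq0.
- by move=> x y xy; rewrite /F ltr_pM2l// ltrD2r.
- by rewrite F' => ?; exact: cvg_cst.
- by rewrite F'; exact: is_cvg_cst.
- by rewrite F'; exact: is_cvg_cst.
- apply: gt0_cvgMrNy => //; exact: cvg_addrr_Ny.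
- apply: gt0_cvgMry => //; exact: cvg_addrr.
- move=> y; apply: cvgM; [exact: cvg_cst|exact: continuous_gauss1_cos].
Qed.

Lemma measurable_bforml n (B : 'M[R]_n) a :
  measurable_fun [set: 'rV[R]_n] (fun x => bform B x a : T1).
Proof.
under eq_fun do rewrite bformE.
apply: measurable_sum => i; apply: measurable_sum => j; apply: measurable_funM => //.
by apply: measurable_funM => //; exact: measurable_rV_coord.
Qed.

Lemma measurable_bform2 n (B : 'M[R]_n) :
  measurable_fun [set: 'rV[R]_n] (fun x => bform B x x : T1).
Proof.
under eq_fun do rewrite bformE.
apply: measurable_sum => i; apply: measurable_sum => j; apply: measurable_funM; last exact: measurable_rV_coord.
by apply: measurable_funM => //; exact: measurable_rV_coord.
Qed.

(** A nonnegative family, for |q| <= p, that is closed up to constants under integrating out one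
    coordinate: the form, [q] and [u] change, the shape does not. Differences of two members give
    signed cosine integrals. *)
Definition gaussk n (B : 'M[R]_n) (al be : 'rV[R]_n) (p q u : R) (x : 'rV[R]_n) : R :=
  expR (bform B x al - bform B x x / 2) * (p + q * cos (bform B x be + u)).

Lemma measurable_cos_fun d (T : measurableType d) (f : T -> T1) : measurable_fun setT f ->
  measurable_fun setT (fun x => cos (f x) : T1).
Proof. by move=> mf; apply: measurableT_comp => //; apply: continuous_measurable_fun; exact: continuous_cos. Qed.

Lemma measurable_gaussk n B al be p q u : measurable_fun [set: 'rV[R]_n] (gaussk B al be p q u : 'rV[R]_n -> T1).
Proof.
apply: measurable_funM.
  apply: measurableT_comp => //; apply: measurable_funB; first exact: measurable_bforml.
  by apply: measurable_funM => //; exact: measurable_bform2.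
apply: measurable_funD => //; apply: measurable_funM => //; apply: measurable_cos_fun.
by apply: measurable_funD => //; exact: measurable_bforml.
Qed.

Section Schur.
Variables (n : nat) (B : 'M[R]_(1 + n)).
Hypothesis Bsym : B^T = B.
Hypothesis Bpos : forall a, a != 0 -> 0 < bform B a a.
Let b := B 0 0.
Let w : 'rV[R]_n := ursubmx B.
(** The Schur complement of the top left entry: the form that remains after completing the square in
    the first coordinate, which [schur_shift] translates. *)
Definition schur : 'M[R]_n := drsubmx B - b^-1 *: (w^T *m w).
Definition schur_shift (v : 'rV[R]_n) : R := (v *m w^T) 0 0 / b.

Let BE : B = block_mx b%:M w w^T (drsubmx B).
Proof.
rewrite -[LHS]submxK; congr block_mx.
  apply/matrixP => i j; rewrite !ord1 !mxE eqxx mulr1n; congr (B _ _); exact: val_inj.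
by rewrite -[in LHS]Bsym -trmx_ursub.
Qed.

Lemma schur_b_gt0 : 0 < b.
Proof.
have := Bpos (a := delta_mx 0 0); rewrite /bform -rowE trmx_delta -colE !mxE; apply.
by apply/eqP => /rowP/(_ 0)/eqP; rewrite !mxE !eqxx oner_eq0.
Qed.

Lemma bform_schur (x0 y0 : R) (v u : 'rV[R]_n) :
  bform B (row_mx x0%:M v) (row_mx y0%:M u) =
  b * (x0 + schur_shift v) * (y0 + schur_shift u) + bform schur v u.
Proof.
have b0 := gt_eqF schur_b_gt0.
have E : (w *m u^T) 0 0 = (u *m w^T) 0 0 by rewrite -[w *m u^T]trmxK trmx_mul trmxK mxE.
have F (M N : 'M[R]_1) : (M + N) 0 0 = M 0 0 + N 0 0 by rewrite mxE.
have F1 (M : 'M[R]_1) (k : R) : (M *m k%:M) 0 0 = k * M 0 0 by rewrite mul_mx_scalar mxE.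
have F2 (M : 'M[R]_1) (k : R) : (k *: M) 0 0 = k * M 0 0 by rewrite mxE.
have F3 (k : R) : (k%:M : 'M[R]_1) 0 0 = k by rewrite mxE eqxx mulr1n.
have F4 (M N : 'M[R]_1) : (M *m N) 0 0 = M 0 0 * N 0 0 by rewrite mxE big_ord1.
have F5 (M : 'M[R]_1) : (- M) 0 0 = - M 0 0 by rewrite mxE.
have e3 : (v *m schur *m u^T) 0 0 = (v *m drsubmx B *m u^T) 0 0 - (v *m w^T) 0 0 * (u *m w^T) 0 0 / b.
  rewrite /schur mulmxBr mulmxBl F F5 -scalemxAr -scalemxAl F2 mulmxA -(mulmxA (v *m w^T)) F4 E.
  by congr (_ - _); rewrite mulrC.
rewrite /bform {1}BE mul_row_block tr_row_mx mul_row_col tr_scalar_mx.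
rewrite !mulmxDl !F !F1 F3 mul_scalar_mx -scalemxAl F2 e3 /schur_shift E.
by field; rewrite b0.
Qed.

Lemma schur_sym : schur^T = schur.
Proof.
by rewrite /schur linearB linearZ /= trmx_mul trmxK trmx_drsub Bsym.
Qed.

Lemma schur_pos a : a != 0 -> 0 < bform schur a a.
Proof.
move=> a0; have := Bpos (a := row_mx (- schur_shift a)%:M a).
rewrite bform_schur addNr mulr0 add0r; apply.
by apply: contraNneq a0 => /(congr1 (@rsubmx _ _ 1 _)); rewrite row_mxKr linear0 => ->.
Qed.

Lemma det_schur : \det B = b * \det schur.
Proof.
have b0 : b != 0 by rewrite gt_eqF// schur_b_gt0.
pose U : 'M[R]_(1 + n) := block_mx 1%:M (- b^-1 *: w) 0 1%:M.
have : \det (B *m U) = b * \det schur.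
  rewrite {1}BE mulmx_block !mulmx1 !mulmx0 !addr0 mul_scalar_mx scalerA mulrN mulfV// scaleN1r addNr.
  rewrite -[w^T *m _]scalemxAr scaleNr addrC det_lblock det_scalar1.
  by congr (_ * \det _).
rewrite det_mulmx => <-; rewrite /U det_ublock !det1 !mulr1. by [].
Qed.
End Schur.

Lemma rV_consE n (p : T1 * 'rV[R]_n) : rV_cons p = row_mx (p.1%:M : 'rV[R]_1) p.2 :> 'rV[R]_(1 + n).
Proof. by []. Qed.

(** Induction on the dimension: Tonelli isolates the first coordinate, [gauss1_formula] integrates
    it, and a Gaussian for the Schur complement remains. Positivity of the determinant is carried
    along because the square root factors over it. *)
Lemma gauss_formula n (B : 'M[R]_n) al be p q u : B^T = B -> (forall a, a != 0 -> 0 < bform B a a) -> `|q| <= p ->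
  (\int[lebesgue_rV n]_x (gaussk B al be p q u x)%:E =
   (Num.sqrt (2 * pi) ^+ n / Num.sqrt (\det B) * (expR (bform B al al / 2) *
      (p + q * expR (- (bform B be be / 2)) * cos (bform B al be + u))))%:E)%E /\ 0 < \det B.
Proof.
elim: n B al be p q u => [|n IH] B al be p q u Bs Bp qp.
  rewrite det_mx00 /= integral_dirac//; last by apply/measurable_EFinP; exact: measurable_gaussk.
  rewrite /dirac indicT mul1e; split => //; congr EFin.
  have b0 (x z : 'rV[R]_0) : bform B x z = 0 by rewrite [x]thinmx0 bform0l.
  by rewrite /gaussk !b0 !mul0r subr0 oppr0 !add0r expR0 sqrtr1 expr0 invr1 !(mul1r, mulr1).
have sp := schur_pos Bs Bp; have ss := schur_sym Bs; have b0 := schur_b_gt0 Bp.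
have dE := det_schur Bs Bp.
set b : R := (B : 'M[R]_(1 + n)) 0 0 in b0 dE *.
pose S := schur B; have [_ dS] := IH S 0 0 1 0 0 ss sp (eq_ind_r (fun x => x <= 1) ler01 (normr0 _)).
have dB : 0 < \det B by rewrite dE mulr_gt0.
split => //.
pose A0 := (al : 'rV[R]_(1 + n)) 0 0; pose al' := rsubmx (al : 'rV[R]_(1 + n)).
pose D0 := (be : 'rV[R]_(1 + n)) 0 0; pose be' := rsubmx (be : 'rV[R]_(1 + n)).
have consE (a : 'rV[R]_(1 + n)) : a = row_mx (a 0 0)%:M (rsubmx a).
  rewrite -[LHS]hsubmxK; congr row_mx; apply/rowP => i; rewrite !mxE !ord1 eqxx mulr1n; congr (a _ _); exact: val_inj.
have bE (x0 : R) v (a : 'rV[R]_(1 + n)) : bform (B : 'M[R]_(1 + n)) (row_mx x0%:M v) a =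
    b * (x0 + schur_shift B v) * (a 0 0 + schur_shift B (rsubmx a)) + bform S v (rsubmx a).
  by rewrite {1}[a]consE (bform_schur Bs Bp).
pose A := A0 + schur_shift B al'; pose D := D0 + schur_shift B be'.
have mk := measurable_gaussk B al be p q u.
rewrite /= ge0_integral_pushforward//; last 3 first.
- exact: measurable_rV_cons.
- exact/measurable_EFinP.
- by move=> x _; rewrite lee_fin mulr_ge0 ?expR_ge0 ?posr_cos.
rewrite preimage_setT.
rewrite fubini_tonelli1; last 2 first.
- apply/measurable_EFinP; apply: measurableT_comp => //; exact: measurable_rV_cons.
- by move=> x; rewrite lee_fin mulr_ge0 ?expR_ge0 ?posr_cos.
rewrite /fubini_F fubini_tonelli; last 2 first.
- apply/measurable_EFinP; apply: measurableT_comp => //; exact: measurable_rV_cons.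
- by move=> x; rewrite lee_fin mulr_ge0 ?expR_ge0 ?posr_cos.
(* The one-dimensional integral contributes the constant [K], damps the cosine by exp(-b D^2/2) and
   adds the phase b A D. *)
pose q' := q * expR (- (b * D ^+ 2 / 2)); pose K := Num.sqrt (2 * pi) / Num.sqrt b * expR (b * A ^+ 2 / 2).
have inner v : (\int[mu]_x0 (gaussk B al be p q u (rV_cons (x0, v)))%:E =
    (K * gaussk S al' be' p q' (b * A * D + u) v)%:E)%E.
  pose c := schur_shift B v; pose k := expR (bform S v al' - bform S v v / 2).
  have E x0 : gaussk B al be p q u (rV_cons (x0, v)) = k *
     (expR (b * A * (x0 + c) - b * (x0 + c) ^+ 2 / 2) * (p + q * cos (b * D * (x0 + c) + (bform S v be' + u)))).
    rewrite /gaussk rV_consE !bE mulrA; congr (_ * (p + q * cos _)).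
      rewrite /k -expRD row_mxKr; congr expR; rewrite -/c -/al' -/A0 -/(A) .
      have -> : (row_mx x0%:M v : 'rV[R]_(1 + n)) 0 0 = x0.
        rewrite (_ : 0 = lshift n (0 : 'I_1) :> 'I_(1 + n)); last exact: val_inj.
        by rewrite row_mxEl mxE eqxx mulr1n.
      by rewrite -/A -/c /=; ring.
    by rewrite /= -/c -/be' -/D0 -/D; ring.
  under eq_integral do rewrite E EFinM.
  rewrite ge0_integralZl//; last 3 first.
  + apply/measurable_EFinP; apply: measurable_funM.
      apply: measurableT_comp => //; apply: measurable_funB.
        by apply: measurable_funM => //; exact: measurable_funD.
      apply: measurable_funM => //; apply: measurable_funM => //; apply: measurable_funX; exact: measurable_funD.
    apply: measurable_funD => //; apply: measurable_funM => //; apply: measurable_cos_fun.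
    by apply: measurable_funD => //; apply: measurable_funM => //; exact: measurable_funD.
  + by move=> x0 _; rewrite lee_fin mulr_ge0 ?expR_ge0 ?posr_cos.
  + by rewrite lee_fin expR_ge0.
  rewrite gauss1_formula// -EFinM; congr EFin; rewrite /K /gaussk /q' -/k.
  by rewrite (_ : b * A * D + (bform S v be' + u) = bform S v be' + (b * A * D + u)); ring.
under eq_integral do rewrite inner EFinM.
have K0 : 0 <= K by rewrite mulr_ge0 ?expR_ge0// divr_ge0// sqrtr_ge0.
have q'p : `|q'| <= p.
  rewrite normrM (le_trans _ qp)// ler_piMr// ger0_norm ?expR_ge0// -expR0 ler_expR oppr_le0.
  by rewrite divr_ge0// mulr_ge0// ?sqr_ge0// ltW.
rewrite ge0_integralZl//; last 2 first.
- by apply/measurable_EFinP; exact: measurable_gaussk.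
- by move=> x _; rewrite lee_fin mulr_ge0 ?expR_ge0 ?posr_cos.
have [-> _] := IH S al' be' p q' (b * A * D + u) ss sp q'p.
have bEE a a' : bform B a a' = b * ((a : 'rV[R]_(1 + n)) 0 0 + schur_shift B (rsubmx (a : 'rV[R]_(1 + n)))) *
   ((a' : 'rV[R]_(1 + n)) 0 0 + schur_shift B (rsubmx (a' : 'rV[R]_(1 + n)))) + bform S (rsubmx (a : 'rV[R]_(1 + n))) (rsubmx (a' : 'rV[R]_(1 + n))).
  by rewrite {1}[a]consE bE.
rewrite -EFinM; congr EFin; rewrite !bEE -/A0 -/al' -/D0 -/be' -/A -/D dE (sqrtrM _ (ltW b0)).
rewrite /K /q' -/S (exprS (Num.sqrt (2 * pi)) n).
rewrite (_ : b * A * D + bform S al' be' + u = bform S al' be' + (b * A * D + u)); last by ring.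
rewrite [(b * A * A + _) / 2](_ : _ = b * A ^+ 2 / 2 + bform S al' al' / 2); last by field.
rewrite [(b * D * D + _) / 2](_ : _ = b * D ^+ 2 / 2 + bform S be' be' / 2); last by field.
rewrite opprD !expRD; field.
by rewrite !gt_eqF ?sqrtr_gt0.
Qed.

End GaussFormula.

(** * Exponential transforms *)

Section ComplexExp.
Context {R : realType}.
Implicit Types (a b t h : R) (z w : R[i]).
Local Notation Re := (@complex.Re R).
Local Notation Im := (@complex.Im R).

Lemma cReD z w : Re (z + w) = Re z + Re w. Proof. by case: z; case: w. Qed.
Lemma cImD z w : Im (z + w) = Im z + Im w. Proof. by case: z; case: w. Qed.
Lemma cReM z w : Re (z * w) = Re z * Re w - Im z * Im w. Proof. by case: z; case: w. Qed.
Lemma cImM z w : Im (z * w) = Re z * Im w + Im z * Re w. Proof. by case: z; case: w. Qed.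
Lemma cReN z : Re (- z) = - Re z. Proof. by case: z. Qed.
Lemma cImN z : Im (- z) = - Im z. Proof. by case: z. Qed.
Lemma cReB z w : Re (z - w) = Re z - Re w. Proof. by rewrite cReD cReN. Qed.
Lemma cImB z w : Im (z - w) = Im z - Im w. Proof. by rewrite cImD cImN. Qed.

Lemma cRe_additive : zmod_morphism Re. Proof. exact: cReB. Qed.
Lemma cIm_additive : zmod_morphism Im. Proof. exact: cImB. Qed.
HB.instance Definition _ := GRing.isZmodMorphism.Build R[i] R Re cRe_additive.
HB.instance Definition _ := GRing.isZmodMorphism.Build R[i] R Im cIm_additive.

Lemma complex_ext z w : Re z = Re w -> Im z = Im w -> z = w.
Proof. by case: z => a b; case: w => c d /= -> ->. Qed.

Lemma Re_scale (k : R) w : Re (k%:C%C * w) = k * Re w.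
Proof. by case: w => a b /=; rewrite mul0r subr0. Qed.

Definition cexp a b : R[i] := Complex (expR a * cos b) (expR a * sin b).

Lemma cexpD a b a' b' : cexp (a + a') (b + b') = cexp a b * cexp a' b'.
Proof. by apply: complex_ext; rewrite ?cReM ?cImM /= expRD ?cosD ?sinD; ring. Qed.

Lemma cexp0 : cexp 0 0 = 1.
Proof. by apply: complex_ext; rewrite /= expR0 ?cos0 ?sin0 mul1r. Qed.

Lemma cexpX a b n : cexp a b ^+ n = cexp (n%:R * a) (n%:R * b).
Proof.
elim: n => [|n IH]; first by rewrite expr0 !mul0r cexp0.
by rewrite exprS IH -cexpD; congr cexp; rewrite -natr1; ring.
Qed.

Definition ccvg (u : nat -> R[i]) (l : R[i]) :=
  (Re \o u) @ \oo --> Re l /\ (Im \o u) @ \oo --> Im l.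

Lemma ccvg_cst z : ccvg (fun=> z) z. Proof. by split; exact: cvg_cst. Qed.

Lemma ccvgM u v z w : ccvg u z -> ccvg v w -> ccvg (fun n => u n * v n) (z * w).
Proof.
move=> [u1 u2] [v1 v2]; split.
  rewrite (_ : Re \o _ = (fun n => Re (u n) * Re (v n) - Im (u n) * Im (v n))) ?cReM; first by apply: cvgB; apply: cvgM.
  by apply/funext => n /=; rewrite cReM.
rewrite (_ : Im \o _ = (fun n => Re (u n) * Im (v n) + Im (u n) * Re (v n))) ?cImM; first by apply: cvgD; apply: cvgM.
by apply/funext => n /=; rewrite cImM.
Qed.

Lemma ccvg_prod I (s : seq I) (u : I -> nat -> R[i]) (l : I -> R[i]) :
  (forall i, ccvg (u i) (l i)) -> ccvg (fun n => \prod_(i <- s) u i n) (\prod_(i <- s) l i).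
Proof.
move=> ul; elim: s => [|i s IH].
  by rewrite big_nil (_ : (fun n => _) = fun=> 1); [exact: ccvg_cst|apply/funext => n; rewrite big_nil].
rewrite big_cons (_ : (fun n => _) = (fun n => u i n * \prod_(j <- s) u j n)); first exact: ccvgM.
by apply/funext => n; rewrite big_cons.
Qed.

Lemma ccvg_cexp (a b : nat -> R) p q : a @ \oo --> p -> b @ \oo --> q ->
  ccvg (fun n => cexp (a n) (b n)) (cexp p q).
Proof.
move=> ap bq; split; apply: cvgM.
- exact: (cvg_comp _ _ ap (@continuous_expR R p)).
- exact: (cvg_comp _ _ bq (@continuous_cos R q)).
- exact: (cvg_comp _ _ ap (@continuous_expR R p)).
- exact: (cvg_comp _ _ bq (@continuous_sin R q)).
Qed.

(** The 1-norm is submultiplicative and dominates both real and imaginary part, which is what the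
    estimates below use. *)
Definition cnorm z : R := `|Re z| + `|Im z|.

Lemma cnorm_ge0 z : 0 <= cnorm z. Proof. exact: addr_ge0. Qed.

Lemma cnormD z w : cnorm (z + w) <= cnorm z + cnorm w.
Proof. by rewrite /cnorm cReD cImD addrACA lerD// ler_normD. Qed.

Lemma cnormM z w : cnorm (z * w) <= cnorm z * cnorm w.
Proof.
rewrite /cnorm cReM cImM; apply: (@le_trans _ _ (`|Re z| * `|Re w| + `|Im z| * `|Im w| + (`|Re z| * `|Im w| + `|Im z| * `|Re w|))).
  rewrite -!normrM; apply: lerD; [exact: ler_normB|exact: ler_normD].
by rewrite le_eqVlt; apply/orP; left; apply/eqP; ring.
Qed.

Lemma cnormX_le z (M : R) n : cnorm z <= M -> 1 <= M -> cnorm (z ^+ n) <= M ^+ n.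
Proof.
move=> zM M1; elim: n => [|n IH]; first by rewrite !expr0 /cnorm normr1 normr0 addr0.
by rewrite !exprS (le_trans (cnormM _ _))// ler_pM// cnorm_ge0.
Qed.

(** Telescoping z^n - w^n into n terms, each with one factor z - w and the other factors bounded by
    [M]. *)
Lemma cnormX_sub z w (M : R) n : cnorm z <= M -> cnorm w <= M -> 1 <= M ->
  cnorm (z ^+ n - w ^+ n) <= n%:R * cnorm (z - w) * M ^+ n.
Proof.
move=> zM wM M1; elim: n => [|n IH].
  by rewrite !expr0 subrr /cnorm !normr0 addr0 !mul0r.
have -> : z ^+ n.+1 - w ^+ n.+1 = z * (z ^+ n - w ^+ n) + (z - w) * w ^+ n by rewrite !exprS; ring.
rewrite (le_trans (cnormD _ _))//.
rewrite [X in _ <= X](_ : _ = n%:R * cnorm (z - w) * M ^+ n.+1 + cnorm (z - w) * M ^+ n.+1); last by rewrite -natr1; ring.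
rewrite lerD//.
  rewrite (le_trans (cnormM _ _))// exprS mulrCA ler_pM// ?cnorm_ge0//.
rewrite (le_trans (cnormM _ _))// ler_wpM2l ?cnorm_ge0// (le_trans (cnormX_le _ wM M1))//.
by rewrite exprS ler_peMl// exprn_ge0// (le_trans ler01).
Qed.

Lemma sin_abs_le b : `|sin b| <= `|b|.
Proof.
wlog b0 : b / 0 <= b.
  move=> H; case: (lerP 0 b) => [/H//|/ltW b0]; by have := H (- b); rewrite sinN !normrN oppr_ge0; apply.
rewrite [X in _ <= X]ger0_norm//.
have [c _] : exists2 c, c \in `[0, b] & sin b - sin 0 = cos c * (b - 0).
  apply: (@MVT_segment _ sin cos) => //.
  by apply: continuous_subspaceT => x; exact: continuous_sin.
rewrite sin0 !subr0 => ->; rewrite normrM (ger0_norm b0) ler_piMl//.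
by rewrite ler_norml cos_geN1 cos_le1.
Qed.

Lemma one_sub_cos_le b : 0 <= 1 - cos b <= b ^+ 2 / 2.
Proof.
have E : 1 - cos b = 2 * sin (b / 2) ^+ 2.
  have := cos2Dsin2 (b / 2); have -> : cos b = cos (b / 2 + b / 2) by rewrite -splitr.
  rewrite cosD !expr2; lra.
rewrite E mulr_ge0 ?sqr_ge0//=; have := sin_abs_le (b / 2); rewrite -(@ler_sqr _ `|_|) ?nnegrE// !real_normK ?num_real//.
rewrite exprMn; lra.
Qed.

Lemma sub_sin_le b : `|b| <= 1 -> `|b - sin b| <= `|b| ^+ 2.
Proof.
wlog b0 : b / 0 <= b.
  move=> H; case: (lerP 0 b) => [/H//|/ltW b0 b1]; have := H (- b).
  by rewrite sinN oppr_ge0 normrN (_ : - b - - sin b = - (b - sin b)) ?normrN; [apply|ring].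
rewrite ger0_norm// => b1.
have [c] : exists2 c, c \in `[0, b] & sin b - sin 0 = cos c * (b - 0).
  apply: (@MVT_segment _ sin cos) => //.
  by apply: continuous_subspaceT => x; exact: continuous_sin.
rewrite in_itv /= sin0 !subr0 => /andP[c0 cb] ->; have /andP[h1 h2] := one_sub_cos_le c.
have -> : b - cos c * b = b * (1 - cos c) by ring.
rewrite ger0_norm ?mulr_ge0// expr2 ler_wpM2l// (le_trans h2)//; nra.
Qed.

Lemma expR_sub_le a : `|a| <= 2^-1 -> `|expR a - 1 - a| <= 2 * `|a| ^+ 2.
Proof.
rewrite ler_norml => /andP[a1 a2]; have h1 := expR_ge1Dx a; have h2 := expR_ge1Dx (- a).
rewrite ger0_norm; last lra.
rewrite real_normK ?num_real//.
have : expR a * expR (- a) = 1 by rewrite -expRD subrr expR0.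
have := expR_gt0 a; nra.
Qed.

(** With z = 1 + w, the exponential of w agrees with z up to second order; the constant 8 is
    generous. *)
Lemma cexp_approx z : cnorm (z - 1) <= 2^-1 ->
  cnorm (z - cexp (Re (z - 1)) (Im (z - 1))) <= 8 * cnorm (z - 1) ^+ 2.
Proof.
set a := Re (z - 1); set b := Im (z - 1); rewrite {1 3}/cnorm -/a -/b => h.
have zE : z = Complex (1 + a) b.
  by apply: complex_ext; rewrite /a /b ?cReB ?cImB /=; ring.
have a2 : `|a| <= 2^-1 by have := normr_ge0 b; lra.
have b2 : `|b| <= 2^-1 by have := normr_ge0 a; lra.
have h1 := expR_sub_le a2; have /andP[h2 h3] := one_sub_cos_le b.
have h4 : `|b - sin b| <= `|b| ^+ 2 by apply: sub_sin_le; lra.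
have h5 := sin_abs_le b.
have e2 : expR a <= 2.
  move: h1; rewrite ler_norml => /andP[_ h1]; have := ler_norm a; have := normr_ge0 a; nra.
have e1 : `|1 - expR a| <= 2 * `|a|.
  have -> : 1 - expR a = - (expR a - 1 - a) + - a by ring.
  rewrite (le_trans (ler_normD _ _))// !normrN; have := normr_ge0 a; nra.
rewrite /cnorm zE cReB cImB /=.
have -> : 1 + a - expR a * cos b = - (expR a - 1 - a) + expR a * (1 - cos b) by ring.
have -> : b - expR a * sin b = (b - sin b) + sin b * (1 - expR a) by ring.
have e3 : `|- (expR a - 1 - a) + expR a * (1 - cos b)| <= 2 * `|a| ^+ 2 + `|b| ^+ 2.
  rewrite (le_trans (ler_normD _ _))// normrN lerD// ger0_norm ?mulr_ge0 ?expR_ge0//.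
  rewrite real_normK ?num_real//; have := expR_ge0 a; nra.
have e4 : `|b - sin b + sin b * (1 - expR a)| <= `|b| ^+ 2 + `|b| * (2 * `|a|).
  by rewrite (le_trans (ler_normD _ _))// lerD// normrM ler_pM.
have := normr_ge0 a; have := normr_ge0 b; nra.
Qed.

Lemma cnorm_cexp a b : cnorm (cexp a b) <= expR (`|a| + `|b|).
Proof.
rewrite /cnorm /= !normrM (ger0_norm (expR_ge0 a)) -mulrDr expRD ler_pM ?expR_ge0 ?addr_ge0//.
  by rewrite ler_expR ler_norm.
apply: le_trans (expR_ge1Dx _); rewrite lerD ?sin_abs_le//.
by rewrite ler_norml cos_geN1 cos_le1.
Qed.

(** Write z = 1 + w and compare z^N with exp(w)^N, which converges because N w does. The error is at
    most of order N |w|^2 e^(N |w|), that is, the bounded N |w| times |w|, which tends to 0. *)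
Lemma ccvg_pow (z : nat -> R[i]) (N : nat -> nat) p q :
  (fun n => (N n)%:R * Re (z n - 1)) @ \oo --> p -> (fun n => (N n)%:R * Im (z n - 1)) @ \oo --> q ->
  (fun n => cnorm (z n - 1)) @ \oo --> (0 : R) ->
  ccvg (fun n => z n ^+ N n) (cexp p q).
Proof.
move=> zp zq z0; pose y n := cexp (Re (z n - 1)) (Im (z n - 1)) ^+ N n.
have yl : ccvg y (cexp p q).
  rewrite (_ : y = fun n => cexp ((N n)%:R * Re (z n - 1)) ((N n)%:R * Im (z n - 1))); first exact: ccvg_cexp.
  by apply/funext => n; rewrite /y cexpX.
pose d n := cnorm (z n - 1); pose B n := 8 * ((N n)%:R * d n) * d n * expR ((N n)%:R * d n).
have Nd : (fun n => (N n)%:R * d n) @ \oo --> `|p| + `|q|.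
  rewrite (_ : (fun n => _) = (fun n => `|(N n)%:R * Re (z n - 1)| + `|(N n)%:R * Im (z n - 1)|)).
    by apply: cvgD; apply: cvg_norm.
  by apply/funext => n; rewrite /d /cnorm !normrM ger0_norm// mulrDr.
have B0 : B @ \oo --> (0 : R).
  rewrite (_ : 0 = 8 * (`|p| + `|q|) * 0 * expR (`|p| + `|q|)); last by rewrite mulr0 mul0r.
  apply: cvgM; last exact: (cvg_comp _ _ Nd (@continuous_expR R _)).
  by apply: cvgM => //; apply: cvgM => //; exact: cvg_cst.
have d_small : \forall n \near \oo, d n <= 2^-1.
  have /cvgrPdist_le/(_ (2^-1)) := z0; rewrite invr_gt0 => /(_ (ltr0n _ _)); apply: filterS => n.
  by rewrite sub0r normrN ger0_norm ?cnorm_ge0.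
have le : \forall n \near \oo, cnorm (z n ^+ N n - y n) <= B n.
  move: d_small; apply: filterS => n dn.
  have e1 : 1 <= expR (d n) by rewrite -expR0 ler_expR cnorm_ge0.
  apply: le_trans (cnormX_sub (N n) _ _ e1) _.
  - rewrite -[z n](subrK 1) (le_trans (cnormD _ _))// (le_trans _ (expR_ge1Dx _))//.
    by rewrite addrC lerD// /cnorm normr1 normr0 addr0.
  - exact: cnorm_cexp.
  rewrite /B expRM_natl; rewrite ler_wpM2r ?exprn_ge0 ?expR_ge0//.
  have := cexp_approx dn; rewrite -/(d n) => h; have := ler0n R (N n); have := cnorm_ge0 (z n - 1); rewrite -/(d n).
  move=> d0 N0; rewrite (le_trans (ler_wpM2l N0 h))//.
  by rewrite le_eqVlt; apply/orP; left; apply/eqP; ring.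
have c0 (f : R[i] -> R) : (forall w, `|f w| <= cnorm w) -> (fun n => f (z n ^+ N n - y n)) @ \oo --> (0 : R).
  move=> fc; apply/cvgr0Pnorm_le => e e0; have /cvgr0Pnorm_le/(_ e e0) := B0.
  move: le; apply: filterS2 => n h1 h2; apply: le_trans (fc _) (le_trans h1 (le_trans (ler_norm _) h2)).
case: yl => y1 y2; split.
  rewrite (_ : Re \o _ = (fun n => Re (z n ^+ N n - y n)) \+ (Re \o y)); last first.
    by apply/funext => n /=; rewrite cReB subrK.
  rewrite -[Re _]add0r; apply: cvgD => //; apply: c0 => w; by rewrite lerDl.
rewrite (_ : Im \o _ = (fun n => Im (z n ^+ N n - y n)) \+ (Im \o y)); last first.
  by apply/funext => n /=; rewrite cImB subrK.
rewrite -[Im _]add0r; apply: cvgD => //; apply: c0 => w; by rewrite lerDr.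
Qed.

(** The real part of exp(i t + h (a + i b)). The phase [t] yields the imaginary part too and absorbs
    derivatives in h. *)
Definition wave1 a b t h : R := expR (h * a) * cos (h * b + t).

Lemma is_derive_wave1 a b t h :
  is_derive h 1 (wave1 a b t) (a * wave1 a b t h + b * wave1 a b (t + pi / 2) h).
Proof.
have h1 : is_derive h 1 (fun z : R => z * a) a by apply: is_derive_eq; rewrite /GRing.scale /=; ring.
have h2 : is_derive h 1 (expR \o (fun z : R => z * a)) (expR (h * a) * a) by exact: is_derive1_comp.
have h3 := is_derive_cos_affine 1 b t h.
rewrite [X in is_derive _ _ X _](_ : wave1 a b t = (expR \o (fun z : R => z * a)) * (fun z : R => 1 * cos (z * b + t))); last first.
  by apply/funext => z; rewrite !fctE mul1r.
apply: is_derive_eq; rewrite /GRing.scale /= /wave1 !mul1r addrA cosDpihalf; ring.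
Qed.

Lemma wave1_0 a b t : wave1 a b t 0 = cos t.
Proof. by rewrite /wave1 !mul0r expR0 mul1r add0r. Qed.

Lemma cvg_ext (f g : nat -> R) (l : R) : f =1 g -> f @ \oo --> l -> g @ \oo --> l.
Proof. by move/funext->. Qed.

Lemma derive_seq (F : R -> R) d (h : nat -> R) : is_derive (0 : R) 1 F d -> h @ \oo --> (0 : R) ->
  (forall n, h n != 0) -> (fun n => (F (h n) - F 0) / h n) @ \oo --> d.
Proof.
move=> dF h0 hn0; have := @ex_derive _ _ _ _ _ _ _ dF; rewrite /derivable => cF.
have := @derive_val _ _ _ _ _ _ _ dF; rewrite /derive => <-.
have /(_ h) : forall h : nat -> R, h @ \oo --> (0 : R)^' -> (fun n => (h n)^-1 *: ((F \o shift 0) (h n *: 1) - F 0)) @ \oo -->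
    lim ((fun h => h^-1 *: ((F \o shift 0) (h *: 1) - F 0)) @ (0 : R)^').
  by move=> h' hh'; exact: (cvg_comp _ _ hh' cF).
have hh : h @ \oo --> (0 : R)^'.
  move=> A [e /= e0 eA]; have /cvgrPdist_lt/(_ e e0) := h0.
  by apply: filterS => n hn; apply: eA => //=; rewrite distrC.
move=> /(_ hh); apply: cvg_ext => n /=.
by rewrite addr0 /GRing.scale /= mulr1 mulrC.
Qed.

(** Second-order Taylor expansion along a sequence. After subtracting d h^2/2, the mean value
    theorem gives h (F'(xi) - d xi) with 0 < xi <= h, and F'(xi)/xi tends to d. *)
Lemma derive2_seq (F F' : R -> R) d (h : nat -> R) : (forall x : R, is_derive x 1 F (F' x)) -> F' 0 = 0 ->
  is_derive (0 : R) 1 F' d -> h @ \oo --> (0 : R) -> (forall n, 0 < h n) ->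
  (fun n => (F (h n) - F 0) / h n ^+ 2) @ \oo --> d / 2.
Proof.
move=> dF F'0 dF' h0 hn0.
have [xi xiP] : exists xi : nat -> R, forall n, 0 < xi n <= h n /\
   F (h n) - d / 2 * h n ^+ 2 - F 0 = (F' (xi n) - d * xi n) * h n.
  pose G x := F x - d / 2 * x ^+ 2.
  have dG (x : R) : is_derive x 1 G (F' x - d * x).
    by apply: is_derive_eq; rewrite /GRing.scale /=; field.
  have mvt n : exists xi, 0 < xi <= h n /\ F (h n) - d / 2 * h n ^+ 2 - F 0 = (F' xi - d * xi) * h n.
    have [x] : exists2 c, c \in `]0, h n[ & G (h n) - G 0 = (F' c - d * c) * (h n - 0).
      apply: (@MVT _ G) => //.
      apply: derivable_within_continuous => x _; by have [] := dG x.
    rewrite in_itv /= /G expr0n /= mulr0 !subr0 => /andP[x0 xh] E; exists x; rewrite x0 ltW//.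
  exists (fun n => xget 0 [set xi | 0 < xi <= h n /\ F (h n) - d / 2 * h n ^+ 2 - F 0 = (F' xi - d * xi) * h n]) => n.
  exact: (@xgetPex _ 0 [set xi | 0 < xi <= h n /\ _] (mvt n)).
have xi0 : xi @ \oo --> (0 : R).
  apply: (@squeeze_cvgr _ _ _ _ (cst 0) h) => //; last exact: cvg_cst.
  by apply: nearW => n; have [/andP[/ltW -> ->] _] := xiP n.
have q0 : (fun n => (F' (xi n) - F' 0) / xi n - d) @ \oo --> (0 : R).
  rewrite -[X in _ --> X](subrr d); apply: cvgB; last exact: cvg_cst.
  by apply: (derive_seq dF' xi0) => n; have [/andP[/lt0r_neq0]] := xiP n.
have r0 : (fun n => (F (h n) - d / 2 * h n ^+ 2 - F 0) / h n ^+ 2) @ \oo --> (0 : R).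
  apply/cvgr0Pnorm_le => e e0; have /cvgr0Pnorm_le/(_ e e0) := q0; apply: filterS => n.
  have [/andP[x0 xh] ->] := xiP n; rewrite F'0 subr0 => q.
  have -> : (F' (xi n) - d * xi n) * h n / h n ^+ 2 = (F' (xi n) / xi n - d) * (xi n / h n).
    by field; rewrite !gt_eqF.
  have e1 : `|xi n / h n| <= 1.
    by rewrite ger0_norm ?divr_ge0 ?(ltW x0) ?(ltW (hn0 n))// ler_pdivrMr// mul1r.
  by rewrite normrM (le_trans _ q)// ler_piMr.
rewrite (_ : (fun n => _) = (fun n => (F (h n) - d / 2 * h n ^+ 2 - F 0) / h n ^+ 2 + d / 2)).
  by rewrite -[X in _ --> X]add0r; apply: cvgD => //; exact: cvg_cst.
by apply/funext => n; field; rewrite gt_eqF.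
Qed.

(** This is 2 sinh(h z / 2) / h -> z at the complex number z = a + i b, read off from the
    derivatives of [wave1] with phases 0 and - pi/2. *)
Lemma ccvg_sinh a b (h : nat -> R) : h @ \oo --> (0 : R) -> (forall n, 0 < h n) ->
  ccvg (fun n => (h n)^-1%:C%C * (cexp (h n * (a / 2)) (h n * (b / 2)) - cexp (- (h n * (a / 2))) (- (h n * (b / 2)))))
    (Complex a b).
Proof.
move=> h0 hn0; have D t : is_derive (0 : R) 1 (wave1 (a / 2) (b / 2) t - wave1 (- (a / 2)) (- (b / 2)) t)
    (a * cos t + b * cos (t + pi / 2)).
  have h1 := is_derive_wave1 (a / 2) (b / 2) t 0; have h2 := is_derive_wave1 (- (a / 2)) (- (b / 2)) t 0.
  by apply: is_derive_eq; rewrite !wave1_0; field.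
have L t : (fun n => (wave1 (a / 2) (b / 2) t (h n) - wave1 (- (a / 2)) (- (b / 2)) t (h n)) / h n) @ \oo -->
    a * cos t + b * cos (t + pi / 2).
  have := derive_seq (D t) h0 (fun n => lt0r_neq0 (hn0 n)).
  by apply: cvg_ext => n; rewrite !fctE !wave1_0 subrr subr0.
split.
  have := L 0; rewrite cos0 add0r cos_pihalf mulr0 mulr1 addr0; apply: cvg_ext => n.
  by rewrite /comp cReM cReB /= mul0r subr0 /wave1 !addr0 !mulrN mulrC.
have := L (- (pi / 2)); rewrite addNr cosN cos_pihalf cos0 mulr0 mulr1 add0r; apply: cvg_ext => n.
by rewrite /comp cImM cImB /= mul0r addr0 /wave1 !cos_sub_pihalf !mulrN mulrC.
Qed.

End ComplexExp.

Lemma Rdominated_cvg {R : realType} d (T : measurableType d) (mu : {measure set T -> \bar R})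
    (f : nat -> T -> R) (g G : T -> R) :
  (forall n, measurable_fun setT (f n)) -> measurable_fun setT g ->
  mu.-integrable setT (EFin \o G) -> (forall x, f ^~ x @ \oo --> g x) -> (forall n x, `|f n x| <= G x) ->
  (fun n => \int[mu]_x f n x) @ \oo --> \int[mu]_x g x.
Proof.
move=> mf mg iG fg fG.
have inn n : mu.-integrable setT (EFin \o f n).
  apply: le_integrable iG => //; first exact/measurable_EFinP.
  by move=> x _ /=; rewrite lee_fin (le_trans (fG n x))// ler_norm.
have [||||ig _ dc] := @dominated_convergence _ _ R mu setT measurableT (fun n => EFin \o f n) (EFin \o g) (EFin \o G) _ _ _ iG.
- by move=> n; exact/measurable_EFinP.
- exact/measurable_EFinP.
- apply: aeW => x _; apply: cvg_EFin; [exact: nearW|exact: fg].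
- by apply: aeW => x n _ /=; rewrite lee_fin.
apply: fine_cvg; rewrite fineK; first exact: dc.
exact: integrable_fin_num.
Qed.

(** * Gaussian transforms of the product of the roots *)

Section GaussTransform.
Context {R : realType} {r : nat}.
Variables (B : 'M[R]_r) (Pos : seq 'rV[R]_r).
Local Notation fm := (bform B).
Local Notation sr b := (delta_mx 0 b : 'rV[R]_r).
Hypothesis Bsym : B^T = B.
Hypothesis Bpos : forall a, a != 0 -> 0 < fm a a.
Hypothesis Pos_uniq : uniq Pos.
Hypothesis Pos_neq0 : forall x, x \in Pos -> x != 0.
Hypothesis Pos_ge0 : forall x b, x \in Pos -> 0 <= x 0 b.
Hypothesis simple_Pos : forall b, sr b \in Pos.
Hypothesis refl_Pos : forall b x, x \in Pos -> x != sr b -> refl B b x \in Pos.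
Hypothesis Pos_int : forall b x, x \in Pos ->
  exists z : int, 2 * (fm x (sr b)) / (fm (sr b) (sr b)) = z%:~R.
Local Notation rho := (half_sum Pos).
Local Notation mu := (@lebesgue_rV R r).
Local Notation T1 := (measurableTypeR R).
Implicit Types (al be x : 'rV[R]_r) (u : R).

Definition gauss_const : R := Num.sqrt (2 * pi) ^+ r / Num.sqrt (\det B).
Definition gaussB x : R := expR (- (fm x x / 2)).
Definition wave al be u x : R := expR (fm x al) * cos (fm x be + u).
Definition half_sinh x : R := \prod_(b <- Pos) (expR (fm x b / 2) - expR (- (fm x b / 2))).
Definition exp2s (S : seq 'rV[R]_r) x : R := \prod_(b <- S) exp2 (fm x b).
(** With zeta = al + i be, this is the real part of e^(i u) e^((zeta,zeta)/2) times the product of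
    the (b,zeta): the root product evaluated at the complex point zeta. *)
Definition transform al be u : R := expR ((fm al al - fm be be) / 2) *
  complex.Re (cexp 0 (fm al be + u) * \prod_(b <- Pos) Complex (fm b al) (fm b be)).

Lemma gaussB_ge0 x : 0 <= gaussB x. Proof. exact: expR_ge0. Qed.

Lemma measurable_wave al be u : measurable_fun [set: 'rV[R]_r] (wave al be u : _ -> T1).
Proof.
apply: measurable_funM; first by apply: measurableT_comp => //; exact: measurable_bforml.
by apply: measurable_cos_fun; apply: measurable_funD => //; exact: measurable_bforml.
Qed.

Lemma measurable_gaussB : measurable_fun [set: 'rV[R]_r] (gaussB : _ -> T1).
Proof.
apply: measurableT_comp => //; apply: measurableT_comp => //.
by apply: measurable_funM => //; exact: measurable_bform2.
Qed.

Lemma le_integrable_rV (f G : 'rV[R]_r -> R) : measurable_fun [set: 'rV[R]_r] (f : _ -> T1) -> (forall y, `|f y| <= G y) ->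
  mu.-integrable setT (EFin \o G) -> mu.-integrable setT (EFin \o f).
Proof.
move=> mf fG; apply: le_integrable => //; first exact/measurable_EFinP.
by move=> y _ /=; rewrite lee_fin (le_trans (fG y))// ler_norm.
Qed.

Lemma gauss_const_gt0 : 0 < gauss_const.
Proof.
have q0 : `|0 : R| <= 1 by rewrite normr0.
have [_ dB] := gauss_formula 0 0 0 Bsym Bpos q0.
by rewrite divr_gt0 ?exprn_gt0 ?sqrtr_gt0 ?mulr_gt0 ?pi_gt0.
Qed.

Lemma integrable_gaussk al be p q u : `|q| <= p -> mu.-integrable setT (EFin \o gaussk B al be p q u).
Proof.
move=> qp; apply/integrableP; split; first by apply/measurable_EFinP; exact: measurable_gaussk.
under eq_integral do rewrite /= ger0_norm ?mulr_ge0 ?expR_ge0 ?posr_cos//.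
by have [-> _] := gauss_formula al be u Bsym Bpos qp; rewrite ltry.
Qed.

Lemma wave_gauss al be u : mu.-integrable setT (EFin \o (fun x => wave al be u x * gaussB x)) /\
  \int[mu]_x (wave al be u x * gaussB x) = gauss_const * (expR ((fm al al - fm be be) / 2) * cos (fm al be + u)).
Proof.
have q1 : `|1 : R| <= 1 by rewrite normr1.
have q0 : `|0 : R| <= 1 by rewrite normr0.
have i1 := integrable_gaussk al be u q1; have i0 := integrable_gaussk al be u q0.
have E x : wave al be u x * gaussB x = gaussk B al be 1 1 u x - gaussk B al be 1 0 u x.
  by rewrite /gaussk expRD /wave /gaussB; ring.
split.
  have := integrableB (@measurableT _ 'rV[R]_r) i1 i0.
  by apply: eq_integrable => // x _ /=; rewrite -EFinB E.
under eq_Rintegral do rewrite E.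
rewrite RintegralB// /Rintegral.
have [-> _] := gauss_formula al be u Bsym Bpos q1; have [-> _] := gauss_formula al be u Bsym Bpos q0.
have -> : expR ((fm al al - fm be be) / 2) = expR (fm al al / 2) * expR (- (fm be be / 2)).
  by rewrite -expRD; congr expR; field.
by rewrite /= -/gauss_const; ring.
Qed.

Lemma integrable_exp2s S al : mu.-integrable setT (EFin \o (fun x => expR (fm x al) * exp2s S x * gaussB x)).
Proof.
elim: S al => [|b S IH] al.
  have [i _] := wave_gauss al 0 0; apply: eq_integrable i => // x _ /=.
  by rewrite /wave /exp2s big_nil bform0r addr0 cos0.
have := integrableD (@measurableT _ 'rV[R]_r) (IH (al + 2 *: b)) (IH (al - 2 *: b)).
apply: eq_integrable => // x _ /=; rewrite -EFinD; congr EFin.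
rewrite /exp2s big_cons /exp2 !bformDr bformNr !bformZr !expRD mulNr; ring.
Qed.

Lemma integrable_wave_dom S (f : 'rV[R]_r -> R) al (c : R) : measurable_fun [set: 'rV[R]_r] (f : _ -> T1) ->
  (forall x, `|f x| <= c * (expR (fm x al) * exp2s S x)) -> mu.-integrable setT (EFin \o (fun x => f x * gaussB x)).
Proof.
move=> mf fc; apply: (@le_integrable_rV _ (fun x => c * (expR (fm x al) * exp2s S x * gaussB x))).
- by apply: measurable_funM => //; exact: measurable_gaussB.
- by move=> x; rewrite normrM (ger0_norm (gaussB_ge0 x)) mulrA ler_wpM2r ?gaussB_ge0.
- exact: (integrableZl _ _ (integrable_exp2s S al)).
Qed.

Lemma root_prod_le x : `|root_prod B Pos x| <= exp2s Pos x.
Proof.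
rewrite /root_prod /exp2s; elim: Pos => [|b S IH]; first by rewrite !big_nil normr1.
by rewrite !big_cons normrM ler_pM// exp2_norm.
Qed.

(** A bound uniform in 0 < h <= 1, so that one integrable majorant serves the whole limit h -> 0. *)
Lemma sinh_le (t h : R) : 0 < h <= 1 -> `|(expR (h * t / 2) - expR (- (h * t / 2))) / h| <= exp2 t.
Proof.
move=> /andP[h0 h1]; wlog t0 : t / 0 <= t.
  move=> H; case: (lerP 0 t) => [/H//|/ltW t0]; have := H (- t); rewrite oppr_ge0 => /(_ t0).
  have -> : exp2 (- t) = exp2 t by rewrite /exp2 !mulrN !mulNr opprK addrC.
  have -> : (expR (h * - t / 2) - expR (- (h * - t / 2))) / h = - ((expR (h * t / 2) - expR (- (h * t / 2))) / h).
    by rewrite !mulrN !mulNr opprK; ring.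
  by rewrite normrN.
have ht : 0 <= h * t / 2 by rewrite divr_ge0// mulr_ge0// ltW.
have e1 : expR (- (h * t / 2)) <= expR (h * t / 2) by rewrite ler_expR; lra.
rewrite ger0_norm ?divr_ge0 ?subr_ge0// ?(ltW h0)//.
apply: le_trans (exp2_abs t); rewrite (ger0_norm t0) ler_pdivrMr//.
have E : expR (- (h * t / 2)) = expR (h * t / 2) * expR (- (h * t)) by rewrite -expRD; congr expR; field.
have e2 := expR_ge1Dx (- (h * t)).
have e3 : expR (h * t / 2) <= expR t by rewrite ler_expR; nra.
have e4 := expR_ge1Dx t.
have -> : expR (2 * t) = expR t * expR t by rewrite -expRD; congr expR; ring.
have p0 := expR_gt0 (h * t / 2); rewrite E.
apply: (@le_trans _ _ (expR (h * t / 2) * (h * t))); first nra.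
apply: (@le_trans _ _ (expR t * (expR t * h))); last by rewrite mulrA.
apply: ler_pM; [exact: expR_ge0|by rewrite mulr_ge0// ltW|exact: e3|].
rewrite mulrC ler_wpM2r ?(ltW h0)//; lra.
Qed.

Lemma half_sinhZ (h : R) x : half_sinh (h *: x) = dsum Pos (fun y => expR (h * fm x y)).
Proof.
rewrite (dsum_exp _ (f := fun y => expR (h * fm x y))); last 2 first.
- by move=> y z; rewrite bformDr mulrDr expRD.
- by rewrite bform0r mulr0 expR0.
by apply: eq_bigr => b _; rewrite bformNr !bformZr bformZl mulrN; congr (expR _ - expR (- _)); field.
Qed.

Lemma half_sinhE x : half_sinh x = dsum Pos (fun y => expR (fm x y)).
Proof. by rewrite -[in LHS](scale1r x) half_sinhZ; apply: eq_dsum => y; rewrite mul1r. Qed.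

Lemma half_sinh_le (h : R) x : 0 < h <= 1 -> `|half_sinh (h *: x) / h ^+ size Pos| <= exp2s Pos x.
Proof.
move=> hh; rewrite /half_sinh /exp2s; elim: Pos => [|b S IH].
  by rewrite !big_nil expr0 divr1 normr1.
rewrite !big_cons exprS invfM mulrACA normrM ler_pM// bformZl; exact: sinh_le.
Qed.

Lemma half_sinh_cvg (h : nat -> R) x : h @ \oo --> (0 : R) -> (forall n, 0 < h n) ->
  (fun n => half_sinh (h n *: x) / h n ^+ size Pos) @ \oo --> root_prod B Pos x.
Proof.
move=> h0 hn; rewrite /half_sinh /root_prod; elim: Pos => [|b S IH].
  rewrite big_nil; apply: (cvg_ext (f := fun=> 1)); last exact: cvg_cst.
  by move=> n; rewrite big_nil expr0 divr1.
rewrite big_cons; apply: (cvg_ext (f := fun n => ((expR (fm (h n *: x) b / 2) - expR (- (fm (h n *: x) b / 2))) / h n) *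
   ((\prod_(b <- S) (expR (fm (h n *: x) b / 2) - expR (- (fm (h n *: x) b / 2)))) / h n ^+ size S))).
  by move=> n; rewrite big_cons exprS invfM mulrACA.
apply: cvgM => //; have [c _] := ccvg_sinh (fm x b) 0 h0 hn; apply: cvg_ext c => n.
rewrite /comp mul0r !mulr0 oppr0 cReM cReB /= cos0 mul0r subr0 !mulr1 bformZl mulrC mulrA.
by [].
Qed.

(** Expanding (al + h y, al + h y) leaves a factor in (y,y), which [dsum_norm] pulls out as a
    function of (rho,rho), and a factor multiplicative in y, which [dsum_exp] turns into a product
    over the roots. *)
Lemma dsum_wave_gauss al be u (h : R) :
  dsum Pos (fun y => expR ((fm (al + h *: y) (al + h *: y) - fm be be) / 2) * cos (fm (al + h *: y) be + u)) =
  expR (h ^+ 2 * fm rho rho / 2) * (expR ((fm al al - fm be be) / 2) *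
   complex.Re (cexp 0 (fm al be + u) * \prod_(b <- Pos)
     (cexp (h * (fm b al / 2)) (h * (fm b be / 2)) - cexp (- (h * (fm b al / 2))) (- (h * (fm b be / 2)))))).
Proof.
pose q y := expR (h * fm y al) * cos (h * fm y be + (fm al be + u)).
rewrite (eq_dsum _ (q' := fun y => expR (h ^+ 2 * fm y y / 2) * (expR ((fm al al - fm be be) / 2) * q y))); last first.
  move=> y; rewrite /q !(bformDl, bformDr, bformZl, bformZr) (bformC al y)//.
  have E4 (a b c d : R) : a * (b * (c * d)) = a * b * c * d by ring.
  by rewrite E4 -!expRD; congr (expR _ * cos _); [field|ring].
rewrite (dsum_norm Bsym Bpos Pos_uniq Pos_ge0 simple_Pos refl_Pos Pos_int (fun s => expR (h ^+ 2 * s / 2))).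
congr (_ * _); rewrite dsumMl; congr (_ * _).
set P := \prod_(b <- Pos) _; have -> : P = dsum Pos (fun y => cexp (h * fm y al) (h * fm y be)).
  rewrite (dsum_exp _ (f := fun y => cexp (h * fm y al) (h * fm y be))); last 2 first.
  - by move=> y z; rewrite !bformDl !mulrDr cexpD.
  - by rewrite !bform0l !mulr0 cexp0.
  apply: eq_bigr => b _; rewrite !bformNl !bformZl !mulrN.
  by congr (cexp _ _ - cexp (- _) (- _)); ring.
rewrite -dsumMl [RHS]dsum_morph; apply: eq_dsum => y /=.
by rewrite /q cosD expR0; ring.
Qed.

Lemma transform_cvg al be u (h : nat -> R) : h @ \oo --> (0 : R) -> (forall n, 0 < h n) ->
  (fun n => dsum Pos (fun y => expR ((fm (al + h n *: y) (al + h n *: y) - fm be be) / 2) *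
     cos (fm (al + h n *: y) be + u)) / h n ^+ size Pos) @ \oo --> transform al be u.
Proof.
move=> h0 hn; pose P n := \prod_(b <- Pos) ((h n)^-1%:C%C * (cexp (h n * (fm b al / 2)) (h n * (fm b be / 2)) -
   cexp (- (h n * (fm b al / 2))) (- (h n * (fm b be / 2))))).
have PE n (z : R[i]) : complex.Re (z * \prod_(b <- Pos) (cexp (h n * (fm b al / 2)) (h n * (fm b be / 2)) -
   cexp (- (h n * (fm b al / 2))) (- (h n * (fm b be / 2))))) / h n ^+ size Pos = complex.Re (z * P n).
  rewrite /P big_split /= big_const_seq count_predT iter_mulr_1 mulrCA -rmorphXn Re_scale mulrC exprVn.
  by [].
have [Pc _] : ccvg (fun n => cexp 0 (fm al be + u) * P n) (cexp 0 (fm al be + u) * \prod_(b <- Pos) Complex (fm b al) (fm b be)).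
  apply: ccvgM; first exact: ccvg_cst.
  by apply: ccvg_prod => b; exact: ccvg_sinh.
have L : (fun n => h n ^+ 2 * fm rho rho / 2) @ \oo --> (0 : R).
  have : (fun n => h n ^+ 2 * fm rho rho / 2) @ \oo --> (0 : R) ^+ 2 * fm rho rho / 2.
    apply: cvgM; last exact: cvg_cst; apply: cvgM; last exact: cvg_cst.
    by rewrite expr2; apply: cvgM.
  by rewrite expr0n /= !mul0r.
have e1 : (fun n => expR (h n ^+ 2 * fm rho rho / 2)) @ \oo --> (1 : R).
  by rewrite -[X in _ --> X]expR0; exact: (cvg_comp _ _ L (@continuous_expR R 0)).
rewrite /transform -[X in _ --> X]mul1r.
apply: (cvg_ext (f := fun n => expR (h n ^+ 2 * fm rho rho / 2) * (expR ((fm al al - fm be be) / 2) *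
   complex.Re (cexp 0 (fm al be + u) * P n)))).
  by move=> n; rewrite dsum_wave_gauss -PE !mulrA.
by apply: cvgM => //; apply: cvgM => //; exact: cvg_cst.
Qed.

(* p is the limit of half_sinh (h x) / h^N as h -> 0, and half_sinh is a signed sum of exponentials. *)
Lemma transform_gauss al be u : mu.-integrable setT (EFin \o (fun x => wave al be u x * root_prod B Pos x * gaussB x)) /\
  \int[mu]_x (wave al be u x * root_prod B Pos x * gaussB x) = gauss_const * transform al be u.
Proof.
pose h (n : nat) : R := n.+1%:R^-1.
have h0 : h @ \oo --> (0 : R) by exact: cvg_harmonic.
have hn n : 0 < h n by rewrite invr_gt0.
have hn1 n : 0 < h n <= 1 by rewrite hn /= invf_le1// ler1n.
pose f n x := wave al be u x * (half_sinh (h n *: x) / h n ^+ size Pos) * gaussB x.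
have wle x : `|wave al be u x| <= expR (fm x al).
  by rewrite normrM (ger0_norm (expR_ge0 _)) ler_piMr ?expR_ge0// ler_norml cos_geN1 cos_le1.
have mrp : measurable_fun [set: 'rV[R]_r] (root_prod B Pos : _ -> T1).
  by apply: measurable_prod => b _; exact: measurable_bforml.
have mhs (k : R) : measurable_fun [set: 'rV[R]_r] ((fun x => half_sinh (k *: x)) : _ -> T1).
  apply: measurable_prod => b _; under eq_fun do rewrite bformZl.
  by apply: measurable_funB; apply: measurableT_comp => //; [|apply: measurableT_comp => //];
    apply: measurable_funM => //; apply: measurable_funM => //; exact: measurable_bforml.
have i0 : mu.-integrable setT (EFin \o (fun x => wave al be u x * root_prod B Pos x * gaussB x)).
  apply: (@integrable_wave_dom Pos _ al 1).
    by apply: measurable_funM => //; exact: measurable_wave.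
  by move=> x; rewrite mul1r normrM ler_pM// root_prod_le.
have dom n x : `|wave al be u x * (half_sinh (h n *: x) / h n ^+ size Pos)| <= expR (fm x al) * exp2s Pos x.
  by rewrite normrM ler_pM// half_sinh_le.
have mf n : measurable_fun [set: 'rV[R]_r] (f n : _ -> T1).
  apply: measurable_funM; last exact: measurable_gaussB.
  by apply: measurable_funM; [exact: measurable_wave|apply: measurable_funM => //; exact: mhs].
have inn n : mu.-integrable setT (EFin \o f n).
  apply: (@integrable_wave_dom Pos _ al 1); last by move=> x; rewrite mul1r; exact: dom.
  by apply: measurable_funM; [exact: measurable_wave|apply: measurable_funM => //; exact: mhs].
split => //.
have mg : measurable_fun [set: 'rV[R]_r] ((fun x => wave al be u x * root_prod B Pos x * gaussB x) : _ -> T1).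
  apply: measurable_funM; last exact: measurable_gaussB.
  by apply: measurable_funM => //; exact: measurable_wave.
have Dm : (fun n => \int[mu]_x f n x) @ \oo --> \int[mu]_x (wave al be u x * root_prod B Pos x * gaussB x).
  apply: (Rdominated_cvg mf mg (integrable_exp2s Pos al)) => [x|n x].
    apply: cvgM; last exact: cvg_cst; apply: cvgM; first exact: cvg_cst.
    exact: half_sinh_cvg.
  by rewrite normrM (ger0_norm (gaussB_ge0 x)) ler_wpM2r ?gaussB_ge0.
have fE n : \int[mu]_x f n x = gauss_const * (dsum Pos (fun y => expR ((fm (al + h n *: y) (al + h n *: y) - fm be be) / 2) *
     cos (fm (al + h n *: y) be + u)) / h n ^+ size Pos).
  pose k := (h n ^+ size Pos)^-1.
  have fwE x : f n x = dsum Pos (fun y => k * (wave (al + h n *: y) be u x * gaussB x)).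
    rewrite /f half_sinhZ.
    rewrite [LHS](_ : _ = (k * (wave al be u x * gaussB x)) * dsum Pos (fun y => expR (h n * fm x y))); last by rewrite /k; ring.
    rewrite -dsumMl; apply: eq_dsum => y; rewrite /wave bformDr bformZr expRD.
    by ring.
  have dI (S : seq 'rV[R]_r) (w : 'rV[R]_r -> 'rV[R]_r -> R) : (forall y, mu.-integrable setT (EFin \o w y)) ->
     mu.-integrable setT (EFin \o (fun x => dsum S (w^~ x))) /\ \int[mu]_x dsum S (w^~ x) = dsum S (fun y => \int[mu]_x w y x).
    elim: S w => [|b S IH] w iw //=.
    have [i1 e1] := IH (fun y => w (y + 2^-1 *: b)) (fun y => iw _); have [i2 e2] := IH (fun y => w (y - 2^-1 *: b)) (fun y => iw _).
    split; last by rewrite RintegralB// e1 e2.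
    have := integrableB (@measurableT _ 'rV[R]_r) i1 i2.
    by apply: eq_integrable => // x _ /=; rewrite -EFinB.
  under eq_Rintegral do rewrite fwE.
  have iw y : mu.-integrable setT (EFin \o (fun x => k * (wave (al + h n *: y) be u x * gaussB x))).
    by have [i _] := wave_gauss (al + h n *: y) be u; exact: (integrableZl _ _ i).
  have [_ ->] := dI Pos _ iw.
  rewrite -/k [RHS]mulrA mulrAC -dsumMl; apply: eq_dsum => y.
  have [i e] := wave_gauss (al + h n *: y) be u.
  by rewrite RintegralZl// e; ring.
apply: (cvg_unique _ Dm) => //.
apply: (cvg_ext (f := fun n => gauss_const * (dsum Pos (fun y => expR ((fm (al + h n *: y) (al + h n *: y) - fm be be) / 2) *
     cos (fm (al + h n *: y) be + u)) / h n ^+ size Pos))) => [n|]; first by rewrite fE.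
by apply: cvgM; [exact: cvg_cst|exact: transform_cvg].
Qed.

End GaussTransform.

(** * Limits of normalized characters *)

Section TransformLimit.
Context {R : realType} {r : nat}.
Variables (B : 'M[R]_r) (Pos : seq 'rV[R]_r).
Local Notation fm := (bform B).
Local Notation wave := (wave B).
Local Notation half_sinh := (half_sinh B Pos).
Local Notation transform := (transform B Pos).
Hypothesis Bsym : B^T = B.

Lemma dsum_exchange (A : zmodType) (S T : seq 'rV[R]_r) (f : 'rV[R]_r -> 'rV[R]_r -> A) :
  dsum S (fun x => dsum T (f x)) = dsum T (fun y => dsum S (f^~ y)).
Proof.
elim: S f => //= b S IH f; rewrite !IH -dsumN -dsumD; exact: eq_dsum.
Qed.

Lemma dsum_cvg (S : seq 'rV[R]_r) (f : nat -> 'rV[R]_r -> R) (l : 'rV[R]_r -> R) :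
  (forall y, f ^~ y @ \oo --> l y) -> (fun n => dsum S (f n)) @ \oo --> dsum S l.
Proof.
elim: S f l => [|b S IH] f l fl /=; first exact: fl.
by apply: cvgB; apply: IH => y; exact: fl.
Qed.

Lemma is_derive_sum_seq (I : Type) (s : seq I) (f df : I -> R -> R) (x : R) :
  (forall i, is_derive x 1 (f i) (df i x)) ->
  is_derive x 1 (fun z => \sum_(i <- s) f i z) (\sum_(i <- s) df i x).
Proof.
move=> dfi; elim: s => [|i s IH].
  rewrite big_nil (_ : (fun z => _) = cst 0); first exact: is_derive_cst.
  by apply/funext => z; rewrite big_nil.
rewrite big_cons (_ : (fun z => _) = f i + (fun z => \sum_(j <- s) f j z)); first exact: is_deriveD.
by apply/funext => z; rewrite big_cons.
Qed.

(** The formal character with weight list [s], evaluated at h (al + i be). *)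
Definition csum (s : seq 'rV[R]_r) (h : R) al be : R[i] := \sum_(v <- s) cexp (h * fm v al) (h * fm v be).

(** The central limit theorem for one factor: with zero mean and covariance c times the form, the
    normalized character is 1 + h^2 c (zeta,zeta)/2 + o(h^2) at zeta = al + i be, and it is raised
    to the power k / h^2. *)
Lemma pow_limit (s : seq 'rV[R]_r) (c k : R) (N : nat -> nat) (h : nat -> R) al be :
  (0 < size s)%N -> (forall a, \sum_(v <- s) fm v a = 0) ->
  (forall a, \sum_(v <- s) fm v a ^+ 2 = (size s)%:R * c * fm a a) ->
  h @ \oo --> (0 : R) -> (forall n, 0 < h n) -> (forall n, (N n)%:R = k / h n ^+ 2) ->
  ccvg (fun n => ((size s)%:R^-1%:C%C * csum s (h n) al be) ^+ N n)
    (cexp (k * c * ((fm al al - fm be be) / 2)) (k * c * fm al be)).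
Proof.
move=> s0 m1 m2 h0 hn NE; have sz : (size s)%:R != 0 :> R by rewrite pnatr_eq0 -lt0n.
(* Polarization of the second moments. *)
have m2' a b : \sum_(v <- s) fm v a * fm v b = (size s)%:R * c * fm a b.
  have := m2 (a + b); under eq_bigr do rewrite bformDr sqrrD.
  rewrite !big_split /= !m2 !(bformDl, bformDr) (bformC b a)//.
  by move: (\sum_(i <- s) _) => S; lra.
pose W t (x : R) := \sum_(v <- s) wave1 (fm v al) (fm v be) t x.
pose W' t (x : R) := \sum_(v <- s) (fm v al * wave1 (fm v al) (fm v be) t x + fm v be * wave1 (fm v al) (fm v be) (t + pi / 2) x).
have W2 t : (fun n => (W t (h n) - W t 0) / h n ^+ 2) @ \oo -->
    (size s)%:R * c * ((fm al al - fm be be) * cos t + 2 * fm al be * cos (t + pi / 2)) / 2.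
  apply: (derive2_seq (F' := W' t)) => //.
  - move=> x; apply: (is_derive_sum_seq s (f := fun v => wave1 (fm v al) (fm v be) t) (df := fun v x =>
      fm v al * wave1 (fm v al) (fm v be) t x + fm v be * wave1 (fm v al) (fm v be) (t + pi / 2) x)) => v.
    exact: is_derive_wave1.
  - rewrite /W'; under eq_bigr do rewrite !wave1_0.
    by rewrite big_split /= -!mulr_suml !m1 !mul0r addr0.
  - pose dd v := fm v al * (fm v al * cos t + fm v be * cos (t + pi / 2)) +
      fm v be * (fm v al * cos (t + pi / 2) + fm v be * cos (t + pi / 2 + pi / 2)).
    have -> : (size s)%:R * c * ((fm al al - fm be be) * cos t + 2 * fm al be * cos (t + pi / 2)) = \sum_(v <- s) dd v.
      have E v : dd v = (fm v al * fm v al - fm v be * fm v be) * cos t + (fm v al * fm v be) * (2 * cos (t + pi / 2)).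
        rewrite /dd; have -> : cos (t + pi / 2 + pi / 2) = - cos t by rewrite cosDpihalf sinDpihalf.
        by ring.
      under eq_bigr do rewrite E.
      by rewrite big_split /= -!mulr_suml big_split /= sumrN !m2'; ring.
    apply: (is_derive_sum_seq s (df := fun v _ => dd v)) => v.
    have h1 := is_derive_wave1 (fm v al) (fm v be) t 0; have h2 := is_derive_wave1 (fm v al) (fm v be) (t + pi / 2) 0.
    by apply: is_derive_eq; rewrite !wave1_0 /GRing.scale /= /dd; ring.
have W0 t : W t 0 = (size s)%:R * cos t.
  rewrite /W; under eq_bigr do rewrite wave1_0.
  by rewrite big_const_seq count_predT iter_addr_0 mulr_natl.
have ReE n : complex.Re ((size s)%:R^-1%:C%C * csum s (h n) al be - 1) = (W 0 (h n) - W 0 0) / (size s)%:R.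
  rewrite cReB Re_scale W0 cos0 mulr1 mulrBl mulfV//= /csum raddf_sum mulrC; congr (_ / _ - _).
  by apply: eq_bigr => v _; rewrite /wave1 addr0.
have ImE n : complex.Im ((size s)%:R^-1%:C%C * csum s (h n) al be - 1) = (W (- (pi / 2)) (h n) - W (- (pi / 2)) 0) / (size s)%:R.
  rewrite cImB cImM /= mul0r addr0 subr0 W0 cosN cos_pihalf mulr0 subr0 /csum raddf_sum mulrC; congr (_ / _).
  by apply: eq_bigr => v _; rewrite /wave1 cos_sub_pihalf.
have ht : forall t, (fun n => (W t (h n) - W t 0) / (size s)%:R) @ \oo --> (0 : R).
  move=> t; apply: (cvg_ext (f := fun n => (W t (h n) - W t 0) / h n ^+ 2 * (h n * h n) / (size s)%:R)).
    by move=> n; field; rewrite sz gt_eqF.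
  rewrite [X in _ --> X](_ : 0 = (size s)%:R * c * ((fm al al - fm be be) * cos t + 2 * fm al be * cos (t + pi / 2)) / 2 * (0 * 0) / (size s)%:R); last first.
    by rewrite !mulr0 mul0r.
  by apply: cvgM; [apply: cvgM => //; apply: cvgM|exact: cvg_cst].
have lim t : (fun n => (N n)%:R * ((W t (h n) - W t 0) / (size s)%:R)) @ \oo -->
   k * c * ((fm al al - fm be be) / 2 * cos t + fm al be * cos (t + pi / 2)).
  apply: (cvg_ext (f := fun n => k / (size s)%:R * ((W t (h n) - W t 0) / h n ^+ 2))).
    by move=> n; rewrite NE; field; rewrite sz gt_eqF.
  rewrite [X in _ --> X](_ : _ = k / (size s)%:R * ((size s)%:R * c * ((fm al al - fm be be) * cos t + 2 * fm al be * cos (t + pi / 2)) / 2)).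
    by apply: cvgM => //; exact: cvg_cst.
  by field.
apply: ccvg_pow.
- have := lim 0; rewrite cos0 add0r cos_pihalf mulr0 mulr1 addr0; apply: cvg_ext => n; by rewrite ReE.
- have := lim (- (pi / 2)); rewrite addNr cosN cos_pihalf cos0 mulr0 mulr1 add0r; apply: cvg_ext => n; by rewrite ImE.
- rewrite -[X in _ --> X](addr0 (0 : R)) -[X in _ --> X + _](normr0 R) -[X in _ --> _ + X](normr0 R).
  apply: cvgD; apply: cvg_norm.
    by apply: cvg_ext (ht 0) => n; rewrite ReE.
  by apply: cvg_ext (ht (- (pi / 2))) => n; rewrite ImE.
Qed.

Section Sequences.
Variables (m : nat) (s : 'I_m -> seq 'rV[R]_r) (c tau : 'I_m -> R).
Hypothesis s_gt0 : forall k, (0 < size (s k))%N.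
Hypothesis s_mean : forall k a, \sum_(v <- s k) fm v a = 0.
Hypothesis s_var : forall k a, \sum_(v <- s k) fm v a ^+ 2 = (size (s k))%:R * c k * fm a a.
Variables (xx : R) (eps : nat -> R) (N : nat -> 'I_m -> nat).
Hypothesis xE : xx = \sum_k tau k * c k.
Hypothesis x_gt0 : 0 < xx.
Hypothesis eps_gt0 : forall n, 0 < eps n.
Hypothesis eps0 : eps @ \oo --> (0 : R).
Hypothesis NE : forall n k, (N n k)%:R = tau k / eps n.
Variable t : nat -> seq 'rV[R]_r.
Hypothesis t_char : forall n (f : 'rV[R]_r -> R[i]), {morph f : x y / x + y >-> x * y} -> f 0 = 1 ->
  \sum_(v <- t n) f v = \prod_k (\sum_(v <- s k) f v) ^+ N n k.
Hypothesis t_size : forall n, size (t n) = (\prod_k size (s k) ^ N n k)%N.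

Definition delta n : R := Num.sqrt (eps n / xx).

Lemma delta_gt0 n : 0 < delta n. Proof. by rewrite sqrtr_gt0 divr_gt0. Qed.

Lemma delta_cvg : delta @ \oo --> (0 : R).
Proof.
have : (fun n => eps n / xx) @ \oo --> (0 : R) / xx by apply: cvgM => //; exact: cvg_cst.
rewrite mul0r => h; have := cvg_comp _ _ h (@sqrt_continuous R 0); by rewrite sqrtr0.
Qed.

Lemma t_gt0 n : (0 < size (t n))%N.
Proof. by rewrite t_size prodn_gt0// => k; rewrite expn_gt0 s_gt0. Qed.

(** The character of the tensor product is a product of powers. Each factor contributes the share
    [tau k * c k / xx] of the exponent, and the shares add up to 1 by the choice of [xx]. *)
Lemma char_limit al be : ccvg (fun n => (size (t n))%:R^-1%:C%C * csum (t n) (delta n) al be)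
  (cexp ((fm al al - fm be be) / 2) (fm al be)).
Proof.
pose p k := tau k / xx * c k * ((fm al al - fm be be) / 2); pose q k := tau k / xx * c k * fm al be.
have sumE (z : R) : \sum_k tau k / xx * c k * z = z.
  rewrite -mulr_suml (_ : \sum_k _ = 1) ?mul1r//; under eq_bigr do rewrite mulrAC.
  by rewrite -mulr_suml -xE mulfV// gt_eqF.
have -> : cexp ((fm al al - fm be be) / 2) (fm al be) = \prod_k cexp (p k) (q k).
  rewrite -[in LHS](sumE ((fm al al - fm be be) / 2)) -[in LHS](sumE (fm al be)).
  elim: (index_enum _) => [|k l IH]; first by rewrite !big_nil cexp0.
  by rewrite !big_cons cexpD IH.
have E n : (size (t n))%:R^-1%:C%C * csum (t n) (delta n) al be =
    \prod_k ((size (s k))%:R^-1%:C%C * csum (s k) (delta n) al be) ^+ N n k.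
  rewrite /csum (t_char n (f := fun v => cexp (delta n * fm v al) (delta n * fm v be))); last 2 first.
  - by move=> v w; rewrite !bformDl !mulrDr cexpD.
  - by rewrite !bform0l !mulr0 cexp0.
  under [RHS]eq_bigr do rewrite exprMn.
  rewrite big_split /= t_size natr_prod -prodfV rmorph_prod; congr (_ * _).
  by apply: eq_bigr => k _; rewrite natrX -exprVn rmorphXn.
rewrite (_ : (fun n => _) = (fun n => \prod_k ((size (s k))%:R^-1%:C%C * csum (s k) (delta n) al be) ^+ N n k)); last exact/funext.
apply: ccvg_prod => k; apply: pow_limit => //; [exact: delta_cvg|exact: delta_gt0|].
move=> n; rewrite NE sqr_sqrtr; last by rewrite divr_ge0// ltW.
by field; rewrite !gt_eqF.
Qed.

Definition omega_supp n := undup [seq v + y | v <- t n, y <- dpts Pos].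
Definition mult_u n := alt_sum Pos (fun z => (count_mem z (t n))%:R : R).
(** Summation against the rescaled measure u_n [half_sinh] on the whole space. The power of
    [delta n] compensates the order of vanishing of [half_sinh] at 0, and [size (t n)] is the
    dimension of the tensor product. *)
Definition omega n (F : 'rV[R]_r -> R) : R := (delta n ^+ size Pos * (size (t n))%:R)^-1 *
  \sum_(x <- omega_supp n) mult_u n x * (half_sinh (delta n *: x) * F (delta n *: x)).

(** Expanding [half_sinh] turns its product with the wave into a signed sum of waves with exponents
    [al + y]. For each of them [alt_sum_pairing] separates the normalized character from the
    denominator, which converge by [char_limit] and [ccvg_sinh]. *)
Lemma omega_wave al be u : (fun n => omega n (wave al be u)) @ \oo --> dsum Pos (fun y => transform (al + y) be u).
Proof.
pose h := delta; pose T n : R := (size (t n))%:R.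
pose g n al' := complex.Re (cexp 0 u * ((T n)^-1%:C%C * csum (t n) (h n) al' be * \prod_(b <- Pos)
   ((h n)^-1%:C%C * (cexp (h n * (fm b al' / 2)) (h n * (fm b be / 2)) - cexp (- (h n * (fm b al' / 2))) (- (h n * (fm b be / 2))))))).
have gl al' : g^~ al' @ \oo --> transform al' be u.
  have [gc _] : ccvg (fun n => cexp 0 u * ((T n)^-1%:C%C * csum (t n) (h n) al' be * \prod_(b <- Pos)
   ((h n)^-1%:C%C * (cexp (h n * (fm b al' / 2)) (h n * (fm b be / 2)) - cexp (- (h n * (fm b al' / 2))) (- (h n * (fm b be / 2)))))))
   (cexp 0 u * (cexp ((fm al' al' - fm be be) / 2) (fm al' be) * \prod_(b <- Pos) Complex (fm b al') (fm b be))).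
    apply: ccvgM; first exact: ccvg_cst.
    apply: ccvgM; first exact: char_limit.
    by apply: ccvg_prod => b; apply: ccvg_sinh; [exact: delta_cvg|exact: delta_gt0].
  move: gc; congr (_ @ _ --> _).
  rewrite /transform -Re_scale; congr complex.Re; rewrite !mulrA; congr (_ * _).
  have -> : ((expR ((fm al' al' - fm be be) / 2))%:C)%C = cexp ((fm al' al' - fm be be) / 2) 0.
    by rewrite /cexp cos0 sin0 mulr0 mulr1.
  by rewrite -!cexpD; congr cexp; ring.
apply: (cvg_ext (f := fun n => dsum Pos (fun y => g n (al + y)))); last by apply: dsum_cvg => y; exact: gl.
move=> n; rewrite /omega.
pose q y x := wave (al + y) be u (h n *: x).
have hq x : half_sinh (h n *: x) * wave al be u (h n *: x) = dsum Pos (fun y => q y x).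
  rewrite half_sinhE mulrC -dsumMl; apply: eq_dsum => y.
  by rewrite /q /wave bformDr expRD; ring.
under eq_bigr do rewrite hq.
rewrite -(alt_sum_pairing (fun x => dsum Pos (fun y => q y x)) (undup_uniq _)); last first.
  by move=> v y vt yP; rewrite mem_undup; exact: allpairs_f.
under eq_bigr do rewrite dsum_exchange.
rewrite -dsum_sum -dsumMl; apply: eq_dsum => y; set al' := al + y.
have E1 v : dsum Pos (fun z => q y (v + z)) = complex.Re (cexp 0 u * (cexp (h n * fm v al') (h n * fm v be) *
   dsum Pos (fun z => cexp (h n * fm z al') (h n * fm z be)))).
  rewrite -!dsumMl dsum_morph; apply: eq_dsum => z.
  rewrite /comp -!cexpD /q /wave -/al' scalerDr !bformDl !bformZl add0r -mulrDr.
  by rewrite [_ + u]addrC.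
under eq_bigr do rewrite E1.
rewrite -raddf_sum -mulr_sumr -mulr_suml -/(csum (t n) (h n) al' be) -Re_scale /g; congr complex.Re.
have -> : dsum Pos (fun z => cexp (h n * fm z al') (h n * fm z be)) = \prod_(b <- Pos)
   (cexp (h n * (fm b al' / 2)) (h n * (fm b be / 2)) - cexp (- (h n * (fm b al' / 2))) (- (h n * (fm b be / 2)))).
  rewrite (dsum_exp _ (f := fun y => cexp (h n * fm y al') (h n * fm y be))); last 2 first.
  - by move=> a b; rewrite !bformDl !mulrDr cexpD.
  - by rewrite !bform0l !mulr0 cexp0.
  apply: eq_bigr => b _; rewrite !bformNl !bformZl !mulrN.
  by congr (cexp _ _ - cexp (- _) (- _)); ring.
rewrite [in LHS]big_split /= big_const_seq count_predT iter_mulr_1 -rmorphXn.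
rewrite invfM -exprVn rmorphM -/(T n) -/h; ring.
Qed.

End Sequences.
End TransformLimit.

(** * Weak convergence from exponential transforms *)

Section Levy.
Context {R : realType} {r : nat}.
Implicit Types (x y b : 'rV[R]_r) (F G : 'rV[R]_r -> R).
Local Notation T1 := (measurableTypeR R).

Definition dotp x b : R := \sum_i x 0 i * b 0 i.

Lemma dotpD x b b' : dotp x (b + b') = dotp x b + dotp x b'.
Proof. by rewrite /dotp -big_split; apply: eq_bigr => i _; rewrite mxE mulrDr. Qed.

Lemma dotpN x b : dotp x (- b) = - dotp x b.
Proof. by rewrite /dotp -sumrN; apply: eq_bigr => i _; rewrite mxE mulrN. Qed.

Lemma dotp0 x : dotp x 0 = 0.
Proof. by rewrite /dotp big1// => i _; rewrite mxE mulr0. Qed.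

Lemma dotp_delta x (i : 'I_r) (a : R) : dotp x (a *: delta_mx 0 i) = a * x 0 i.
Proof.
rewrite /dotp (bigD1 i)//= big1 ?addr0 => [|j ji]; rewrite !mxE ?eqxx ?mulr1; first by rewrite mulrC.
by rewrite (negPf ji) andbF !mulr0.
Qed.

(** The phases cover sines as well, and the product formula for cosines makes this an algebra of
    real functions. *)
Definition trigpoly F := exists l : seq (R * 'rV[R]_r * R), forall x,
  F x = \sum_(p <- l) p.1.1 * cos (dotp x p.1.2 + p.2).

Lemma trigpoly_cos (c u : R) b : trigpoly (fun x => c * cos (dotp x b + u)).
Proof. by exists [:: (c, b, u)] => x; rewrite big_seq1. Qed.

Lemma trigpoly_cst (c : R) : trigpoly (fun=> c).
Proof. by exists [:: (c, 0, 0)] => x; rewrite big_seq1 /= dotp0 addr0 cos0 mulr1. Qed.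

Lemma trigpolyD F G : trigpoly F -> trigpoly G -> trigpoly (fun x => F x + G x).
Proof. by move=> [l Fl] [l' Gl]; exists (l ++ l') => x; rewrite big_cat Fl Gl. Qed.

Lemma trigpolyM F G : trigpoly F -> trigpoly G -> trigpoly (fun x => F x * G x).
Proof.
move=> [l Fl] [l' Gl].
exists (flatten [seq [:: (p.1.1 * q.1.1 / 2, p.1.2 + q.1.2, p.2 + q.2); (p.1.1 * q.1.1 / 2, p.1.2 - q.1.2, p.2 - q.2)] | p <- l, q <- l']) => x.
rewrite big_flatten /= big_allpairs_dep /= Fl Gl mulr_suml; apply: eq_bigr => p _.
rewrite mulr_sumr; apply: eq_bigr => q _; rewrite !big_cons big_nil /= addr0 !dotpD dotpN.
have -> : dotp x p.1.2 + dotp x q.1.2 + (p.2 + q.2) = (dotp x p.1.2 + p.2) + (dotp x q.1.2 + q.2) by ring.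
have -> : dotp x p.1.2 - dotp x q.1.2 + (p.2 - q.2) = (dotp x p.1.2 + p.2) - (dotp x q.1.2 + q.2) by ring.
by move: (dotp x p.1.2 + p.2) (dotp x q.1.2 + q.2) => A D; rewrite cosD cosB; field.
Qed.

Lemma trigpoly_ext F G : F =1 G -> trigpoly F -> trigpoly G.
Proof. by move/funext->. Qed.

Definition inc (i : 'I_r) (k : 'I_r -> nat) : 'I_r -> nat := fun j => (k j + (i == j))%N.

(* Expectation of [f] after the Bernoulli increments listed in [l], with success probabilities [v]. *)
Fixpoint bern (l : seq 'I_r) (v : 'I_r -> R) (f : ('I_r -> nat) -> R) (k : 'I_r -> nat) : R :=
  if l is i :: l' then (1 - v i) * bern l' v f k + v i * bern l' v f (inc i k) else f k.

Lemma bernD l v f g k : bern l v (fun q => f q + g q) k = bern l v f k + bern l v g k.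
Proof. by elim: l k => //= i l IH k; rewrite !IH; ring. Qed.

Lemma bernZ l v f (c : R) k : bern l v (fun q => c * f q) k = c * bern l v f k.
Proof. by elim: l k => //= i l IH k; rewrite !IH; ring. Qed.

Lemma bern_cst l v (c : R) k : bern l v (fun=> c) k = c.
Proof. by elim: l k => //= i l IH k; rewrite !IH; ring. Qed.

Lemma bern_sum l v I (s : seq I) (f : I -> ('I_r -> nat) -> R) k :
  bern l v (fun q => \sum_(i <- s) f i q) k = \sum_(i <- s) bern l v (f i) k.
Proof.
elim: s => [|i s IH].
  rewrite big_nil -[RHS](bern_cst l v 0 k); congr (bern l v _ k); apply/funext => q; by rewrite big_nil.
rewrite big_cons -IH -bernD; congr (bern l v _ k); apply/funext => q; by rewrite big_cons.
Qed.

Lemma bern_le l v f g k : (forall i, 0 <= v i <= 1) -> (forall q, f q <= g q) -> bern l v f k <= bern l v g k.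
Proof.
move=> v01 fg; elim: l k => //= i l IH k; have /andP[v0 v1] := v01 i.
by apply: lerD; rewrite ler_wpM2l ?subr_ge0.
Qed.

(** Squared bias plus variance of a binomial variable: coordinate [i] receives as many independent
    increments as it is listed in [l]. *)
Lemma bern_var l v i (c : R) k : bern l v (fun q => ((q i)%:R - c) ^+ 2) k =
  ((k i)%:R + (count_mem i l)%:R * v i - c) ^+ 2 + (count_mem i l)%:R * (v i * (1 - v i)).
Proof.
elim: l k => [|j l IH] k /=; first by rewrite !mul0r !addr0.
rewrite !IH /inc; have [->|ji] := eqVneq j i.
  by rewrite addn1 -natr1 add1n -[(_.+1)%:R]natr1; ring.
by rewrite add0n addn0; ring.
Qed.

Lemma trigpoly_bern l (v : 'rV[R]_r -> 'I_r -> R) f k : (forall i, trigpoly (v^~ i)) ->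
  trigpoly (fun x => bern l (v x) f k).
Proof.
move=> tv; elim: l k => [|i l IH] k /=; first exact: trigpoly_cst.
apply: trigpolyD; apply: trigpolyM => //.
apply: (trigpoly_ext (F := fun x => 1 + (-1) * v x i)) => [x|]; first by rewrite mulN1r.
by apply: trigpolyD; [|apply: trigpolyM => //]; exact: trigpoly_cst.
Qed.

(** With m and D the half sum and half difference of the angles, cos m >= |sin D| on this range, so
    |sin al - sin be| = 2 cos m |sin D| >= 2 sin(D)^2 = 1 - cos(al - be). *)
Lemma sin_quant (al be e : R) : - (pi / 2) <= al <= pi / 2 -> - (pi / 2) <= be <= pi / 2 -> 0 <= e <= pi ->
  `|sin al - sin be| < 1 - cos e -> `|al - be| < e.
Proof.
wlog ab : al be / be <= al.
  move=> H h1 h2; case: (leP be al) => [ab|/ltW ab]; first by apply: H.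
  by move=> he h; rewrite distrC; apply: (H _ _ ab h2 h1 he); rewrite distrC.
move=> /andP[a1 a2] /andP[b1 b2] /andP[e0 e1]; pose D := (al - be) / 2; pose m := (al + be) / 2.
have p0 := pi_gt0 R.
have E : sin al - sin be = 2 * cos m * sin D.
  have -> : al = m + D by rewrite /m /D; field.
  have -> : be = m - D by rewrite /m /D; field.
  by rewrite sinD sinB; ring.
have D0 : 0 <= D by rewrite /D; lra.
have sD : 0 <= sin D by apply: sin_ge0_pi; rewrite /D; lra.
have cm : sin D <= cos m.
  have -> : sin D = cos (pi / 2 - D) by rewrite cosB cos_pihalf sin_pihalf mul0r add0r mul1r.
  have -> : cos m = cos `|m| by case: (lerP 0 m) => m0; [rewrite ger0_norm|rewrite ltr0_norm// cosN].
  have [m1 m2] : `|m| <= pi / 2 - D /\ 0 <= `|m| by split => //; rewrite ler_norml /m /D; lra.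
  rewrite leNgt; apply/negP; rewrite ltr_cos ?in_itv /=; [lra| |]; rewrite /D; lra.
rewrite E ger0_norm ?mulr_ge0// ?(le_trans sD)// => h.
rewrite ger0_norm ?subr_ge0// ltNge; apply/negP => eD.
have c2 : cos (al - be) <= cos e.
  rewrite leNgt; apply/negP; rewrite ltr_cos ?in_itv /=; lra.
have c3 : cos (al - be) = 1 - 2 * sin D ^+ 2.
  have -> : al - be = D + D by rewrite /D; field.
  have := cos2Dsin2 D; rewrite cosD !expr2; lra.
have : 2 * sin D * sin D <= 2 * cos m * sin D by rewrite ler_wpM2r// ler_wpM2l.
rewrite expr2 in c3; lra.
Qed.

Definition unif_cont F := forall e : R, 0 < e -> exists2 d : R, 0 < d &
  forall x y, (forall i, `|x 0 i - y 0 i| <= d) -> `|F x - F y| <= e.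

(** Compactness of a box one unit larger than the support gives uniformity inside. For a point
    outside, its close neighbours are still beyond [K], so both values vanish. *)
Lemma continuous_unif_cont F (K : R) : continuous F -> (forall x, (exists i, K <= `|x 0 i|) -> F x = 0) -> unif_cont F.
Proof.
move=> cF F0 e e0.
pose box := [set x : 'rV[R]_r | forall i, `[- (`|K| + 1), `|K| + 1]%classic (x ord0 i)].
have cbox : compact box.
  by apply: (@rV_compact R r (fun=> `[- (`|K| + 1), `|K| + 1]%classic)) => i; exact: segment_compact.
pose P (d : R) x := forall y, (forall i, `|x 0 i - y 0 i| < d) -> `|F x - F y| <= e.
have nP : \forall d \near (0 : R)^'+, box `<=` P d.
  have /compact_near_coveringP := cbox; apply => x _.
  have /cvgrPdist_lt/(_ (e / 2)) := cF x; rewrite divr_gt0// => /(_ isT).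
  rewrite -filter_from_ballE => -[d /= d0 dP].
  exists (ball x (d / 2), [set t | 0 < t < d / 2]) => /=.
    split; first by apply: nbhsx_ballx; rewrite divr_gt0.
    exists (d / 2) => //=; first by rewrite divr_gt0.
    by move=> t /=; rewrite sub0r normrN => td t0; rewrite t0/=; apply: le_lt_trans td; exact: ler_norm.
  move=> [x' t] /= [xx' /andP[t0 td]] y x'y.
  have h1 : `|F x - F x'| < e / 2.
    by apply: dP; apply: le_ball xx'; lra.
  have h2 : `|F x - F y| < e / 2.
    apply: dP; split => // i j; rewrite !ord1; have [_ /(_ 0 j)] := xx'; have := x'y j; rewrite /ball /= => h3 h4.
    by have := ler_distD (x' 0 j) (x 0 j) (y 0 j); lra.
  have := ler_distD (F x) (F x') (F y); rewrite [`|F x' - F x|]distrC; lra.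
have [d [d0 d1 dP]] : exists d : R, [/\ 0 < d, d < 1 & box `<=` P d].
  near (0 : R)^'+ => d; exists d; split; near: d.
    - exact: nbhs_right_gt.
    - exact: nbhs_right_lt.
    - exact: nP.
exists (d / 2); first by rewrite divr_gt0.
move=> x y xy; have [bx|nbx] := pselect (box x).
  by apply: dP => // i; apply: le_lt_trans (xy i) _; lra.
have [i xi] : exists i, `|K| + 1 < `|x 0 i|.
  apply: contrapT => nx; apply: nbx => i /=; rewrite in_itv /= -ler_norml leNgt; apply/negP => h; apply: nx.
  by exists i.
have Kn := ler_norm K.
rewrite !F0 ?subrr ?normr0 ?(ltW e0)//; exists i; last lra.
have := xy i; have := ler_distD (y 0 i) (x 0 i) 0; rewrite !subr0; lra.
Unshelve. all: by end_near. Qed.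

Definition clip (s : R) : R := if s < -1 then -1 else if 1 < s then 1 else s.

Lemma clip_itv s : -1 <= clip s <= 1.
Proof. by rewrite /clip; case: ltP => // h1; [lra|case: ltP => // h2; lra]. Qed.

Lemma clip_dist s (t : R) : -1 <= t <= 1 -> `|clip s - t| <= `|s - t|.
Proof.
move=> /andP[t1 t2]; rewrite /clip; case: ltP => h1; [|case: ltP => h2 //].
  by rewrite distrC [X in _ <= X]distrC !ger0_norm; lra.
by rewrite !ger0_norm; lra.
Qed.

(** Bernstein approximation in the variables (1 + sin(a x_i))/2, in which Bernstein polynomials are
    trigonometric. Being expectations of values of [F], the approximants keep the bound [M] on the
    whole space, also far outside the box where they approximate. *)
Lemma trig_approx F (K M : R) : continuous F -> (forall x, (exists i, K <= `|x 0 i|) -> F x = 0) ->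
  (forall x, `|F x| <= M) -> forall e L : R, 0 < e -> 0 < L ->
  exists T, [/\ trigpoly T, forall x, `|T x| <= M & forall x, (forall i, `|x 0 i| <= L) -> `|T x - F x| <= e].
Proof.
move=> cF F0 FM e L e0 L0; have p0 := pi_gt0 R.
have M0 : 0 <= M by apply: le_trans (FM 0).
(* At this frequency the box of half-width [L] corresponds to angles in [-pi/2, pi/2], where the
   sine can be inverted. *)
pose a := pi / 2 / L; have a0 : 0 < a by rewrite !divr_gt0.
have e20 : 0 < e / 2 by rewrite divr_gt0.
have [d' d'0 dP'] := continuous_unif_cont cF F0 e20.
pose d := Num.min d' (pi / a).
have d0 : 0 < d by rewrite lt_min d'0 divr_gt0.
have ad : 0 <= a * d <= pi.
  rewrite mulr_ge0 ?(ltW a0) ?(ltW d0)//= mulrC -ler_pdivlMr// /d ge_min lexx orbT//.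
(* Frequencies within [eta] of [v] move the sine by less than 2 [eta], below the tolerance 1 - cos
   (a d) of [sin_quant]. *)
pose eta := (1 - cos (a * d)) / 4.
have eta0 : 0 < eta.
  rewrite divr_gt0// subr_gt0 -(cos0 R) ltr_cos ?in_itv/= ?lexx ?(ltW p0)//.
  by rewrite mulr_gt0.
pose v x (i : 'I_r) := (1 + sin (a * x 0 i)) / 2.
have v01 x i : 0 <= v x i <= 1.
  by rewrite /v; have := sin_le1 (a * x 0 i); have := sin_geN1 (a * x 0 i); lra.
have [n n0 nP] : exists2 n, (0 < n)%N & 2 * M / eta ^+ 2 * r%:R / n%:R <= e / 2.
  pose C := 2 * M / eta ^+ 2 * r%:R / (e / 2); have C0 : 0 <= C.
    apply: divr_ge0; last exact: ltW.
    by apply: mulr_ge0 => //; apply: divr_ge0; [exact: mulr_ge0|exact/exprn_ge0/ltW].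
  exists (Num.bound C).+1 => //; rewrite ler_pdivrMr// [X in _ <= X]mulrC -ler_pdivrMr//.
  by apply: le_trans (ltW (archi_boundP C0)) _; rewrite ler_nat.
pose l := flatten (nseq n (enum 'I_r)).
have cl i : count_mem i l = n.
  rewrite /l; elim: n {n0 nP l} => //= n IH; rewrite count_cat IH count_uniq_mem ?enum_uniq// mem_enum.
  by rewrite add1n.
(* The grid point whose sine is 2k/n - 1. Clipping is there because the bounds below are stated for
   all counts k, including k > n. *)
pose yy (k : 'I_r -> nat) : 'rV[R]_r := \row_i (asin (clip (2 * (k i)%:R / n%:R - 1)) / a).
pose T x := bern l (v x) (fun k => F (yy k)) (fun=> 0%N).
exists T; split.
- apply: trigpoly_bern => i.
  apply: (trigpoly_ext (F := fun x => 2^-1 + 2^-1 * cos (dotp x (a *: delta_mx 0 i) + - (pi / 2)))).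
    by move=> x; rewrite dotp_delta cos_sub_pihalf /v; field.
  by apply: trigpolyD; [exact: trigpoly_cst|exact: trigpoly_cos].
- move=> x; rewrite ler_norml; apply/andP; split.
    rewrite -(bern_cst l (v x) (- M) (fun=> 0%N)); apply: bern_le => // k.
    by have := FM (yy k); rewrite ler_norml => /andP[].
  rewrite -(bern_cst l (v x) M (fun=> 0%N)); apply: bern_le => // k.
  by have := FM (yy k); rewrite ler_norml => /andP[].
move=> x xL; pose S k := \sum_(i <- enum 'I_r) ((k i : nat)%:R - n%:R * v x i) ^+ 2.
have nR : 0 < n%:R :> R by rewrite ltr0n.
pose g k := e / 2 + 2 * M / eta ^+ 2 / n%:R ^+ 2 * S k.
have S0 k : 0 <= S k by apply: sumr_ge0 => i _; exact: sqr_ge0.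
have diff k : `|F (yy k) - F x| <= g k.
  (* Close counts are handled by uniform continuity. Otherwise some term of [S k] is at least (n
     eta)^2, and Chebyshev's inequality applies. *)
  have [close|] := pselect (forall i, `|(k i)%:R / n%:R - v x i| < eta).
    have : `|F (yy k) - F x| <= e / 2.
      apply: dP' => i; rewrite mxE.
      have := clip_itv (2 * (k i)%:R / n%:R - 1); set s := clip _ => sI.
      have ax : - (pi / 2) <= a * x 0 i <= pi / 2.
        rewrite -ler_norml normrM (gtr0_norm a0) /a; have := xL i.
        rewrite -(ler_pM2l (divr_gt0 (divr_gt0 p0 (ltr0Sn R 1)) L0)) => h; apply: le_trans h _.
        by rewrite divfK ?gt_eqF.
      have as1 : - (pi / 2) <= asin s <= pi / 2 by rewrite asin_geNpi2// asin_lepi2.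
      have : `|sin (asin s) - sin (a * x 0 i)| < 1 - cos (a * d).
        rewrite asinK ?in_itv//; apply: le_lt_trans (clip_dist _ _) _; first by rewrite sin_le1 sin_geN1.
        have -> : 2 * (k i)%:R / n%:R - 1 - sin (a * x 0 i) = 2 * ((k i)%:R / n%:R - v x i) by rewrite /v; field; rewrite gt_eqF.
        rewrite normrM ger0_norm//; have := close i; rewrite /eta; have := eta0; rewrite /eta; lra.
      move=> /(sin_quant as1 ax ad) h; apply: (@le_trans _ _ d); last by rewrite /d ge_min lexx.
      have -> : asin s / a - x 0 i = (asin s - a * x 0 i) / a by field; rewrite gt_eqF.
      by rewrite normrM normfV (gtr0_norm a0) ler_pdivrMr// [X in _ <= X]mulrC ltW.
    move=> h; apply: (le_trans h); rewrite /g lerDl; apply: mulr_ge0 => //.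
    by apply: divr_ge0; [apply: divr_ge0; [exact: mulr_ge0|exact/exprn_ge0/ltW]|exact/exprn_ge0/ltW].
  move=> /existsNP[i /negP]; rewrite -leNgt => far.
  have h1 : `|F (yy k) - F x| <= 2 * M.
    by rewrite (le_trans (ler_normB _ _))//; have := FM (yy k); have := FM x; lra.
  have h2 : eta ^+ 2 <= S k / n%:R ^+ 2.
    rewrite ler_pdivlMr ?exprn_gt0// -exprMn.
    have : (eta * n%:R) ^+ 2 <= ((k i)%:R - n%:R * v x i) ^+ 2.
      rewrite -[X in _ <= X]real_normK ?num_real// ler_sqr ?nnegrE// ?mulr_ge0 ?(ltW eta0)//.
      have -> : (k i)%:R - n%:R * v x i = ((k i)%:R / n%:R - v x i) * n%:R by field; rewrite gt_eqF.
      by rewrite normrM (gtr0_norm nR) ler_wpM2r// ltW.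
    move=> h; apply: (le_trans h); rewrite /S (big_rem i) ?mem_enum//= lerDl sumr_ge0// => j _; exact: sqr_ge0.
  rewrite (le_trans h1)//; apply: (@le_trans _ _ (2 * M * (S k / n%:R ^+ 2 / eta ^+ 2))).
    by rewrite ler_peMr ?mulr_ge0// ler_pdivlMr ?exprn_gt0// mul1r.
  rewrite /g (_ : 2 * M / eta ^+ 2 / n%:R ^+ 2 * S k = 2 * M * (S k / n%:R ^+ 2 / eta ^+ 2)); last by field; rewrite !gt_eqF.
  by rewrite lerDr ltW.
have bg : bern l (v x) g (fun=> 0%N) <= e.
  rewrite /g bernD bern_cst bernZ bern_sum.
  under eq_bigr do rewrite bern_var cl.
  have : 2 * M / eta ^+ 2 / n%:R ^+ 2 * (\sum_(i <- enum 'I_r)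
      ((0%:R + n%:R * v x i - n%:R * v x i) ^+ 2 + n%:R * (v x i * (1 - v x i)))) <= 2 * M / eta ^+ 2 * r%:R / n%:R.
    have -> : 2 * M / eta ^+ 2 * r%:R / n%:R = 2 * M / eta ^+ 2 / n%:R ^+ 2 * (\sum_(i <- enum 'I_r) n%:R).
      rewrite big_const_seq count_predT iter_addr_0 -cardE card_ord -mulr_natr; field; by rewrite !gt_eqF.
    rewrite ler_wpM2l ?divr_ge0 ?exprn_ge0 ?mulr_ge0 ?(ltW eta0)// ler_sum// => i _.
    rewrite add0r subrr expr0n add0r ler_piMr// ?ltW//; have := v01 x i; nra.
  by move: nP; lra.
rewrite ler_norml; apply/andP; split.
  rewrite lerBrDr addrC; have : bern l (v x) (fun k => F x + (-1) * g k) (fun=> 0%N) <= T x.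
    by apply: bern_le => // k; have := diff k; rewrite ler_norml; lra.
  rewrite bernD bernZ bern_cst; lra.
have : T x <= bern l (v x) (fun k => F x + g k) (fun=> 0%N).
  by apply: bern_le => // k; have := diff k; rewrite ler_norml; lra.
rewrite bernD bern_cst; lra.
Qed.

End Levy.

(** * Convergence of positive functionals from their transforms *)

Section LevyConvergence.
Context {R : realType} {r : nat}.
Implicit Types (x y b : 'rV[R]_r) (F G : 'rV[R]_r -> R).
Local Notation T1 := (measurableTypeR R).
Local Notation mu := (@lebesgue_rV R r).
Variables (L : nat -> ('rV[R]_r -> R) -> R) (W : 'rV[R]_r -> R).
Hypothesis L_lin : forall n (a : R) F G, L n (fun x => a * F x + G x) = a * L n F + L n G.
Hypothesis L_mono : forall n F G, (forall x, F x <= G x) -> L n F <= L n G.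
Hypothesis W_meas : measurable_fun [set: 'rV[R]_r] (W : _ -> T1).
Hypothesis W_ge0 : forall x, 0 <= W x.
(** It dominates every e^|x_i| and so controls tails, yet it is a finite sum of real exponentials,
    so its convergence follows from that of the same transforms. *)
Definition exp_norm x : R := \sum_i (expR (x 0 i) + expR (- x 0 i)).
Hypothesis W_int : mu.-integrable setT (EFin \o W).
Hypothesis WE_int : mu.-integrable setT (EFin \o (fun x => exp_norm x * W x)).
Hypothesis L_cos : forall b (u : R), (fun n => L n (fun x => cos (dotp x b + u))) @ \oo -->
  \int[mu]_x (cos (dotp x b + u) * W x).
Hypothesis L_exp : (fun n => L n exp_norm) @ \oo --> \int[mu]_x (exp_norm x * W x).

Lemma levy_ext n F G : F =1 G -> L n F = L n G.
Proof. by move/funext->. Qed.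

Lemma levy_0 n : L n (fun=> 0) = 0.
Proof.
have := L_lin n (-1) (fun=> 0) (fun=> 0); rewrite (levy_ext n (G := fun=> 0)); first by lra.
by move=> x; rewrite mulr0 addr0.
Qed.

Lemma levyZ n (a : R) F : L n (fun x => a * F x) = a * L n F.
Proof.
have := L_lin n a F (fun=> 0); rewrite levy_0 addr0 => <-; apply: levy_ext => x; by rewrite addr0.
Qed.

Lemma levyD n F G : L n (fun x => F x + G x) = L n F + L n G.
Proof. by have := L_lin n 1 F G; rewrite mul1r => <-; apply: levy_ext => x; rewrite mul1r. Qed.

Lemma measurable_dotp b : measurable_fun [set: 'rV[R]_r] ((fun x => dotp x b) : _ -> T1).
Proof. by apply: measurable_sum => i; apply: measurable_funM => //; exact: measurable_rV_coord. Qed.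

Lemma measurable_trigpoly F : trigpoly F -> measurable_fun [set: 'rV[R]_r] (F : _ -> T1).
Proof.
case=> l Fl; rewrite (_ : F = fun x => \sum_(p <- l) p.1.1 * cos (dotp x p.1.2 + p.2)); last exact/funext.
apply: measurable_sum => p; apply: measurable_funM => //; apply: measurable_cos_fun.
by apply: measurable_funD => //; exact: measurable_dotp.
Qed.

Lemma integrable_bounded F (M : R) : measurable_fun [set: 'rV[R]_r] (F : _ -> T1) -> (forall x, `|F x| <= M) ->
  mu.-integrable setT (EFin \o (fun x => F x * W x)).
Proof.
move=> mF FM; apply: (@le_integrable_rV _ _ _ (fun x => M * W x)).
- exact: measurable_funM.
- by move=> x; rewrite normrM (ger0_norm (W_ge0 x)) ler_wpM2r.
- exact: (integrableZl _ _ W_int).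
Qed.

Lemma levy_trigpoly F : trigpoly F -> (fun n => L n F) @ \oo --> \int[mu]_x (F x * W x).
Proof.
case=> l; elim: l F => [|p l IH] F Fl.
  have F0 x : F x = 0 by rewrite Fl big_nil.
  have -> : \int[mu]_x (F x * W x) = 0.
    by under eq_Rintegral do rewrite F0 mul0r; rewrite /Rintegral integral0.
  apply: (cvg_ext (f := fun=> 0)); last exact: cvg_cst.
  by move=> n; rewrite (levy_ext n (G := fun=> 0)) ?levy_0.
pose G x := \sum_(q <- l) q.1.1 * cos (dotp x q.1.2 + q.2).
have FG x : F x = p.1.1 * cos (dotp x p.1.2 + p.2) + G x by rewrite Fl big_cons.
have tG : trigpoly G by exists l.
have cos1 (b : 'rV[R]_r) (u : R) x : `|cos (dotp x b + u)| <= 1 by rewrite ler_norml cos_geN1 cos_le1.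
have GM x : `|G x| <= \sum_(q <- l) `|q.1.1|.
  rewrite /G; elim: (l) => [|q l' IHl]; first by rewrite !big_nil normr0.
  by rewrite !big_cons (le_trans (ler_normD _ _))// lerD// normrM ler_piMr.
have mc : measurable_fun [set: 'rV[R]_r] ((fun x => cos (dotp x p.1.2 + p.2)) : _ -> T1).
  by apply: measurable_cos_fun; apply: measurable_funD => //; exact: measurable_dotp.
have i1 := integrable_bounded mc (cos1 _ _); have i2 := integrable_bounded (measurable_trigpoly tG) GM.
have i1' : mu.-integrable setT (EFin \o (fun x => p.1.1 * (cos (dotp x p.1.2 + p.2) * W x))) by exact: (integrableZl _ _ i1).
have -> : \int[mu]_x (F x * W x) = p.1.1 * (\int[mu]_x (cos (dotp x p.1.2 + p.2) * W x)) + \int[mu]_x (G x * W x).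
  under eq_Rintegral do rewrite FG mulrDl -mulrA.
  by rewrite RintegralD// RintegralZl.
apply: (cvg_ext (f := fun n => p.1.1 * L n (fun x => cos (dotp x p.1.2 + p.2)) + L n G)).
  by move=> n; rewrite -L_lin; apply: levy_ext => x; rewrite FG.
by apply: cvgD; [apply: cvgM; [exact: cvg_cst|exact: L_cos]|exact: IH].
Qed.

Lemma exp_norm_ge0 x : 0 <= exp_norm x.
Proof. by apply: sumr_ge0 => i _; rewrite addr_ge0 ?expR_ge0. Qed.

Lemma exp_norm_ge x i (l : R) : l <= `|x 0 i| -> expR l <= exp_norm x.
Proof.
move=> lx; rewrite /exp_norm (bigD1 i)//=; apply: ler_wpDr.
  by apply: sumr_ge0 => j _; rewrite addr_ge0 ?expR_ge0.
case: (leP 0 (x 0 i)) => x0.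
  by apply: ler_wpDr; rewrite ?expR_ge0// ler_expR -(ger0_norm x0).
by apply: ler_wpDl; rewrite ?expR_ge0// ler_expR -(ltr0_norm x0).
Qed.

Section Test.
Variables (F : 'rV[R]_r -> R) (K M : R).
Hypothesis cF : continuous F.
Hypothesis F0 : forall x, (exists i, K <= `|x 0 i|) -> F x = 0.
Hypothesis FM : forall x, `|F x| <= M.

(** The sigma-algebra on row vectors is generated by the coordinates; a continuous test function is
    measurable for it as a pointwise limit of trigonometric polynomials on growing boxes. *)
Lemma measurable_test : measurable_fun [set: 'rV[R]_r] (F : _ -> T1).
Proof.
have [T TP] : exists T : nat -> 'rV[R]_r -> R, forall n, trigpoly (T n) /\
    forall x, (forall i, `|x 0 i| <= n.+1%:R) -> `|T n x - F x| <= n.+1%:R^-1.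
  have ex' n : exists T, trigpoly T /\ forall x, (forall i, `|x 0 i| <= n.+1%:R) -> `|T x - F x| <= n.+1%:R^-1.
    have [|T [tT _ TF]] := trig_approx cF F0 FM (e := n.+1%:R^-1) (L := n.+1%:R) _ (ltr0Sn _ n); first by rewrite invr_gt0.
    by exists T.
  exists (fun n => xget F [set T | trigpoly T /\ forall x, (forall i, `|x 0 i| <= n.+1%:R) -> `|T x - F x| <= n.+1%:R^-1]) => n.
  exact: (@xgetPex _ F [set T | trigpoly T /\ _] (ex' n)).
apply/measurable_EFinP; apply: (emeasurable_fun_cvg (fun n => EFin \o T n)) => [n|x _].
  by apply/measurable_EFinP; apply: measurable_trigpoly; have [] := TP n.
apply: cvg_EFin; first exact: nearW.
apply/cvgrPdist_le => e e0.
have [k kP] : exists k : nat, forall i, `|x 0 i| <= k%:R.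
  exists (Num.bound (\sum_i `|x 0 i|)) => i; apply: le_trans (ltW (archi_boundP _)); last exact: sumr_ge0.
  by rewrite (bigD1 i)//= lerDl sumr_ge0.
near=> n; rewrite /= distrC; have [_ TF] := TP n; apply: le_trans (TF x _) _.
  move=> i; apply: le_trans (kP i) _; rewrite ler_nat ltnW// ltnS; near: n; exact: nbhs_infty_ge.
rewrite invf_ple ?posrE//; apply: le_trans (ltW (archi_boundP _)) _; first by rewrite invr_ge0 ltW.
rewrite ler_nat ltnW// ltnS; near: n; exact: nbhs_infty_ge.
Unshelve. all: by end_near. Qed.

(** Replace [F] by a trigonometric polynomial close to it on a large box. Outside the box both are
    bounded by [M], and the difference is dominated by a small multiple of [exp_norm], whose values
    under the functionals converge. *)
Lemma levy : (fun n => L n F) @ \oo --> \int[mu]_x (F x * W x).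
Proof.
have M0 : 0 <= M by apply: le_trans (FM 0).
have mF := measurable_test; have iF := integrable_bounded mF FM.
apply/cvgrPdist_le => e e0.
pose C1 := \int[mu]_x W x; pose C2 := \int[mu]_x (exp_norm x * W x).
have C10 : 0 <= C1 by exact: Rintegral_ge0.
have C20 : 0 <= C2 by apply: Rintegral_ge0 => x _; rewrite mulr_ge0 ?exp_norm_ge0.
pose e1 := e / 8 / (C1 + 1); have e10 : 0 < e1 by rewrite !divr_gt0// ltr_wpDl.
(* Since l e^(-l) <= 1, this radius brings the tail term [k * C2] below e/8. *)
pose l := 1 + 2 * M * C2 / (e / 8); have l0 : 0 < l.
  by rewrite ltr_wpDr// divr_ge0 ?mulr_ge0// ltW// divr_gt0.
pose k := 2 * M * expR (- l); have k0 : 0 <= k by rewrite mulr_ge0 ?expR_ge0// mulr_ge0.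
have kC : k * C2 <= e / 8.
  have : expR (- l) * l <= 1.
    have h := expR_ge1Dx l; rewrite -[X in _ <= X](expR0) -(addNr l) expRD ler_wpM2l ?expR_ge0//; lra.
  have : 2 * M * C2 <= (e / 8) * l.
    rewrite /l mulrDr mulr1 [X in _ <= _ + X]mulrC divfK ?lerDr ?gt_eqF ?divr_gt0//; lra.
  have := expR_ge0 (- l); rewrite /k => h1 h2 h3.
  apply: (@le_trans _ _ (e / 8 * (expR (- l) * l))); last by rewrite ler_piMr//; lra.
  rewrite [X in X <= _](_ : _ = (2 * M * C2) * expR (- l)); last by ring.
  by rewrite [X in _ <= X](_ : _ = (e / 8 * l) * expR (- l)); [rewrite ler_wpM2r|ring].
have e1C : e1 * C1 <= e / 8.
  by rewrite /e1 mulrAC ler_pdivrMr ?ltr_wpDl// ler_wpM2l//; lra.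
have [T [tT TM TF]] := trig_approx cF F0 FM e10 l0.
pose eta x := e1 + k * exp_norm x.
have diff x : `|T x - F x| <= eta x.
  have [bx|/existsNP[i /negP]] := pselect (forall i, `|x 0 i| <= l).
    by rewrite (le_trans (TF x bx))// lerDl mulr_ge0 ?exp_norm_ge0.
  rewrite -ltNge => /ltW /exp_norm_ge h; rewrite (le_trans (ler_normB _ _))//.
  apply: (@le_trans _ _ (2 * M)); first by have := TM x; have := FM x; lra.
  rewrite /eta /k ler_wpDl ?(ltW e10)// -mulrA ler_peMr ?mulr_ge0//.
  by rewrite -(expR0) -(addNr l) expRD ler_wpM2l ?expR_ge0.
have Leta : (fun n => L n eta) @ \oo --> e1 * C1 + k * C2.
  apply: (cvg_ext (f := fun n => e1 * L n (fun=> cos (dotp (0 : 'rV[R]_r) (0 : 'rV[R]_r) + 0)) + k * L n exp_norm)).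
    move=> n; rewrite -levyZ -levyZ -levyD; apply: levy_ext => x; by rewrite dotp0 addr0 cos0 mulr1.
  apply: cvgD; apply: cvgM; [exact: cvg_cst| |exact: cvg_cst|exact: L_exp].
  have := @L_cos (0 : 'rV[R]_r) (0 : R); have -> : \int[mu]_x (cos (dotp x 0 + 0) * W x) = C1.
    by apply: eq_Rintegral => x _; rewrite dotp0 addr0 cos0 mul1r.
  by apply: cvg_ext => n; apply: levy_ext => x; rewrite !dotp0.
have LTF n : `|L n T - L n F| <= L n eta.
  have -> : L n T - L n F = L n (fun x => T x - F x).
    have -> : (fun x => T x - F x) = (fun x => (-1) * F x + T x) by apply/funext => x; ring.
    by rewrite L_lin; ring.
  rewrite ler_norml; apply/andP; split.
    rewrite -mulN1r -levyZ; apply: L_mono => x; have := diff x; rewrite ler_norml; lra.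
  by apply: L_mono => x; have := diff x; rewrite ler_norml; lra.
have mT := measurable_trigpoly tT; have iT := integrable_bounded mT TM.
have iEta : mu.-integrable setT (EFin \o (fun x => e1 * W x + k * (exp_norm x * W x))).
  have a1 : mu.-integrable setT (EFin \o (fun x => e1 * W x)) by exact: (integrableZl _ _ W_int).
  have a2 : mu.-integrable setT (EFin \o (fun x => k * (exp_norm x * W x))) by exact: (integrableZl _ _ WE_int).
  have := integrableD (@measurableT _ 'rV[R]_r) a1 a2; by apply: eq_integrable => // x _ /=; rewrite -EFinD.
have OTF : `|\int[mu]_x (T x * W x) - \int[mu]_x (F x * W x)| <= e / 4.
  rewrite -RintegralB//; apply: le_trans (le_normr_Rintegral _ _) _ => //.
    have := integrableB (@measurableT _ 'rV[R]_r) iT iF; by apply: eq_integrable => // x _ /=; rewrite -EFinB.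
  apply: (@le_trans _ _ (\int[mu]_x (e1 * W x + k * (exp_norm x * W x)))).
    apply: le_Rintegral => //.
      have := integrable_norm (integrableB (@measurableT _ 'rV[R]_r) iT iF).
      by apply: eq_integrable => // x _ /=; rewrite -EFinB.
    move=> x _; rewrite -mulrBl normrM (ger0_norm (W_ge0 x)) mulrA -mulrDl ler_wpM2r//; exact: diff.
  have a1 : mu.-integrable setT (EFin \o (fun x => e1 * W x)) by exact: (integrableZl _ _ W_int).
  have a2 : mu.-integrable setT (EFin \o (fun x => k * (exp_norm x * W x))) by exact: (integrableZl _ _ WE_int).
  rewrite RintegralD// !RintegralZl//; have := kC; have := e1C; rewrite /C1 /C2; lra.
have e4 : 0 < e / 4 by rewrite divr_gt0.
have /cvgrPdist_le/(_ _ e4) := levy_trigpoly tT.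
have /cvgrPdist_le/(_ _ e4) := Leta.
apply: filterS2 => n; rewrite distrC => /ler_normlP[_ h1] h2; have := LTF n.
have := ler_distD (\int[mu]_x (T x * W x)) (\int[mu]_x (F x * W x)) (L n F).
have := ler_distD (L n T) (\int[mu]_x (T x * W x)) (L n F).
rewrite [`|_ - \int[mu]_x (T x * W x)|]distrC.
move: OTF h2 h1 kC e1C; lra.
Qed.

End Test.
End LevyConvergence.

(** * The limit on the Weyl chamber *)

Section Cutoffs.
Context {R : realType}.
Implicit Type t : R.

Lemma sinh_ge t : 0 <= t -> t <= expR (t / 2) - expR (- (t / 2)).
Proof.
move=> t0; pose f := (fun s : R => expR s - expR (- s) - 2 * s).
have df (x : R) : is_derive x 1 f (expR x + expR (- x) - 2).
  have d1 : is_derive x 1 (fun y : R => - y) (- 1) by apply: is_derive_eq; rewrite /GRing.scale /=; ring.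
  have d2 : is_derive x 1 (expR \o (fun y : R => - y)) (expR (- x) * - 1) by exact: is_derive1_comp.
  have d3 : is_derive x 1 (fun y : R => y * 2) 2 by apply: is_derive_eq; rewrite /GRing.scale /=; ring.
  have -> : f = (expR - (expR \o (fun y : R => - y))) - (fun y : R => y * 2) by apply/funext => y; rewrite /f !fctE [2 * y]mulrC.
  by apply: is_derive_eq; rewrite /GRing.scale /=; ring.
have h : f 0 <= f (t / 2).
  apply: (@ger0_derive1_le_cc _ f 0 (t / 2)).
  - by move=> x _; apply: ex_derive.
  - move=> x _; rewrite derive1E derive_val.
    have := expR_ge1Dx x; have := expR_ge1Dx (- x); lra.
  - apply: continuous_subspaceT => x; apply: differentiable_continuous; apply/derivable1_diffP; exact: ex_derive.
  - by rewrite bound_itvE; lra.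
  - by rewrite bound_itvE; lra.
  - lra.
move: h; rewrite /f oppr0 expR0; lra.
Qed.

(** The piecewise linear function equal to 0 for t <= 0, to t on [0,1] and to 1 beyond; in this
    closed form its continuity is that of the absolute value. *)
Definition ramp t : R := (1 + `|t| - `|t - 1|) / 2.

Lemma ramp01 t : 0 <= ramp t <= 1.
Proof.
rewrite /ramp; case: (ger0P t) => h; case: (ger0P (t - 1)) => h'; apply/andP; split; lra.
Qed.

Lemma ramp0 t : t <= 0 -> ramp t = 0.
Proof. by move=> t0; rewrite /ramp (ler0_norm t0) ler0_norm; lra. Qed.

Lemma ramp1 t : 1 <= t -> ramp t = 1.
Proof. by move=> t1; rewrite /ramp !ger0_norm; lra. Qed.

Lemma continuous_ramp : continuous ramp.
Proof.
move=> t; apply: cvgM; last exact: cvg_cst.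
apply: cvgB; last by apply: cvg_norm; apply: cvgB; [exact: cvg_id|exact: cvg_cst].
by apply: cvgD; [exact: cvg_cst|apply: cvg_norm; exact: cvg_id].
Qed.

Lemma measurable_ramp d (T : measurableType d) (f : T -> R) :
  measurable_fun setT (f : _ -> measurableTypeR R) -> measurable_fun setT ((fun x => ramp (f x)) : _ -> measurableTypeR R).
Proof.
by move=> mf; apply: measurableT_comp => //; exact: continuous_measurable_fun continuous_ramp.
Qed.

Lemma prod01 (I : Type) (s : seq I) (f : I -> R) : (forall i, 0 <= f i <= 1) -> 0 <= \prod_(i <- s) f i <= 1.
Proof.
move=> f01; elim: s => [|i s /andP[h0 h1]]; first by rewrite big_nil lexx ler01.
by rewrite big_cons; have /andP[i0 i1] := f01 i; rewrite mulr_ge0//= mulr_ile1.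
Qed.

Lemma cvg_prod_seq (I : Type) (s : seq I) (T : Type) (F : set_system T) {FF : Filter F} (f : I -> T -> R) (l : I -> R) :
  (forall i, f i @ F --> l i) -> (fun x => \prod_(i <- s) f i x) @ F --> \prod_(i <- s) l i.
Proof.
move=> fl; elim: s => [|i s IH].
  by rewrite big_nil; under eq_fun do rewrite big_nil; exact: cvg_cst.
by rewrite big_cons; under eq_fun do rewrite big_cons; apply: cvgM.
Qed.

Lemma cvg_sum_seq (I : Type) (s : seq I) (T : Type) (F : set_system T) {FF : Filter F} (f : I -> T -> R) (l : I -> R) :
  (forall i, f i @ F --> l i) -> (fun x => \sum_(i <- s) f i x) @ F --> \sum_(i <- s) l i.
Proof.
move=> fl; elim: s => [|i s IH].
  by rewrite big_nil; under eq_fun do rewrite big_nil; exact: cvg_cst.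
by rewrite big_cons; under eq_fun do rewrite big_cons; apply: cvgD.
Qed.

End Cutoffs.

(** * Limit densities, cutoffs and the mass near the walls *)

Section ChamberLimit.
Context {R : realType} {r : nat}.
Variables (B : 'M[R]_r) (Pos : seq 'rV[R]_r).
Local Notation fm := (bform B).
Local Notation sr b := (delta_mx 0 b : 'rV[R]_r).
Hypothesis Bsym : B^T = B.
Hypothesis Bpos : forall a : 'rV[R]_r, a != 0 -> 0 < fm a a.
Hypothesis Pos_uniq : uniq Pos.
Hypothesis Pos_neq0 : forall x, x \in Pos -> x != 0.
Hypothesis Pos_ge0 : forall (x : 'rV[R]_r) b, x \in Pos -> 0 <= x 0 b.
Hypothesis simple_Pos : forall b, sr b \in Pos.
Hypothesis refl_Pos : forall b x, x \in Pos -> x != sr b -> refl B b x \in Pos.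
Hypothesis Pos_int : forall b x, x \in Pos ->
  exists z : int, 2 * (fm x (sr b)) / (fm (sr b) (sr b)) = z%:~R.
Local Notation rho := (half_sum Pos).
Local Notation mu := (@lebesgue_rV R r).
Local Notation T1 := (measurableTypeR R).
Local Notation pr := (root_prod B Pos).
Local Notation hs := (half_sinh B Pos).
Local Notation gB := (gaussB B).
Local Notation gc := (gauss_const B).
Implicit Types (x al be b : 'rV[R]_r) (u : R).

(** The density of the limit of [omega] on the whole space; [dens] is the limit density sought on
    the chamber. Their quotient is p / [half_sinh] up to the constant [pr rho]. *)
Definition weight x : R := hs x * pr x * gB x / gc.
Definition dens x : R := pr x ^+ 2 * gB x / (gc * pr rho).

Lemma fm_cvg x b : (fun y : 'rV[R]_r => fm y b) @ x --> fm x b.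
Proof.
have E y : fm y b = \sum_i y 0 i * (B *m b^T) i 0 by rewrite /bform -mulmxA mxE.
rewrite E; under eq_fun do rewrite E.
apply: (@cvg_sum_seq _ _ _ _ (nbhs x)) => i; apply: cvgM; [exact: coord_continuous|exact: cvg_cst].
Qed.

Lemma cst_cvg (k : R) x : (fun=> k) y @[y --> x] --> k.
Proof. exact: (@cst_continuous 'rV[R]_r R k x). Qed.

Lemma pr_cvg x : pr y @[y --> x] --> pr x.
Proof. by apply: (@cvg_prod_seq _ _ _ _ (nbhs x)) => b; exact: fm_cvg. Qed.

Lemma hs_cvg x : hs y @[y --> x] --> hs x.
Proof.
apply: (@cvg_prod_seq _ _ _ _ (nbhs x)) => b.
have c1 : (fun y : 'rV[R]_r => fm y b / 2) @ x --> fm x b / 2 by exact: (cvgM (@fm_cvg x b) (cvg_cst _)).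
apply: cvgB; first exact: (cvg_comp _ _ c1 (@continuous_expR R _)).
exact: (cvg_comp _ _ (cvgN c1) (@continuous_expR R _)).
Qed.

Lemma pair_le (t : R) : t ^+ 2 <= (expR (t / 2) - expR (- (t / 2))) * t.
Proof.
wlog t0 : t / 0 <= t.
  move=> H; case: (lerP 0 t) => [/H//|/ltW t0]; have := H (- t).
  by rewrite oppr_ge0 sqrrN mulNr opprK => /(_ t0); nra.
by have := sinh_ge t0; nra.
Qed.

(** Factor by factor t^2 <= 2 sinh(t/2) t, which holds for both signs of t because both sides are
    even. *)
Lemma sqr_pr_le x : pr x ^+ 2 <= hs x * pr x.
Proof.
rewrite /root_prod /half_sinh -prodrXl -big_split /= ler_prod// => b _.
by rewrite sqr_ge0 pair_le.
Qed.

Lemma hs_pr_ge0 x : 0 <= hs x * pr x.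
Proof. exact: le_trans (sqr_ge0 _) (sqr_pr_le x). Qed.

Lemma pr_gt0 x : sdom B x -> 0 < pr x.
Proof. by move=> sx; rewrite /root_prod big_seq prodr_gt0// => b bP; exact: (sdom_Pos_gt0 Bsym Pos_neq0 Pos_ge0 sx bP). Qed.

Lemma pr_le_hs x : sdom B x -> pr x <= hs x.
Proof. by move=> /pr_gt0 p0; have := sqr_pr_le x; rewrite expr2 ler_pM2r. Qed.

Lemma weight_ge0 x : 0 <= weight x.
Proof.
by rewrite /weight; apply: divr_ge0; [rewrite mulr_ge0 ?hs_pr_ge0 ?gaussB_ge0|rewrite ltW// (gauss_const_gt0 Bsym Bpos)].
Qed.

Lemma pr_rho_gt0 : 0 < pr rho.
Proof. apply: pr_gt0; exact: (rho_sdom Bsym Bpos). Qed.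

Lemma gpr_gt0 : 0 < gc * pr rho.
Proof. by rewrite mulr_gt0 ?pr_rho_gt0 ?(gauss_const_gt0 Bsym Bpos). Qed.

Lemma dens_ge0 x : 0 <= dens x.
Proof. by rewrite /dens; apply: divr_ge0; [rewrite mulr_ge0 ?sqr_ge0 ?gaussB_ge0|rewrite ltW// gpr_gt0]. Qed.

Lemma dens_le x : dens x <= weight x / pr rho.
Proof.
rewrite /dens /weight invfM [gc^-1 * _]mulrC mulrA -[leRHS]mulrA [_^-1 * _]mulrC mulrA.
rewrite ler_wpM2r ?invr_ge0 ?(ltW (gauss_const_gt0 Bsym Bpos))// ler_wpM2r ?invr_ge0 ?(ltW pr_rho_gt0)//.
by rewrite ler_wpM2r ?gaussB_ge0// sqr_pr_le.
Qed.

Lemma dens_wall x : dom B x -> ~ sdom B x -> dens x = 0.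
Proof.
move=> dx /existsNP[b /negP]; rewrite -leNgt => xb.
have xb0 : fm x (sr b) = 0 by apply/eqP; rewrite eq_le xb dx.
suff p0 : pr x = 0 by rewrite /dens p0 expr0n/= !mul0r.
by apply/eqP; rewrite prodf_seq_eq0; apply/hasP; exists (sr b) => //=; rewrite xb0.
Qed.

Lemma measurable_weight : measurable_fun [set: 'rV[R]_r] (weight : _ -> T1).
Proof.
apply: measurable_funM => //; apply: measurable_funM; last exact: measurable_gaussB.
apply: measurable_funM; last by apply: measurable_prod => b _; exact: measurable_bforml.
rewrite (_ : hs = fun x => \prod_(b <- Pos) (expR (fm x b / 2) - expR (- (fm x b / 2)))) //.
apply: measurable_prod => b _.
have m1 : measurable_fun [set: 'rV[R]_r] ((fun x => fm x b / 2) : _ -> T1).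
  by apply: measurable_funM => //; exact: measurable_bforml.
by apply: measurable_funB; apply: measurableT_comp => //; apply: measurableT_comp.
Qed.

Lemma measurable_dens : measurable_fun [set: 'rV[R]_r] (dens : _ -> T1).
Proof.
apply: measurable_funM => //; apply: measurable_funM; last exact: measurable_gaussB.
by apply: measurable_funX; apply: measurable_prod => b _; exact: measurable_bforml.
Qed.

Lemma dsum_integral (S : seq 'rV[R]_r) (w : 'rV[R]_r -> 'rV[R]_r -> R) : (forall y, mu.-integrable setT (EFin \o w y)) ->
  mu.-integrable setT (EFin \o (fun x => dsum S (w^~ x))) /\ \int[mu]_x dsum S (w^~ x) = dsum S (fun y => \int[mu]_x w y x).
Proof.
elim: S w => [|b S IH] w iw //=.
have [i1 e1] := IH (fun y => w (y + 2^-1 *: b)) (fun y => iw _); have [i2 e2] := IH (fun y => w (y - 2^-1 *: b)) (fun y => iw _).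
split; last by rewrite RintegralB// e1 e2.
have := integrableB (@measurableT _ 'rV[R]_r) i1 i2.
by apply: eq_integrable => // x _ /=; rewrite -EFinB.
Qed.

(** The expansion of [half_sinh] reduces the integral to the Gaussian transforms of
    [transform_gauss], with the same shifts [al + y] as in [omega_wave]. *)
Lemma wave_weight al be u : mu.-integrable setT (EFin \o (fun x => wave B al be u x * weight x)) /\
  \int[mu]_x (wave B al be u x * weight x) = dsum Pos (fun y => transform B Pos (al + y) be u).
Proof.
have gc0 : gc != 0 by rewrite gt_eqF ?(gauss_const_gt0 Bsym Bpos).
pose w y x := gc^-1 * (wave B (al + y) be u x * pr x * gB x).
have tg y := transform_gauss Bsym Bpos Pos_uniq Pos_ge0 simple_Pos refl_Pos Pos_int (al + y) be u.
have iw y : mu.-integrable setT (EFin \o w y) by have [i _] := tg y; exact: (integrableZl _ _ i).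
have E x : wave B al be u x * weight x = dsum Pos (w^~ x).
  transitivity (dsum Pos (fun y => (wave B al be u x * (pr x * gB x / gc)) * expR (fm x y))).
    have h (a b d e k : R) : a * (b * d * e / k) = a * (d * e / k) * b by ring.
    by rewrite /weight half_sinhE dsumMl; exact: h.
  apply: eq_dsum.
  by move=> y; rewrite /w /wave bformDr expRD; ring.
have [i e] := dsum_integral Pos iw.
split; first by apply: eq_integrable i => // x _ /=; rewrite E.
under eq_Rintegral do rewrite E; rewrite e; apply: eq_dsum => y.
have [j f] := tg y; by rewrite /w RintegralZl// f mulrA mulVf// mul1r.
Qed.

Lemma weight_int : mu.-integrable setT (EFin \o weight).
Proof.
have [i _] := wave_weight 0 0 0; apply: eq_integrable i => // x _ /=.
by rewrite /wave !bform0r addr0 expR0 cos0 !mul1r.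
Qed.

Lemma dens_int : mu.-integrable setT (EFin \o dens).
Proof.
apply: (@le_integrable_rV _ _ _ (fun x => (pr rho)^-1 * weight x)).
- exact: measurable_dens.
- by move=> x; rewrite (ger0_norm (dens_ge0 x)) mulrC dens_le.
- exact: (integrableZl _ _ weight_int).
Qed.

Lemma Bunit : B \in unitmx.
Proof.
rewrite -row_free_unit -kermx_eq0; apply/negPn/negP => /rowV0Pn[v /sub_kermxP vB v0].
by have := Bpos v0; rewrite /bform vB mul0mx mxE ltxx.
Qed.

Lemma dotpE x b : dotp x b = fm x (b *m invmx B).
Proof. by rewrite /bform trmx_mul trmx_inv Bsym mulmxA mulmxK ?Bunit// mxE; apply: eq_bigr => i _; rewrite mxE. Qed.

(** The exponential moments are waves without oscillation, their exponents being the vectors dual to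
    the coordinates under the form. *)
Lemma exp_normE x : exp_norm x = \sum_i (wave B (sr i *m invmx B) 0 0 x + wave B (- (sr i *m invmx B)) 0 0 x).
Proof.
apply: eq_bigr => i _; rewrite /wave bformNr -dotpE !bform0r addr0 cos0 !mulr1.
suff -> : dotp x (sr i) = x 0 i by [].
rewrite /dotp (bigD1 i)//= mxE !eqxx mulr1 big1 ?addr0// => j ji; by rewrite mxE (negPf ji) andbF mulr0.
Qed.

Lemma exp_norm_sum (L : ('rV[R]_r -> R) -> R) : L (fun=> 0) = 0 -> (forall F G, L (fun x => F x + G x) = L F + L G) ->
  L exp_norm = \sum_i (L (wave B (sr i *m invmx B) 0 0) + L (wave B (- (sr i *m invmx B)) 0 0)).
Proof.
move=> L0 LD; have -> : exp_norm = (fun x => \sum_i (wave B (sr i *m invmx B) 0 0 x + wave B (- (sr i *m invmx B)) 0 0 x)).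
  by apply/funext => x; rewrite exp_normE.
elim: (index_enum _) => [|i l IH].
  by rewrite big_nil -[RHS]L0; congr L; apply/funext => x; rewrite big_nil.
by rewrite big_cons -IH -!LD; congr L; apply/funext => x; rewrite big_cons.
Qed.

Lemma exp_norm_weight : mu.-integrable setT (EFin \o (fun x => exp_norm x * weight x)) /\
  \int[mu]_x (exp_norm x * weight x) = \sum_i (dsum Pos (fun y => transform B Pos (sr i *m invmx B + y) 0 0) +
    dsum Pos (fun y => transform B Pos (- (sr i *m invmx B) + y) 0 0)).
Proof.
have -> : (fun x => exp_norm x * weight x) = (fun x => \sum_i (wave B (sr i *m invmx B) 0 0 x * weight x + wave B (- (sr i *m invmx B)) 0 0 x * weight x)).
  by apply/funext => x; rewrite exp_normE mulr_suml; apply: eq_bigr => i _; rewrite mulrDl.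
elim: (index_enum _) => [|i l [IH1 IH2]].
  rewrite big_nil (_ : (fun x => _) = fun=> 0); last by apply/funext => x; rewrite big_nil.
  by split; [exact: integrable0|rewrite /Rintegral integral0].
rewrite big_cons -IH2.
have [i1 e1] := wave_weight (sr i *m invmx B) 0 0; have [i2 e2] := wave_weight (- (sr i *m invmx B)) 0 0.
have i3 : mu.-integrable setT (EFin \o (fun x => wave B (sr i *m invmx B) 0 0 x * weight x + wave B (- (sr i *m invmx B)) 0 0 x * weight x)).
  have := integrableD (@measurableT _ 'rV[R]_r) i1 i2; by apply: eq_integrable => // x _ /=; rewrite -EFinD.
have -> : (fun x => \sum_(j <- i :: l) (wave B (sr j *m invmx B) 0 0 x * weight x + wave B (- (sr j *m invmx B)) 0 0 x * weight x)) =
  (fun x => (wave B (sr i *m invmx B) 0 0 x * weight x + wave B (- (sr i *m invmx B)) 0 0 x * weight x) +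
   \sum_(j <- l) (wave B (sr j *m invmx B) 0 0 x * weight x + wave B (- (sr j *m invmx B)) 0 0 x * weight x)).
  by apply/funext => x; rewrite big_cons.
split; last by rewrite RintegralD// RintegralD// e1 e2.
have := integrableD (@measurableT _ 'rV[R]_r) i3 IH1; by apply: eq_integrable => // x _ /=; rewrite -EFinD.
Qed.

(** [rad k] restricts to a box of size of order k. [chi k] vanishes outside the open chamber and
    where some simple root is at most 1/k, while [chi_abs k] agrees with it on the chamber but is
    defined symmetrically, so that the mass near the walls can be measured on the whole space. *)
Definition rad (k : R) x : R := \prod_i ramp (2 - `|x 0 i| / k).
Definition chi (k : R) x : R := \prod_b ramp (k * fm x (sr b) - 1).
Definition chi_abs (k : R) x : R := \prod_b ramp (k * `|fm x (sr b)| - 1).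
Definition kap (k : R) x : R := rad k x * chi k x.

Lemma rad01 k x : 0 <= rad k x <= 1. Proof. by apply: prod01 => i; exact: ramp01. Qed.
Lemma chi01 k x : 0 <= chi k x <= 1. Proof. by apply: prod01 => i; exact: ramp01. Qed.
Lemma chi_abs01 k x : 0 <= chi_abs k x <= 1. Proof. by apply: prod01 => i; exact: ramp01. Qed.

Lemma kap01 k x : 0 <= kap k x <= 1.
Proof.
have /andP[a0 a1] := rad01 k x; have /andP[b0 b1] := chi01 k x.
by rewrite /kap mulr_ge0//= mulr_ile1.
Qed.

Lemma norm_coord_cvg x i : (fun y : 'rV[R]_r => `|y 0 i|) @ x --> `|x 0 i|.
Proof. exact: (cvg_norm (@coord_continuous _ _ _ 0 i x)). Qed.

Lemma rad_cvg k x : rad k y @[y --> x] --> rad k x.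
Proof.
apply: (@cvg_prod_seq _ _ _ _ (nbhs x)) => i.
have c1 : (fun y : 'rV[R]_r => 2 - `|y 0 i| / k) @ x --> 2 - `|x 0 i| / k.
  exact: (cvgB (cvg_cst _) (cvgM (@norm_coord_cvg x i) (cvg_cst _))).
exact: (cvg_comp _ _ c1 (@continuous_ramp R _)).
Qed.

Lemma chi_cvg k x : chi k y @[y --> x] --> chi k x.
Proof.
apply: (@cvg_prod_seq _ _ _ _ (nbhs x)) => i.
have c1 : (fun y : 'rV[R]_r => k * fm y (sr i) - 1) @ x --> k * fm x (sr i) - 1.
  exact: (cvgB (cvgM (cvg_cst _) (@fm_cvg x (sr i))) (cvg_cst _)).
exact: (cvg_comp _ _ c1 (@continuous_ramp R _)).
Qed.

Lemma chi_abs_cvg k x : chi_abs k y @[y --> x] --> chi_abs k x.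
Proof.
apply: (@cvg_prod_seq _ _ _ _ (nbhs x)) => i.
have c1 : (fun y : 'rV[R]_r => k * `|fm y (sr i)| - 1) @ x --> k * `|fm x (sr i)| - 1.
  exact: (cvgB (cvgM (cvg_cst _) (cvg_norm (@fm_cvg x (sr i)))) (cvg_cst _)).
exact: (cvg_comp _ _ c1 (@continuous_ramp R _)).
Qed.

Lemma rad_supp k x i : 0 < k -> 2 * k <= `|x 0 i| -> rad k x = 0.
Proof.
move=> k0 xi; apply/eqP; rewrite prodf_seq_eq0; apply/hasP; exists i => /=; first exact: mem_index_enum.
by apply/eqP/ramp0; rewrite subr_le0 ler_pdivlMr.
Qed.

(** Where [rad k] differs from 1 some |x_i| exceeds k, and there [exp_norm x] is at least e^k. *)
Lemma rad_le k x : 0 < k -> 1 - rad k x <= expR (- k) * exp_norm x.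
Proof.
move=> k0; have [h|/existsNP[i /negP]] := pselect (forall i, `|x 0 i| <= k).
  rewrite /rad big1 ?subrr ?mulr_ge0 ?expR_ge0 ?exp_norm_ge0// => i _; apply: ramp1.
  have : `|x 0 i| / k <= 1 by rewrite ler_pdivrMr// mul1r.
  lra.
rewrite -ltNge => /ltW /exp_norm_ge h; apply: (@le_trans _ _ 1); first by have /andP[] := rad01 k x; lra.
by rewrite -(expR0) -(addNr k) expRD ler_wpM2l ?expR_ge0.
Qed.

Lemma chi_sdom k x : 0 < k -> ~ sdom B x -> chi k x = 0.
Proof.
move=> k0 /existsNP[b /negP]; rewrite -leNgt => xb.
apply/eqP; rewrite prodf_seq_eq0; apply/hasP; exists b => /=; first exact: mem_index_enum.
by apply/eqP/ramp0; have := mulr_ge0_le0 (ltW k0) xb; lra.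
Qed.

Lemma kap_sdom k x : 0 < k -> ~ sdom B x -> kap k x = 0.
Proof. by move=> k0 sx; rewrite /kap chi_sdom ?mulr0. Qed.

Lemma chi_absE k x : dom B x -> chi_abs k x = chi k x.
Proof. by move=> dx; apply: eq_bigr => b _; rewrite ger0_norm. Qed.

Lemma rad_to1 x : (fun n => rad n.+1%:R x) @ \oo --> (1 : R).
Proof.
rewrite -[X in _ --> X](@big1_eq R 1 *%R _ (index_enum 'I_r) xpredT).
apply: cvg_prod_seq => i; apply: cvg_near_cst; near=> n; apply: ramp1.
suff : `|x 0 i| / n.+1%:R <= 1 by move: (_ / _) => q; lra.
rewrite ler_pdivrMr// mul1r; apply: le_trans (ltW (archi_boundP (normr_ge0 _))) _.
rewrite ler_nat ltnW// ltnS; near: n; exact: nbhs_infty_ge.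
Unshelve. all: by end_near. Qed.

Lemma ramp_to1 (a : R) : 0 < a -> \forall n \near \oo, ramp (n.+1%:R * a - 1) = 1.
Proof.
move=> a0; near=> n; apply: ramp1.
suff : 2 <= n.+1%:R * a by lra.
rewrite -ler_pdivrMr//; apply: le_trans (ltW (archi_boundP _)) _; first by rewrite divr_ge0// ltW.
rewrite ler_nat ltnW// ltnS; near: n; exact: nbhs_infty_ge.
Unshelve. all: by end_near. Qed.

Lemma chi_to1 x : sdom B x -> (fun n => chi n.+1%:R x) @ \oo --> (1 : R).
Proof.
move=> sx; rewrite -[X in _ --> X](@big1_eq R 1 *%R _ (index_enum 'I_r) xpredT).
apply: cvg_prod_seq => b; apply: cvg_near_cst; have := ramp_to1 (sx b).
by apply: filterS => n ->.
Qed.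

Lemma chi_abs_to1 x : (forall i : 'I_r, fm x (sr i) != 0) -> (fun n => chi_abs n.+1%:R x) @ \oo --> (1 : R).
Proof.
move=> sx; rewrite -[X in _ --> X](@big1_eq R 1 *%R _ (index_enum 'I_r) xpredT).
apply: cvg_prod_seq => b; apply: cvg_near_cst.
have xb : 0 < `|fm x (sr b)| by rewrite normr_gt0.
by have := ramp_to1 xb; apply: filterS => n ->.
Qed.

Lemma nbhs_sdom x : sdom B x -> \forall y \near x, sdom B y.
Proof. by move=> sx; apply: (@filter_forall _ _ _ (nbhs x)) => b; exact: (cvgr_gt _ (@fm_cvg x (sr b)) _ (sx b)). Qed.

Lemma within_cvg (f : 'rV[R]_r -> R) x : {within [set y | dom B y], continuous f} -> sdom B x -> f y @[y --> x] --> f x.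
Proof.
move=> /subspace_continuousP cf sx; have := cf x (sdom_dom sx).
rewrite within_interior//; have := nbhs_sdom sx; apply: filterS => y; exact: sdom_dom.
Qed.

Lemma near_cst_cvg (F : 'rV[R]_r -> R) (l : R) (x : 'rV[R]_r) : (\forall y \near x, F y = l) -> F y @[y --> x] --> l.
Proof.
move=> h A /nbhs_singleton Al; exact: (@filterS _ (nbhs x) _ _ _ (fun y (e : F y = l) => eq_ind_r A Al e) h).
Qed.

(** Continuity of [f] is available on the open chamber; elsewhere [kap k] vanishes on a whole
    neighbourhood, where the product is constantly 0. *)
Lemma continuous_kap (f : 'rV[R]_r -> R) k : 0 < k -> (forall x, sdom B x -> f y @[y --> x] --> f x) ->
  continuous (fun x => kap k x * f x).
Proof.
move=> k0 cf x; have [sx|nsx] := pselect (sdom B x).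
  exact: (cvgM (cvgM (@rad_cvg k x) (@chi_cvg k x)) (cf x sx)).
suff : (fun y => kap k y * f y) @ x --> (0 : R) by rewrite /continuous_at/= (kap_sdom k0 nsx) mul0r.
move: nsx => /existsNP[b /negP]; rewrite -leNgt => xb.
have xk : fm x (sr b) < k^-1 by apply: le_lt_trans xb _; rewrite invr_gt0.
have h : \forall y \near x, fm y (sr b) < k^-1 by exact: (cvgr_lt _ (@fm_cvg x (sr b)) _ xk).
have H : \forall y \near x, kap k y * f y = 0.
  near=> y; have yk : fm y (sr b) < k^-1 by near: y; exact: h.
  rewrite /kap (_ : chi k y = 0) ?mulr0 ?mul0r//; apply/eqP; rewrite prodf_seq_eq0; apply/hasP; exists b => /=; first exact: mem_index_enum.
  apply/eqP/ramp0; have : k * fm y (sr b) < 1 by rewrite mulrC -ltr_pdivlMr// div1r.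
  lra.
exact: near_cst_cvg H.
Unshelve. all: by end_near. Qed.

Lemma measurable_rad k : measurable_fun [set: 'rV[R]_r] (rad k : _ -> T1).
Proof.
apply: measurable_prod => i _; apply: measurable_ramp; apply: measurable_funB => //.
by apply: measurable_funM => //; apply: measurableT_comp => //; exact: measurable_rV_coord.
Qed.

Lemma measurable_chi_abs k : measurable_fun [set: 'rV[R]_r] (chi_abs k : _ -> T1).
Proof.
apply: measurable_prod => i _; apply: measurable_ramp; apply: measurable_funB => //.
by apply: measurable_funM => //; apply: measurableT_comp => //; exact: measurable_bforml.
Qed.

(** Off the walls the cutoffs tend to 1, and on the walls [root_prod], hence [weight], is 0: the
    integrand tends to 0 everywhere and is dominated by [weight]. *)
Lemma wall_integral_cvg :
  (fun n => \int[mu]_x (rad n.+1%:R x * (1 - chi_abs n.+1%:R x) * weight x)) @ \oo --> (0 : R).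
Proof.
have -> : 0 = \int[mu]_(x in setT) (0 : R) by rewrite /Rintegral integral0.
apply: (Rdominated_cvg (G := weight)).
- move=> n; apply: measurable_funM; last exact: measurable_weight.
  by apply: measurable_funM; [exact: measurable_rad|apply: measurable_funB => //; exact: measurable_chi_abs].
- exact: measurable_cst.
- exact: weight_int.
- move=> x; have [h|/existsNP[b /negP]] := pselect (forall i : 'I_r, fm x (sr i) != 0).
    rewrite [X in _ --> X](_ : _ = 1 * (1 - 1) * weight x); last by ring.
    apply: cvgM; last exact: cvg_cst.
    apply: cvgM; first exact: rad_to1.
    by apply: cvgB; [exact: cvg_cst|exact: chi_abs_to1].
  rewrite negbK => /eqP xb; apply: cvg_near_cst; near=> n.
  suff p0 : pr x = 0 by rewrite /weight p0 mulr0 !mul0r mulr0.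
  by apply/eqP; rewrite prodf_seq_eq0; apply/hasP; exists (sr b) => //=; rewrite xb.
- move=> n x; rewrite normrM (ger0_norm (weight_ge0 x)) ler_piMl ?weight_ge0// normrM.
  have /andP[a0 a1] := rad01 n.+1%:R x; have /andP[b0 b1] := chi_abs01 n.+1%:R x.
  by rewrite mulr_ile1 ?ger0_norm ?subr_ge0//; lra.
Unshelve. all: by end_near. Qed.

Section Bounded.
Variables (f : 'rV[R]_r -> R) (M : R).
Hypothesis cf : forall x, sdom B x -> f y @[y --> x] --> f x.
Hypothesis fM : forall x, dom B x -> `|f x| <= M.

Lemma bound_ge0 : 0 <= M.
Proof. by apply: le_trans (fM (x := 0) _) => // b; rewrite bform0l. Qed.

Lemma kapf_le k x : 0 < k -> `|kap k x * f x| <= M.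
Proof.
move=> k0; have [sx|nsx] := pselect (sdom B x); last by rewrite kap_sdom// mul0r normr0 bound_ge0.
have /andP[a0 a1] := kap01 k x; rewrite normrM (ger0_norm a0).
by apply: le_trans (fM (sdom_dom sx)); rewrite ler_piMl.
Qed.

Lemma kapf_supp k x : 0 < k -> (exists i, 2 * k <= `|x 0 i|) -> kap k x * f x = 0.
Proof. by move=> k0 [i xi]; rewrite /kap (rad_supp k0 xi) !mul0r. Qed.

Lemma measurable_kapf k : 0 < k -> measurable_fun [set: 'rV[R]_r] ((fun x => kap k x * f x) : _ -> T1).
Proof.
move=> k0; apply: (@measurable_test _ _ _ (2 * k) M (continuous_kap k0 cf)).
  by move=> x; exact: kapf_supp.
by move=> x; exact: kapf_le.
Qed.

(** The cutoffs tend to 1 on the open chamber only, but [dens] is 0 on its walls, so the limit is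
    the integral over the closed chamber. *)
Lemma kapf_integral_cvg : (fun n => \int[mu]_x (kap n.+1%:R x * f x * dens x)) @ \oo -->
  \int[mu]_(x in [set y | dom B y]) (f x * dens x).
Proof.
rewrite [X in _ --> X]Rintegral_mkcond.
have pt x : (fun n => kap n.+1%:R x * f x * dens x) @ \oo --> ((fun x => f x * dens x) \_ [set y | dom B y]) x.
  rewrite patchE; case: ifPn => [/set_mem dx|/negP ndx].
    have [sx|nsx] := pselect (sdom B x); last first.
      by apply: cvg_near_cst; near=> n; rewrite !dens_wall// !mulr0.
    have -> : f x * dens x = 1 * 1 * f x * dens x by ring.
    exact: (cvgM (cvgM (cvgM (rad_to1 x) (chi_to1 sx)) (cvg_cst _)) (cvg_cst _)).
  apply: cvg_near_cst; near=> n; rewrite kap_sdom ?mul0r//.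
  by move=> sx; apply: ndx; apply/mem_set; exact: sdom_dom.
have mk n : measurable_fun [set: 'rV[R]_r] ((fun x => kap n.+1%:R x * f x * dens x) : _ -> T1).
  by apply: measurable_funM; [exact: measurable_kapf|exact: measurable_dens].
apply: (Rdominated_cvg (G := fun x => M * dens x)) => //.
(* Measurability of the limit integrand is inherited from the continuous cut-off functions. *)
- apply/measurable_EFinP; apply: (emeasurable_fun_cvg (fun n => EFin \o (fun x => kap n.+1%:R x * f x * dens x))) => [n|x _].
    by apply/measurable_EFinP; exact: mk.
  by apply: cvg_EFin; [exact: nearW|exact: pt].
- exact: (integrableZl _ _ dens_int).
- by move=> n x; rewrite normrM (ger0_norm (dens_ge0 x)) ler_wpM2r ?dens_ge0 ?kapf_le.
Unshelve. all: by end_near. Qed.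

End Bounded.

Section Sequences.
Variables (m : nat) (s : 'I_m -> seq 'rV[R]_r) (c tau : 'I_m -> R).
Hypothesis s_gt0 : forall k, (0 < size (s k))%N.
Hypothesis s_mean : forall k a, \sum_(v <- s k) fm v a = 0.
Hypothesis s_var : forall k a, \sum_(v <- s k) fm v a ^+ 2 = (size (s k))%:R * c k * fm a a.
Variables (xx : R) (eps : nat -> R) (N : nat -> 'I_m -> nat).
Hypothesis xE : xx = \sum_k tau k * c k.
Hypothesis xx_gt0 : 0 < xx.
Hypothesis eps_gt0 : forall n, 0 < eps n.
Hypothesis eps0 : eps @ \oo --> (0 : R).
Hypothesis NE : forall n k, (N n k)%:R = tau k / eps n.
Variable t : nat -> seq 'rV[R]_r.
Hypothesis t_char : forall n (f : 'rV[R]_r -> R[i]), {morph f : x y / x + y >-> x * y} -> f 0 = 1 ->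
  \sum_(v <- t n) f v = \prod_k (\sum_(v <- s k) f v) ^+ N n k.
Hypothesis t_size : forall n, size (t n) = (\prod_k size (s k) ^ N n k)%N.
Local Notation dl := (delta xx eps).
Local Notation supp n := (omega_supp Pos t n).
Local Notation u_ := (mult_u Pos t).
Local Notation om := (omega B Pos xx eps t).
Local Notation Tn n := ((size (t n))%:R : R).
Hypothesis t_refl : forall n i x, count_mem (refl B i x) (t n) = count_mem x (t n).
Hypothesis u_ge0 : forall n x, sdom B x -> 0 <= u_ n x.
Hypothesis u_dom : forall n x, sdom B x -> u_ n x != 0 -> dom B (x - rho).
Hypothesis u_mass : forall n, \sum_(x <- supp n | `[< sdom B x >]) u_ n x * pr x = pr rho * Tn n.

Let dl0 n : 0 < dl n. Proof. exact: delta_gt0. Qed.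
Let T0 n : 0 < Tn n. Proof. by rewrite ltr0n (t_gt0 s_gt0 t_size). Qed.
Let c0 n : 0 <= (dl n ^+ size Pos * Tn n)^-1.
Proof. by rewrite invr_ge0 mulr_ge0 ?exprn_ge0// ltW. Qed.

Lemma mult_u_supp n x : u_ n x != 0 -> x \in supp n.
Proof.
apply: contraR; rewrite mem_undup => xS; rewrite /mult_u /alt_sum (eq_dsum_pts (q' := fun=> 0)) ?dsum0// => z zP.
apply/eqP; rewrite pnatr_eq0 -leqn0 leqNgt -has_count has_pred1; apply: contra xS => xs.
by rewrite -[x](subrK z); exact: allpairs_f.
Qed.

(** Both [u_ n] and [half_sinh] are antisymmetric, so their product is invariant; moving the point
    into the open chamber makes both factors nonnegative. *)
Lemma mult_u_hs_ge0 n x (d : R) : 0 < d -> 0 <= u_ n x * hs (d *: x).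
Proof.
move=> d0; have [->|u0] := eqVneq (u_ n x) 0; first by rewrite mul0r.
have au : antisym B (u_ n).
  apply: (alt_sum_antisym Bpos Pos_uniq Pos_ge0 simple_Pos refl_Pos) => i z; by rewrite t_refl.
have [w sw] := to_sdom Bpos au (@mult_u_supp n) u0.
have ah : antisym B (fun y => hs (d *: y)).
  move=> i y; rewrite !half_sinhZ -(dsum_refl Bpos Pos_uniq Pos_ge0 simple_Pos refl_Pos i).
  by apply: eq_dsum => z /=; rewrite refl_formC.
have -> : u_ n x * hs (d *: x) = u_ n (act B w x) * hs (d *: act B w x).
  rewrite (antisym_act w x au) (antisym_act w x ah) mulrACA -exprMn mulrNN mulr1 expr1n mul1r //.
have sd : sdom B (d *: act B w x) by move=> i; rewrite bformZl mulr_gt0.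
by rewrite mulr_ge0 ?u_ge0// ltW// (lt_le_trans (pr_gt0 sd) (pr_le_hs sd)).
Qed.

Lemma om_lin n (a : R) F G : om n (fun x => a * F x + G x) = a * om n F + om n G.
Proof.
rewrite /omega mulrCA -mulrDr; congr (_ * _); rewrite mulr_sumr -big_split /=.
by apply: eq_bigr => x _; ring.
Qed.

Lemma om_mono n F G : (forall x, F x <= G x) -> om n F <= om n G.
Proof.
move=> FG; rewrite /omega ler_wpM2l//; apply: ler_sum => x _.
by rewrite !mulrA ler_wpM2l// mult_u_hs_ge0.
Qed.

Lemma om_wave al be u : (fun n => om n (wave B al be u)) @ \oo --> \int[mu]_x (wave B al be u x * weight x).
Proof.
have [_ ->] := wave_weight al be u.
exact: (omega_wave Bsym s_gt0 s_mean s_var xE xx_gt0 eps_gt0 eps0 NE t_char t_size).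
Qed.

Lemma om_cos b (u : R) : (fun n => om n (fun x => cos (dotp x b + u))) @ \oo --> \int[mu]_x (cos (dotp x b + u) * weight x).
Proof.
have E : (fun x => cos (dotp x b + u)) = wave B 0 (b *m invmx B) u.
  by apply/funext => x; rewrite /wave bform0r expR0 mul1r dotpE.
under eq_Rintegral do rewrite (congr1 (@^~ _) E).
by rewrite E; exact: om_wave.
Qed.

Lemma om_exp : (fun n => om n exp_norm) @ \oo --> \int[mu]_x (exp_norm x * weight x).
Proof.
have [_ ->] := exp_norm_weight.
have LD n F G : om n (fun x => F x + G x) = om n F + om n G.
  by have := om_lin n 1 F G; rewrite mul1r => <-; congr (om n _); apply/funext => x; rewrite mul1r.
have L0 n : om n (fun=> 0) = 0 by rewrite /omega big1 ?mulr0// => x _; rewrite !mulr0.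
apply: (cvg_ext (f := fun n => \sum_i (om n (wave B (sr i *m invmx B) 0 0) + om n (wave B (- (sr i *m invmx B)) 0 0)))).
  by move=> n; rewrite (exp_norm_sum (L0 n) (LD n)).
apply: cvg_sum_seq => i.
have h al := @om_wave al 0 0.
have [_ <-] := wave_weight (sr i *m invmx B) 0 0; have [_ <-] := wave_weight (- (sr i *m invmx B)) 0 0.
exact: (cvgD (h _) (h _)).
Qed.

Lemma om_test F (K M : R) : continuous F -> (forall x, (exists i, K <= `|x 0 i|) -> F x = 0) -> (forall x, `|F x| <= M) ->
  (fun n => om n F) @ \oo --> \int[mu]_x (F x * weight x).
Proof.
have [i _] := exp_norm_weight.
exact: (levy om_lin om_mono measurable_weight weight_ge0 weight_int i om_cos om_exp).
Qed.

(** The Plancherel mass of the weight [x - rho]: [u_ n x] is its multiplicity and [pr x / pr rho]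
    its dimension. *)
Definition chamber_mass n x : R := u_ n x * pr x / (pr rho * Tn n).
Definition chamber_sum n (F : 'rV[R]_r -> R) : R := \sum_(x <- supp n | `[< sdom B x >]) chamber_mass n x * F x.

Lemma chamber_mass_ge0 n x : sdom B x -> 0 <= chamber_mass n x.
Proof.
move=> sx; rewrite /chamber_mass; apply: divr_ge0; first by rewrite mulr_ge0 ?u_ge0// ltW// pr_gt0.
by rewrite mulr_ge0 ?(ltW pr_rho_gt0).
Qed.

Lemma chamber_sum1 n : chamber_sum n (fun=> 1) = 1.
Proof.
rewrite /chamber_sum /chamber_mass; under eq_bigr do rewrite mulr1.
by rewrite -mulr_suml u_mass mulfV// mulf_neq0 ?gt_eqF ?pr_rho_gt0.
Qed.

Lemma chamber_sumB n F G : chamber_sum n (fun x => F x - G x) = chamber_sum n F - chamber_sum n G.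
Proof. by rewrite /chamber_sum -sumrB; apply: eq_bigr => x _; rewrite mulrBr. Qed.

Lemma chamber_sumZ n (a : R) F : chamber_sum n (fun x => a * F x) = a * chamber_sum n F.
Proof. by rewrite /chamber_sum mulr_sumr; apply: eq_bigr => x _; rewrite mulrCA. Qed.

Lemma chamber_sum_const n (a : R) : chamber_sum n (fun=> a) = a.
Proof. by rewrite -[RHS]mulr1 -(chamber_sum1 n) -chamber_sumZ; congr chamber_sum; apply/funext => x; rewrite mulr1. Qed.

Lemma chamber_sum_mono n F G : (forall x, sdom B x -> u_ n x != 0 -> F x <= G x) -> chamber_sum n F <= chamber_sum n G.
Proof.
move=> FG; apply: ler_sum => x /asboolP sx; have [u0|u0] := eqVneq (u_ n x) 0.
  by rewrite /chamber_mass u0 !mul0r.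
by rewrite ler_wpM2l ?FG// chamber_mass_ge0.
Qed.

Lemma chamber_sum_dist n F G H : (forall x, sdom B x -> u_ n x != 0 -> `|F x - G x| <= H x) ->
  `|chamber_sum n F - chamber_sum n G| <= chamber_sum n H.
Proof.
move=> FG; rewrite -chamber_sumB ler_norml -mulN1r -chamber_sumZ.
by apply/andP; split; apply: chamber_sum_mono => x sx u0; have := FG x sx u0; rewrite ler_norml; lra.
Qed.

Lemma prZ (d : R) x : pr (d *: x) = d ^+ size Pos * pr x.
Proof.
rewrite /root_prod; under eq_bigr do rewrite bformZl.
by rewrite big_split /= big_const_seq count_predT iter_mulr_1.
Qed.

Lemma chamber_massE n x : chamber_mass n x = (dl n ^+ size Pos * Tn n)^-1 * (u_ n x * pr (dl n *: x)) / pr rho.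
Proof.
have p0 : pr rho != 0 by rewrite gt_eqF ?pr_rho_gt0.
have t0 : Tn n != 0 by rewrite gt_eqF ?T0.
have d0 : dl n ^+ size Pos != 0 by rewrite expf_neq0 ?gt_eqF.
rewrite /chamber_mass prZ; move: (dl n ^+ _) d0 => D D0; field.
by rewrite p0 t0 D0.
Qed.

Lemma sdomZ (d : R) x : 0 < d -> sdom B (d *: x) <-> sdom B x.
Proof.
by move=> d0; split=> sx i; have := sx i; rewrite bformZl pmulr_rgt0.
Qed.

(** On the chamber p <= [half_sinh], and the terms of [omega] outside the chamber are
    nonnegative. *)
Lemma chamber_sum_le n F : (forall x, 0 <= F x) -> chamber_sum n (fun x => F (dl n *: x)) <= om n F / pr rho.
Proof.
move=> F0; rewrite /omega /chamber_sum mulr_sumr mulr_suml big_mkcond /=; apply: ler_sum => x _.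
have h : 0 <= (dl n ^+ size Pos * Tn n)^-1 * (u_ n x * (hs (dl n *: x) * F (dl n *: x))) / pr rho.
  by rewrite mulr_ge0 ?invr_ge0 ?(ltW pr_rho_gt0)// mulr_ge0// mulrA mulr_ge0// mult_u_hs_ge0.
case: asboolP => // sx; rewrite chamber_massE mulrAC ler_wpM2r ?invr_ge0 ?(ltW pr_rho_gt0)//.
rewrite -mulrA ler_wpM2l// -mulrA ler_wpM2l ?u_ge0// ler_wpM2r// pr_le_hs//; exact/sdomZ.
Qed.

(** For functions supported in the open chamber the passage from p to [half_sinh] is exact, since
    [half_sinh] is nonzero there. *)
Lemma chamber_sum_eq n F : (forall x, ~ sdom B x -> F x = 0) ->
  chamber_sum n (fun x => F (dl n *: x)) = om n (fun x => F x * (pr x / hs x)) / pr rho.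
Proof.
move=> F0; rewrite /omega /chamber_sum mulr_sumr mulr_suml big_mkcond /=; apply: eq_bigr => x _.
case: asboolP => sx; last by rewrite F0 ?mul0r ?mulr0 ?mul0r// => /(sdomZ _ (dl0 n)).
have sd : sdom B (dl n *: x) by apply/sdomZ.
have h0 : hs (dl n *: x) != 0 by rewrite gt_eqF// (lt_le_trans (pr_gt0 sd) (pr_le_hs sd)).
rewrite chamber_massE (_ : hs (dl n *: x) * _ = pr (dl n *: x) * F (dl n *: x)); first by ring.
by rewrite mulrCA [hs _ * _]mulrC divfK// mulrC.
Qed.

(** The product of the cutoff, [f] and p / [half_sinh] is a bounded continuous test function of
    bounded support, to which the convergence of [omega] applies. *)
Lemma chamber_kap (f : 'rV[R]_r -> R) (k M : R) : 0 < k -> (forall x, sdom B x -> f y @[y --> x] --> f x) ->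
  (forall x, dom B x -> `|f x| <= M) ->
  (fun n => chamber_sum n (fun x => kap k (dl n *: x) * f (dl n *: x))) @ \oo --> \int[mu]_x (kap k x * f x * dens x).
Proof.
move=> k0 cf fM; pose F x := kap k x * (f x * (pr x / hs x)).
have hs0 x : sdom B x -> hs x != 0 by move=> sx; rewrite gt_eqF// (lt_le_trans (pr_gt0 sx) (pr_le_hs sx)).
have M0 := bound_ge0 fM.
have cF : continuous F.
  apply: continuous_kap => // x sx; exact: (cvgM (cf x sx) (cvgM (@pr_cvg x) (cvgV (hs0 x sx) (@hs_cvg x)))).
have FM x : `|F x| <= M.
  have [sx|nsx] := pselect (sdom B x); last by rewrite /F kap_sdom// mul0r normr0.
  have /andP[a0 a1] := kap01 k x; rewrite /F mulrA normrM.
  have p1 : `|pr x / hs x| <= 1.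
    rewrite ger0_norm; first by rewrite ler_pdivrMr ?mul1r ?pr_le_hs// (lt_le_trans (pr_gt0 sx) (pr_le_hs sx)).
    by rewrite ltW// divr_gt0 ?pr_gt0// (lt_le_trans (pr_gt0 sx) (pr_le_hs sx)).
  apply: le_trans (kapf_le fM x k0); by rewrite ler_piMr.
have FK x : (exists i, 2 * k <= `|x 0 i|) -> F x = 0 by move=> [i xi]; rewrite /F /kap (rad_supp k0 xi) !mul0r.
have h := om_test cF FK FM.
have -> : \int[mu]_x (kap k x * f x * dens x) = \int[mu]_x (F x * weight x) / pr rho.
  have mF := measurable_test cF FK FM.
  have iF := integrable_bounded measurable_weight weight_ge0 weight_int mF FM.
  rewrite mulrC -RintegralZl//; apply: eq_Rintegral => x _.
  have [sx|nsx] := pselect (sdom B x); last by rewrite /F kap_sdom// !mul0r mulr0.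
  rewrite /F /dens /weight; field.
  by rewrite hs0// !gt_eqF ?pr_rho_gt0 ?(gauss_const_gt0 Bsym Bpos).
apply: (cvg_ext (f := fun n => om n F / pr rho)); last exact: (cvgM h (cvg_cst _)).
move=> n; rewrite (@chamber_sum_eq n (fun x => kap k x * f x)); last by move=> x nsx; rewrite kap_sdom// mul0r.
by congr (om n _ / _); apply/funext => x; rewrite /F mulrA.
Qed.

Local Notation domset := [set y | dom B y].
Local Notation Ik k := (\int[mu]_x (kap k x * 1 * dens x)).

Lemma chamber_kap1 k : 0 < k -> (fun n => chamber_sum n (fun x => kap k (dl n *: x))) @ \oo --> Ik k.
Proof.
move=> k0; have h : forall x, dom B x -> `|1 : R| <= 1 by move=> x _; rewrite normr1.
apply: (cvg_ext (f := fun n => chamber_sum n (fun x => kap k (dl n *: x) * 1))); last exact: (chamber_kap k0 (fun x _ => @cst_cvg 1 x) h).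
by move=> n; congr chamber_sum; apply/funext => x; rewrite mulr1.
Qed.

Lemma Ik_le1 k : 0 < k -> Ik k <= 1.
Proof.
move=> k0; apply: (cvgr_to_le (chamber_kap1 k0)); apply: nearW => n.
rewrite -(chamber_sum1 n); apply: chamber_sum_mono => x _ _; by have /andP[] := kap01 k (dl n *: x).
Qed.

Lemma Ik_cvg : (fun n => Ik n.+1%:R) @ \oo --> \int[mu]_(x in domset) (1 * dens x).
Proof. by apply: (@kapf_integral_cvg (fun=> 1) 1) => x _; [exact: cst_cvg|rewrite normr1]. Qed.

(** On the chamber 1 - [kap] is at most the tail term plus [rad] times 1 - [chi_abs]. Both terms
    make sense on the whole space, so the mass cut away is bounded by limits of [omega]. *)
Lemma Ik_ge k : 0 < k -> 1 - Ik k <= (expR (- k) * (\int[mu]_x (exp_norm x * weight x)) +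
  \int[mu]_x (rad k x * (1 - chi_abs k x) * weight x)) / pr rho.
Proof.
move=> k0; pose F x := expR (- k) * exp_norm x + rad k x * (1 - chi_abs k x).
have G0 x : 0 <= rad k x * (1 - chi_abs k x).
  have /andP[a0 _] := rad01 k x; have /andP[_ b1] := chi_abs01 k x; by rewrite mulr_ge0// subr_ge0.
have F0 x : 0 <= F x by rewrite addr_ge0// mulr_ge0 ?expR_ge0// exp_norm_ge0.
have GK x : (exists i, 2 * k <= `|x 0 i|) -> rad k x * (1 - chi_abs k x) = 0.
  by move=> [i xi]; rewrite (rad_supp k0 xi) mul0r.
have GM x : `|rad k x * (1 - chi_abs k x)| <= 1.
  rewrite (ger0_norm (G0 x)); have /andP[a0 a1] := rad01 k x; have /andP[b0 b1] := chi_abs01 k x.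
  by rewrite mulr_ile1 ?subr_ge0//; lra.
have cG : continuous (fun x => rad k x * (1 - chi_abs k x)).
  by move=> x; exact: (cvgM (@rad_cvg k x) (cvgB (cvg_cst _) (@chi_abs_cvg k x))).
have hG := om_test cG GK GM.
have hF : (fun n => om n F / pr rho) @ \oo --> (expR (- k) * (\int[mu]_x (exp_norm x * weight x)) +
  \int[mu]_x (rad k x * (1 - chi_abs k x) * weight x)) / pr rho.
  apply: (cvg_ext (f := fun n => (expR (- k) * om n exp_norm + om n (fun x => rad k x * (1 - chi_abs k x))) / pr rho)).
    by move=> n; rewrite -om_lin.
  exact: (cvgM (cvgD (cvgM (cvg_cst _) om_exp) hG) (cvg_cst _)).
apply: (ler_cvg_to (cvgB (cvg_cst (1 : R)) (chamber_kap1 k0)) hF); apply: nearW => n.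
apply: le_trans (chamber_sum_le n F0).
have -> : ((fun=> 1) - (fun n => chamber_sum n (fun x => kap k (dl n *: x)))) n = chamber_sum n (fun=> 1) - chamber_sum n (fun x => kap k (dl n *: x)).
  by rewrite chamber_sum1.
rewrite -chamber_sumB; apply: chamber_sum_mono => x sx _.
have sd : sdom B (dl n *: x) by apply/sdomZ.
have := rad_le (dl n *: x) k0; rewrite /F /kap chi_absE; [lra|exact: sdom_dom].
Qed.

(** The masses sum to 1 for each n, so the integral of the cut-off density is at most 1, while
    [Ik_ge] bounds the loss from above by a quantity that tends to 0 as the cutoff is removed. *)
Lemma chamber_dens1 : \int[mu]_(x in domset) dens x = 1.
Proof.
have -> : \int[mu]_(x in domset) dens x = \int[mu]_(x in domset) (1 * dens x) by apply: eq_Rintegral => x _; rewrite mul1r.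
apply/eqP; rewrite eq_le; apply/andP; split.
  by apply: (cvgr_to_le Ik_cvg); apply: nearW => n; exact: Ik_le1.
have e0 : (fun n => expR (- n.+1%:R)) @ \oo --> (0 : R).
  apply/cvgrPdist_le => e ee; near=> n; rewrite sub0r normrN ger0_norm ?expR_ge0// expRN.
  rewrite invf_ple ?posrE ?expR_gt0//; apply: le_trans (expR_ge1Dx _).
  apply: le_trans (ltW (archi_boundP _)) _; first by rewrite invr_ge0 ltW.
  apply: (@le_trans _ _ n%:R); first by rewrite ler_nat; near: n; exact: nbhs_infty_ge.
  by rewrite -natr1; lra.
have h : (fun n => (expR (- n.+1%:R) * (\int[mu]_x (exp_norm x * weight x)) +
    \int[mu]_x (rad n.+1%:R x * (1 - chi_abs n.+1%:R x) * weight x)) / pr rho) @ \oo --> (0 * (\int[mu]_x (exp_norm x * weight x)) + 0) / pr rho.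
  exact: (cvgM (cvgD (cvgM e0 (cvg_cst _)) wall_integral_cvg) (cvg_cst _)).
have h' : (fun n => 1 - Ik n.+1%:R) @ \oo --> 1 - \int[mu]_(x in domset) (1 * dens x) by exact: (cvgB (cvg_cst _) Ik_cvg).
have H : \forall n \near \oo, 1 - Ik n.+1%:R <= (expR (- n.+1%:R) * (\int[mu]_x (exp_norm x * weight x)) +
    \int[mu]_x (rad n.+1%:R x * (1 - chi_abs n.+1%:R x) * weight x)) / pr rho.
  by apply: nearW => n; exact: Ik_ge.
have : 1 - \int[mu]_(x in domset) (1 * dens x) <= (0 * (\int[mu]_x (exp_norm x * weight x)) + 0) / pr rho by exact: (ler_cvg_to h' h H).
by rewrite mul0r addr0 mul0r subr_le0.
Unshelve. all: by end_near. Qed.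

(** The shift by [rho] becomes [dl n] times [rho] after rescaling, which uniform continuity
    absorbs. *)
Lemma shift_small (F : 'rV[R]_r -> R) (e : R) : unif_cont F -> 0 < e ->
  \forall n \near \oo, forall x, `|F (dl n *: (x - rho)) - F (dl n *: x)| <= e.
Proof.
move=> uF e0; have [d d0 dF] := uF e e0.
pose K := \sum_i `|rho 0 i| + 1; have K0 : 0 < K by rewrite ltr_wpDl// sumr_ge0.
have /cvgrPdist_le/(_ (d / K) (divr_gt0 d0 K0)) := delta_cvg xx eps0.
apply: filterS => n; rewrite sub0r normrN (gtr0_norm (dl0 n)) ler_pdivlMr// => nd x; apply: dF => i.
have rK : `|rho 0 i| <= K by rewrite /K (bigD1 i)//= -addrA lerDl addr_ge0// sumr_ge0.
have -> : (dl n *: (x - rho)) 0 i - (dl n *: x) 0 i = - (dl n * rho 0 i) by move: (half_sum _) => z; rewrite !mxE; ring.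
by apply: le_trans nd; rewrite normrN normrM (gtr0_norm (dl0 n)) ler_wpM2l// ltW.
Qed.

(** The cut-off function converges by [chamber_kap]. Since the limit has total mass 1, the mass the
    cutoff discards is small uniformly for large n, and there the bound on [f] suffices. *)
Lemma chamber_limit (f : 'rV[R]_r -> R) (M : R) : {within domset, continuous f} -> (forall x, dom B x -> `|f x| <= M) ->
  (fun n => chamber_sum n (fun x => f (dl n *: (x - rho)))) @ \oo --> \int[mu]_(x in domset) (f x * dens x).
Proof.
move=> /within_cvg cf fM; have M0 := bound_ge0 fM.
(* The errors below add up to 3 (M + 1) q, which is 3 e / 16. *)
apply/cvgrPdist_le => e e0; pose q := e / 16 / (M + 1).
have q0 : 0 < q by rewrite !divr_gt0// ltr_wpDl.
have qM : (M + 1) * q = e / 16 by rewrite /q mulrC divfK// gt_eqF// ltr_wpDl.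
have c1 x : sdom B x -> (fun=> 1 : R) y @[y --> x] --> (1 : R) by move=> _; exact: cst_cvg.
have I1 : \int[mu]_(x in domset) (1 * dens x) = 1 by rewrite -[RHS]chamber_dens1; apply: eq_Rintegral => x _; rewrite mul1r.
have [k k0 [h1 h2]] : exists2 k : R, 0 < k & 1 - Ik k <= q /\ `|\int[mu]_(x in domset) (f x * dens x) - \int[mu]_x (kap k x * f x * dens x)| <= q.
  have /cvgrPdist_le/(_ q q0) n1 := Ik_cvg; have /cvgrPdist_le/(_ q q0) n2 := kapf_integral_cvg cf fM.
  have [n _ /(_ n (leqnn n))] := filterI n1 n2; rewrite I1 => -[/ler_normlP[_ a1] a2].
  by exists n.+1%:R.
have kc (g : 'rV[R]_r -> R) (M' : R) : (forall x, sdom B x -> g y @[y --> x] --> g x) -> unif_cont (fun x => kap k x * g x).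
  move=> cg; apply: (@continuous_unif_cont _ _ _ (2 * k) (continuous_kap k0 cg)).
  by move=> x [i xi]; rewrite /kap (rad_supp k0 xi) !mul0r.
have u1 := shift_small (kc _ 1 c1) q0; have u2 := shift_small (kc f M cf) q0.
have /cvgrPdist_le/(_ q q0) v1 := chamber_kap1 k0; have /cvgrPdist_le/(_ q q0) v2 := chamber_kap k0 cf fM.
near=> n.
have w1 : forall x, `|kap k (dl n *: (x - rho)) * 1 - kap k (dl n *: x) * 1| <= q by near: n; exact: u1.
have w2 : forall x, `|kap k (dl n *: (x - rho)) * f (dl n *: (x - rho)) - kap k (dl n *: x) * f (dl n *: x)| <= q.
  by near: n; exact: u2.
have w3 : `|Ik k - chamber_sum n (fun x => kap k (dl n *: x))| <= q by near: n; exact: v1.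
have w4 : `|\int[mu]_x (kap k x * f x * dens x) - chamber_sum n (fun x => kap k (dl n *: x) * f (dl n *: x))| <= q.
  by near: n; exact: v2.
pose S1 := chamber_sum n (fun x => kap k (dl n *: x)).
pose S2 := chamber_sum n (fun x => kap k (dl n *: (x - rho))).
pose A1 := chamber_sum n (fun x => kap k (dl n *: x) * f (dl n *: x)).
pose A2 := chamber_sum n (fun x => kap k (dl n *: (x - rho)) * f (dl n *: (x - rho))).
have d1 : `|S2 - S1| <= q.
  rewrite -(chamber_sum_const n q); apply: chamber_sum_dist => x _ _; by have := w1 x; rewrite !mulr1.
have d2 : `|A2 - A1| <= q by rewrite -(chamber_sum_const n q); apply: chamber_sum_dist => x _ _; exact: w2.
(* Here [f] is evaluated at a rescaled dominant weight, inside the closed chamber where it is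
   bounded by [M]. *)
have d3 : `|chamber_sum n (fun x => f (dl n *: (x - rho))) - A2| <= M * (1 - S2).
  have -> : 1 - S2 = chamber_sum n (fun x => 1 - kap k (dl n *: (x - rho))) by rewrite chamber_sumB chamber_sum1.
  rewrite -chamber_sumZ; apply: chamber_sum_dist => x sx u0.
  have dx : dom B (dl n *: (x - rho)) by move=> i; rewrite bformZl mulr_ge0 ?(ltW (dl0 n))//; exact: (u_dom sx u0).
  have /andP[a0 a1] := kap01 k (dl n *: (x - rho)).
  have -> : f (dl n *: (x - rho)) - kap k (dl n *: (x - rho)) * f (dl n *: (x - rho)) =
    (1 - kap k (dl n *: (x - rho))) * f (dl n *: (x - rho)) by ring.
  by rewrite normrM ger0_norm ?subr_ge0// mulrC ler_wpM2r ?subr_ge0// fM.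
have d4 : 1 - S2 <= 3 * q by move: d1 w3; rewrite -/S1 !ler_norml; lra.
have d5 : M * (1 - S2) <= M * (3 * q) by rewrite ler_wpM2l.
move: w4 d2 d3 h2; rewrite -/A1 !ler_norml; nra.
Unshelve. all: by end_near. Qed.

End Sequences.

End ChamberLimit.

(** * Roots of a simple Lie algebra *)

Section LieBasics.
Context {F : fieldType} {g : lieAlgebraType F}.
Implicit Types x y z : g.

HB.instance Definition _ x := GRing.isSemilinear.Build F g g _ (lie x)
  (GRing.semilinear_linear (lie_linearr x)).

Lemma lieDl x y z : lie (x + y) z = lie x z + lie y z.
Proof. by have := lie_linearl z 1 x y; rewrite !scale1r. Qed.

Lemma lie0l z : lie 0 z = 0.
Proof. by apply: (addrI (lie 0 z)); rewrite -lieDl !addr0. Qed.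

Lemma lieZl a x z : lie (a *: x) z = a *: lie x z.
Proof. by have := lie_linearl z a x 0; rewrite lie0l !addr0. Qed.

Lemma lie_suml I (s : seq I) (P : pred I) (f : I -> g) z :
  lie (\sum_(i <- s | P i) f i) z = \sum_(i <- s | P i) lie (f i) z.
Proof.
by elim/big_rec2: _ => [|i y1 y2 _ <-]; rewrite ?lie0l// lieDl.
Qed.

Lemma lieC x y : lie x y = - lie y x.
Proof.
apply/eqP; rewrite -addr_eq0; apply/eqP.
have := liexx (x + y); rewrite lieDl !linearD /= !liexx add0r addr0.
by rewrite addrC.
Qed.

Lemma lieJ x y z : lie x (lie y z) = lie (lie x y) z + lie y (lie x z).
Proof.
have := lie_jacobi x y z; rewrite (lieC (lie x y)) (lieC x z) linearN /=.
by move/eqP; rewrite -addrA addr_eq0 opprD => /eqP ->; rewrite addrC.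
Qed.

Lemma adE x y : ad x y = lie x y.
Proof. by rewrite lfunE. Qed.

(** A trace does not depend on the basis, so the Killing form may be computed in a basis of root
    vectors. *)
Lemma killing_basis n (e : n.-tuple g) (x y : g) : basis_of fullv e ->
  killing x y = \sum_i coord e i (lie x (lie y (tnth e i))).
Proof.
move=> be; have en : n = \dim {:g} by rewrite -(size_basis be).
subst n; set b := vbasis {:g}; have bb : basis_of fullv b by exact: vbasisP.
rewrite /killing -/b; set phi := (ad x \o ad y)%VF.
have -> : passmx.mxof b b phi =
    passmx.mxof b e \1 *m passmx.mxof e e phi *m passmx.mxof e b \1.
  by rewrite -!passmx.mxof_comp// comp_lfun1l comp_lfun1r.
rewrite mxtrace_mulC mulmxA -passmx.mxof_comp// comp_lfun1r passmx.mxof1 ?(basis_free be)//.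
rewrite mul1mx; apply: eq_bigr => i _; rewrite !mxE /= comp_lfunE !adE.
by rewrite passmx.vecof_delta -tnth_nth.
Qed.

Lemma coord_tnth n (e : n.-tuple g) (i j : 'I_n) : basis_of fullv e ->
  coord e i (tnth e j) = (i == j)%:R.
Proof. by move=> be; rewrite (tnth_nth 0) coord_free ?(basis_free be)// eq_sym. Qed.

Lemma coord_sum_tnth n (e : n.-tuple g) (x : g) : basis_of fullv e ->
  x = \sum_i coord e i x *: tnth e i.
Proof.
move=> be; rewrite {1}(coord_basis be (memvf x)).
by apply: eq_bigr => i _; rewrite (tnth_nth 0).
Qed.

Lemma killingC x y : killing x y = killing y x.
Proof. by rewrite /killing !(passmx.mxof_comp _ _ (vbasisP _)) mxtrace_mulC. Qed.

Lemma killing_is_linear x : linear (killing x : g -> F^o).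
Proof.
move=> a y z; rewrite !(killing_basis _ _ (vbasisP _)) scaler_sumr -big_split /=.
by apply: eq_bigr => i _; rewrite lieDl lieZl !linearP.
Qed.

HB.instance Definition _ x := GRing.isSemilinear.Build F g F^o _ (killing x)
  (GRing.semilinear_linear (killing_is_linear x)).

Lemma killingDl x y z : killing (x + y) z = killing x z + killing y z.
Proof. by rewrite ![killing _ z]killingC linearD. Qed.

Lemma killingZl a x z : killing (a *: x) z = a * killing x z.
Proof. by rewrite ![killing _ z]killingC linearZ. Qed.

Lemma killing_suml I (s : seq I) (P : pred I) (f : I -> g) z :
  killing (\sum_(i <- s | P i) f i) z = \sum_(i <- s | P i) killing (f i) z.
Proof. by rewrite killingC linear_sum; apply: eq_bigr => i _; rewrite killingC. Qed.

Lemma killingZr a x y : killing x (a *: y) = a * killing x y.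
Proof. by rewrite killingC killingZl killingC. Qed.

Lemma killing_sumr I (s : seq I) (P : pred I) (f : I -> g) z :
  killing z (\sum_(i <- s | P i) f i) = \sum_(i <- s | P i) killing z (f i).
Proof. exact: linear_sum. Qed.

Lemma killing_inv x y z : killing (lie x y) z = killing x (lie y z).
Proof.
rewrite /killing; set b := vbasis {:g}; set M := passmx.mxof b b.
have MC p q : M (p \o q)%VF = M q *m M p by rewrite /M (passmx.mxof_comp _ _ (vbasisP _)).
have adl u v : M (ad (lie u v)) = M (ad v) *m M (ad u) - M (ad u) *m M (ad v).
  have -> : ad (lie u v) = (ad u \o ad v)%VF - (ad v \o ad u)%VF.
    by apply/lfunP => w; rewrite add_lfunE opp_lfunE !comp_lfunE !adE lieJ addrK.
  have := passmx.mxof_linear b b (-1) (ad v \o ad u)%VF (ad u \o ad v)%VF.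
  by rewrite -/M !scaleN1r !MC addrC => <-; rewrite addrC.
rewrite !MC !adl mulmxBr mulmxBl !linearB /=.
by congr (_ - _); rewrite mulmxA // mxtrace_mulC mulmxA.
Qed.

End LieBasics.

(** * Root vectors, real coordinates and the Killing form *)

Section RootBasis.
Context {F : fieldType} {g : lieAlgebraType F} {h : {vspace g}}.

Definition weight_functional n (e : n.-tuple g) (i : 'I_n) (H : subvs_of h) : F^o :=
  coord e i (lie (vsval H) e`_i).

Fact weight_functional_linear n (e : n.-tuple g) i : linear (weight_functional e i).
Proof. by move=> a x y; rewrite /weight_functional linearP lieDl lieZl linearP. Qed.

HB.instance Definition _ n (e : n.-tuple g) i :=
  GRing.isSemilinear.Build F (subvs_of h) F^o _ (weight_functional e i)
  (GRing.semilinear_linear (weight_functional_linear e i)).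

(** The operators ad x for x in a basis of h commute and are diagonalizable, hence simultaneously
    diagonalizable; linearity extends the eigenvectors to all of h. *)
Lemma root_basis : cartan_subalgebra h ->
  exists (e : (\dim {:g}).-tuple g) (L : 'I_(\dim {:g}) -> cartan_dual h),
    basis_of fullv e /\ forall i, in_root_space (L i) (tnth e i).
Proof.
move=> [habel _ hdiag]; set b := vbasis {:g}; have bb : basis_of fullv b := vbasisP _.
pose M (x : g) := passmx.mxof b b (ad x).
have [P Pu /allP PD] : codiagonalizable [seq M x | x <- vbasis h].
  apply/codiagonalizableP; split.
    move=> _ _ /mapP[x xh ->] /mapP[y yh ->]; rewrite /comm_mx /M -!passmx.mxof_comp//.
    congr passmx.mxof; apply/lfunP => z; rewrite !comp_lfunE !adE lieJ.
    by rewrite (habel y x) ?lie0l ?add0r// vbasis_mem.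
  move=> _ /mapP[x /vbasis_mem/hdiag[e be ec] ->].
  have Pu : passmx.mxof e b \1 \in unitmx.
    by have /mulmx1_unit[] : passmx.mxof e b \1 *m passmx.mxof b e \1 = 1%:M
      by rewrite -passmx.mxof_comp// comp_lfun1l passmx.mxof1// (basis_free be).
  exists (passmx.mxof e b \1) => //.
  apply/similar_diagPex; exists (\row_i coord e i (lie x e`_i)).
  apply/(similarP Pu); rewrite -passmx.mxof_comp// comp_lfun1r.
  rewrite -[RHS]mulmx1 -[ad x]comp_lfun1l (passmx.mxof_comp _ _ be) mulmx1; congr (_ *m _).
  apply/matrixP => i j; rewrite !mxE /= adE passmx.vecof_delta.
  have [c ec'] := ec i; rewrite (tnth_nth 0) in ec'.
  by rewrite ec' !linearZ /= !coord_free ?(basis_free be)//; case: eqVneq => [->|] //=;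
    rewrite ?eqxx ?mulr1n// mulr0 mulr0n.
pose e := [tuple passmx.vecof b (row i P) | i < \dim {:g}].
have eE (i : 'I_(\dim {:g})) : e`_i = passmx.vecof b (row i P).
  by rewrite -(tnth_nth 0) tnth_mktuple.
have be : basis_of fullv e.
  rewrite basisEfree subvf size_tuple leqnn !andbT; apply/freeP => k k0 i.
  suff : (\row_i k i) = 0 by move/rowP/(_ i); rewrite !mxE.
  suff : (\row_i k i) *m P = 0 by move=> /(congr1 (mulmx^~ (invmx P))); rewrite mulmxK// mul0mx.
  apply/eqP; rewrite -(passmx.vecof_eq0 bb); apply/eqP; rewrite -k0.
  rewrite mulmx_sum_row linear_sum; apply: eq_bigr => j _.
  by rewrite linearZ /= eE mxE.
have eig x : x \in h -> forall i : 'I_(\dim {:g}), exists c, lie x e`_i = c *: e`_i.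
  move=> xh i.
  have eigb y : y \in (vbasis h : seq g) -> exists c, lie y e`_i = c *: e`_i.
    move=> yh; have /PD : M y \in [seq M x | x <- vbasis h] by apply/mapP; exists y.
    move=> /= /similar_diagPex[D /(similarP Pu) PMD]; exists (D 0 i).
    rewrite -adE eE (hom_vecof b bb) -/(M y) -row_mul PMD row_mul -linearZ /=.
    by congr passmx.vecof; rewrite row_diag_mx -scalemxAl -rowE.
  rewrite (coord_vbasis xh) lie_suml.
  elim/big_ind: _ => [|u v [c cE] [c' c'E]|j _]; first by exists 0; rewrite scale0r.
    by exists (c + c'); rewrite cE c'E scalerDl.
  have [|c cE] := eigb ((vbasis h)`_j); first by rewrite mem_nth// size_tuple.
  by exists (coord (vbasis h) j x * c); rewrite lieZl cE scalerA.
exists e, (fun i => linfun (weight_functional e i)); split => // i H.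
rewrite lfunE /= (tnth_nth 0); have [c cE] := eig _ (subvsP H) i; rewrite /weight_functional cE.
by rewrite linearZ /= coord_free ?(basis_free be)// eqxx mulr1.
Qed.

End RootBasis.

Definition nat_vec {R : realFieldType} {r} (a : 'rV[R]_r) : Prop := forall b, exists k : nat, a 0 b = k%:R.

Section RootComb.
Context {R : realFieldType} {F : fieldType} (iota : {rmorphism R -> F})
  {g : lieAlgebraType F} {h : {vspace g}} {r : nat}.
Variable alpha : r.-tuple (cartan_dual h).
Implicit Type a : 'rV[R]_r.

(** The map [root_comb] over an arbitrary embedding [iota] of an ordered field, so that weights are
    row vectors over a field where sums of squares are positive. *)
Definition rcomb a : cartan_dual h := \sum_b iota (a 0 b) *: tnth alpha b.

Lemma rcombD a (b : 'rV[R]_r) : rcomb (a + b) = rcomb a + rcomb b.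
Proof.
rewrite /rcomb -big_split; apply: eq_bigr => i _.
by rewrite mxE rmorphD scalerDl.
Qed.

Lemma rcombZ (k : R) a : rcomb (k *: a) = iota k *: rcomb a.
Proof.
rewrite /rcomb scaler_sumr; apply: eq_bigr => i _.
by rewrite mxE rmorphM scalerA.
Qed.

Lemma rcomb0 : rcomb 0 = 0.
Proof. by rewrite -(scale0r (0 : 'rV[R]_r)) rcombZ rmorph0 scale0r. Qed.

Lemma rcombN a : rcomb (- a) = - rcomb a.
Proof. by rewrite -scaleN1r rcombZ rmorphN rmorph1 scaleN1r. Qed.

Lemma rcomb_sum I (s : seq I) (P : pred I) (f : I -> 'rV[R]_r) :
  rcomb (\sum_(i <- s | P i) f i) = \sum_(i <- s | P i) rcomb (f i).
Proof.
by elim/big_rec2: _ => [|i y1 y2 _ <-]; rewrite ?rcomb0// rcombD.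
Qed.

Lemma rcomb_delta (b : 'I_r) : rcomb (delta_mx 0 b) = tnth alpha b.
Proof.
rewrite /rcomb (bigD1 b) //= [X in _ + X]big1 => [|c /negPf cb].
  by rewrite addr0 mxE !eqxx rmorph1 scale1r.
by rewrite mxE eqxx cb rmorph0 scale0r.
Qed.

Hypothesis alpha_simple : simple_roots alpha.

Lemma rcomb_free (c : 'I_r -> F) : \sum_b c b *: tnth alpha b = 0 -> forall b, c b = 0.
Proof.
move=> c0; have [/basis_free/freeP fa _ _] := alpha_simple; apply: fa; rewrite -[RHS]c0.
by apply: eq_bigr => b _; rewrite (tnth_nth 0).
Qed.

Lemma rcomb_inj : injective (rcomb).
Proof.
move=> a b /eqP; rewrite -subr_eq0 -rcombN -rcombD => /eqP /rcomb_free ab0.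
apply/eqP; rewrite -subr_eq0; apply/eqP/rowP => i; move: (ab0 i); rewrite !mxE.
by move/eqP; rewrite fmorph_eq0 => /eqP.
Qed.

Lemma root_coord (lam : cartan_dual h) : lam = 0 \/ is_root lam ->
  exists a, lam = rcomb a /\ (nat_vec a \/ nat_vec (- a)).
Proof.
case=> [->|]; first by exists 0; rewrite rcomb0; split => //; left => i; exists 0%N; rewrite mxE.
have [_ _ ar] := alpha_simple => /ar[k kE].
pose a : 'rV[R]_r := \row_i (k i)%:R.
have aE : rcomb a = \sum_b tnth alpha b *+ k b.
  by apply: eq_bigr => b _; rewrite mxE rmorph_nat scaler_nat.
have na : nat_vec a by move=> b; exists (k b); rewrite mxE.
case: kE => ->; [exists a|exists (- a)].
  by split; [|left].
by rewrite rcombN aE opprK; split; [|right].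
Qed.

End RootComb.

Section Killing.
Context {R : realFieldType} {F : fieldType} {iota : {rmorphism R -> F}}
  {g : lieAlgebraType F} {h : {vspace g}} {r : nat}.
Variable alpha : r.-tuple (cartan_dual h).
Hypothesis g_simple : simple_lie_algebra g.
Hypothesis h_cartan : cartan_subalgebra h.
Hypothesis alpha_simple : simple_roots alpha.
Local Notation n := (\dim {:g}).
Local Notation rc := (rcomb iota alpha).

Lemma real_root_basis : exists (e : n.-tuple g) (wt : 'I_n -> 'rV[R]_r),
  [/\ basis_of fullv e, forall i, in_root_space (rc (wt i)) (tnth e i)
    & forall i, nat_vec (wt i) \/ nat_vec (- wt i)].
Proof.
have [e [L [be eL]]] := root_basis h_cartan.
have LP i : exists a, L i = rc a /\ (nat_vec a \/ nat_vec (- a)).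
  apply: root_coord => //; have [->|L0] := eqVneq (L i) 0; first by left.
  right; split => //; exists (tnth e i); last exact: eL.
  by apply/eqP => /(congr1 (coord e i)); rewrite coord_tnth// linear0 eqxx => /eqP; rewrite oner_eq0.
have [wt wtP] := choice LP; exists e, wt; split => // i; last by case: (wtP i).
by have [<- _] := wtP i.
Qed.

Variables (e : n.-tuple g) (wt : 'I_n -> 'rV[R]_r).
Hypothesis be : basis_of fullv e.
Hypothesis we : forall i, in_root_space (rc (wt i)) (tnth e i).
Hypothesis wint : forall i, nat_vec (wt i) \/ nat_vec (- wt i).

Lemma killing_cartan (H H' : subvs_of h) :
  killing (vsval H) (vsval H') = \sum_i (rc (wt i) H : F) * rc (wt i) H'.
Proof.
rewrite (killing_basis _ _ be); apply: eq_bigr => i _.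
by rewrite we linearZ /= we !linearZ /= (coord_tnth _ _ be) eqxx mulr1 mulrC.
Qed.

Lemma root_space_cartan (H : g) : H \in h -> in_root_space (0 : cartan_dual h) H.
Proof.
have [habel _ _] := h_cartan.
by move=> hH H'; rewrite lfunE /= scale0r habel// subvsP.
Qed.

Lemma root_space0 x : in_root_space (0 : cartan_dual h) x -> x \in h.
Proof.
move=> x0; have [_ hself _] := h_cartan; apply: hself => y yh.
by rewrite lieC -[y](vsprojK yh) x0 lfunE /= scale0r oppr0.
Qed.

Lemma killing_root_space (L L' : cartan_dual h) x y :
  in_root_space L x -> in_root_space L' y -> killing x y != 0 -> L + L' = 0.
Proof.
move=> Lx Ly xy0; apply/lfunP => H; apply: (mulIf xy0); rewrite !lfunE /= mul0r mulrDl.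
rewrite -killingZl -Lx lieC -scaleN1r killingZl killing_inv Ly killingZr mulN1r.
by rewrite addNr.
Qed.

Lemma wt0_cartan i : wt i = 0 -> (tnth e i) \in h.
Proof. by move=> wi; apply: root_space0; rewrite -(rcomb0 iota alpha) -wi. Qed.

Lemma wt_neq0 : exists i, wt i != 0.
Proof.
apply: contrapT => nwt; have [[x [y]]] := g_simple.
have gh z : z \in h.
  rewrite (coord_sum_tnth z be); apply: memv_suml => i _; apply: memvZ.
  by apply: wt0_cartan; apply/eqP/negPn/negP => wi; apply: nwt; exists i.
by have [habel _ _] := h_cartan; rewrite habel ?gh// eqxx.
Qed.

(** On h the Killing form is the sum of the squares of the weights. If it vanished, independence of
    the simple roots would give sums of squares of real coordinates equal to 0, so all weights would
    vanish, against [wt_neq0]. *)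
Lemma killing_neq0 : exists x y : g, killing x y != 0.
Proof.
apply: contrapT => k0; have kk (x y : g) : killing x y = 0.
  by apply/eqP/negPn/negP => xy; apply: k0; exists x, y.
have [i0] := wt_neq0; suff -> : wt i0 = 0 by rewrite eqxx.
have S0 b c : \sum_i wt i 0 b * wt i 0 c = 0.
  suff : iota (\sum_i wt i 0 b * wt i 0 c) = 0 :> F by move/eqP; rewrite fmorph_eq0 => /eqP.
  move: c; apply: (rcomb_free alpha_simple); apply/lfunP => H'.
  rewrite sum_lfunE [RHS]lfunE /=; move: b.
  apply: (rcomb_free alpha_simple); apply/lfunP => H; rewrite [RHS]lfunE /=.
  rewrite -[RHS](kk (vsval H) (vsval H')) killing_cartan sum_lfunE.
  have E (k : F) (f : cartan_dual h) K : (k *: f) K = k * f K :> F by rewrite lfunE.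
  under eq_bigr do rewrite E mulr_suml.
  rewrite exchange_big /=.
  under eq_bigr do under eq_bigr do rewrite E.
  rewrite [RHS](eq_bigr (fun i => \sum_b \sum_c iota (wt i 0 b) * iota (wt i 0 c) *
     (tnth alpha b H : F) * (tnth alpha c H' : F))); last first.
    move=> i _; rewrite /rcomb !sum_lfunE mulr_suml; apply: eq_bigr => b _.
    rewrite mulr_sumr; apply: eq_bigr => c _; rewrite !E.
    by rewrite -!mulrA; congr (_ * _); rewrite mulrCA.
  rewrite [RHS]exchange_big [LHS]exchange_big /=; apply: eq_bigr => b _.
  rewrite [RHS]exchange_big /=; apply: eq_bigr => c _.
  rewrite rmorph_sum !mulr_suml; apply: eq_bigr => i _.
  by rewrite rmorphM /= mulrAC.
apply/rowP => b; rewrite mxE; have /eqP := S0 b b.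
rewrite psumr_eq0 => [|i _]; last by rewrite -expr2 sqr_ge0.
by move=> /allP/(_ i0); rewrite mem_index_enum mulf_eq0 orbb => /(_ isT)/eqP.
Qed.

(** The radical is an ideal by invariance, and it is not everything by [killing_neq0]. *)
Lemma killing_nondeg (x : g) : (forall y, killing x y = 0) -> x = 0.
Proof.
pose I := (\bigcap_(i < n) lker (linfun (killing ((tnth e i) : g) : g -> F^o)))%VS.
have memI z : z \in I <-> forall y, killing z y = 0.
  rewrite /I memvE; split.
    move=> /subv_bigcapP zI y; rewrite killingC (coord_sum_tnth y be) killing_suml.
    rewrite big1// => i _; rewrite killingZl; have := zI i isT.
    by rewrite -memvE memv_ker lfunE /= => /eqP ->; rewrite mulr0.
  move=> z0; apply/subv_bigcapP => i _; rewrite -memvE memv_ker lfunE /=.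
  by rewrite killingC z0.
have Iid : lie_ideal I.
  by move=> u v /memI v0; apply/memI => y; rewrite lieC -scaleN1r killingZl killing_inv v0 mulr0.
have [_ gs] := g_simple; case: (gs _ Iid) => IE; last first.
  have [u [v]] := killing_neq0; have /memI -> : u \in I by rewrite IE memvf.
  by rewrite eqxx.
by move=> x0; apply/eqP; rewrite -memv0 -IE; apply/memI.
Qed.

(** An element of h is orthogonal to the root vectors of nonzero weight, and the basis vectors of
    weight 0 lie in h. *)
Lemma killing_cartan_nondeg (H : subvs_of h) :
  (forall H' : subvs_of h, killing (vsval H) (vsval H') = 0) -> H = 0.
Proof.
move=> H0; apply: subvs_inj; rewrite linear0; apply: killing_nondeg => y.
rewrite (coord_sum_tnth y be) killing_sumr big1// => i _; rewrite killingZr.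
have [wi|wi] := eqVneq (wt i) 0.
  by rewrite -[(tnth e i)](vsprojK (wt0_cartan wi)) H0 mulr0.
apply/eqP; rewrite mulf_eq0; apply/orP; right; apply: contraNT wi => kn0.
have := killing_root_space (root_space_cartan (subvsP H)) (@we i) kn0.
by rewrite add0r -(rcomb0 iota alpha) => /(rcomb_inj alpha_simple) ->.
Qed.

Definition killing_cartan_fun (t H : subvs_of h) : F^o := killing (vsval t) (vsval H).

Fact killing_cartan_fun_linear t : linear (killing_cartan_fun t).
Proof.
by move=> a x y; rewrite /killing_cartan_fun linearP killingC killingDl killingZl ![killing _ (vsval t)]killingC.
Qed.

HB.instance Definition _ t := GRing.isSemilinear.Build F (subvs_of h) F^o _
  (killing_cartan_fun t) (GRing.semilinear_linear (killing_cartan_fun_linear t)).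

Definition killing_cartan_hom (t : subvs_of h) : cartan_dual h := linfun (killing_cartan_fun t).

Fact killing_cartan_hom_linear : linear killing_cartan_hom.
Proof.
move=> a x y; apply/lfunP => H; rewrite add_lfunE scale_lfunE !lfunE /= /killing_cartan_fun.
by rewrite linearP killingDl killingZl.
Qed.

HB.instance Definition _ := GRing.isSemilinear.Build F (subvs_of h) (cartan_dual h) _
  killing_cartan_hom (GRing.semilinear_linear killing_cartan_hom_linear).

(** Nondegeneracy on h makes the map to the dual injective, hence onto by dimension, so the default
    value of [xget] is never taken. *)
Lemma killing_dualP (lam : cartan_dual h) (H : subvs_of h) :
  killing (vsval (killing_dual lam)) (vsval H) = lam H.
Proof.
move: H; rewrite /killing_dual.
apply: (@xgetPex _ 0 [set t : subvs_of h | forall H, killing (vsval t) (vsval H) = lam H]).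
have lk0 : lker (linfun killing_cartan_hom) = 0%VS.
  apply/eqP; rewrite -subv0; apply/subvP => t; rewrite memv_ker lfunE /= => /eqP t0.
  rewrite memv0; apply/eqP/killing_cartan_nondeg => H'.
  by have := congr1 (fun f : cartan_dual h => f H') t0; rewrite !lfunE.
have img : limg (linfun killing_cartan_hom) = fullv.
  apply/eqP; rewrite eqEdim subvf limg_dim_eq ?lk0 ?capv0// !dimvf.
  by rewrite /dim /= muln1.
have /memv_imgP[t _ tE] : lam \in limg (linfun killing_cartan_hom) by rewrite img memvf.
by exists t => H; rewrite tE lfunE /= lfunE.
Qed.

End Killing.

(** * Representations with diagonal Cartan action *)

Section DiagRep.
Context {R : realFieldType} {F : fieldType} (iota : {rmorphism R -> F})
  {g : lieAlgebraType F} {h : {vspace g}} {r : nat}.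
Variable alpha : r.-tuple (cartan_dual h).
Local Notation rc := (rcomb iota alpha).

Definition diag_rep (V : lierep g) (wt : 'I_(rdim V) -> 'rV[R]_r) : Prop :=
  forall H : subvs_of h, V (vsval H) = diag_mx (\row_j (rc (wt j) H : F)).

Variables (V : lierep g) (wt : 'I_(rdim V) -> 'rV[R]_r).
Hypothesis Vd : diag_rep wt.

HB.instance Definition _ (W : lierep g) := GRing.isSemilinear.Build F g 'M[F]_(rdim W) _
  (rmx W) (GRing.semilinear_linear (@rmx_linear _ _ W)).

Lemma diag_repE (H : subvs_of h) j l : V (vsval H) j l = (rc (wt j) H : F) *+ (j == l).
Proof. by rewrite Vd !mxE; case: eqVneq => [->|]. Qed.

Lemma diag_rep_shift a x j l : simple_roots alpha -> in_root_space (rc a) x ->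
  V x j l != 0 -> wt j = wt l + a.
Proof.
move=> sa xa xjl; apply: (rcomb_inj sa); rewrite rcombD; apply/lfunP => H.
apply/eqP; rewrite lfunE /= addrC -subr_eq; apply/eqP; apply: (mulIf xjl).
have /(congr1 (fun A => fun_of_matrix A j l)) := rmx_lie V (vsval H) x.
rewrite xa linearZ /= mxE => E; apply: (etrans _ (esym E)); rewrite [RHS]mxE [X in _ = _ + X]mxE.
rewrite Vd mul_diag_mx mul_mx_diag !mxE mulrBl.
by congr (_ - _); rewrite mulrC.
Qed.

(** The indices in [I] span a coordinate subspace stable under both matrices, and a commutator has
    trace 0 on it. *)
Lemma sum_commutator_stable n (X Y : 'M[F]_n) (I : pred 'I_n) :
  (forall j l, I l -> X j l != 0 -> I j) -> (forall j l, I l -> Y j l != 0 -> I j) ->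
  \sum_(j | I j) (X *m Y - Y *m X) j j = 0.
Proof.
move=> IX IY.
have E (A B : 'M[F]_n) : (forall j l, I l -> B j l != 0 -> I j) ->
    \sum_(j | I j) (A *m B) j j = \sum_(j | I j) \sum_(l | I l) A j l * B l j.
  move=> IB; apply: eq_bigr => j Ij; rewrite mxE [RHS]big_mkcond; apply: eq_bigr => l _.
  case: ifPn => // nIl; have [->|/(IB _ _ Ij)] := eqVneq (B l j) 0; first by rewrite mulr0.
  by rewrite (negPf nIl).
under eq_bigr do rewrite mxE [X in _ + X]mxE.
rewrite sumrB (E X Y)// (E Y X)// [X in _ - X]exchange_big /=.
apply/eqP; rewrite subr_eq0; apply/eqP.
by apply: eq_bigr => j _; apply: eq_bigr => l _; rewrite mulrC.
Qed.

Lemma weight_sum_stable (I : pred 'I_(rdim V)) x y (t : subvs_of h) : lie x y = vsval t ->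
  (forall j l, I l -> V x j l != 0 -> I j) -> (forall j l, I l -> V y j l != 0 -> I j) ->
  \sum_(j | I j) (rc (wt j) t : F) = 0.
Proof.
move=> xyt Ix Iy; rewrite -[RHS](sum_commutator_stable Ix Iy); apply: eq_bigr => j _.
by rewrite -rmx_lie xyt diag_repE eqxx.
Qed.

End DiagRep.

Section Adjoint.
Context {F : fieldType} {g : lieAlgebraType F}.
Variables (e : (\dim {:g}).-tuple g).
Hypothesis be : basis_of fullv e.

Definition adjoint_mx (x : g) : 'M[F]_(\dim {:g}) := \matrix_(j, i) coord e j (lie x (tnth e i)).

Fact adjoint_mx_linear : linear adjoint_mx.
Proof.
by move=> a x y; apply/matrixP => j i; rewrite !mxE lieDl lieZl linearP.
Qed.

Lemma adjoint_mxM x y i j :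
  (adjoint_mx x *m adjoint_mx y) i j = coord e i (lie x (lie y (tnth e j))).
Proof.
rewrite [lie y _](coord_sum_tnth _ be) !linear_sum mxE.
by apply: eq_bigr => k _; rewrite !mxE !linearZ /= mulrC.
Qed.

Fact adjoint_mx_lie x y :
  adjoint_mx (lie x y) = adjoint_mx x *m adjoint_mx y - adjoint_mx y *m adjoint_mx x.
Proof.
apply/matrixP => i j; rewrite [RHS]mxE [X in _ + X]mxE !adjoint_mxM mxE.
by rewrite lieJ linearD addrK.
Qed.

Definition adjoint := LieRep adjoint_mx_linear adjoint_mx_lie.

End Adjoint.

Section RootForm.
Context {R : realFieldType} {F : fieldType} {iota : {rmorphism R -> F}}
  {g : lieAlgebraType F} {h : {vspace g}} {r : nat}.
Variable alpha : r.-tuple (cartan_dual h).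
Hypothesis g_simple : simple_lie_algebra g.
Hypothesis h_cartan : cartan_subalgebra h.
Hypothesis alpha_simple : simple_roots alpha.
Local Notation n := (\dim {:g}).
Local Notation rc := (rcomb iota alpha).
Variables (e : n.-tuple g) (wt : 'I_n -> 'rV[R]_r).
Hypothesis be : basis_of fullv e.
Hypothesis we : forall i, in_root_space (rc (wt i)) (tnth e i).
Hypothesis wint : forall i, nat_vec (wt i) \/ nat_vec (- wt i).

Lemma adjoint_diag : diag_rep iota alpha (V := adjoint be) wt.
Proof.
move=> H; apply/matrixP => j i; rewrite !mxE /= we linearZ /= (coord_tnth _ _ be).
by case: eqVneq => [->|] //=; rewrite ?mulr1// mulr0.
Qed.

Let kdP := killing_dualP g_simple h_cartan alpha_simple be we.
Let knd := killing_nondeg g_simple h_cartan alpha_simple be we.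
Let kcnd := killing_cartan_nondeg g_simple h_cartan alpha_simple be we.

Lemma killing_dual_uniq (lam : cartan_dual h) (t : subvs_of h) :
  (forall H : subvs_of h, killing (vsval t) (vsval H) = lam H) -> t = killing_dual lam.
Proof.
move=> tl; apply/eqP; rewrite -subr_eq0; apply/eqP/kcnd => H'.
by rewrite linearB /= -scaleN1r killingDl killingZl tl kdP mulN1r subrr.
Qed.

Lemma killing_dual_linear : linear (@killing_dual _ g h).
Proof.
move=> a x y; apply/esym/killing_dual_uniq => H.
by rewrite linearP /= killingDl killingZl !kdP !lfunE /= lfunE.
Qed.

(** The bracket has weight 0, so it lies in h, where it is determined by its Killing products; these
    follow from invariance. *)
Lemma lie_opposite a x y : in_root_space (rc a) x -> in_root_space (rc (- a)) y ->
  lie x y = killing x y *: vsval (killing_dual (rc a)).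
Proof.
move=> xa ya.
have xyh : lie x y \in h.
  apply: (root_space0 h_cartan) => H; rewrite lfunE /= scale0r lieJ xa ya lieZl linearZ /=.
  by rewrite rcombN -scalerDl !lfunE /= addrN scale0r.
have tE : vsproj h (lie x y) = killing x y *: killing_dual (rc a).
  apply/eqP; rewrite -subr_eq0; apply/eqP/kcnd => H.
  rewrite (_ : vsval _ = lie x y + (- killing x y) *: vsval (killing_dual (rc a))).
    rewrite killingDl killingZl kdP killing_inv (lieC y) ya rcombN lfunE /=.
    by rewrite scaleNr opprK killingZr mulNr mulrC addrN.
  by rewrite linearB linearZ /= vsprojK// scalerN scaleNr.
by rewrite -(vsprojK xyh) tE linearZ.
Qed.

Lemma dual_root_basis : exists y : 'I_n -> g,
  [/\ forall i j : 'I_n, killing (tnth e i) (y j) = (i == j)%:R,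
      forall j, in_root_space (rc (- wt j)) (y j),
      forall z, z = \sum_(i < n) killing z (y i) *: (tnth e i)
    & forall z, z = \sum_(i < n) killing z (tnth e i) *: y i].
Proof.
pose G : 'M[F]_n := \matrix_(i, j) killing (tnth e i) (tnth e j).
have GE i j : G i j = killing (tnth e i) (tnth e j) by rewrite mxE.
have Gu : G \in unitmx.
  rewrite -row_free_unit -kermx_eq0; apply/eqP/row_matrixP => i.
  set u := row i _; rewrite row0.
  have uG : u *m G = 0 by apply/eqP; rewrite -sub_kermx row_sub.
  have z0 : \sum_(k < n) u 0 k *: (tnth e k) = 0.
    apply: knd => y; rewrite (coord_sum_tnth y be) killing_sumr big1// => j _.
    rewrite killingZr; have /rowP/(_ j) := uG; rewrite mxE [RHS]mxE => uGj.
    rewrite killing_suml (eq_bigr (fun k => u 0 k * G k j)) => [|k _]; last by rewrite killingZl GE.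
    by rewrite uGj mulr0.
  have /freeP fe := basis_free be.
  apply/rowP => k; rewrite [RHS]mxE; apply: (fe (fun k => u 0 k)); rewrite -[RHS]z0.
  by apply: eq_bigr => l _; rewrite (tnth_nth 0).
have [y ey] : exists y : 'I_n -> g, forall i j : 'I_n, killing (tnth e i) (y j) = (i == j)%:R.
  exists (fun j => \sum_(k < n) invmx G k j *: (tnth e k)) => i j.
  rewrite killing_sumr (eq_bigr (fun k => G i k * invmx G k j)) => [|k _].
    by have /matrixP/(_ i j) := mulmxV Gu; rewrite [LHS]mxE [in RHS]mxE.
  by rewrite killingZr GE mulrC.
have zE (z : g) : z = \sum_(i < n) killing z (y i) *: (tnth e i).
  rewrite {1}(coord_sum_tnth z be); apply: eq_bigr => i _; congr (_ *: _).
  rewrite [in RHS](coord_sum_tnth z be) killing_suml (bigD1 i) //= big1 ?addr0.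
    by rewrite killingZl ey eqxx mulr1.
  by move=> k ki; rewrite killingZl ey (negPf ki) mulr0.
have zE' (z : g) : z = \sum_(i < n) killing z (tnth e i) *: y i.
  apply/eqP; rewrite -subr_eq0; apply/eqP/knd => w.
  rewrite (coord_sum_tnth w be) killing_sumr big1// => j _.
  rewrite killingZr -scaleN1r killingDl killingZl killing_suml (bigD1 j) //= big1 ?addr0.
    by rewrite killingZl [X in _ * (_ * X)]killingC ey eqxx mulr1 mulN1r addrN mulr0.
  by move=> k kj; rewrite killingZl [X in _ * X]killingC ey eq_sym (negPf kj) mulr0.
have knd' (z z' : g) : (forall i : 'I_n, killing z (tnth e i) = killing z' (tnth e i)) -> z = z'.
  by move=> zz; rewrite (zE' z) (zE' z'); apply: eq_bigr => i _; rewrite zz.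
exists y; split => // j H; apply: knd' => i.
rewrite lieC -scaleN1r killingZl killing_inv we killingZr killingZl [killing (y j) _]killingC ey.
rewrite rcombN lfunE /=; case: eqVneq => [->|_]; last by rewrite !mulr0.
by rewrite !mulr1 mulN1r.
Qed.

End RootForm.

(** * Strings of weights *)

Section Sl2.
Context {R : realFieldType} {F : fieldType} {iota : {rmorphism R -> F}}
  {g : lieAlgebraType F} {h : {vspace g}} {r : nat}.
Variable alpha : r.-tuple (cartan_dual h).
Hypothesis alpha_simple : simple_roots alpha.
Local Notation rc := (rcomb iota alpha).
Variables (V : lierep g) (wt : 'I_(rdim V) -> 'rV[R]_r).
Hypothesis Vd : diag_rep iota alpha wt.

Definition weight_vec (mu : 'rV[R]_r) (v : 'cV[F]_(rdim V)) : Prop :=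
  forall j, v j 0 != 0 -> wt j = mu.

Lemma weight_vec_shift mu a x v : in_root_space (rc a) x -> weight_vec mu v ->
  weight_vec (mu + a) (V x *m v).
Proof.
move=> xa vmu j; rewrite mxE => /eqP; case: (pickP (fun l => V x j l * v l 0 != 0)) => [l|all0].
  by rewrite mulf_eq0 negb_or => /andP[/(diag_rep_shift Vd alpha_simple xa) -> /vmu ->].
by rewrite big1// => l _; apply/eqP; rewrite (negbFE (all0 l)).
Qed.

Lemma weight_vec_cartan mu v (H : subvs_of h) : weight_vec mu v ->
  V (vsval H) *m v = (rc mu H : F) *: v.
Proof.
move=> vmu; rewrite Vd mul_diag_mx; apply/colP => j; rewrite !mxE.
by have [->|/vmu ->] := eqVneq (v j 0) 0; rewrite ?mulr0.
Qed.

Lemma weight_vec_cartanP mu v : (forall H : subvs_of h, V (vsval H) *m v = (rc mu H : F) *: v) ->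
  weight_vec mu v.
Proof.
move=> vmu j vj; apply: (rcomb_inj (iota := iota) alpha_simple); apply/lfunP => H.
apply: (mulIf vj); have /colP/(_ j) := vmu H.
by rewrite Vd mul_diag_mx !mxE.
Qed.

Definition pow_act (x : g) k (v : 'cV[F]_(rdim V)) := iter k (mulmx (V x)) v.

Lemma weight_vec_pow mu a x k v : in_root_space (rc a) x -> weight_vec mu v ->
  weight_vec (mu + a *+ k) (pow_act x k v).
Proof.
move=> xa vmu; elim: k => [|k IH]; first by rewrite mulr0n addr0.
by rewrite mulrSr addrA; apply: weight_vec_shift.
Qed.

Lemma pow_act_eq0 mu a x v : a != 0 -> in_root_space (rc a) x -> weight_vec mu v ->
  exists k, pow_act x k v = 0.
Proof.
move=> a0 xa vmu; apply: contrapT => npow.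
have P k : exists j : 'I_(rdim V), wt j = mu + a *+ k.
  have [j vj] : exists j, pow_act x k v j 0 != 0.
    apply: contrapT => nj; apply: npow; exists k; apply/colP => j; rewrite mxE.
    by apply/eqP/negPn/negP => vj; apply: nj; exists j.
  by exists j; have W := weight_vec_pow (k := k) xa vmu; exact: W vj.
have [f fE] := choice P.
have inj : injective (fun k : 'I_(rdim V).+1 => f k).
  move=> k l fkl; apply: val_inj; apply/eqP; rewrite -(eqr_nat R) -subr_eq0.
  have : mu + a *+ k = mu + a *+ l by rewrite -!fE fkl.
  move=> /addrI; rewrite -(scaler_nat k) -(scaler_nat l) => /eqP; rewrite -subr_eq0 -scalerBl scaler_eq0.
  by rewrite (negPf a0) orbF.
by have := leq_card _ inj; rewrite !card_ord ltnn.
Qed.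

Let two_neq0 : (2 : F) != 0.
Proof. by rewrite -(rmorph_nat iota) fmorph_eq0 pnatr_eq0. Qed.

(** The classical computation for a vector killed by x, carried out modulo the stable subspace [K],
    which makes it apply to maximal vectors of quotients. The element [t] is not normalized to a
    coroot, whence the factor [rc a t]. *)
Lemma sl2_mod (K : {vspace 'cV[F]_(rdim V)}) x y (t : subvs_of h) a mu v :
  a != 0 -> in_root_space (rc a) x -> in_root_space (rc (- a)) y -> lie x y = vsval t ->
  (forall u, u \in K -> V x *m u \in K) -> (forall u, u \in K -> V y *m u \in K) ->
  weight_vec mu v -> v \notin K -> V x *m v \in K ->
  exists n : nat, rc mu t = n%:R / 2 * rc a t :> F.
Proof.
move=> a0 xa ya xyt xK yK vmu vK xvK.
(* The coefficient in x y^k v = c_k y^(k-1) v modulo [K]; it must vanish at the first power of y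
   that sends v into [K]. *)
pose c k : F := k%:R * rc mu t - k%:R * (k%:R - 1) / 2 * rc a t.
have XY u : V x *m (V y *m u) = V y *m (V x *m u) + V (vsval t) *m u.
  by rewrite -xyt rmx_lie mulmxBl -!mulmxA addrC subrK.
have cK k : V x *m pow_act y k.+1 v - c k.+1 *: pow_act y k v \in K.
  elim: k => [|k IH].
    rewrite /= XY (weight_vec_cartan _ vmu) /c mulr1n mul1r subrr mulr0 mul0r mul0r subr0 addrK.
    exact: yK.
  have vk : weight_vec (mu + (- a) *+ k.+1) (pow_act y k.+1 v) by apply: weight_vec_pow.
  rewrite [pow_act y k.+2 v]/= -[V y *m iter _ _ _]/(pow_act y k.+1 v) XY.
  rewrite (weight_vec_cartan _ vk).
  have -> : V y *m (V x *m pow_act y k.+1 v) + (rc (mu + (- a) *+ k.+1) t : F) *: pow_act y k.+1 v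
     - c k.+2 *: pow_act y k.+1 v = V y *m (V x *m pow_act y k.+1 v - c k.+1 *: pow_act y k v).
    rewrite mulmxBr -scalemxAr -[V y *m pow_act y k v]/(pow_act y k.+1 v).
    rewrite -addrA -scalerBl -scaleNr; congr (_ + _ *: _).
    rewrite rcombD mulNrn rcombN -scaler_nat rcombZ rmorph_nat /c !lfunE /= !lfunE /= lfunE /=.
    rewrite -![_ *: _]/(_ * _) -[k.+2%:R]natr1 -[k.+1%:R]natr1; field.
    by [].
  exact: yK.
have exK : exists k, pow_act y k v \in K.
  by have [|k vk0] := pow_act_eq0 _ ya vmu; [rewrite oppr_eq0|exists k; rewrite vk0 mem0v].
case: (ex_minnP exK) => -[|n] nK nmin; first by rewrite nK in vK.
exists n; have nn : pow_act y n v \notin K by apply/negP => /nmin; rewrite ltnn.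
have := memvB (xK _ nK) (cK n); rewrite subKr => cn; have c0 : c n.+1 = 0.
  apply/eqP/negPn/negP => cn0; move/negP: nn; apply.
  by rewrite -(scale1r (pow_act _ _ _)) -(mulVf cn0) -scalerA memvZ.
have n1 : (n.+1%:R : F) != 0 by rewrite -(rmorph_nat iota) fmorph_eq0 pnatr_eq0.
apply: (mulfI n1); move/eqP: c0; rewrite /c subr_eq0 => /eqP ->.
by rewrite -[n.+1%:R]natr1; field.
Qed.

(** Raise a basis vector by x until the next step kills it and apply [sl2_mod] to the top; going
    back down subtracts twice the number of steps. *)
Lemma weight_integral x y (t : subvs_of h) a j :
  a != 0 -> in_root_space (rc a) x -> in_root_space (rc (- a)) y -> lie x y = vsval t ->
  exists z : int, rc (wt j) t = z%:~R / 2 * rc a t :> F.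
Proof.
move=> a0 xa ya xyt; pose v : 'cV[F]_(rdim V) := delta_mx j 0.
have vj : weight_vec (wt j) v.
  by move=> k; have [->//|/negPf kj] := eqVneq k j; rewrite /v mxE kj /= mulr0n eqxx.
have exK : exists k, pow_act x k v == 0.
  by have [//|k vk0] := pow_act_eq0 _ xa vj; exists k; rewrite vk0.
case: (ex_minnP exK) => -[|n] nK nmin.
  by move/eqP/colP/(_ j): nK => /eqP; rewrite !mxE !eqxx oner_eq0.
have nn : pow_act x n v \notin 0%VS by rewrite memv0; apply/negP => /nmin; rewrite ltnn.
have [||| m] := sl2_mod (K := 0%VS) a0 xa ya xyt _ _ (weight_vec_pow (k := n) xa vj) nn.
- by move=> u; rewrite memv0 => /eqP ->; rewrite mulmx0 mem0v.
- by move=> u; rewrite memv0 => /eqP ->; rewrite mulmx0 mem0v.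
- by rewrite memv0.
rewrite rcombD -scaler_nat rcombZ rmorph_nat lfunE /= lfunE /= => E.
have -> : rc (wt j) t = m%:R / 2 * rc a t - n%:R * rc a t :> F by rewrite -E addrK.
exists (m%:Z - (2 * n)%:Z)%R.
rewrite intrB -!pmulrn natrM; field.
by [].
Qed.

End Sl2.

(** * Positivity of the form and multiples of roots *)

Section Roots.
Context {R : realFieldType} {F : fieldType} {iota : {rmorphism R -> F}}
  {g : lieAlgebraType F} {h : {vspace g}} {r : nat}.
Variable alpha : r.-tuple (cartan_dual h).
Hypothesis g_simple : simple_lie_algebra g.
Hypothesis h_cartan : cartan_subalgebra h.
Hypothesis alpha_simple : simple_roots alpha.
Local Notation n := (\dim {:g}).
Local Notation rc := (rcomb iota alpha).
Local Notation kd a := (killing_dual (rc a)).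
Variables (e : n.-tuple g) (wt : 'I_n -> 'rV[R]_r).
Hypothesis be : basis_of fullv e.
Hypothesis we : forall i, in_root_space (rc (wt i)) (tnth e i).
Hypothesis wint : forall i, nat_vec (wt i) \/ nat_vec (- wt i).
Variable y : 'I_n -> g.
Hypothesis ey : forall i j : 'I_n, killing (tnth e i) (y j) = (i == j)%:R.
Hypothesis yw : forall j, in_root_space (rc (- wt j)) (y j).

Let adjd := adjoint_diag be we.

Lemma rcombDE a b (t : subvs_of h) : rc (a + b) t = rc a t + rc b t :> F.
Proof. by rewrite rcombD lfunE. Qed.

Lemma rcombZE k a (t : subvs_of h) : rc (k *: a) t = iota k * rc a t :> F.
Proof. by rewrite rcombZ lfunE. Qed.

Lemma lie_dual_root i : lie (tnth e i) (y i) = vsval (kd (wt i)).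
Proof. by rewrite (lie_opposite g_simple h_cartan alpha_simple be we (we i) (yw i)) ey eqxx scale1r. Qed.

(** The span of the root vectors with weights in [wt l] plus integer multiples of [wt i] is stable
    under e_i and y_i, so the trace of their bracket on it is 0. Solving for the value at [wt l]
    gives a rational ratio. *)
Lemma root_string_ratio i l : wt i != 0 ->
  exists q : R, rc (wt l) (kd (wt i)) = iota q * rc (wt i) (kd (wt i)) :> F.
Proof.
move=> wi0; pose I j := `[< exists k : int, wt j = wt l + k%:~R *: wt i >].
have kP j : exists k : int, I j -> wt j = wt l + k%:~R *: wt i.
  have [/asboolP[k kE]|nI] := boolP (I j); first by exists k.
  by exists 0.
have [k kE] := choice kP.
have Ix j l' : I l' -> adjoint be (tnth e i) j l' != 0 -> I j.
  move=> /asboolP[k' k'E] /(diag_rep_shift adjd alpha_simple (@we i)) jE.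
  by apply/asboolP; exists (k' + 1); rewrite jE k'E -addrA rmorphD scalerDl scale1r.
have Iy j l' : I l' -> adjoint be (y i) j l' != 0 -> I j.
  move=> /asboolP[k' k'E] /(diag_rep_shift adjd alpha_simple (@yw i)) jE.
  by apply/asboolP; exists (k' - 1); rewrite jE k'E -addrA rmorphB scalerBl scale1r.
have := weight_sum_stable adjd (lie_dual_root i) Ix Iy.
under eq_bigr => j Ij do rewrite (kE j Ij) rcombDE rcombZE.
rewrite big_split /= sumr_const -mulr_suml -rmorph_sum => S0.
have I0 : #|I| != 0%N.
  by rewrite -lt0n; apply/card_gt0P; exists l; apply/asboolP; exists 0; rewrite scale0r addr0.
exists (- (\sum_(j | I j) (k j)%:~R) / #|I|%:R).
have cI : (#|I|%:R : F) != 0 by rewrite -(rmorph_nat iota) fmorph_eq0 pnatr_eq0.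
apply: (mulfI cI); rewrite mulr_natl rmorphM rmorphN fmorphV rmorph_nat.
move/eqP: S0; rewrite addr_eq0 => /eqP ->; field.
exact: cI.
Qed.

Lemma killing_kd a b : killing (vsval (kd a)) (vsval (kd b)) = rc a (kd b).
Proof. exact: (killing_dualP g_simple h_cartan alpha_simple be we). Qed.

Lemma rc_kd_eq0 a : (forall l, rc (wt l) (kd a) = 0) -> a = 0.
Proof.
move=> a0; apply: (rcomb_inj (iota := iota) alpha_simple); rewrite rcomb0.
apply/lfunP => H; rewrite -(killing_dualP g_simple h_cartan alpha_simple be we) lfunE /=.
by rewrite (killing_cartan be we) big1// => i _; rewrite a0 mul0r.
Qed.

(** With D the norm of the root and q_l the ratios of [root_string_ratio], the formula for the
    Killing form on h reads D = D^2 times the sum of the q_l^2, so D is the inverse of a positive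
    number. *)
Lemma root_norm i : wt i != 0 -> exists2 s : R, 0 < s & rc (wt i) (kd (wt i)) = iota s.
Proof.
move=> wi0; have [q qE] := choice (fun l => root_string_ratio l wi0).
set D := rc (wt i) (kd (wt i)).
have D0 : (D : F) != 0.
  by apply: contraNneq wi0 => D0; apply/eqP/rc_kd_eq0 => l; rewrite qE -/D D0 mulr0.
have DE : D = iota (\sum_l q l ^+ 2) * D ^+ 2 :> F.
  rewrite {1}/D -killing_kd (killing_cartan be we) rmorph_sum mulr_suml.
  by apply: eq_bigr => l _; rewrite qE -/D rmorphXn; ring.
have {DE} D1 : iota (\sum_l q l ^+ 2) * D = 1.
  by apply: (mulIf D0); rewrite mul1r [RHS]DE; ring.
have S0 : \sum_l q l ^+ 2 != 0.
  by apply/eqP => S0; move/eqP: D1; rewrite S0 rmorph0 mul0r eq_sym oner_eq0.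
exists (\sum_l q l ^+ 2)^-1.
  by rewrite invr_gt0 lt0r S0 sumr_ge0// => l _; rewrite sqr_ge0.
rewrite fmorphV; apply: (mulfI (_ : iota (\sum_l q l ^+ 2) != 0)); first by rewrite fmorph_eq0.
by rewrite mulfV ?fmorph_eq0.
Qed.

Lemma is_root_wt lam : is_root lam -> exists2 i, lam = rc (wt i) & wt i != 0.
Proof.
case=> lam0 [x x0 xlam]; have [i ci] : exists i, coord e i x != 0.
  apply: contrapT => nc; move/negP: x0; apply; rewrite (coord_sum_tnth x be) big1// => i _.
  by have [->|ci] := eqVneq (coord e i x) 0; [rewrite scale0r|case: nc; exists i].
have lamE : lam = rc (wt i).
  apply/lfunP => H; apply: (mulIf ci); rewrite -[LHS]linearZ /= -xlam.
  rewrite [in LHS](coord_sum_tnth x be) linear_sum linear_sum (bigD1 i) //= big1 ?addr0 => [|j ji].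
    by rewrite linearZ /= we !linearZ /= coord_tnth// eqxx mulr1 mulrC.
  by rewrite linearZ /= we !linearZ /= coord_tnth// eq_sym (negPf ji) !mulr0.
exists i => //; apply: contraNneq lam0 => wi; by rewrite lamE wi rcomb0.
Qed.

Lemma simple_wt b : exists i, wt i = delta_mx 0 b.
Proof.
have [_ ar _] := alpha_simple; have [i iE _] := is_root_wt (ar b); exists i.
by apply: (rcomb_inj (iota := iota) alpha_simple); rewrite -iE rcomb_delta.
Qed.

Let kdD a b : kd (a + b) = kd a + kd b.
Proof.
have := killing_dual_linear g_simple h_cartan alpha_simple be we 1 (rc a) (rc b).
by rewrite !scale1r -rcombD.
Qed.

Let kdZ k a : kd (k *: a) = iota k *: kd a.
Proof.
have k0 : killing_dual (0 : cartan_dual h) = 0.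
  by apply/esym/(killing_dual_uniq g_simple h_cartan alpha_simple be we) => H;
    rewrite linear0 lfunE /= -(scale0r 0) killingZl mul0r.
have := killing_dual_linear g_simple h_cartan alpha_simple be we (iota k) (rc a) 0.
by rewrite k0 !addr0 -rcombZ.
Qed.

(** Norms and ratios being in the image of [iota], so is the Gram matrix. Positivity comes from
    (a,a) being the sum of the (wt i,a)^2, which vanishes only if a does. *)
Lemma root_gram : exists B : 'M[R]_r,
  [/\ B^T = B, forall a b, rc a (kd b) = iota (bform B a b) :> F
    & forall a, a != 0 -> 0 < bform B a a].
Proof.
have PB b c : exists s : R, rc (delta_mx 0 b) (kd (delta_mx 0 c)) = iota s.
  have [i <-] := simple_wt b; have [j jE] := simple_wt c; rewrite -jE.
  have wj0 : wt j != 0.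
    by rewrite jE; apply/eqP => /rowP/(_ c)/eqP; rewrite !mxE !eqxx oner_eq0.
  have [q ->] := root_string_ratio i wj0; have [s _ ->] := root_norm wj0.
  by exists (q * s); rewrite rmorphM.
have P2 b : exists fb : 'I_r -> R, forall c, rc (delta_mx 0 b) (kd (delta_mx 0 c)) = iota (fb c).
  by have [fb fbE] := choice (PB b); exists fb.
have [f fE] := choice P2.
pose B : 'M[R]_r := \matrix_(b, c) f b c.
have BE a b : rc a (kd b) = iota (bform B a b) :> F.
  rewrite {1}(row_sum_delta a) rcomb_sum sum_lfunE bformE rmorph_sum; apply: eq_bigr => i _.
  rewrite rcombZ lfunE /= rmorph_sum.
  have -> : kd b = \sum_c iota (b 0 c) *: kd (delta_mx 0 c).
    rewrite {1}(row_sum_delta b); elim/big_rec2: _ => [|c u v _ <-].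
      by rewrite -(scale0r (0 : 'rV[R]_r)) kdZ rmorph0 scale0r.
    by rewrite kdD kdZ.
  rewrite linear_sum -[_ *: _]/(_ * _) mulr_sumr; apply: eq_bigr => c _.
  by rewrite linearZ /= fE mxE !rmorphM -mulrA; congr (_ * _); rewrite mulrC.
have Bsum a : bform B a a = \sum_i bform B (wt i) a ^+ 2.
  apply: (fmorph_inj iota); rewrite -BE -killing_kd (killing_cartan be we) rmorph_sum.
  by apply: eq_bigr => i _; rewrite BE rmorphXn expr2.
exists B; split=> //.
  apply/matrixP => b c; rewrite !mxE; apply: (fmorph_inj iota); rewrite -!fE.
  by rewrite -!killing_kd killingC.
move=> a a0; rewrite Bsum lt0r sumr_ge0 ?andbT => [|i _]; last exact: sqr_ge0.
apply: contraNneq a0 => /eqP; rewrite psumr_eq0 => [/allP s0|i _]; last exact: sqr_ge0.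
apply/eqP/rc_kd_eq0 => l; rewrite BE.
by have := s0 l (mem_index_enum _); rewrite sqrf_eq0 => /eqP ->; rewrite rmorph0.
Qed.

Variable B : 'M[R]_r.
Hypothesis Bsym : B^T = B.
Hypothesis BE : forall a b, rc a (kd b) = iota (bform B a b) :> F.
Hypothesis Bpos : forall a, a != 0 -> 0 < bform B a a.

Definition adj_col (z : g) : 'cV[F]_n := \col_k coord e k z.

Lemma adj_colE x z : adjoint be x *m adj_col z = adj_col (lie x z).
Proof.
apply/colP => j; rewrite !mxE [in RHS](coord_sum_tnth z be) !linear_sum.
by apply: eq_bigr => k _; rewrite !mxE !linearZ /= mulrC.
Qed.

Lemma adj_col_eq0 z : adj_col z = 0 -> z = 0.
Proof.
move=> /colP z0; rewrite (coord_sum_tnth z be) big1// => i _.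
by have := z0 i; rewrite !mxE => ->; rewrite scale0r.
Qed.

Lemma adj_col_weight a z : in_root_space (rc a) z ->
  weight_vec (V := adjoint be) wt a (adj_col z).
Proof.
move=> za; apply: (weight_vec_cartanP alpha_simple adjd) => H.
by rewrite adj_colE za; apply/colP => j; rewrite !mxE linearZ.
Qed.

(** If i and j differ, y_j is orthogonal to e_i and hence killed by it, although its weight is the
    opposite of [wt i]. Then [sl2_mod] gives -1 = k/2 for a natural number k. *)
Lemma root_mult1 i j : wt i != 0 -> wt i = wt j -> i = j.
Proof.
move=> wi0 wij; apply/eqP/negPn/negP => ij.
have yj0 : y j != 0.
  by apply/eqP => y0; have /eqP := ey j j; rewrite y0 -(scale0r 0) killingZr mul0r eqxx eq_sym oner_eq0.
have ywj : in_root_space (rc (- wt i)) (y j) by rewrite wij; exact: yw.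
have ywi : in_root_space (rc (- wt i)) (y i) by exact: yw.
have c0 : adj_col (y j) \notin 0%VS by rewrite memv0; apply: contra yj0 => /eqP/adj_col_eq0 ->.
have [|||k] := sl2_mod alpha_simple adjd (K := 0%VS) wi0 (@we i) ywi (lie_dual_root i) _ _
   (adj_col_weight ywj) c0.
- by move=> u; rewrite memv0 => /eqP ->; rewrite mulmx0 mem0v.
- by move=> u; rewrite memv0 => /eqP ->; rewrite mulmx0 mem0v.
- rewrite adj_colE (lie_opposite g_simple h_cartan alpha_simple be we (we i) ywj) ey (negPf ij).
  rewrite scale0r memv0; apply/eqP/colP => l.
  by rewrite !mxE linear0.
rewrite -scaleN1r rcombZE BE -(rmorph_nat iota) -(rmorph_nat iota 2) -fmorphV -!rmorphM => /fmorph_inj.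
move/(mulIf (lt0r_neq0 (Bpos wi0))) => E.
by have : 0 <= -1 :> R; [rewrite E divr_ge0|rewrite oppr_ge0 ler10].
Qed.

(** A trace argument on the span of the weights z [wt i] with integers z >= -1: it contains i and j,
    contributing 1 and k, and at most one negative contribution -1, so for k >= 2 the total cannot
    be 0. *)
Lemma root_multiple i j k : wt i != 0 -> wt j = wt i *+ k -> (k <= 1)%N.
Proof.
move=> wi0 wj; rewrite leqNgt; apply/negP => k2.
pose t l := bform B (wt l) (wt i); have s0 := Bpos wi0.
pose I l := `[< exists2 z : int, -1 <= z & wt l = z%:~R *: wt i >].
have Ix l l' : I l' -> adjoint be (tnth e i) l l' != 0 -> I l.
  move=> /asboolP[z z1 zE] /(diag_rep_shift adjd alpha_simple (@we i)) lE.
  apply/asboolP; exists (z + 1); first by rewrite (le_trans z1)// lerDl.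
  by rewrite lE zE rmorphD scalerDl scale1r.
(* Stability at the lower end z = -1: root spaces are lines, so y_i is a multiple of the vector of
   that weight and their bracket is 0. *)
have Iy l l' : I l' -> adjoint be (y i) l l' != 0 -> I l.
  move=> /asboolP[z z1 zE] ll'; have lE := diag_rep_shift adjd alpha_simple (@yw i) ll'.
  move: z1; rewrite le_eqVlt => /orP[/eqP zN1|z1].
    exfalso; move/negP: ll'; apply; apply/eqP.
    have wl' : wt l' = - wt i by rewrite zE -zN1 rmorphN scaleN1r.
    suff -> : y i = coord e l' (y i) *: tnth e l'.
      by rewrite /= mxE lieZl liexx scaler0 linear0.
    rewrite {1}(coord_sum_tnth (y i) be) (bigD1 l') //= big1 ?addr0// => l2 l2l'.
    have [->|c0] := eqVneq (coord e l2 (y i)) 0; first by rewrite scale0r.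
    have := adj_col_weight (@yw i) (j := l2); rewrite mxE => /(_ c0) wl2.
    move/eqP: l2l'; case; apply: root_mult1; last by rewrite wl2.
    by rewrite wl2 oppr_eq0.
  apply/asboolP; exists (z - 1); first by lia.
  by rewrite lE zE rmorphB scalerBl scale1r.
have S0 : \sum_(l | I l) t l = 0.
  apply: (fmorph_inj iota); rewrite rmorph0 rmorph_sum -[RHS](weight_sum_stable adjd (lie_dual_root i) Ix Iy).
  by apply: eq_bigr => l _; rewrite BE.
have Ii : I i by apply/asboolP; exists 1 => //; rewrite scale1r.
have Ij : I j by apply/asboolP; exists k%:Z; [lia|rewrite wj -scaler_nat].
have ij : j != i.
  apply: contraTneq k2 => ji; rewrite -leqNgt; move: wj; rewrite ji -scaler_nat => /eqP.
  rewrite -{1}(scale1r (wt i)) -subr_eq0 -scalerBl scaler_eq0 (negPf wi0) orbF subr_eq0 => /eqP/esym/eqP.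
  by rewrite pnatr_eq1 => /eqP ->.
have tz l (z : R) : wt l = z *: wt i -> t l = z * bform B (wt i) (wt i).
  by move=> lE; rewrite /t lE bformZl.
have zneg l : I l -> t l < 0 -> wt l = - wt i.
  move=> /asboolP[z z1 zE]; rewrite (tz _ _ zE) pmulr_llt0// ltrz0 => z0.
  by rewrite zE (_ : z = -1) ?rmorphN ?scaleN1r//; lia.
have rest : - bform B (wt i) (wt i) <= \sum_(l | (I l && (l != i)) && (l != j)) t l.
  have [l0 /andP[Il0 tl0]|none] := pickP (fun l => I l && (t l < 0)).
    have wl0 := zneg _ Il0 tl0.
    rewrite (bigD1 l0) /=; last first.
      rewrite Il0 /=; apply/andP; split; apply: contraTneq tl0 => ->; rewrite -leNgt.
        by rewrite /t ltW.
      by rewrite /t wj -scaler_nat bformZl mulr_ge0// ltW.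
    rewrite /t wl0 bformNl lerDl sumr_ge0// => l /andP[/andP[/andP[Il _] _] ll0].
    rewrite leNgt; apply/negP => /(zneg _ Il) wl; move/eqP: ll0; apply.
    by apply: root_mult1; rewrite wl ?wl0// oppr_eq0.
  apply: (@le_trans _ _ 0); first by rewrite oppr_le0 ltW.
  apply: sumr_ge0 => l /andP[/andP[Il _] _].
  by rewrite leNgt; have := none l; rewrite Il /= => ->.
move: S0; rewrite (bigD1 i) //= (bigD1 j) /=; last by rewrite Ij.
have -> : t i = bform B (wt i) (wt i) by [].
rewrite (tz j k%:R) ?wj ?scaler_nat// => S0.
have : (2%:R : R) <= k%:R by rewrite ler_nat.
move: rest S0; set S := \sum_(l | _) _ => rest S0 k2'.
have : 2 * bform B (wt i) (wt i) <= k%:R * bform B (wt i) (wt i) by rewrite ler_pM2r.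
lra.
Qed.

End Roots.

Lemma mx_scAr (F : fieldType) d (k : F) (M N : 'M[F]_d) : M * (k *: N) = k *: (M * N).
Proof. by rewrite -[LHS]/(M *m _) -scalemxAr. Qed.

Lemma mx_scAl (F : fieldType) d (k : F) (M N : 'M[F]_d) : (k *: M) * N = k *: (M * N).
Proof. by rewrite -[LHS]/(_ *m N) -scalemxAl. Qed.

(** * Weights, Casimir element and complete reducibility *)

Section MatrixExp.
Context {F : fieldType} {d : nat}.
Hypothesis charF : forall k : nat, (k.+1%:R : F) != 0.
Implicit Types A X : 'M[F]_d.

(** The truncated series, which is the exponential as soon as [A ^+ K = 0]. *)
Definition mexp K A : 'M[F]_d := \sum_(k < K) (k`!%:R : F)^-1 *: A ^+ k.

Let fact_neq0 k : (k`!%:R : F) != 0.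
Proof. by rewrite -(prednK (fact_gt0 k)). Qed.

Lemma pow_commutator A X X1 X2 : A * X = X * A + X1 -> A * X1 = X1 * A + X2 -> A * X2 = X2 * A ->
  forall k, A ^+ k.+2 * X = X * A ^+ k.+2 + (k.+2%:R : F) *: (X1 * A ^+ k.+1) +
    ((k.+2%:R : F) * k.+1%:R / 2) *: (X2 * A ^+ k).
Proof.
move=> AX AX1 AX2.
have two : (2 : F) != 0 := charF 1.
elim=> [|k IH].
  rewrite expr2 -mulrA AX mulrDr mulrA AX mulrDl AX1 expr1 expr0 mulr1 mulrA.
  rewrite mulr1 mulfV// scale1r -!addrA; congr (_ + _).
  by rewrite addrA -mulr2n scaler_nat.
have e1 : A * (X * A ^+ k.+2) = X * A ^+ k.+3 + X1 * A ^+ k.+2.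
  by rewrite mulrA AX mulrDl -mulrA -exprS.
have e2 : A * (X1 * A ^+ k.+1) = X1 * A ^+ k.+2 + X2 * A ^+ k.+1.
  by rewrite mulrA AX1 mulrDl -mulrA -exprS.
have e3 : A * (X2 * A ^+ k) = X2 * A ^+ k.+1 by rewrite mulrA AX2 -mulrA -exprS.
rewrite exprS -mulrA IH 2!mulrDr !mx_scAr e1 e2 e3.
move: (X * A ^+ k.+3) (X1 * A ^+ k.+2) (X2 * A ^+ k.+1) => P Q T.
apply/matrixP => i j; rewrite !mxE -[k.+3%:R]natr1 -[k.+2%:R]natr1 -[k.+1%:R]natr1; field.
exact: two.
Qed.

(** Conjugation by exp(A) is exp(ad A), which stops after the quadratic term because the third
    iterated bracket of A with X vanishes. Here [X1] and [X2] are the first two brackets. *)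
Lemma mexp_commutator K A X X1 X2 : A ^+ K = 0 ->
  A * X = X * A + X1 -> A * X1 = X1 * A + X2 -> A * X2 = X2 * A ->
  mexp K A * X = (X + X1 + (2 : F)^-1 *: X2) * mexp K A.
Proof.
move=> AK AX AX1 AX2.
have two : (2 : F) != 0 := charF 1.
have AKn k : (K <= k)%N -> A ^+ k = 0.
  by move=> Kk; rewrite -(subnK Kk) exprD AK mulr0.
have ext k : mexp (k + K) A = mexp K A.
  by elim: k => //= k IH; rewrite addSn /mexp big_ord_recr /= AKn ?leq_addl// scaler0 addr0.
have key k : mexp k.+2 A * X = X * mexp k.+2 A + X1 * mexp k.+1 A + (2 : F)^-1 *: (X2 * mexp k A).
  elim: k => [|k IH].
    rewrite /mexp !big_ord_recr !big_ord0 /= !add0r !fact0 factS fact0 muln1 !invr1 !scale1r.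
    by rewrite expr0 expr1 mulrDl mulrDr !mulr1 mul1r mulr0 scaler0 addr0 AX addrA.
  have E j : mexp j.+1 A = mexp j A + (j`!%:R : F)^-1 *: A ^+ j by rewrite /mexp big_ord_recr.
  rewrite (E k.+2) [in X1 * _](E k.+1) [in X2 * _](E k).
  rewrite mulrDl IH !mulrDr !mx_scAl !mx_scAr (pow_commutator AX AX1 AX2) !scalerDr !scalerA.
  have -> : (k.+2`!%:R : F)^-1 * k.+2%:R = (k.+1`!%:R)^-1.
    by rewrite factS natrM invfM mulrC mulrA mulfV ?charF// mul1r.
  have -> : (k.+2`!%:R : F)^-1 * (k.+2%:R * k.+1%:R / 2) = 2^-1 * (k`!%:R)^-1.
    have H (a b c : F) : a != 0 -> b != 0 -> c != 0 -> (a * (b * c))^-1 * (a * b / 2) = 2^-1 * c^-1.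
      by move=> a0 b0 c0; field; rewrite a0 b0 c0 two.
    by rewrite !factS !natrM H.
  set u1 := X * mexp k.+2 A; set u2 := X1 * mexp k.+1 A; set u3 := _ *: (X2 * mexp k A).
  set v1 := _ *: (X * _); set v2 := _ *: (X1 * _); set v3 := _ *: (X2 * _).
  by rewrite addrACA [u1 + u2 + _]addrACA.
have := key K; rewrite -[K.+2]add2n -[K.+1]add1n !ext => ->.
by rewrite !mulrDl -mx_scAl.
Qed.

Lemma mexp_unit K A : A ^+ K = 0 -> mexp K A \in unitmx.
Proof.
case: K => [|K] AK.
  have d0 (u v : 'M[F]_d) : u = v.
    by rewrite -[u]mulr1 -[v]mulr1 -[1](expr0 A) AK !mulr0.
  by rewrite (d0 (mexp 0 A) 1%:M) unitmx1.
pose C := \sum_(k < K) (k.+1`!%:R : F)^-1 *: A ^+ k.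
have ME : mexp K.+1 A = 1 - (- (A * C)).
  rewrite opprK /mexp big_ord_recl fact0 invr1 scale1r expr0; congr (_ + _).
  by rewrite mulr_sumr; apply: eq_bigr => k _; rewrite mx_scAr -exprS.
have AC : GRing.comm A C.
  rewrite /GRing.comm mulr_sumr mulr_suml; apply: eq_bigr => k _.
  by rewrite mx_scAr mx_scAl -exprS -exprSr.
have NK : (- (A * C)) ^+ K.+1 = 0.
  by rewrite exprNn exprMn_comm// AK mul0r mulr0.
have U : mexp K.+1 A * (\sum_(i < K.+1) (- (A * C)) ^+ i) = 1.
  by rewrite ME -opprB mulNr -subrX1 NK sub0r opprK.
by have [] := mulmx1_unit U.
Qed.

End MatrixExp.

(** An invertible matrix with nonzero entries only between equal labels is block diagonal, and its
    blocks must be square: both counts are traces of S times its inverse restricted to one label. *)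
Lemma unitmx_count (F : fieldType) d (S : 'M[F]_d) (T : eqType) (f k : 'I_d -> T) (mu : T) :
  (forall j : nat, (j.+1%:R : F) != 0) -> S \in unitmx ->
  (forall j l, S j l != 0 -> f j = k l) -> #|[pred j | f j == mu]| = #|[pred l | k l == mu]|.
Proof.
move=> charF Su SE.
have E (c : {pred 'I_d}) (M : 'M[F]_d) : M = 1%:M -> (#|c|%:R : F) = \sum_(j | c j) M j j.
  move=> ->; rewrite -sum1_card natr_sum; apply: eq_bigr => j _; by rewrite mxE eqxx.
have inj (a b : nat) : (a%:R : F) = b%:R -> a = b.
  wlog ab : a b / (a <= b)%N.
    by move=> H; case/orP: (leq_total a b) => ab E'; [apply: H|apply/esym/H].
  move=> abE; apply/eqP; rewrite eqn_leq ab leqNgt; apply/negP => lt.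
  have := charF (b - a).-1; rewrite prednK ?subn_gt0// natrB ?(ltnW lt)//.
  by rewrite abE subrr eqxx.
apply: inj; rewrite (E _ _ (mulmxV Su)) [RHS](E _ _ (mulVmx Su)).
transitivity (\sum_(j | f j == mu) \sum_(l | k l == mu) S j l * invmx S l j).
  apply: eq_bigr => j /eqP fj; rewrite mxE [RHS]big_mkcond; apply: eq_bigr => l _.
  case: ifPn => // /eqP kl; have [->|/SE fk] := eqVneq (S j l) 0; first by rewrite mul0r.
  by case: kl; rewrite -fk.
rewrite exchange_big; apply: eq_bigr => l /eqP kl; rewrite mxE [LHS]big_mkcond; apply: eq_bigr => j _.
case: ifPn => [_|/eqP fj]; first by rewrite mulrC.
have [->|/SE fk] := eqVneq (S j l) 0; first by rewrite mulr0.
by case: fj; rewrite fk.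
Qed.

Lemma vsvalZ (F : fieldType) (g : vectType F) (h : {vspace g}) k (t : subvs_of h) :
  vsval (k *: t) = k *: vsval t.
Proof. exact: linearZ. Qed.

Lemma vsvalB (F : fieldType) (g : vectType F) (h : {vspace g}) (t t' : subvs_of h) :
  vsval (t - t') = vsval t - vsval t'.
Proof. exact: linearB. Qed.

Section Weights.
Context {R : realFieldType} {F : fieldType} {iota : {rmorphism R -> F}}
  {g : lieAlgebraType F} {h : {vspace g}} {r : nat}.
Variable alpha : r.-tuple (cartan_dual h).
Hypothesis g_simple : simple_lie_algebra g.
Hypothesis h_cartan : cartan_subalgebra h.
Hypothesis alpha_simple : simple_roots alpha.
Local Notation n := (\dim {:g}).
Local Notation rc := (rcomb iota alpha).
Local Notation kd a := (killing_dual (rc a)).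
Variables (e : n.-tuple g) (wt : 'I_n -> 'rV[R]_r).
Hypothesis be : basis_of fullv e.
Hypothesis we : forall i, in_root_space (rc (wt i)) (tnth e i).
Hypothesis wint : forall i, nat_vec (wt i) \/ nat_vec (- wt i).
Variable y : 'I_n -> g.
Hypothesis ey : forall i j : 'I_n, killing (tnth e i) (y j) = (i == j)%:R.
Hypothesis yw : forall j, in_root_space (rc (- wt j)) (y j).
Hypothesis eE : forall z, z = \sum_(i < n) killing z (y i) *: tnth e i.
Hypothesis yE : forall z, z = \sum_(i < n) killing z (tnth e i) *: y i.
Variable B : 'M[R]_r.
Hypothesis Bsym : B^T = B.
Hypothesis BE : forall a b, rc a (kd b) = iota (bform B a b) :> F.
Hypothesis Bpos : forall a, a != 0 -> 0 < bform B a a.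

Definition refl_root a x : 'rV[R]_r := x - (2 * bform B x a / bform B a a) *: a.

Let charF k : (k.+1%:R : F) != 0.
Proof. by rewrite -(rmorph_nat iota) fmorph_eq0 pnatr_eq0. Qed.

Section OneRep.
Variables (V : lierep g) (wV : 'I_(rdim V) -> 'rV[R]_r).
Hypothesis Vd : diag_rep iota alpha wV.
Local Notation d := (rdim V).

Lemma pow_actE x k v : pow_act x k v = (V x : 'M[F]_d) ^+ k *m v.
Proof.
elim: k => [|k IH]; first by rewrite expr0 mul1mx.
by rewrite /= -/(pow_act x k v) IH exprS -mulmxA.
Qed.

Lemma root_vec_nilpotent a x : a != 0 -> in_root_space (rc a) x ->
  exists K, (V x : 'M[F]_d) ^+ K = 0.
Proof.
move=> a0 xa.
have P l : exists k, (V x : 'M[F]_d) ^+ k *m delta_mx l (0 : 'I_1) = 0.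
  have wl : weight_vec (V := V) wV (wV l) (delta_mx l 0).
    by move=> j; have [->//|/negPf jl] := eqVneq j l; rewrite mxE jl /= mulr0n eqxx.
  by have [k kE] := pow_act_eq0 alpha_simple Vd a0 xa wl; exists k; rewrite -pow_actE.
have [k kE] := choice P; exists (\max_l k l); apply/matrixP => j l; rewrite mxE.
have kl : (k l <= \max_l k l)%N by exact: leq_bigmax.
have /matrixP/(_ j 0) : (V x : 'M[F]_d) ^+ (\max_l k l) *m delta_mx l (0 : 'I_1) = 0.
  by rewrite -(subnK kl) exprD -mulmxA kE mulmx0.
by rewrite -colE !mxE.
Qed.

(* The root reflection is realized by exp(e) exp(-f) exp(e) for an sl2-triple. *)
Lemma weight_count_refl i mu : wt i != 0 ->
  #|[pred j | wV j == refl_root (wt i) mu]| = #|[pred j | wV j == mu]|.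
Proof.
move=> wi0; set a := wt i; have s0 := Bpos wi0; rewrite -/a in s0.
pose s := bform B a a; have sF : iota s != 0 by rewrite fmorph_eq0 gt_eqF.
pose h' : subvs_of h := (2 / iota s) *: kd a.
pose yy : g := (2 / iota s) *: y i.
have xyh : lie (tnth e i) yy = vsval h'.
  rewrite /yy linearZ /= (lie_dual_root g_simple h_cartan alpha_simple be we ey yw).
  first [by rewrite /h' (linearZ (vsval (U := h)))|exact: (esym (linearZ _ _))|by rewrite /h' linearZ_LR|by rewrite /h' raddfZ].
have ah' : rc a h' = 2 :> F.
  by rewrite /h' linearZ /= BE -[_ *: _]/(_ * _) divfK.
have yya : in_root_space (rc (- a)) yy.
  by move=> H; rewrite /yy linearZ /= yw !scalerA mulrC.
pose X : 'M[F]_d := V (tnth e i); pose Y : 'M[F]_d := V yy; pose Hm : 'M[F]_d := V (vsval h').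
have HX (H : subvs_of h) : (V (vsval H) : 'M[F]_d) * X = X * V (vsval H) + (rc a H : F) *: X.
  by apply/eqP; rewrite addrC -subr_eq -[_ - _]rmx_lie we linearZ.
have HY (H : subvs_of h) : (V (vsval H) : 'M[F]_d) * Y = Y * V (vsval H) - (rc a H : F) *: Y.
  apply/eqP; rewrite addrC -subr_eq -[_ - _]rmx_lie yya linearZ /=.
  by rewrite rcombN lfunE /= scaleNr.
have XY : X * Y = Y * X + Hm.
  by apply/eqP; rewrite addrC -subr_eq -[_ - _]rmx_lie xyh.
have [K1 XK] := root_vec_nilpotent wi0 (@we i).
have [K2 YK] : exists K, Y ^+ K = 0 by apply: root_vec_nilpotent yya; rewrite oppr_eq0.
pose K := (K1 + K2)%N.
have {}XK : X ^+ K = 0 by rewrite exprD XK mul0r.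
have {}YK : (- Y) ^+ K = 0 by rewrite exprNn [Y ^+ _]exprD YK !mulr0.
pose E := mexp K X; pose G := mexp K (- Y).
have EH H : E * V (vsval H) = (V (vsval H) - (rc a H : F) *: X) * E.
  rewrite (@mexp_commutator _ _ charF K X _ (- ((rc a H : F) *: X)) 0)//.
  - by rewrite scaler0 addr0.
  - by rewrite HX addrK.
  - by rewrite addr0 mulrN mulNr mx_scAr mx_scAl.
  - by rewrite mulr0 mul0r.
have EX : E * X = X * E.
  rewrite (@mexp_commutator _ _ charF K X _ 0 0)// ?scaler0 ?addr0//.
  - by rewrite mulr0 mul0r.
  - by rewrite mulr0 mul0r.
have GH H : G * V (vsval H) = (V (vsval H) - (rc a H : F) *: Y) * G.
  rewrite (@mexp_commutator _ _ charF K (- Y) _ (- ((rc a H : F) *: Y)) 0)//.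
  - by rewrite scaler0 addr0.
  - by rewrite mulrN mulNr HY opprB addrAC subrr add0r.
  - by rewrite addr0 !mulrN !mulNr mx_scAr mx_scAl.
  - by rewrite mulr0 mul0r.
have GX : G * X = (X + Hm - Y) * G.
  rewrite (@mexp_commutator _ _ charF K (- Y) _ Hm (- (2 *: Y)))//.
  - by rewrite scalerN scalerA mulVf ?scale1r//; exact: (charF 1).
  - by rewrite mulrN mulNr XY opprD subrK.
  - by rewrite mulrN mulNr /Hm HY ah' opprB addrAC subrr add0r.
  - by rewrite !mulrN !mulNr mx_scAr mx_scAl.
pose S := E * G * E.
have Su : S \in unitmx by rewrite !unitmx_mul !mexp_unit.
have SH H : S * V (vsval H) = V (vsval (H - (rc a H : F) *: h')) * S.
  have EHm : E * Hm = (Hm - 2 *: X) * E by rewrite /Hm EH ah'.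
  have step1 : G * (V (vsval H) - (rc a H : F) *: X) =
      (V (vsval H) - (rc a H : F) *: X - (rc a H : F) *: Hm) * G.
    rewrite mulrBr mx_scAr GH GX -mx_scAl -mulrBl; congr (_ * _).
    apply/matrixP => j l; rewrite !mxE; ring.
  have step2 : E * (V (vsval H) - (rc a H : F) *: X - (rc a H : F) *: Hm) =
      (V (vsval H) - (rc a H : F) *: Hm) * E.
    rewrite !mulrBr !mx_scAr EH EX EHm -!mx_scAl -!mulrBl; congr (_ * _).
    apply/matrixP => j l; rewrite !mxE; ring.
  rewrite /S -mulrA EH mulrA -[E * G * _]mulrA step1 mulrA step2 -!mulrA.
  rewrite vsvalB vsvalZ; congr (_ * _).
  transitivity (V (- (rc a H : F) *: vsval h' + vsval H)); last by rewrite scaleNr addrC.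
  by rewrite rmx_linear scaleNr addrC.
clearbody S.
apply/esym; rewrite -(@unitmx_count _ _ S _ (fun j => refl_root a (wV j)) wV mu charF Su).
  apply: eq_card => j; rewrite !inE.
  have RK x : refl_root a (refl_root a x) = x.
    rewrite /refl_root bformDl bformNl bformZl -addrA -opprD -scalerDl.
    rewrite [X in X *: a](_ : _ = 0) ?scale0r ?subr0//.
    by field; rewrite gt_eqF.
  by apply/eqP/eqP => [<-|->]; rewrite RK.
move=> j l Sjl; apply: (rcomb_inj (iota := iota) alpha_simple); apply/lfunP => H.
have /matrixP/(_ j l) := SH H.
rewrite Vd Vd -[_ * diag_mx _]/(_ *m _) -[diag_mx _ * _]/(_ *m _) mul_mx_diag mul_diag_mx !mxE.
move=> E0; have E1 : rc (wV l) H = rc (wV j) (H - (rc a H : F) *: h') :> F.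
  by apply: (mulfI Sjl); rewrite E0 mulrC.
have hj : rc (wV j) h' = 2 / iota s * iota (bform B (wV j) a) :> F.
  by rewrite /h' linearZ /= BE.
have E2 : rc (wV j) (H - (rc a H : F) *: h') = rc (wV j) H - rc a H * rc (wV j) h' :> F.
  by rewrite linearB linearZ.
apply: (etrans _ (esym E1)); rewrite E2 hj /refl_root -scaleNr rcombDE rcombZE.
rewrite rmorphN !rmorphM fmorphV rmorph_nat -/s.
by field.
Qed.

End OneRep.
End Weights.

Section TraceDefect.
Context {F : fieldType} {g : lieAlgebraType F}.

Definition trace_defect (V : lierep g) (k : F) (z x : g) : F^o :=
  \tr (V z *m V x) - k * killing z x.

Fact trace_defect_linear V k z : linear (trace_defect V k z).
Proof.
move=> c u v; rewrite /trace_defect linearP mulmxDr -scalemxAr linearD linearZ /=.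
rewrite ![killing z _]killingC killingDl killingZl -[c *: _]/(c * _); ring.
Qed.

HB.instance Definition _ V k z := GRing.isSemilinear.Build F g F^o _ (trace_defect V k z)
  (GRing.semilinear_linear (trace_defect_linear V k z)).

End TraceDefect.

(** * The Casimir element and traces on weight spaces *)

Section Casimir.
Context {R : realFieldType} {F : fieldType} {iota : {rmorphism R -> F}}
  {g : lieAlgebraType F} {h : {vspace g}} {r : nat}.
Variable alpha : r.-tuple (cartan_dual h).
Hypothesis g_simple : simple_lie_algebra g.
Hypothesis h_cartan : cartan_subalgebra h.
Hypothesis alpha_simple : simple_roots alpha.
Local Notation n := (\dim {:g}).
Local Notation rc := (rcomb iota alpha).
Local Notation kd a := (killing_dual (rc a)).
Variables (e : n.-tuple g) (wt : 'I_n -> 'rV[R]_r).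
Hypothesis be : basis_of fullv e.
Hypothesis we : forall i, in_root_space (rc (wt i)) (tnth e i).
Hypothesis wint : forall i, nat_vec (wt i) \/ nat_vec (- wt i).
Variable y : 'I_n -> g.
Hypothesis ey : forall i j : 'I_n, killing (tnth e i) (y j) = (i == j)%:R.
Hypothesis yw : forall j, in_root_space (rc (- wt j)) (y j).
Hypothesis eE : forall z, z = \sum_(i < n) killing z (y i) *: tnth e i.
Hypothesis yE : forall z, z = \sum_(i < n) killing z (tnth e i) *: y i.
Variable B : 'M[R]_r.
Hypothesis Bsym : B^T = B.
Hypothesis BE : forall a b, rc a (kd b) = iota (bform B a b) :> F.
Hypothesis Bpos : forall a, a != 0 -> 0 < bform B a a.

Definition pos_vec (a : 'rV[R]_r) := (a != 0) && [forall b, 0 <= a 0 b].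

Lemma wt_trichotomy i : [\/ wt i = 0, pos_vec (wt i) | pos_vec (- wt i)].
Proof.
have [w0|w0] := eqVneq (wt i) 0; first by constructor 1.
case: (wint i) => wi; [constructor 2|constructor 3]; rewrite /pos_vec ?oppr_eq0 w0 /=;
  by apply/forallP => b; have [k ->] := wi b; rewrite ler0n.
Qed.

Lemma pos_vecN a : pos_vec a -> pos_vec (- a) = false.
Proof.
move=> /andP[a0 /forallP ap]; apply/negP => /andP[_ /forallP an].
move/eqP: a0; apply; apply/rowP => b; rewrite mxE; apply/eqP.
by rewrite eq_le ap andbT; have := an b; rewrite mxE oppr_ge0.
Qed.

Lemma killing_weights i j : killing (tnth e i) (tnth e j) != 0 -> wt i = - wt j.
Proof.
move=> k0; have := killing_root_space (@we i) (@we j) k0.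
rewrite -rcombD -(rcomb0 iota alpha) => /(rcomb_inj alpha_simple) /eqP.
by rewrite addr_eq0 => /eqP.
Qed.

Section OneRep.
Variable V : lierep g.

(** The Casimir element may be computed in any pair of dual bases: the change-of-basis matrices
    express the inverse Gram matrix as Q^T P. *)
Lemma casimir_dual : casimir V = \sum_i V (tnth e i) *m V (y i).
Proof.
set b := vbasis {:g}; have bb : basis_of fullv b := vbasisP _.
pose P : 'M[F]_n := \matrix_(i, k) coord b k (tnth e i).
pose Q : 'M[F]_n := \matrix_(i, k) coord b k (y i).
have bs z : z = \sum_(k < n) coord b k z *: b`_k by rewrite {1}(coord_basis bb (memvf z)).
have PGQ : P *m @killing_gram _ g *m Q^T = 1%:M.
  apply/matrixP => i j; rewrite [RHS]mxE -ey [in RHS](bs (tnth e i)) [in RHS](bs (y j)).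
  rewrite killing_sumr mxE; apply: eq_bigr => l _.
  rewrite killingZr killing_suml [in LHS]mxE mulr_suml mulr_sumr; apply: eq_bigr => k _.
  have -> : P i k = coord b k (tnth e i) by rewrite mxE.
  have -> : Q^T l j = coord b l (y j) by rewrite !mxE.
  have -> : @killing_gram _ g k l = killing b`_k b`_l by rewrite mxE.
  by rewrite killingZl; ring.
have QP : Q^T *m P = invmx (@killing_gram _ g).
  have Gu : @killing_gram _ g \in unitmx.
    by have [] := mulmx1_unit PGQ; rewrite unitmx_mul => /andP[].
  have E : Q^T *m P *m @killing_gram _ g = 1%:M.
    by rewrite -mulmxA; apply: mulmx1C.
  by rewrite -[LHS]mulmx1 -(mulmxV Gu) mulmxA E mul1mx.
have Gsym : (@killing_gram _ g)^T = killing_gram.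
  by apply/matrixP => i j; rewrite !mxE killingC.
have PQ k l : invmx (@killing_gram _ g) k l = \sum_i P i k * Q i l.
  have -> : invmx (@killing_gram _ g) k l = invmx (@killing_gram _ g) l k.
    by rewrite -[in LHS]Gsym -trmx_inv mxE.
  by rewrite -QP mxE; apply: eq_bigr => i _; rewrite [Q^T _ _]mxE mulrC.
rewrite /casimir -/b.
under eq_bigr => k _ do under eq_bigr => l _ do rewrite PQ scaler_suml.
under eq_bigr => k _ do rewrite exchange_big.
rewrite exchange_big; apply: eq_bigr => i _ /=.
have VE z : V z = \sum_(k < n) coord b k z *: V b`_k.
  by rewrite {1}(bs z) linear_sum; apply: eq_bigr => k _; rewrite linearZ.
rewrite (VE (tnth e i)) (VE (y i)) mulmx_suml.
apply: eq_bigr => k _; rewrite mulmx_sumr; apply: eq_bigr => l _.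
by rewrite -scalemxAl -scalemxAr scalerA !mxE.
Qed.

(** The terms of negative weight are expanded again in the dual basis, which rewrites them as y_k
    e_k over the positive weights. *)
Lemma casimir_decomp : casimir V = \sum_(i | wt i == 0) V (tnth e i) *m V (y i) +
  \sum_(i | pos_vec (wt i)) (V (tnth e i) *m V (y i) + V (y i) *m V (tnth e i)).
Proof.
rewrite casimir_dual (bigID (fun i => wt i == 0)) /=; congr (_ + _).
rewrite (bigID (fun i => pos_vec (wt i))) /= big_split /=; congr (_ + _).
  by apply: eq_bigl => i; rewrite /pos_vec; case: eqP.
rewrite (eq_bigl (fun i => pos_vec (- wt i))); last first.
  move=> i; case: (wt_trichotomy i) => [->|wi|wi].
  - by rewrite eqxx oppr0 /pos_vec eqxx.
  - by rewrite (pos_vecN wi) wi andbF.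
  - rewrite wi -[wt i]opprK (pos_vecN wi) andbT; have [w0 _] := andP wi.
    by rewrite opprK -oppr_eq0.
transitivity (\sum_(i | pos_vec (- wt i)) \sum_(k | pos_vec (wt k))
    killing (tnth e i) (tnth e k) *: (V (y k) *m V (y i))).
  apply: eq_bigr => i wi; rewrite {1}(yE (tnth e i)) linear_sum mulmx_suml.
  rewrite [RHS]big_mkcond; apply: eq_bigr => k _; case: ifPn => wk.
    by rewrite linearZ /= -scalemxAl.
  have [->|/killing_weights wik] := eqVneq (killing (tnth e i) (tnth e k)) 0.
    by rewrite scale0r linear0 mul0mx.
  by move: wi wk; rewrite wik opprK => ->.
rewrite exchange_big; apply: eq_bigr => k wk.
rewrite [in RHS](yE (tnth e k)) linear_sum mulmx_sumr [LHS]big_mkcond; apply: eq_bigr => i _.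
rewrite killingC; case: ifPn => wi; first by rewrite linearZ /= -scalemxAr.
have [->|/killing_weights wik] := eqVneq (killing (tnth e k) (tnth e i)) 0.
  by rewrite scale0r linear0 mulmx0.
by move: wi wk; rewrite wik => /negP.
Qed.

(** The commutator is a double sum whose coefficients cancel in pairs by invariance of the Killing
    form. *)
Lemma casimir_comm z : V z *m casimir V = casimir V *m V z.
Proof.
rewrite casimir_dual mulmx_sumr mulmx_suml; apply/eqP; rewrite -subr_eq0 -sumrB; apply/eqP.
have E i : V z *m (V (tnth e i) *m V (y i)) - V (tnth e i) *m V (y i) *m V z =
    V (lie z (tnth e i)) *m V (y i) + V (tnth e i) *m V (lie z (y i)).
  rewrite !rmx_lie mulmxBl mulmxBr !mulmxA addrA subrK.
  by [].
under eq_bigr do rewrite E.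
rewrite big_split /=.
have -> : \sum_i V (lie z (tnth e i)) *m V (y i) =
    \sum_i \sum_j killing (lie z (tnth e i)) (y j) *: (V (tnth e j) *m V (y i)).
  apply: eq_bigr => i _; rewrite {1}(eE (lie z (tnth e i))) linear_sum mulmx_suml.
  by apply: eq_bigr => j _; rewrite linearZ /= -scalemxAl.
have -> : \sum_i V (tnth e i) *m V (lie z (y i)) =
    \sum_i \sum_j killing (lie z (y i)) (tnth e j) *: (V (tnth e i) *m V (y j)).
  apply: eq_bigr => i _; rewrite {1}(yE (lie z (y i))) linear_sum mulmx_sumr.
  by apply: eq_bigr => j _; rewrite linearZ /= -scalemxAr.
rewrite exchange_big -big_split big1// => i _; rewrite -big_split big1// => j _ /=.
rewrite -scalerDl; have -> : killing (lie z (tnth e j)) (y i) = - killing (lie z (y i)) (tnth e j).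
  by rewrite lieC -scaleN1r killingZl killing_inv killingC mulN1r.
by rewrite addNr scale0r.
Qed.

Lemma cartan_form mu : \sum_(i | wt i == 0) (rc mu (vsproj h (tnth e i)) : F) * rc mu (vsproj h (y i)) =
  iota (bform B mu mu).
Proof.
rewrite -BE -(killing_kd g_simple h_cartan alpha_simple be we).
have E : kd mu = \sum_(i | wt i == 0) (rc mu (vsproj h (y i)) : F) *: vsproj h (tnth e i).
  apply: subvs_inj; rewrite linear_sum {1}(eE (vsval (kd mu))) [RHS]big_mkcond.
  apply: eq_bigr => i _; case: ifPn => [/eqP wi|wi].
    have eh := wt0_cartan h_cartan we wi.
    have yh : y i \in h.
      by apply: (root_space0 h_cartan); rewrite -(rcomb0 iota alpha) -oppr0 -wi; exact: yw.
    rewrite linearZ /= vsprojK//; congr (_ *: _).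
    by rewrite -{1}(vsprojK yh) (killing_dualP g_simple h_cartan alpha_simple be we).
  have [->|k0] := eqVneq (killing (vsval (kd mu)) (y i)) 0; first by rewrite scale0r.
  have := killing_root_space (root_space_cartan h_cartan (subvsP (kd mu))) (@yw i) k0.
  rewrite add0r -(rcomb0 iota alpha) => /(rcomb_inj alpha_simple)/eqP.
  by rewrite oppr_eq0 (negPf wi).
rewrite {2}E linear_sum killing_sumr; apply: eq_bigr => i wi.
rewrite linearZ /= killingZr (killing_dualP g_simple h_cartan alpha_simple be we).
by rewrite mulrC.
Qed.

Variable wV : 'I_(rdim V) -> 'rV[R]_r.
Hypothesis Vd : diag_rep iota alpha wV.

Definition two_rho : 'rV[R]_r := \sum_(i | pos_vec (wt i)) wt i.

(** Modulo [K] the raising operators kill v, so e_i y_i + y_i e_i reduces to the bracket, which acts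
    by (mu, wt i); the sum over positive roots gives the term with 2 rho. *)
Lemma casimir_max_vec (K : {vspace 'cV[F]_(rdim V)}) mu v :
  (forall x u, u \in K -> V x *m u \in K) -> weight_vec wV mu v ->
  (forall i, pos_vec (wt i) -> V (tnth e i) *m v \in K) ->
  casimir V *m v - iota (bform B mu (mu + two_rho)) *: v \in K.
Proof.
move=> KV vmu vK; rewrite casimir_decomp mulmxDl bformDr rmorphD scalerDl opprD addrACA.
rewrite [X in X + _](_ : _ = 0) ?add0r.
  rewrite mulmx_suml /two_rho bform_sumr rmorph_sum scaler_suml -sumrB.
  apply: memv_suml => i wi; rewrite mulmxDl -!mulmxA.
  have -> : V (tnth e i) *m (V (y i) *m v) = V (y i) *m (V (tnth e i) *m v) + V (vsval (kd (wt i))) *m v.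
    rewrite -(lie_dual_root g_simple h_cartan alpha_simple be we ey yw) rmx_lie mulmxBl !mulmxA.
    by rewrite addrC subrK.
  rewrite (weight_vec_cartan Vd _ vmu) BE addrAC addrK.
  by apply: memvD; apply: KV; apply: vK.
rewrite mulmx_suml -cartan_form scaler_suml -sumrB big1// => i /eqP wi.
have eh := wt0_cartan h_cartan we wi.
have yh : y i \in h.
  by apply: (root_space0 h_cartan); rewrite -(rcomb0 iota alpha) -oppr0 -wi; exact: yw.
rewrite -mulmxA -{1}(vsprojK yh) (weight_vec_cartan Vd _ vmu) -scalemxAr -{1}(vsprojK eh).
by rewrite (weight_vec_cartan Vd _ vmu) scalerA mulrC subrr.
Qed.

Definition weight_trace (A : 'M[F]_(rdim V)) mu : F := \sum_(j | wV j == mu) A j j.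

Lemma weight_trace_shift a x x' mu : in_root_space (rc a) x -> in_root_space (rc (- a)) x' ->
  weight_trace (V x' *m V x) mu = weight_trace (V x *m V x') (mu + a).
Proof.
move=> xa xa'; rewrite /weight_trace.
transitivity (\sum_(j | wV j == mu) \sum_(l | wV l == mu + a) V x' j l * V x l j).
  apply: eq_bigr => j /eqP wj; rewrite mxE [RHS]big_mkcond; apply: eq_bigr => l _.
  case: ifPn => // /eqP wl; have [->|/(diag_rep_shift Vd alpha_simple xa) wlj] := eqVneq (V x l j) 0.
    by rewrite mulr0.
  by case: wl; rewrite wlj wj.
rewrite exchange_big; apply: eq_bigr => l /eqP wl; rewrite mxE [LHS]big_mkcond; apply: eq_bigr => j _.
case: ifPn => [_|/eqP wj]; first by rewrite mulrC.
have [->|/(diag_rep_shift Vd alpha_simple xa) wlj] := eqVneq (V x l j) 0; first by rewrite mul0r.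
by case: wj; apply: (addIr a); rewrite -wlj.
Qed.

(** The trace of [e_i, y_i] on one weight space, combined with cyclicity between neighbouring weight
    spaces. This is the recursion [hT] of the Freudenthal argument; the next lemma supplies [hc]. *)
Lemma weight_trace_commutator i mu :
  weight_trace (V (tnth e i) *m V (y i)) mu - weight_trace (V (tnth e i) *m V (y i)) (mu + wt i) =
  iota (bform B mu (wt i)) * #|[pred j | wV j == mu]|%:R.
Proof.
rewrite -(weight_trace_shift mu (@we i) (@yw i)) /weight_trace -sumrB.
rewrite (eq_bigr (fun j => iota (bform B mu (wt i)))) => [|j /eqP wj].
  by rewrite sumr_const mulr_natr.
have -> : (V (tnth e i) *m V (y i)) j j - (V (y i) *m V (tnth e i)) j j =
    V (lie (tnth e i) (y i)) j j by rewrite rmx_lie !mxE.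
rewrite (lie_dual_root g_simple h_cartan alpha_simple be we ey yw) (diag_repE Vd) eqxx.
by rewrite mulr1n BE wj.
Qed.

Lemma weight_trace_casimir mu : weight_trace (casimir V) mu =
  iota (bform B mu mu) * #|[pred j | wV j == mu]|%:R +
  \sum_(i | pos_vec (wt i)) (weight_trace (V (tnth e i) *m V (y i)) mu +
                             weight_trace (V (tnth e i) *m V (y i)) (mu + wt i)).
Proof.
have wtD A A' nu : weight_trace (A + A') nu = weight_trace A nu + weight_trace A' nu.
  by rewrite /weight_trace -big_split; apply: eq_bigr => j _; rewrite mxE.
have wt_sum (P : pred 'I_n) (A : 'I_n -> 'M[F]_(rdim V)) nu :
    weight_trace (\sum_(i | P i) A i) nu = \sum_(i | P i) weight_trace (A i) nu.
  rewrite /weight_trace exchange_big; apply: eq_bigr => j _; by rewrite summxE.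
rewrite casimir_decomp wtD !wt_sum; congr (_ + _); last first.
  apply: eq_bigr => i wi; rewrite wtD; congr (_ + _).
  by rewrite (weight_trace_shift mu (@we i) (@yw i)).
transitivity (\sum_(j | wV j == mu) iota (bform B mu mu)); last by rewrite sumr_const mulr_natr.
rewrite exchange_big; apply: eq_bigr => j /eqP wj; rewrite -cartan_form; apply: eq_bigr => i /eqP wi.
have eh := wt0_cartan h_cartan we wi.
have yh : y i \in h.
  by apply: (root_space0 h_cartan); rewrite -(rcomb0 iota alpha) -oppr0 -wi; exact: yw.
rewrite -{1}(vsprojK eh) -{1}(vsprojK yh) Vd mul_diag_mx !mxE (diag_repE Vd) eqxx mulr1n.
by rewrite wj.
Qed.

(** For a fixed kappa, the elements on which the trace form is kappa times the Killing form
    constitute an ideal. Choosing kappa from one root vector puts that vector in the ideal, because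
    root spaces are lines, and simplicity does the rest. *)
Lemma trace_form : exists kappa, forall x x', \tr (V x *m V x') = kappa * killing x x'.
Proof.
pose tau (x x' : g) : F := \tr (V x *m V x').
have tauC x x' : tau x x' = tau x' x by rewrite /tau mxtrace_mulC.
have tauDl x x' z : tau (x + x') z = tau x z + tau x' z by rewrite /tau linearD mulmxDl linearD.
have tauZl k x z : tau (k *: x) z = k * tau x z by rewrite /tau linearZ /= -scalemxAl linearZ.
have tau_inv x u z : tau (lie x u) z = tau x (lie u z).
  rewrite /tau !rmx_lie mulmxBl mulmxBr !linearB /= !mulmxA; congr (_ - _) => //.
  by rewrite -(mulmxA (V u)) (mxtrace_mulC (V u)).
have tau_w a b x z : in_root_space (rc a) x -> in_root_space (rc b) z -> tau x z != 0 -> a + b = 0.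
  move=> xa zb; apply: contraNeq => ab; rewrite /tau /mxtrace big1// => j _.
  rewrite mxE big1// => l _; apply/eqP; rewrite mulf_eq0; apply/contraT; rewrite negb_or => /andP[].
  move=> /(diag_rep_shift Vd alpha_simple xa) E1 /(diag_rep_shift Vd alpha_simple zb) E2.
  move: E1; rewrite E2 -addrA => /esym/eqP; rewrite -subr_eq0 addrAC subrr add0r.
  by rewrite addrC (negPf ab).
have [i wi] := wt_neq0 g_simple h_cartan be we.
pose kappa := tau (tnth e i) (y i); exists kappa.
pose I := (\bigcap_(j < n) lker (linfun (trace_defect V kappa (y j))))%VS.
have memI z : z \in I <-> forall u, tau z u = kappa * killing z u.
  rewrite /I memvE; split.
    move=> /subv_bigcapP zI u; rewrite (yE u) killing_sumr.
    have -> : tau z (\sum_(j < n) killing u (tnth e j) *: y j) = \sum_(j < n) killing u (tnth e j) * tau z (y j).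
      rewrite tauC; elim/big_rec2: _ => [|j u1 u2 _ <-].
        by rewrite -(scale0r 0) tauZl mul0r.
      by rewrite tauDl tauZl tauC.
    rewrite mulr_sumr; apply: eq_bigr => j _; rewrite killingZr mulrCA; congr (_ * _).
    have := zI j isT; rewrite -memvE memv_ker.
    by rewrite lfunE /= /trace_defect -/(tau _ _) subr_eq0 tauC killingC => /eqP.
  move=> zt; apply/subv_bigcapP => j _; rewrite -memvE memv_ker.
  by rewrite lfunE /= /trace_defect -/(tau _ _) tauC zt killingC subrr.
have Iid : lie_ideal I.
  move=> u v /memI v0; apply/memI => z.
  rewrite lieC -scaleN1r tauZl killingZl tau_inv v0 killing_inv; ring.
have [_ gs] := g_simple; case: (gs _ Iid) => IE; last first.
  move=> x x'; have /memI H : x \in I by rewrite IE memvf.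
  exact: H.
have eI : tnth e i \in I.
  apply/memI => u; rewrite (yE u) killing_sumr.
  have -> : tau (tnth e i) (\sum_(j < n) killing u (tnth e j) *: y j) =
      \sum_(j < n) killing u (tnth e j) * tau (tnth e i) (y j).
    rewrite tauC; elim/big_rec2: _ => [|j u1 u2 _ <-].
      by rewrite -(scale0r 0) tauZl mul0r.
    by rewrite tauDl tauZl tauC.
  rewrite mulr_sumr; apply: eq_bigr => j _; rewrite killingZr mulrCA; congr (_ * _).
  rewrite ey; case: eqVneq => [<-|ij]; first by rewrite mulr1.
  rewrite mulr0; apply/eqP/negPn/negP => /(tau_w _ _ _ _ (@we i) (@yw j))/eqP.
  rewrite subr_eq0 => /eqP wij; move/eqP: ij; apply.
  exact: (root_mult1 g_simple h_cartan alpha_simple be we ey yw BE Bpos).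
move: eI; rewrite IE memv0 => /eqP ei0.
by have := ey i i; rewrite ei0 -(scale0r 0) killingZl mul0r eqxx => /eqP; rewrite eq_sym oner_eq0.
Qed.

End OneRep.
End Casimir.

Lemma scalerI_col (F : fieldType) d (u : 'cV[F]_d) c c' : u != 0 -> c *: u = c' *: u -> c = c'.
Proof.
move=> u0 /eqP; rewrite -subr_eq0 -scalerBl scaler_eq0 (negPf u0) orbF subr_eq0.
by move/eqP.
Qed.

(** * Maximal vectors, generated submodules and complements *)

Section Submodules.
Context {R : realFieldType} {F : fieldType} {iota : {rmorphism R -> F}}
  {g : lieAlgebraType F} {h : {vspace g}} {r : nat}.
Variable alpha : r.-tuple (cartan_dual h).
Hypothesis g_simple : simple_lie_algebra g.
Hypothesis h_cartan : cartan_subalgebra h.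
Hypothesis alpha_simple : simple_roots alpha.
Local Notation n := (\dim {:g}).
Local Notation rc := (rcomb iota alpha).
Local Notation kd a := (killing_dual (rc a)).
Variables (e : n.-tuple g) (wt : 'I_n -> 'rV[R]_r).
Hypothesis be : basis_of fullv e.
Hypothesis we : forall i, in_root_space (rc (wt i)) (tnth e i).
Hypothesis wint : forall i, nat_vec (wt i) \/ nat_vec (- wt i).
Variable y : 'I_n -> g.
Hypothesis ey : forall i j : 'I_n, killing (tnth e i) (y j) = (i == j)%:R.
Hypothesis yw : forall j, in_root_space (rc (- wt j)) (y j).
Hypothesis eE : forall z, z = \sum_(i < n) killing z (y i) *: tnth e i.
Hypothesis yE : forall z, z = \sum_(i < n) killing z (tnth e i) *: y i.
Variable B : 'M[R]_r.
Hypothesis Bsym : B^T = B.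
Hypothesis BE : forall a b, rc a (kd b) = iota (bform B a b) :> F.
Hypothesis Bpos : forall a, a != 0 -> 0 < bform B a a.
Hypothesis rho_dom : forall b, 0 <= bform B (two_rho wt) (delta_mx 0 b).

Definition height (a : 'rV[R]_r) : R := \sum_b a 0 b.

Lemma heightD a b : height (a + b) = height a + height b.
Proof. by rewrite /height -big_split; apply: eq_bigr => i _; rewrite mxE. Qed.

Lemma height_pos (a : 'rV[R]_r) : pos_vec a -> 0 < height a.
Proof.
move=> /andP[a0 /forallP ap]; rewrite lt0r sumr_ge0 ?andbT//.
rewrite /height psumr_eq0//; apply: contra a0 => /allP h0; apply/eqP/rowP => b; rewrite mxE.
by have /eqP := h0 b (mem_index_enum _).
Qed.

Lemma nat_vec_pos (a : 'rV[R]_r) : nat_vec a -> a != 0 -> pos_vec a.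
Proof. by move=> na a0; rewrite /pos_vec a0; apply/forallP => b; have [k ->] := na b; rewrite ler0n. Qed.

Lemma nat_vecD (a b : 'rV[R]_r) : nat_vec a -> nat_vec b -> nat_vec (a + b).
Proof.
by move=> na nb i; have [k ak] := na i; have [l bl] := nb i; exists (k + l)%N; rewrite mxE ak bl natrD.
Qed.

Lemma pos_wt_nat i : pos_vec (wt i) -> nat_vec (wt i).
Proof.
move=> wi; case: (wint i) => // wN; have w0 : - wt i != 0 by rewrite oppr_eq0; case/andP: wi.
by have := nat_vec_pos wN w0; rewrite pos_vecN.
Qed.

Definition dominant (mu : 'rV[R]_r) := forall b, exists k : nat,
  2 * bform B mu (delta_mx 0 b) / bform B (delta_mx 0 b) (delta_mx 0 b) = k%:R.

Let simple_gt0 b : 0 < bform B (delta_mx 0 b) (delta_mx 0 b).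
Proof. by apply: Bpos; apply/eqP => /rowP/(_ b)/eqP; rewrite !mxE !eqxx oner_eq0. Qed.

Lemma dominant_ge0 (mu k : 'rV[R]_r) : dominant mu -> (forall b, 0 <= k 0 b) -> 0 <= bform B k mu.
Proof.
move=> dmu k0; rewrite [k]row_sum_delta bform_suml sumr_ge0// => b _.
rewrite bformZl mulr_ge0// bformC//; have [j jE] := dmu b.
have : 0 <= 2 * bform B mu (delta_mx 0 b) / bform B (delta_mx 0 b) (delta_mx 0 b) by rewrite jE ler0n.
by rewrite pmulr_lge0 ?invr_gt0// pmulr_rge0.
Qed.

Definition cas (mu : 'rV[R]_r) : R := bform B mu (mu + two_rho wt).

(** With lam = mu + k, the difference of the two values is (k,k) + 2(k,mu) + (k, 2 rho), a sum of
    nonnegative terms whose first vanishes only for k = 0. *)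
Lemma cas_inj (lam mu : 'rV[R]_r) : dominant mu -> nat_vec (lam - mu) -> cas lam = cas mu -> lam = mu.
Proof.
move=> dmu; have [k ->] : exists k, lam = mu + k by exists (lam - mu); rewrite addrC subrK.
rewrite addrAC subrr add0r => nk cE; have k0 b : 0 <= k 0 b by have [j ->] := nk b; rewrite ler0n.
have E : bform B k k + 2 * bform B k mu + bform B k (two_rho wt) = 0.
  have bc := bformC mu k Bsym.
  move: cE bc; rewrite /cas !(bformDl, bformDr); move: (bform B k k) (bform B k mu) (bform B mu k) (bform B mu mu) (bform B k _) (bform B mu _) => t1 t2 t3 t4 t5 t6; lra.
have h1 := dominant_ge0 dmu k0.
have h2 : 0 <= bform B k (two_rho wt).
  rewrite [k]row_sum_delta bform_suml sumr_ge0// => b _.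
  by rewrite bformZl mulr_ge0// bformC.
have [->|/Bpos] := eqVneq k 0; first by rewrite addr0.
move: E h1 h2; move: (bform B k k) (bform B k mu) (bform B k _) => t1 t2 t3 *; exfalso; lra.
Qed.

Section OneRep.
Variables (V : lierep g) (wV : 'I_(rdim V) -> 'rV[R]_r).
Hypothesis Vd : diag_rep iota alpha wV.
Local Notation d := (rdim V).
Implicit Types (K M : {vspace 'cV[F]_d}) (v u : 'cV[F]_d) (mu : 'rV[R]_r).

Definition submodule K := forall x u, u \in K -> V x *m u \in K.

Lemma submodule0 : submodule 0.
Proof. by move=> x u; rewrite memv0 => /eqP ->; rewrite mulmx0 mem0v. Qed.

Lemma submoduleD K M : submodule K -> submodule M -> submodule (K + M).
Proof.
move=> sK sM x u /memv_addP[k kK [m mM ->]]; rewrite mulmxDr.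
by apply: memv_add; [apply: sK|apply: sM].
Qed.

Lemma submoduleI K M : submodule K -> submodule M -> submodule (K :&: M).
Proof.
by move=> sK sM x u; rewrite !memv_cap => /andP[uK uM]; rewrite sK// sM.
Qed.

Lemma submodule_basis K : (forall i u, u \in K -> V (tnth e i) *m u \in K) -> submodule K.
Proof.
move=> sK x u uK; rewrite (coord_sum_tnth x be) linear_sum mulmx_suml.
by apply: memv_suml => i _; rewrite linearZ /= -scalemxAl memvZ// sK.
Qed.

Definition wproj mu v : 'cV[F]_d := \col_j (if wV j == mu then v j 0 else 0).

Lemma wproj_weight mu v : weight_vec wV mu (wproj mu v).
Proof. by move=> j; rewrite mxE; case: ifP => [/eqP//|]; rewrite eqxx. Qed.

Lemma wproj_id mu v : weight_vec wV mu v -> wproj mu v = v.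
Proof.
move=> vmu; apply/colP => j; rewrite mxE; case: ifPn => // /eqP wj.
by apply/esym/eqP/negPn/negP => /vmu.
Qed.

Lemma wprojD mu u v : wproj mu (u + v) = wproj mu u + wproj mu v.
Proof. by apply/colP => j; rewrite !mxE; case: ifP => // _; rewrite addr0. Qed.

(** An element H of h that separates an unwanted weight from mu yields H v - wt(H) v, which loses
    that weight and only rescales the component of weight mu; induction on the number of unwanted
    coordinates. *)
Lemma wproj_sub K mu v : submodule K -> v \in K -> wproj mu v \in K.
Proof.
move=> sK; have [k] := ubnP #|[pred j | (v j 0 != 0) && (wV j != mu)]|.
elim: k v => // k IH v ck vK.
have [j0 /andP[vj0 wj0]|none] := pickP [pred j | (v j 0 != 0) && (wV j != mu)]; last first.
  rewrite wproj_id// => j vj; apply/eqP; have := none j; rewrite /= vj /=.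
  by move/negbFE.
have [H HE] : exists H : subvs_of h, rc (wV j0) H != rc mu H :> F.
  apply: contrapT => nH; move/eqP: wj0; apply; apply: (rcomb_inj (iota := iota) alpha_simple).
  by apply/lfunP => H; apply/eqP/negPn/negP => HH; apply: nH; exists H.
pose v' := V (vsval H) *m v - (rc (wV j0) H : F) *: v.
have v'E j : v' j 0 = ((rc (wV j) H : F) - rc (wV j0) H) * v j 0.
  by rewrite /v' Vd mul_diag_mx !mxE mulrBl.
have v'K : v' \in K by rewrite memvB ?memvZ// sK.
have : wproj mu v' \in K.
  apply: IH => //; apply: (@leq_trans #|[pred j | (v j 0 != 0) && (wV j != mu)]|); last by rewrite -ltnS.
  apply/proper_card/properP; split.
    by apply/fintype.subsetP => j; rewrite !inE v'E mulf_eq0 negb_or => /andP[/andP[_ ->]].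
  by exists j0; rewrite !inE ?vj0 ?wj0// v'E subrr mul0r eqxx.
have -> : wproj mu v' = ((rc mu H : F) - rc (wV j0) H) *: wproj mu v.
  apply/colP => j; rewrite [LHS]mxE [RHS]mxE [X in _ * X]mxE v'E; case: ifP => [/eqP -> //|_]; by rewrite mulr0.
have c0 : (rc mu H : F) - rc (wV j0) H != 0 by rewrite subr_eq0 eq_sym.
by move=> /(memvZ (((rc mu H : F) - rc (wV j0) H)^-1)); rewrite scalerA mulVf// scale1r.
Qed.

Lemma wproj_sum v : v = \sum_(mu <- undup [seq wV j | j <- enum 'I_d]) wproj mu v.
Proof.
apply/colP => j; rewrite summxE (bigD1_seq (wV j)) ?undup_uniq//=.
  rewrite mxE eqxx big1 ?addr0// => mu muj; rewrite mxE.
  by rewrite eq_sym (negPf muj).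
by rewrite mem_undup map_f// mem_enum.
Qed.

(** Starting from a weight vector of M outside K, apply raising operators as long as the result
    stays outside K; the height of the weight grows, so this ends. *)
Lemma rel_max_vec K M : submodule K -> submodule M -> ~~ (M <= K)%VS ->
  exists mu v, [/\ v \in M, v \notin K, weight_vec wV mu v
    & forall i, pos_vec (wt i) -> V (tnth e i) *m v \in K].
Proof.
move=> sK sM /subvPn[v0 v0M v0K].
have [mu [v [vM vK vmu]]] : exists mu v, [/\ v \in M, v \notin K & weight_vec wV mu v].
  apply: contrapT => nv; move/negP: v0K; apply; rewrite (wproj_sum v0).
  apply: memv_suml => mu _; apply/negPn/negP => wK; apply: nv; exists mu, (wproj mu v0).
  by split => //; [exact: wproj_sub|exact: wproj_weight].
have [k] := ubnP #|[pred j | height mu < height (wV j)]|.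
elim: k mu v vM vK vmu => // k IH mu v vM vK vmu ck.
have [i /andP[wi viK]|none] := pickP [pred i | pos_vec (wt i) && (V (tnth e i) *m v \notin K)]; last first.
  exists mu, v; split => // i wi; have := none i; rewrite /= wi /=.
  by move/negbFE.
apply: (IH (mu + wt i) (V (tnth e i) *m v)) => //.
- exact: sM.
- exact: (weight_vec_shift alpha_simple Vd (@we i) vmu).
- have v'mu := weight_vec_shift alpha_simple Vd (@we i) vmu.
  apply: (@leq_trans #|[pred j | height mu < height (wV j)]|); last by rewrite -ltnS.
  have hl : height mu < height (mu + wt i) by rewrite heightD ltrDl height_pos.
  apply/proper_card/properP; split.
    by apply/fintype.subsetP => j; rewrite !inE; exact: lt_trans.
  have [j vj] : exists j, (V (tnth e i) *m v) j 0 != 0.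
    apply: contrapT => nj; move/negP: viK; apply; suff -> : V (tnth e i) *m v = 0 by rewrite mem0v.
    by apply/colP => j; rewrite [RHS]mxE; apply/eqP/negPn/negP => vj; apply: nj; exists j.
  by exists j; rewrite !inE (v'mu _ vj) ?hl// ltxx.
Qed.

Lemma rel_max_dominant K mu v : submodule K -> v \notin K -> weight_vec wV mu v ->
  (forall i, pos_vec (wt i) -> V (tnth e i) *m v \in K) -> dominant mu.
Proof.
move=> sK vK vmu vi b.
have [i wi] := simple_wt alpha_simple be we b.
have wi0 : wt i != 0 by rewrite wi; apply/eqP => /rowP/(_ b)/eqP; rewrite !mxE !eqxx oner_eq0.
have pwi : pos_vec (wt i).
  rewrite /pos_vec wi0; apply/forallP => c; rewrite wi mxE; by case: (_ && _).
have [||N] := sl2_mod alpha_simple Vd (K := K) wi0 (@we i) (@yw i)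
   (lie_dual_root g_simple h_cartan alpha_simple be we ey yw i) _ _ vmu vK (vi _ pwi).
- by move=> u; exact: sK.
- by move=> u; exact: sK.
rewrite !BE wi -(rmorph_nat iota) -(rmorph_nat iota 2) -fmorphV -!rmorphM => /fmorph_inj E.
exists N; rewrite E; field; by rewrite gt_eqF.
Qed.

Definition lower (lam : 'rV[R]_r) v := forall j, v j 0 != 0 -> nat_vec (lam - wV j) /\ wV j != lam.

Lemma lowerD (lam : 'rV[R]_r) u v : lower lam u -> lower lam v -> lower lam (u + v).
Proof.
move=> lu lv j; rewrite mxE; have [->|/lu//] := eqVneq (u j 0) 0.
by rewrite add0r; exact: lv.
Qed.

Lemma lowerZ (lam : 'rV[R]_r) c v : lower lam v -> lower lam (c *: v).
Proof. by move=> lv j; rewrite mxE mulf_eq0 negb_or => /andP[_ /lv]. Qed.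

Lemma lower_neg lam v i : pos_vec (- wt i) -> (weight_vec wV lam v \/ lower lam v) ->
  lower lam (V (tnth e i) *m v).
Proof.
move=> wi lv j; rewrite mxE => /eqP; case: (pickP (fun l => V (tnth e i) j l * v l 0 != 0)) => [l|all0].
  rewrite mulf_eq0 negb_or => /andP[/(diag_rep_shift Vd alpha_simple (@we i)) wj vl] _.
  have nwi : nat_vec (- wt i).
    case: (wint i) => // wN; have w0 : wt i != 0 by rewrite -oppr_eq0; case/andP: wi.
    by have := nat_vec_pos wN w0; rewrite -[wt i]opprK pos_vecN.
  have hwi := height_pos wi.
  case: lv => [/(_ _ vl) wl|/(_ _ vl) [nl wl]]; rewrite wj.
    rewrite wl opprD addNKr; split=> //; apply/eqP => E; move: (congr1 height E) hwi.
    rewrite heightD => /eqP; rewrite -subr_eq0 addrAC subrr add0r => /eqP hw.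
    by have := heightD (wt i) (- wt i); rewrite subrr hw add0r /height big1 => [<-|b _]; rewrite ?ltxx ?mxE.
  have nn : nat_vec (lam - (wV l + wt i)).
    by rewrite opprD addrA; apply: nat_vecD.
  split=> //; apply/eqP => E.
  have p1 : pos_vec (lam - wV l) by apply: nat_vec_pos => //; rewrite subr_eq0 eq_sym.
  have := height_pos p1; rewrite -E addrAC subrr add0r.
  move: hwi; have := heightD (wt i) (- wt i); rewrite subrr {1}/height big1 => [|b _]; last by rewrite mxE.
  by move=> /esym/eqP; rewrite addr_eq0 => /eqP -> ; rewrite ltNge => /negP h1 /ltW h2; apply: h1; rewrite -oppr_ge0 ?opprK.
by rewrite big1 ?eqxx// => l _; apply/eqP; rewrite (negbFE (all0 l)).
Qed.

(** The filtration of the submodule generated by v over K by the number of lowering operators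
    applied to v. *)
Fixpoint gen_filt K v k : {vspace 'cV[F]_d} :=
  if k is k'.+1 then
    (gen_filt K v k' + \sum_(i | pos_vec (- wt i)) linfun (mulmx (V (tnth e i))) @: gen_filt K v k')%VS
  else (K + <[v]>)%VS.

Lemma gen_filt_step K v k i u : pos_vec (- wt i) -> u \in gen_filt K v k ->
  V (tnth e i) *m u \in gen_filt K v k.+1.
Proof.
move=> wi uk /=; apply: (subvP (addvSr _ _)); apply: (subvP (sumv_sup i wi (subvv _))).
by apply/memv_imgP; exists u; rewrite // lfunE.
Qed.

Lemma gen_filt_sub K v k : (gen_filt K v k <= gen_filt K v k.+1)%VS.
Proof. exact: addvSl. Qed.

Lemma gen_filt_ind K v (P : 'cV[F]_d -> Prop) k u : u \in gen_filt K v k.+1 ->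
  (forall u1 u2, P u1 -> P u2 -> P (u1 + u2)) -> (forall u, u \in gen_filt K v k -> P u) ->
  (forall i u, pos_vec (- wt i) -> u \in gen_filt K v k -> P (V (tnth e i) *m u)) -> P u.
Proof.
move=> /= /memv_addP[u1 u1k [u2 /memv_sumP[w wk ->] ->]] PD P1 P2.
have P0 : P 0 by apply: P1; rewrite mem0v.
apply: (PD _ _ (P1 _ u1k)); elim/big_ind: _ => // i wi.
by have /memv_imgP[u' u'k ->] := wk i wi; rewrite lfunE /=; exact: P2.
Qed.

(** An operator that does not lower keeps the filtration degree: move it past one lowering operator,
    at the price of a bracket, which is a combination of basis operators acting in the previous
    degree. *)
Lemma gen_filt_nonneg K lam v k i u : submodule K -> weight_vec wV lam v ->
  (forall l, pos_vec (wt l) -> V (tnth e l) *m v \in K) ->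
  ~~ pos_vec (- wt i) -> u \in gen_filt K v k -> V (tnth e i) *m u \in gen_filt K v k.
Proof.
move=> sK vlam vK; elim: k i u => [|k IH] i u wi.
  move=> /= /memv_addP[u1 u1K [_ /vlineP[c ->] ->]]; rewrite mulmxDr.
  rewrite memvD//; first by apply: (subvP (addvSl _ _)); exact: sK.
  rewrite -scalemxAr memvZ//; case: (wt_trichotomy wint i) => [w0|wp|wn].
  - have eh := wt0_cartan h_cartan we w0.
    rewrite -(vsprojK eh) (weight_vec_cartan Vd _ vlam) memvZ//.
    by apply: (subvP (addvSr _ _)); exact: memv_line.
  - by apply: (subvP (addvSl _ _)); exact: vK.
  - by rewrite wn in wi.
move=> uk; apply: (@gen_filt_ind K v (fun u => V (tnth e i) *m u \in gen_filt K v k.+1) k u uk) => [u1 u2 h1 h2|u1 u1k|l u1 wl u1k].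
- by rewrite mulmxDr memvD.
- by apply: (subvP (gen_filt_sub _ _ _)); exact: IH.
have -> : V (tnth e i) *m (V (tnth e l) *m u1) =
    V (tnth e l) *m (V (tnth e i) *m u1) + V (lie (tnth e i) (tnth e l)) *m u1.
  by rewrite rmx_lie mulmxBl -!mulmxA addrC subrK.
rewrite memvD//; first by apply: gen_filt_step => //; exact: IH.
rewrite (eE (lie _ _)) linear_sum mulmx_suml; apply: memv_suml => p _.
rewrite linearZ /= -scalemxAl memvZ//; have [wp|wp] := boolP (pos_vec (- wt p)).
  exact: gen_filt_step.
by apply: (subvP (gen_filt_sub _ _ _)); exact: IH.
Qed.

(** The filtration stabilizes by finiteness of dimension. The last clause records that, modulo K and
    the line of v, only weights strictly below [lam] occur. *)
Lemma gen_submodule K lam v : submodule K -> weight_vec wV lam v ->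
  (forall l, pos_vec (wt l) -> V (tnth e l) *m v \in K) ->
  exists U, [/\ submodule U, (K <= U)%VS, v \in U,
    forall M, submodule M -> (K <= M)%VS -> v \in M -> (U <= M)%VS
    & forall u, u \in U -> exists k c, k \in K /\ lower lam (u - k - c *: v)].
Proof.
move=> sK vlam vK.
have [k kE] : exists k, gen_filt K v k.+1 = gen_filt K v k.
  apply: contrapT => nk.
  have dk k : (k <= \dim (gen_filt K v k))%N.
    elim: k => // k IH; apply: leq_ltn_trans IH _.
    rewrite ltn_neqAle dimvS ?gen_filt_sub// andbT; apply/negP => /eqP dE.
    apply: nk; exists k; apply/esym/eqP; rewrite eqEdim gen_filt_sub dE.
    exact: leqnn.
  have := dk (\dim {:'cV[F]_d}).+1; rewrite leqNgt ltnS dimvS ?subvf//.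
exists (gen_filt K v k); have K0 j : (K + <[v]> <= gen_filt K v j)%VS.
  by elim: j => // j IH; exact: subv_trans IH (gen_filt_sub _ _ _).
split.
- apply: submodule_basis => i u uk; have [wi|wi] := boolP (pos_vec (- wt i)).
    by rewrite -kE; exact: gen_filt_step.
  exact: (gen_filt_nonneg sK vlam vK).
- exact: subv_trans (addvSl _ _) (K0 k).
- by apply: (subvP (K0 k)); apply: (subvP (addvSr _ _)); exact: memv_line.
- move=> M sM KM vM; elim: k {kE} => [|k IH] /=.
    by rewrite subv_add KM -memvE.
  rewrite subv_add IH; apply/subv_sumP => i _; apply/subvP => _ /memv_imgP[u uk ->].
  by rewrite lfunE; apply: sM; exact: (subvP IH).
have Pind j u : u \in gen_filt K v j -> exists k c, k \in K /\ lower lam (u - k - c *: v).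
  elim: j u => [|j IH] u.
    move=> /= /memv_addP[k1 k1K [_ /vlineP[c ->] ->]]; exists k1, c; split => //.
    by rewrite [k1 + _]addrC addrK subrr => l; rewrite mxE eqxx.
  move=> uj; apply: (@gen_filt_ind K v (fun u => exists k c, k \in K /\ lower lam (u - k - c *: v)) j u uj) => [u1 u2 [k1 [c1 [k1K l1]]] [k2 [c2 [k2K l2]]]|u1 /IH//|i u1 wi /IH].
    exists (k1 + k2), (c1 + c2); rewrite memvD//; split => //.
    rewrite (_ : _ - _ = (u1 - k1 - c1 *: v) + (u2 - k2 - c2 *: v)); first exact: lowerD.
    by rewrite scalerDl !opprD !addrA; apply/colP => l; rewrite !mxE; ring.
  case=> k1 [c1 [k1K l1]]; exists (V (tnth e i) *m k1), 0; split; first exact: sK.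
  rewrite scale0r subr0 -mulmxBr -[u1 - k1](subrK (c1 *: v)) mulmxDr.
  apply: lowerD; first by apply: lower_neg => //; right.
  by rewrite -scalemxAr; apply: lowerZ; apply: lower_neg => //; left.
exact: Pind.
Qed.

Lemma cas_max_vec K lam v : submodule K -> weight_vec wV lam v ->
  (forall l, pos_vec (wt l) -> V (tnth e l) *m v \in K) ->
  casimir V *m v - iota (cas lam) *: v \in K.
Proof.
exact: (casimir_max_vec g_simple h_cartan alpha_simple be we wint ey yw eE yE BE Vd).
Qed.

Lemma casimir_eigen_sub c : exists K, submodule K /\
  forall u, (u \in K) = (casimir V *m u == c *: u).
Proof.
exists (lker (linfun (mulmx (casimir V - c%:M)) : 'End('cV[F]_d))).
have memK u : (u \in lker (linfun (mulmx (casimir V - c%:M)) : 'End('cV[F]_d))) = (casimir V *m u == c *: u).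
  by rewrite memv_ker lfunE /= mulmxBl mul_scalar_mx subr_eq0.
split => // x u; rewrite !memK => /eqP uc.
by rewrite mulmxA -(casimir_comm ey eE yE) -mulmxA uc -scalemxAr.
Qed.

Definition irreducible_sub U := U != 0%VS /\
  forall K, submodule K -> (K <= U)%VS -> K = 0%VS \/ K = U.

(** The Casimir element acts on U by [cas lam]. A nonzero submodule contains a maximal vector of
    some weight mu with the same Casimir value; mu is lam or strictly below it, the second is
    excluded by [cas_inj], and the first puts v in the submodule. *)
Lemma max_vec_gen lam v : v != 0 -> weight_vec wV lam v ->
  (forall l, pos_vec (wt l) -> V (tnth e l) *m v = 0) ->
  exists U, [/\ submodule U, v \in U, irreducible_sub U, dominant lam
    & (forall u, u \in U -> casimir V *m u = iota (cas lam) *: u) /\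
      forall u, u \in U -> exists c, lower lam (u - c *: v)].
Proof.
move=> v0 vlam vi; have vi0 l : pos_vec (wt l) -> V (tnth e l) *m v \in (0%VS : {vspace 'cV[F]_d}).
  by move=> wl; rewrite vi// mem0v.
have [U [sU _ vU Umin Ulow]] := gen_submodule submodule0 vlam vi0; exists U.
have v0n : v \notin (0%VS : {vspace 'cV[F]_d}) by rewrite memv0.
have dlam : dominant lam := rel_max_dominant submodule0 v0n vlam vi0.
have {}Ulow u : u \in U -> exists c, lower lam (u - c *: v).
  by move=> /Ulow[k [c []]]; rewrite memv0 => /eqP ->; rewrite subr0; exists c.
have [Ec [sEc memEc]] := casimir_eigen_sub (iota (cas lam)).
have Ucas u : u \in U -> casimir V *m u = iota (cas lam) *: u.
  move=> uU; apply/eqP; rewrite -memEc; apply: (subvP (Umin Ec sEc (sub0v _) _)) uU.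
  by rewrite memEc -subr_eq0 -memv0; exact: (cas_max_vec submodule0 vlam vi0).
split => //; split.
  by apply/eqP => U0; move: vU; rewrite U0 memv0 (negPf v0).
move=> K sK KU; have [->|K0] := eqVneq K 0%VS; [by left|right].
have [|mu [u [uK un umu ui]]] := @rel_max_vec 0%VS K submodule0 sK; first by rewrite subv0.
have dmu := rel_max_dominant submodule0 un umu ui.
have un0 : u != 0 by rewrite -memv0.
have E : cas lam = cas mu.
  apply: (fmorph_inj iota); apply: (scalerI_col un0).
  have := cas_max_vec submodule0 umu ui; rewrite memv0 subr_eq0 => /eqP <-.
  by rewrite Ucas// (subvP KU).
have [c lc] := Ulow u (subvP KU _ uK).
have [j uj] : exists j, u j 0 != 0.
  apply: contrapT => nj; move/eqP: un0; apply; apply/colP => j; rewrite mxE.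
  by apply/eqP/negPn/negP => uj; apply: nj; exists j.
have [mulam|mulam] := eqVneq mu lam.
  apply: subv_anti; rewrite KU /=; apply: Umin => //; first exact: sub0v.
  have uE : u = c *: v.
    apply/eqP; rewrite -subr_eq0; apply/eqP/colP => l; rewrite [RHS]mxE; apply/eqP/negPn/negP => ul.
    have [_ /eqP] := lc l ul; apply; move: ul; rewrite !mxE.
    have [->|/umu ->//] := eqVneq (u l 0) 0; rewrite sub0r oppr_eq0 mulf_eq0 negb_or => /andP[_].
    exact: vlam.
  have c0 : c != 0 by apply: contraNneq un0 => c0; rewrite uE c0 scale0r.
  by rewrite -[v]scale1r -(mulVf c0) -scalerA memvZ// -uE.
exfalso; move/eqP: (mulam); apply; apply/esym; apply: cas_inj => //.
have : (u - c *: v) j 0 != 0.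
  rewrite !mxE; have [->|/vlam vj] := eqVneq (v j 0) 0; first by rewrite mulr0 subr0.
  by move/eqP: mulam => []; rewrite -(umu _ uj) vj.
by move=> /lc[]; rewrite (umu _ uj).
Qed.

(* M is the largest submodule on which the coordinate of a highest weight vector of
   maximal height vanishes. *)
Lemma splitting : (0 < d)%N -> exists U M, [/\ submodule U, submodule M, irreducible_sub U,
  (U + M)%VS = fullv & (U :&: M)%VS = 0%VS].
Proof.
move=> d0; pose i0 : 'I_d := Ordinal d0.
pose j0 := [arg max_(j > i0) height (wV j)]%O.
have j0max j : height (wV j) <= height (wV j0).
  by rewrite /j0; case: arg_maxP => // i _; exact.
pose lam := wV j0.
have lam_max v : weight_vec wV lam v -> forall l, pos_vec (wt l) -> V (tnth e l) *m v = 0.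
  move=> vl l wl; apply/colP => j; rewrite [RHS]mxE; apply/eqP/negPn/negP => vj.
  have := weight_vec_shift alpha_simple Vd (@we l) vl vj => wj.
  by have := j0max j; rewrite wj heightD leNgt ltrDl height_pos.
pose v0 : 'cV[F]_d := delta_mx j0 0.
have v00 : v0 != 0 by apply/eqP => /colP/(_ j0)/eqP; rewrite !mxE !eqxx oner_eq0.
have v0l : weight_vec wV lam v0.
  by move=> j; have [->//|/negPf jj0] := eqVneq j j0; rewrite mxE jj0 /= mulr0n eqxx.
have [U [sU v0U irU dlam [Ucas Ulow]]] := max_vec_gen v00 v0l (lam_max _ v0l).
have [M [sM Mxi Mmax]] : exists M, [/\ submodule M, forall u, u \in M -> u j0 0 = 0
   & forall K, submodule K -> (forall u, u \in K -> u j0 0 = 0) -> (K <= M)%VS].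
  pose P k := `[< exists M, [/\ submodule M, forall u, u \in M -> u j0 0 = 0 & \dim M = k] >].
  have exP : exists k, P k.
    exists 0%N; apply/asboolP; exists 0%VS; split; [exact: submodule0| |exact: dimv0].
    by move=> u; rewrite memv0 => /eqP ->; rewrite mxE.
  have ubP k : P k -> (k <= \dim {:'cV[F]_d})%N.
    by move=> /asboolP[M [_ _ <-]]; rewrite dimvS ?subvf.
  case: (ex_maxnP exP ubP) => k /asboolP[M [sM Mxi dM]] kmax; exists M; split => // K sK Kxi.
  have : P (\dim (M + K)%VS).
    apply/asboolP; exists (M + K)%VS; split => //; first exact: submoduleD.
    by move=> u /memv_addP[u1 /Mxi u1x [u2 /Kxi u2x ->]]; rewrite mxE u1x u2x addr0.
  move=> /kmax; rewrite -dM => dMK; have /eqP -> : M == (M + K)%VS by rewrite eqEdim addvSl.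
  exact: addvSr.
have Wlam v : weight_vec wV lam v -> v \in (U + M)%VS.
  move=> vl; pose v1 := v - v j0 0 *: v0.
  have v1l : weight_vec wV lam v1.
    move=> j; rewrite /v1 !mxE; have [->|/vl//] := eqVneq (v j 0) 0.
    rewrite sub0r oppr_eq0 mulf_eq0 negb_or => /andP[_]; have := v0l j; rewrite mxE; exact.
  rewrite -(subrK (v j0 0 *: v0) v) addrC memv_add ?memvZ// -/v1.
  have [->|v10] := eqVneq v1 0; first by rewrite mem0v.
  have [U1 [sU1 v1U1 _ _ [_ U1low]]] := max_vec_gen v10 v1l (lam_max _ v1l).
  apply: (subvP (Mmax U1 sU1 _)) v1U1 => u /U1low[c lc].
  have v1j0 : v1 j0 0 = 0 by rewrite /v1 !mxE !eqxx mulr1 subrr.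
  apply/eqP/negPn/negP => uj0; have [] := lc j0; last by rewrite eqxx.
  by rewrite [X in X != 0]mxE [X in _ + X]mxE [(c *: v1) j0 0]mxE v1j0 mulr0 subr0.
have UM0 : (U :&: M)%VS = 0%VS.
  have [_ /(_ _ (submoduleI sU sM) (capvSl _ _))[//|UE]] := irU.
  have : v0 \in M by have := capvSr U M; rewrite UE => /subvP/(_ _ v0U).
  by move/Mxi; rewrite mxE !eqxx => /eqP; rewrite oner_eq0.
exists U, M; split => //.
apply/eqP/negPn/negP => UMn.
have sUM := submoduleD sU sM.
have [||mu [v [_ vn vmu vi]]] := @rel_max_vec (U + M)%VS fullv sUM.
- by move=> x u _; rewrite memvf.
- by apply: contra UMn => fUM; apply/eqP/subv_anti; rewrite subvf.
have dmu := rel_max_dominant sUM vn vmu vi.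
(* The operator casimir - [cas lam] kills the weight space of [lam] and preserves the others, so its
   image is a submodule on which the coordinate [j0] vanishes, hence lies in M. *)
have casM w : casimir V *m w - iota (cas lam) *: w \in M.
  pose f : 'End('cV[F]_d) := linfun (mulmx (casimir V - (iota (cas lam))%:M)).
  have fE u : f u = casimir V *m u - iota (cas lam) *: u by rewrite lfunE /= mulmxBl mul_scalar_mx.
  rewrite -fE; apply: (subvP (Mmax (limg f) _ _)) (memv_img _ (memvf w)).
    move=> x _ /memv_imgP[u _ ->]; apply/memv_imgP; exists (V x *m u); first exact: memvf.
    by rewrite !fE mulmxBr -scalemxAr !mulmxA (casimir_comm ey eE yE).
  move=> _ /memv_imgP[u _ ->]; rewrite fE.
  have casw nu u' : weight_vec wV nu u' -> weight_vec wV nu (casimir V *m u').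
    move=> u'n; apply: (weight_vec_cartanP alpha_simple Vd) => H.
    by rewrite mulmxA (casimir_comm ey eE yE) -mulmxA (weight_vec_cartan Vd _ u'n) -scalemxAr.
  rewrite [u](wproj_sum u) mulmx_sumr scaler_sumr -sumrB summxE big1// => nu _.
  have [->|nul] := eqVneq nu lam.
    have wl := @wproj_weight lam u.
    have H : casimir V *m wproj lam u - iota (cas lam) *: wproj lam u \in (0%VS : {vspace 'cV[F]_d}).
      by apply: (cas_max_vec submodule0 wl) => l wl'; rewrite (lam_max _ wl)// mem0v.
    by move: H; rewrite memv0 => /eqP ->; rewrite mxE.
  have wvB c a b : weight_vec wV nu a -> weight_vec wV nu b -> weight_vec wV nu (a - c *: b).
    move=> wa wb j; rewrite !mxE; have [->|/wa//] := eqVneq (a j 0) 0.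
    by rewrite sub0r oppr_eq0 mulf_eq0 negb_or => /andP[_ /wb].
  have wn := wvB (iota (cas lam)) _ _ (casw _ _ (@wproj_weight nu u)) (@wproj_weight nu u).
  by apply/eqP/negPn/negP => /wn; rewrite -/lam => E; rewrite E eqxx in nul.
have casE : cas lam = cas mu.
  apply/eqP; rewrite -subr_eq0; apply/negPn/negP => c0; move/negP: vn; apply.
  have cF : iota (cas lam - cas mu) != 0 by rewrite fmorph_eq0.
  rewrite -[v]scale1r -(mulVf cF) -scalerA memvZ// rmorphB scalerBl.
  have -> : iota (cas lam) *: v - iota (cas mu) *: v = (casimir V *m v - iota (cas mu) *: v) -
      (casimir V *m v - iota (cas lam) *: v).
    by apply/colP => j; rewrite !mxE; ring.
  by rewrite memvB//; [exact: cas_max_vec|apply: (subvP (addvSr _ _))].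
have vmu_n : mu != lam by apply: contraNneq vn => mulam; apply: Wlam; rewrite -mulam.
(* Either some raising operator reaches a nonzero component in U, whose weight is at most [lam], so
   that mu < lam contradicts [cas_inj]; or v is maximal already modulo M. *)
have [i /andP[wi viM]|none] := pickP [pred i | pos_vec (wt i) && (V (tnth e i) *m v \notin M)].
  move/eqP: vmu_n; apply; apply/esym; apply: cas_inj => //.
  have /memv_addP[u uU [m mM E]] := vi i wi.
  have vw := weight_vec_shift alpha_simple Vd (@we i) vmu.
  pose u' := wproj (mu + wt i) u.
  have u'U : u' \in U by exact: wproj_sub.
  have u'0 : u' != 0.
    apply: contraNneq viM => u'0; rewrite -(wproj_id vw) E wprojD -/u' u'0 add0r.
    exact: wproj_sub.
  have [j u'j] : exists j, u' j 0 != 0.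
    apply: contrapT => nj; move/eqP: u'0; apply; apply/colP => j; rewrite [RHS]mxE.
    by apply/eqP/negPn/negP => uj; apply: nj; exists j.
  have wj := wproj_weight u'j.
  have nlam : nat_vec (lam - (mu + wt i)).
    have [c lc] := Ulow u' u'U; have [El|nl] := eqVneq (mu + wt i) lam.
      by rewrite El subrr => b; exists 0%N; rewrite mxE.
    have := lc j; rewrite wj; case=> //; rewrite [X in X != 0]mxE [X in _ + X]mxE [(c *: v0) j 0]mxE.
    have [->|/v0l vj] := eqVneq (v0 j 0) 0; first by rewrite mulr0 subr0.
    by rewrite -vj wj eqxx in nl.
  rewrite (_ : lam - mu = lam - (mu + wt i) + wt i); last by rewrite opprD addrA subrK.
  by apply: nat_vecD => //; exact: pos_wt_nat.
have viM l : pos_vec (wt l) -> V (tnth e l) *m v \in M.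
  by move=> wl; have := none l; rewrite /= wl /= => /negbFE.
(* In the second case N is larger than M, so it has an element with nonzero coordinate [j0]. Then
   [lam] is strictly below mu, against the maximality of its height. *)
have [N [sN MN vN _ Nlow]] := gen_submodule sM vmu viM.
have [u [uN uj0]] : exists u, u \in N /\ u j0 0 != 0.
  apply: contrapT => nu; move/negP: vn; apply; apply: (subvP (addvSr _ _)).
  apply: (subvP (Mmax N sN _)) vN => u uN; apply/eqP/negPn/negP => uj; apply: nu.
  by exists u.
have [k [c [/Mxi kj0 lk]]] := Nlow u uN.
have [vj0|/vmu E] := eqVneq (v j0 0) 0; last by rewrite -E eqxx in vmu_n.
have [] := lk j0; first by rewrite !mxE kj0 vj0 mulr0 !subr0.
move=> nn wn; have p1 : pos_vec (mu - wV j0) by apply: nat_vec_pos => //; rewrite subr_eq0.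
have [jv vjv] : exists j, v j 0 != 0.
  apply: contrapT => nj; move/negP: vn; apply; suff -> : v = 0 by rewrite mem0v.
  by apply/colP => j; rewrite mxE; apply/eqP/negPn/negP => uj; apply: nj; exists j.
have := j0max jv; rewrite (vmu _ vjv) leNgt => /negP; apply.
have hp := height_pos p1; have := heightD (mu - wV j0) (wV j0).
by rewrite subrK => ->; rewrite ltrDr.
Qed.

End OneRep.
End Submodules.

Lemma mx_bij (F : fieldType) m n (A : 'M[F]_(m, n)) : row_free A -> row_full A ->
  exists B : 'M[F]_(n, m), A *m B = 1%:M /\ B *m A = 1%:M.
Proof.
move=> /row_freeP[B AB] /row_fullP[B' BA]; exists B; split => //.
by rewrite -BA -[X in X = _]mul1mx -BA -!mulmxA (mulmxA A) AB mul1mx.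
Qed.

Lemma col_injP (F : fieldType) m n (A : 'M[F]_(m, n)) :
  (forall v : 'cV[F]_n, A *m v = 0 -> v = 0) -> row_full A.
Proof.
move=> Ainj; rewrite /row_full -mxrank_tr; change (row_free A^T); rewrite -kermx_eq0.
apply/eqP/row_matrixP => i; rewrite row0; apply: trmx_inj; rewrite trmx0; apply: Ainj.
by apply: trmx_inj; rewrite trmx_mul trmxK -row_mul mulmx_ker row0 trmx0.
Qed.

Lemma col_surjP (F : fieldType) m n (A : 'M[F]_(m, n)) :
  (forall u : 'cV[F]_m, exists v : 'cV[F]_n, A *m v = u) -> row_free A.
Proof.
move=> Asur; apply/row_freeP.
pose B := \matrix_(i, j) (xget (0 : 'cV[F]_n) [set v : 'cV[F]_n | A *m v = delta_mx j 0]) i 0.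
exists B; apply/matrixP => i j.
have [v Av] := Asur (delta_mx j 0).
have := @xgetPex _ (0 : 'cV[F]_n) [set v : 'cV[F]_n | A *m v = delta_mx j 0] (ex_intro _ v Av) => /=.
by move/colP/(_ i); rewrite !mxE eqxx andbT => <-; apply: eq_bigr => k _; rewrite mxE.
Qed.

Lemma tensmx11 (F : fieldType) m n : (1%:M : 'M[F]_m) *t (1%:M : 'M[F]_n) = 1%:M.
Proof.
apply/matrixP => i j; case: (mxtens_indexP i) => i0 j0; case: (mxtens_indexP j) => k l.
by rewrite tensmxE !mxE (can_eq (@mxtens_indexK _ _)) xpair_eqE -natrM mulnb.
Qed.

Lemma count_codom (T : eqType) d (w : 'I_d -> T) (p : pred T) :
  count p (codom w) = (\sum_(i < d) p (w i))%N.
Proof. by rewrite codomE -sum1_count big_map big_mkcond big_enum; apply: eq_bigr => i _; case: (p _). Qed.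

(** * Isomorphisms, direct sums and weight lists *)

Section RepIso.
Context {F : fieldType} {g : lieAlgebraType F}.
Implicit Types V W U : lierep g.

Lemma rep_iso_refl V : rep_iso V V.
Proof. by exists 1%:M, 1%:M; split=> *; rewrite ?mul1mx ?mulmx1. Qed.

Lemma rep_iso_sym V W : rep_iso V W -> rep_iso W V.
Proof.
case=> A [B [AB BA AV]]; exists B, A; split => // x.
by rewrite -[W x]mulmx1 -AB [W x *m _]mulmxA -AV !mulmxA BA mul1mx.
Qed.

Lemma rep_iso_trans V W U : rep_iso V W -> rep_iso W U -> rep_iso V U.
Proof.
case=> A [B [AB BA AV]] [A' [B' [AB' BA' AV']]]; exists (A' *m A), (B *m B'); split => [||x].
- by rewrite mulmxA -(mulmxA A') AB mulmx1 AB'.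
- by rewrite mulmxA -(mulmxA B) BA' mulmx1 BA.
- by rewrite -mulmxA AV mulmxA AV' mulmxA.
Qed.

Lemma rep_iso_bij V W (A : 'M[F]_(rdim W, rdim V)) : (forall x, A *m V x = W x *m A) ->
  row_free A -> row_full A -> rep_iso V W.
Proof. by move=> AV Af /(mx_bij Af)[B [AB BA]]; exists A, B. Qed.

Lemma rep_iso_dsum V W V' W' : rep_iso V V' -> rep_iso W W' -> rep_iso (rep_dsum V W) (rep_dsum V' W').
Proof.
case=> A [B [AB BA AV]] [A' [B' [AB' BA' AV']]].
exists (block_mx A 0 0 A'), (block_mx B 0 0 B'); split => [||x] /=.
- by rewrite mulmx_block !(mulmx0, mul0mx, addr0, add0r) AB AB' -scalar_mx_block.
- by rewrite mulmx_block !(mulmx0, mul0mx, addr0, add0r) BA BA' -scalar_mx_block.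
- by rewrite !mulmx_block !(mulmx0, mul0mx, addr0, add0r) AV AV'.
Qed.

Lemma rep_iso_tens V W V' W' : rep_iso V V' -> rep_iso W W' -> rep_iso (rep_tens V W) (rep_tens V' W').
Proof.
case=> A [B [AB BA AV]] [A' [B' [AB' BA' AV']]].
exists (A *t A'), (B *t B'); split => [||x] /=.
- by rewrite tensmx_mul AB AB' tensmx11.
- by rewrite tensmx_mul BA BA' tensmx11.
- by rewrite mulmxDr mulmxDl !tensmx_mul AV AV' !(mulmx1, mul1mx).
Qed.

Lemma rep_iso_casimir V W c : rep_iso V W -> casimir W = c%:M -> casimir V = c%:M.
Proof.
case=> A [B [AB BA AV]] cW.
have VE x : V x = B *m (W x *m A) by rewrite -AV mulmxA BA mul1mx.
suff -> : casimir V = B *m (casimir W *m A) by rewrite cW mul_scalar_mx -scalemxAr BA scalemx1.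
rewrite /casimir mulmx_suml mulmx_sumr; apply: eq_bigr => i _.
rewrite mulmx_suml mulmx_sumr; apply: eq_bigr => j _.
rewrite -scalemxAl -scalemxAr !VE; congr (_ *: _).
by rewrite !mulmxA -(mulmxA _ A B) AB mulmx1.
Qed.

Section Conj.
Variables (V : lierep g) (Q : 'M[F]_(rdim V)).
Hypothesis uQ : Q \in unitmx.
Let c x := invmx Q *m V x *m Q.
Let c_linear : linear c.
Proof. by move=> a x y; rewrite /c rmx_linear mulmxDr mulmxDl -scalemxAr -scalemxAl. Qed.
Let c_lie x y : c (lie x y) = c x *m c y - c y *m c x.
Proof. by rewrite /c rmx_lie !mulmxA !(mulmxK uQ) mulmxBr mulmxBl !mulmxA. Qed.
Definition rep_conj := LieRep c_linear c_lie.

Lemma rep_conj_iso : rep_iso V rep_conj.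
Proof.
exists (invmx Q), Q; split => [||x] /=; rewrite ?mulVmx ?mulmxV//.
by rewrite /c -!mulmxA mulmxV// mulmx1.
Qed.
End Conj.

Section Sub.
Variables (V : lierep g) (k : nat) (I : 'M[F]_(rdim V, k)) (J : 'M[F]_(k, rdim V)).
Hypothesis sI : forall x, V x *m I = I *m (J *m (V x *m I)).
Let s x := J *m (V x *m I).
Let s_linear : linear s.
Proof. by move=> a x y; rewrite /s rmx_linear mulmxDl mulmxDr -scalemxAl -scalemxAr. Qed.
Let s_lie x y : s (lie x y) = s x *m s y - s y *m s x.
Proof.
rewrite /s rmx_lie mulmxBl mulmxBr -!mulmxA -!sI.
by rewrite !(mulmxA (V _)).
Qed.
Definition rep_sub := LieRep s_linear s_lie.
End Sub.

Lemma rep_zero0_iso V : rdim V = 0%N -> rep_iso V (rep_zero 0).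
Proof.
move=> V0; exists 0, 0; split => [||x]; rewrite ?mul0mx ?mulmx0.
- by apply/matrixP => -[].
- by apply/matrixP => -[i i0]; exfalso; move: i0; rewrite V0.
- by apply/matrixP => -[].
Qed.

End RepIso.

Section HasWeights.
Context {R : realFieldType} {F : fieldType} (iota : {rmorphism R -> F})
  {g : lieAlgebraType F} {h : {vspace g}} {r : nat}.
Variable alpha : r.-tuple (cartan_dual h).
Local Notation rc := (rcomb iota alpha).
Implicit Types (V W U : lierep g) (s t : seq 'rV[R]_r).

(** The module is isomorphic to one with diagonal Cartan action. The list is taken up to permutation
    and determines all weight multiplicities. *)
Definition has_weights V s := exists (V' : lierep g) (w : 'I_(rdim V') -> 'rV[R]_r),
  [/\ rep_iso V V', diag_rep iota alpha w & perm_eq s (codom w)].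

Lemma has_weights_iso V W s : rep_iso V W -> has_weights V s -> has_weights W s.
Proof.
move=> VW [V' [w [VV' dw sw]]]; exists V', w; split => //.
exact: rep_iso_trans (rep_iso_sym VW) VV'.
Qed.

Lemma rep_iso_dim V W : rep_iso V W -> rdim V = rdim W.
Proof.
case=> A [B [AB BA _]].
have rA : \rank A = rdim W by apply/eqP; apply/row_freeP; exists B.
have rA' : \rank A = rdim V by apply/eqP; apply/row_fullP; exists B.
exact: etrans (esym rA') rA.
Qed.

Lemma has_weights_size V s : has_weights V s -> size s = rdim V.
Proof.
by move=> [V' [w [VV' _ /perm_size ->]]]; rewrite size_codom card_ord (rep_iso_dim VV').
Qed.

Lemma mx_iso_count (T : eqType) m n (A : 'M[F]_(m, n)) (B : 'M[F]_(n, m)) (f : 'I_m -> T) (k : 'I_n -> T) mu :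
  A *m B = 1%:M -> B *m A = 1%:M -> (forall j l, A j l != 0 -> f j = k l) ->
  #|[pred j | f j == mu]| = #|[pred l | k l == mu]|.
Proof.
move=> AB BA; have mn : m = n.
  have rA : \rank A = m by apply/eqP; apply/row_freeP; exists B.
  have rA' : \rank A = n by apply/eqP; apply/row_fullP; exists B.
  by rewrite -rA rA'.
case: _ / mn in A B k AB BA * => fk; apply: (unitmx_count _ _ _ fk) => [j|].
  by rewrite -(rmorph_nat iota) fmorph_eq0 pnatr_eq0.
by have [] := mulmx1_unit AB.
Qed.

Lemma has_weights_uniq V s t : simple_roots alpha -> has_weights V s -> has_weights V t -> perm_eq s t.
Proof.
move=> sa [V1 [w1 [i1 d1 /perm_trans p1]]] [V2 [w2 [i2 d2]]]; rewrite perm_sym => p2; apply: p1; apply: perm_trans p2.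
have [A [B [AB BA AV]]] := rep_iso_trans (rep_iso_sym i2) i1.
apply/allP => mu _ /=; rewrite !count_codom; apply/eqP.
have E (d : nat) (f : 'I_d -> 'rV[R]_r) : (\sum_(i < d) (f i == mu) = #|[pred j | f j == mu]|)%N.
  by rewrite -sum1_card [RHS]big_mkcond; apply: eq_bigr => i _; rewrite inE; case: eqP.
rewrite !E; apply: mx_iso_count AB BA _ => j l Ajl.
apply: (rcomb_inj (iota := iota) sa); apply/lfunP => H.
have /matrixP/(_ j l) := AV (vsval H).
rewrite d1 d2 mul_diag_mx mul_mx_diag !mxE => E'.
by apply: (mulIf Ajl); rewrite -E' mulrC.
Qed.

Lemma has_weights_zero n : has_weights (rep_zero n) (nseq n 0).
Proof.
exists (rep_zero n), (fun=> 0); split; first exact: rep_iso_refl.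
  by move=> H; apply/matrixP => i j; rewrite !mxE rcomb0 lfunE /= mul0rn.
rewrite (_ : codom _ = nseq n 0)//; rewrite codomE /= -[n in nseq n]card_ord cardE.
by elim: (enum _) => //= a l ->.
Qed.

Lemma has_weights_dsum V W s t : has_weights V s -> has_weights W t -> has_weights (rep_dsum V W) (s ++ t).
Proof.
move=> [V1 [w1 [i1 d1 p1]]] [V2 [w2 [i2 d2 p2]]].
exists (rep_dsum V1 V2), (fun i : 'I_(rdim V1 + rdim V2) => match fintype.split i with inl j => w1 j | inr j => w2 j end).
split; first exact: rep_iso_dsum.
  move=> H /=; rewrite d1 d2 -diag_mx_row; congr diag_mx; apply/rowP => i; rewrite !mxE.
  by case: (fintype.split i) => j; rewrite mxE.
apply/seq.permP => p; rewrite count_cat (seq.permP p1) (seq.permP p2) !count_codom /= big_split_ord /=.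
congr (_ + _)%N; apply: eq_bigr => i _.
  by rewrite (unsplitK (inl i)).
by rewrite (unsplitK (inr i)).
Qed.

Lemma has_weights_tens V W s t : has_weights V s -> has_weights W t ->
  has_weights (rep_tens V W) [seq a + b | a <- s, b <- t].
Proof.
move=> [V1 [w1 [i1 d1 p1]]] [V2 [w2 [i2 d2 p2]]].
exists (rep_tens V1 V2), (fun i : 'I_(rdim V1 * rdim V2) => w1 (mxtens_unindex i).1 + w2 (mxtens_unindex i).2).
split; first exact: rep_iso_tens.
  move=> H /=; apply/matrixP => i j; case: (mxtens_indexP i) => i0 j0; case: (mxtens_indexP j) => k l.
  rewrite !mxE !mxtens_indexK /= d1 d2 !mxE rcombD lfunE /=.
  rewrite (can_eq (@mxtens_indexK _ _)) xpair_eqE.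
  have /= -> := congr1 fst (mxtens_indexK (i0, j0)); have /= -> := congr1 snd (mxtens_indexK (i0, j0)).
  by case: eqP => _; case: eqP => _ /=; rewrite ?(add0r, mulr0n, mulr1n, mulr0, mul0r, mulr1, mul1r, addr0).
apply/seq.permP => p.
have pt f : (\sum_(b <- t) f b = \sum_(j < rdim V2) f (w2 j))%N.
  by rewrite (perm_big _ p2) /= codomE big_map big_enum.
have ps f : (\sum_(a <- s) f a = \sum_(j < rdim V1) f (w1 j))%N.
  by rewrite (perm_big _ p1) /= codomE big_map big_enum.
rewrite count_codom -sum1_count big_mkcond big_allpairs_dep ps.
under eq_bigr do rewrite pt.
rewrite pair_bigA /= (reindex (@mxtens_unindex _ _)); last first.
  by exists (@mxtens_index _ _) => i _; rewrite ?mxtens_indexK ?mxtens_unindexK.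
by apply: eq_bigr => i _; case: (p _).
Qed.

(** The columns of P are weight vectors of U or zero. Since P has full row rank, some of its columns
    form a basis, in which h acts diagonally. *)
Lemma has_weights_quot D U (w : 'I_(rdim D) -> 'rV[R]_r) (P : 'M[F]_(rdim U, rdim D)) :
  diag_rep iota alpha w -> (forall x, x \in h -> P *m D x = U x *m P) -> row_free P ->
  exists s, has_weights U s.
Proof.
move=> dw PD fP; have fP' : row_full P^T by rewrite /row_full mxrank_tr.
pose f := fullrankfun fP'; pose Q := (rowsub f P^T)^T.
have uQ : Q \in unitmx by rewrite unitmx_tr fullrowsub_unit.
pose w' := fun j => w (f j).
exists (codom w'), (rep_conj uQ), w'; split => //; first exact: rep_conj_iso.
move=> H /=; rewrite -mulmxA; have -> : U (vsval H) *m Q = Q *m diag_mx (\row_j (rc (w' j) H : F)).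
  apply/matrixP => i j; rewrite mul_mx_diag; have /matrixP/(_ i (f j)) := PD _ (subvsP H).
  rewrite dw mul_mx_diag !mxE => E; rewrite E; apply: eq_bigr => l _; by rewrite !mxE.
by rewrite mulKmx.
Qed.

(** Each summand is a quotient of the diagonal model, through the corresponding block of the
    isomorphism. *)
Lemma has_weights_summand V W s : has_weights (rep_dsum V W) s ->
  (exists t, has_weights V t) /\ (exists t, has_weights W t).
Proof.
move=> [D [w [[A [B [AB BA AV]]] dw _]]].
have BD x : B *m D x = rep_dsum V W x *m B.
  by rewrite -[rep_dsum V W x]mul1mx -BA -!mulmxA (mulmxA A) AV -mulmxA AB mulmx1.
pose B' : 'M[F]_(rdim V + rdim W, rdim D) := B.
split.
  apply: (has_weights_quot (P := usubmx B') dw) => [x xh|].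
    have := BD x; rewrite /= -[B]/B' -{1 2}[B']vsubmxK mul_block_col mul_col_mx.
    by case/eq_col_mx => -> _; rewrite mul0mx addr0.
  apply/row_freeP; exists (A *m col_mx 1%:M 0).
  have /(congr1 usubmx) : B' *m A *m col_mx 1%:M 0 = col_mx 1%:M 0 :> 'M[F]_(_, _) by rewrite /B' BA mul1mx.
  by rewrite -mulmxA -mul_usub_mx => ->; rewrite col_mxKu.
apply: (has_weights_quot (P := dsubmx B') dw) => [x xh|].
  have := BD x; rewrite /= -[B]/B' -{1 2}[B']vsubmxK mul_block_col mul_col_mx.
  by case/eq_col_mx => _ ->; rewrite mul0mx add0r.
apply/row_freeP; exists (A *m col_mx 0 1%:M).
have /(congr1 dsubmx) : B' *m A *m col_mx 0 1%:M = col_mx 0 1%:M :> 'M[F]_(_, _) by rewrite /B' BA mul1mx.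
by rewrite -mulmxA -mul_dsub_mx => ->; rewrite col_mxKd.
Qed.

End HasWeights.

Lemma free_colsP (F : fieldType) d k (X : k.-tuple 'cV[F]_d) : free X ->
  let Q := \matrix_(i, j) (tnth X j) i 0 in
  [/\ forall c : 'cV[F]_k, Q *m c = 0 -> c = 0,
      forall u, u \in <<X>>%VS <-> exists c : 'cV[F]_k, u = Q *m c
    & forall c : 'cV[F]_k, Q *m c = \sum_j c j 0 *: tnth X j].
Proof.
move=> fX Q; have QE (c : 'cV[F]_k) : Q *m c = \sum_j c j 0 *: tnth X j.
  by apply/colP => i; rewrite mxE summxE; apply: eq_bigr => j _; rewrite !mxE mulrC.
split => // [c|u].
  rewrite QE => c0; apply/colP => j; rewrite mxE.
  have /freeP fX' := fX; apply: (fX' (fun j => c j 0)); rewrite -[RHS]c0; apply: eq_bigr => i _.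
  by rewrite (tnth_nth 0).
split=> [/coord_span uX|[c ->]].
  exists (\col_j coord X j u); rewrite QE [LHS]uX; apply: eq_bigr => j _.
  by rewrite mxE (tnth_nth 0).
by rewrite QE; apply: memv_suml => j _; rewrite memvZ// memv_span// mem_tnth.
Qed.

Section SubReps.
Context {F : fieldType} {g : lieAlgebraType F}.
Implicit Types (V W U S : lierep g).

Lemma rep_of_span V k (X : k.-tuple 'cV[F]_(rdim V)) : free X -> submodule <<X>>%VS ->
  exists (Q : 'M[F]_(rdim V, k)) (J : 'M[F]_(k, rdim V)),
  [/\ J *m Q = 1%:M, forall x, V x *m Q = Q *m (J *m (V x *m Q)),
      forall u, u \in <<X>>%VS <-> exists c : 'cV[F]_k, u = Q *m c & forall j, col j Q = tnth X j].
Proof.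
move=> fX sX; have [Qinj QX QE] := free_colsP fX; move: Qinj QX QE; set Q := \matrix_(_, _) _ => Qinj QX QE.
have /row_fullP[J JQ] := col_injP Qinj; exists Q, J; split => // [x|j].
  apply/matrixP => i j; have colE (m : nat) (A : 'M[F]_(m, k)) l : A l j = (A *m delta_mx j 0 : 'cV_m) l 0.
    by rewrite -colE mxE.
  rewrite [LHS]colE [RHS]colE -!mulmxA.
  have /QX[c ->] : V x *m (Q *m delta_mx j 0) \in <<X>>%VS.
    by apply: sX; apply/QX; exists (delta_mx j 0).
  by rewrite !mulmxA -(mulmxA Q J Q) JQ mulmx1.
by apply/colP => i; rewrite !mxE.
Qed.

Lemma rep_of_sub V (K : {vspace 'cV[F]_(rdim V)}) : submodule K ->
  exists (S : lierep g) (Q : 'M[F]_(rdim V, rdim S)),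
  [/\ forall c : 'cV_(rdim S), Q *m c = 0 -> c = 0, forall u, u \in K <-> exists c : 'cV[F]_(rdim S), u = Q *m c,
      forall x, V x *m Q = Q *m S x & rdim S = \dim K].
Proof.
move=> sK; have KE : <<vbasis K>>%VS = K by apply/eqP; rewrite (span_basis (vbasisP K)).
have [||Q [J [JQ sQ QX _]]] := @rep_of_span V _ (vbasis K); rewrite ?KE//.
  exact: basis_free (vbasisP K).
exists (rep_sub sQ), Q; split => // [c Qc|u].
  by rewrite -[c]mul1mx -JQ -mulmxA Qc mulmx0.
by rewrite -QX KE.
Qed.

Lemma rep_of_sub_irr V S (Q : 'M[F]_(rdim V, rdim S)) (K : {vspace 'cV[F]_(rdim V)}) :
  (forall c : 'cV_(rdim S), Q *m c = 0 -> c = 0) -> (forall u, u \in K <-> exists c : 'cV[F]_(rdim S), u = Q *m c) ->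
  (forall x, V x *m Q = Q *m S x) -> rdim S = \dim K -> irreducible_sub K -> rep_irreducible S.
Proof.
move=> Qinj QK QS dS [K0 Kirr]; split; first by rewrite dS lt0n dimv_eq0.
move=> T sT; pose f : 'Hom('cV[F]_(rdim S), 'cV[F]_(rdim V)) := linfun (mulmx Q).
have fE c : f c = Q *m c by rewrite lfunE.
have [||T0|TK] := Kirr (f @: T)%VS.
- move=> x _ /memv_imgP[c cT ->]; apply/memv_imgP; exists (S x *m c); first exact: sT.
  by rewrite !fE !mulmxA QS.
- by apply/subvP => _ /memv_imgP[c cT ->]; apply/QK; exists c; rewrite fE.
- left; apply/eqP; rewrite -subv0; apply/subvP => c cT; rewrite memv0; apply/eqP/Qinj; rewrite -fE.
  by apply/eqP; rewrite -memv0 -T0 memv_img.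
- right; apply/eqP; rewrite eqEsubv subvf /=; apply/subvP => c _.
  have : Q *m c \in K by apply/QK; exists c.
  rewrite -TK => /memv_imgP[c' c'T]; rewrite fE => /eqP; rewrite -subr_eq0 -mulmxBr => /eqP/Qinj/eqP.
  by rewrite subr_eq0 => /eqP ->.
Qed.

Lemma rep_irreducible_iso V W : rep_iso V W -> rep_irreducible V -> rep_irreducible W.
Proof.
move=> VW; have [A [B [AB BA AV]]] := VW; move=> [d0 irrV].
have Qinj (c : 'cV_(rdim W)) : B *m c = 0 -> c = 0 by move=> Bc; rewrite -[c]mul1mx -AB -mulmxA Bc mulmx0.
apply: (@rep_of_sub_irr V W B fullv Qinj).
- by move=> u; split=> _; [exists (A *m u); rewrite mulmxA BA mul1mx|exact: memvf].
- by move=> x; rewrite -[V x *m B]mul1mx -BA -mulmxA (mulmxA A) AV -!mulmxA AB mulmx1.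
- by rewrite dimvf /dim /= muln1 (rep_iso_dim VW).
- split; last by move=> K sK _; exact: irrV.
  by rewrite -dimv_eq0 dimvf /dim /= muln1 -lt0n.
Qed.

Lemma split_iso V (U M : {vspace 'cV[F]_(rdim V)}) : submodule U -> submodule M -> irreducible_sub U ->
  (U + M)%VS = fullv -> (U :&: M)%VS = 0%VS ->
  exists SU SM, [/\ rep_iso V (rep_dsum SU SM), rep_irreducible SU & (rdim SM < rdim V)%N].
Proof.
move=> sU sM irU UM UM0.
have [SU [QU [iU memU QSU dU]]] := rep_of_sub sU; have [SM [QM [iM memM QSM dM]]] := rep_of_sub sM.
have irSU := rep_of_sub_irr iU memU QSU dU irU.
exists SU, SM; split => //; last first.
  have E : rdim V = (\dim U + \dim M)%N.
    by have := dimv_sum_cap U M; rewrite UM UM0 dimv0 addn0 dimvf /dim /= muln1.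
  rewrite dM (leq_trans _ (eq_leq (esym E)))// -[X in (X < _)%N]add0n ltn_add2r -dU.
  by case: irSU.
apply: rep_iso_sym; apply: (@rep_iso_bij _ _ (rep_dsum SU SM) V (row_mx QU QM : 'M[F]_(rdim V, rdim SU + rdim SM))) => /=.
- by move=> x; rewrite mul_mx_row QSU QSM mul_row_block !mulmx0 addr0 add0r.
- apply: col_surjP => u; have : u \in (U + M)%VS by rewrite UM memvf.
  case/memv_addP => u1 /memU[c1 ->] [u2 /memM[c2 ->] ->].
  by exists (col_mx c1 c2); rewrite mul_row_col.
- apply: col_injP => v; rewrite -[v]vsubmxK mul_row_col => /eqP; rewrite addr_eq0 => /eqP E.
  have : QU *m usubmx v \in (U :&: M)%VS.
    rewrite memv_cap; apply/andP; split; first by apply/memU; exists (usubmx v).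
    by rewrite E memvN; apply/memM; exists (dsubmx v).
  rewrite UM0 memv0 => /eqP E0; move: E; rewrite E0 => /eqP; rewrite eq_sym oppr_eq0 => /eqP/iM ->.
  by rewrite (iU _ E0) col_mx0.
Qed.

End SubReps.

(** * Irreducible modules and their decompositions *)

Section Irreducibles.
Context {R : realFieldType} {F : fieldType} {iota : {rmorphism R -> F}}
  {g : lieAlgebraType F} {h : {vspace g}} {r : nat}.
Variable alpha : r.-tuple (cartan_dual h).
Hypothesis g_simple : simple_lie_algebra g.
Hypothesis h_cartan : cartan_subalgebra h.
Hypothesis alpha_simple : simple_roots alpha.
Local Notation n := (\dim {:g}).
Local Notation rc := (rcomb iota alpha).
Local Notation kd a := (killing_dual (rc a)).
Variables (e : n.-tuple g) (wt : 'I_n -> 'rV[R]_r).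
Hypothesis be : basis_of fullv e.
Hypothesis we : forall i, in_root_space (rc (wt i)) (tnth e i).
Hypothesis wint : forall i, nat_vec (wt i) \/ nat_vec (- wt i).
Variable y : 'I_n -> g.
Hypothesis ey : forall i j : 'I_n, killing (tnth e i) (y j) = (i == j)%:R.
Hypothesis yw : forall j, in_root_space (rc (- wt j)) (y j).
Hypothesis eE : forall z, z = \sum_(i < n) killing z (y i) *: tnth e i.
Hypothesis yE : forall z, z = \sum_(i < n) killing z (tnth e i) *: y i.
Variable B : 'M[R]_r.
Hypothesis Bsym : B^T = B.
Hypothesis BE : forall a b, rc a (kd b) = iota (bform B a b) :> F.
Hypothesis Bpos : forall a, a != 0 -> 0 < bform B a a.
Hypothesis rho_dom : forall b, 0 <= bform B (two_rho wt) (delta_mx 0 b).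
Implicit Types (U V W : lierep g) (s t : seq 'rV[R]_r) (lam mu : 'rV[R]_r).
Local Notation hasw := (has_weights iota alpha).

Definition weight_vector U mu (v : 'cV[F]_(rdim U)) := forall H : subvs_of h,
  U (vsval H) *m v = (rc mu H : F) *: v.

Lemma weight_vector_shift U mu v x a : weight_vector mu v -> in_root_space (rc a) x ->
  @weight_vector U (mu + a) (U x *m v).
Proof.
move=> vmu xa H; have -> : U (vsval H) *m (U x *m v) = U x *m (U (vsval H) *m v) + U (lie (vsval H) x) *m v.
  by rewrite rmx_lie mulmxBl -!mulmxA addrC subrK.
by rewrite vmu -scalemxAr xa linearZ /= -scalemxAl -scalerDl rcombDE addrC.
Qed.

(** A free family of weight vectors of maximal length spans a submodule, because root vectors send
    weight vectors to weight vectors; by irreducibility it spans everything. *)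
Lemma irreducible_has_weights U mu v : rep_irreducible U -> v != 0 -> @weight_vector U mu v ->
  exists s, hasw U s.
Proof.
move=> [d0 irrU] v0 vmu.
pose P k := `[< exists X : k.-tuple 'cV[F]_(rdim U), free X /\ forall j, exists nu, weight_vector nu (tnth X j) >].
have P1 : P 1%N.
  apply/asboolP; exists [tuple v]; split; first by rewrite /= seq1_free.
  by move=> j; exists mu; rewrite (ord1 j).
have ubP k : P k -> (k <= \dim {:'cV[F]_(rdim U)})%N.
  move=> /asboolP[X [fX _]]; have := fX; rewrite /free => /eqP sX.
  by rewrite -[k](size_tuple X) -sX dimvS// subvf.
have exP : exists k, P k by exists 1%N.
case: (ex_maxnP exP ubP) => k /asboolP[X [fX Xw]] kmax.
have sX : submodule <<X>>%VS.
  apply: (submodule_basis be) => i u /coord_span ->; rewrite mulmx_sumr; apply: memv_suml => j _.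
  rewrite -scalemxAr memvZ//; apply/negPn/negP => nX; have : P k.+1.
    apply/asboolP; exists [tuple of (U (tnth e i) *m X`_j) :: X]; split; first by rewrite /= free_cons nX.
    move=> l; case: (unliftP ord0 l) => [l'|] ->; first by rewrite tnthS.
    rewrite tnth0; have [nu nuX] := Xw j; exists (nu + wt i).
    by apply: weight_vector_shift => //; rewrite -tnth_nth.
  by move/kmax; rewrite ltnn.
have XF : <<X>>%VS = fullv.
  case: (irrU _ sX) => // X0; have := kmax _ P1.
  have := fX; rewrite /free X0 dimv0 size_tuple eq_sym => /eqP ->; by rewrite ltnn.
have [Q [J [JQ sQ QX Qcol]]] := rep_of_span fX sX.
pose w j := xget 0 [set nu | weight_vector nu (tnth X j)].
have wP j : weight_vector (w j) (tnth X j).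
  by have [nu nuX] := Xw j; exact: (@xgetPex _ 0 [set nu | weight_vector nu (tnth X j)] (ex_intro _ nu nuX)).
exists (codom w), (rep_sub sQ), w; split => //.
  apply: rep_iso_sym; apply: (@rep_iso_bij _ _ (rep_sub sQ) U Q) => /=.
  - by move=> x; rewrite -sQ.
  - by apply: col_surjP => u; have /QX[c ->] : u \in <<X>>%VS by [rewrite XF memvf]; exists c.
  - by apply/row_fullP; exists J.
move=> H /=; have -> : U (vsval H) *m Q = Q *m diag_mx (\row_j (rc (w j) H : F)).
  apply/matrixP => i j; rewrite mul_mx_diag; have /colP/(_ i) := wP j H.
  rewrite -Qcol !mxE [RHS]mulrC => <-; by apply: eq_bigr => l _; rewrite !mxE.
by rewrite mulmxA JQ mul1mx.
Qed.

Definition irr_data U lam s := [/\ rep_irreducible U, hasw U s, dominant B lam, count_mem lam s = 1%N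
  & (forall mu, mu \in s -> nat_vec (lam - mu)) /\ casimir U = (iota (cas wt B lam))%:M].

Lemma irr_data_iso_inv U U' lam s : rep_iso U U' -> irr_data U lam s -> irr_data U' lam s.
Proof.
move=> UU' [irr hw dl cl [sl cU]]; split => //.
- exact: rep_irreducible_iso UU' irr.
- exact: has_weights_iso UU' hw.
- by split => //; apply: rep_iso_casimir cU; exact: rep_iso_sym.
Qed.

(** The submodule generated by the maximal vector is the whole module, so every weight is below
    [lam], and modulo the line of v no vector of weight [lam] is left. *)
Lemma irr_data_diag U (w : 'I_(rdim U) -> 'rV[R]_r) lam v : rep_irreducible U -> diag_rep iota alpha w ->
  v != 0 -> weight_vec w lam v -> (forall l, pos_vec (wt l) -> U (tnth e l) *m v = 0) ->
  irr_data U lam (codom w).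
Proof.
move=> irr dw v0 vl vk.
have [K [sK vK irK dl [Kcas Klow]]] := max_vec_gen g_simple h_cartan alpha_simple be we wint ey yw eE yE Bsym BE Bpos rho_dom dw v0 vl vk.
have KF : K = fullv by case: irr => _ /(_ _ sK)[K0|//]; case: irK; rewrite K0 eqxx.
have {}Klow j : exists c, lower w lam (delta_mx j 0 - c *: v) by apply: Klow; rewrite KF memvf.
have wl j : w j = lam \/ nat_vec (lam - w j).
  have [c lc] := Klow j; have [->|wj] := eqVneq (w j) lam; [by left|right].
  have vj : v j 0 = 0 by apply/eqP/negPn/negP => /vl E; rewrite E eqxx in wj.
  by have [] := lc j; rewrite // !mxE !eqxx vj mulr0 subr0 oner_eq0.
have [j0 vj0] : exists j, v j 0 != 0.
  apply: contrapT => nj; move/eqP: v0; apply; apply/colP => j; rewrite mxE.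
  by apply/eqP/negPn/negP => uj; apply: nj; exists j.
have wj0 := vl _ vj0.
split => //; first by exists U, w; split => //; exact: rep_iso_refl.
  rewrite count_codom (bigD1 j0) //= wj0 eqxx big1 // => j jj0; case: eqP => // wj.
  have low0 c i : w i = lam -> lower w lam (delta_mx j 0 - c *: v) -> (delta_mx j 0 - c *: v) i 0 = 0.
    by move=> wi lc; apply/eqP/negPn/negP => /lc[_]; rewrite wi eqxx.
  have [c lc] := Klow j.
  have := low0 c j0 wj0 lc; rewrite !mxE eq_sym (negPf jj0) /= sub0r => /eqP.
  rewrite oppr_eq0 mulf_eq0 (negPf vj0) orbF => /eqP c0.
  by have := low0 c j wj lc; rewrite c0 scale0r subr0 mxE !eqxx => /eqP; rewrite oner_eq0.
split.
  move=> _ /codomP[j ->]; case: (wl j) => // ->; rewrite subrr => b; exists 0%N; by rewrite mxE.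
apply/matrixP => i j; have := Kcas (delta_mx j 0); rewrite KF memvf => /(_ isT) /colP/(_ i).
by rewrite -colE !mxE eqxx andbT mulr_natr.
Qed.

Lemma irr_data_exists U s : rep_irreducible U -> hasw U s -> exists lam, irr_data U lam s.
Proof.
move=> irr [D [w [UD dw sw]]]; have irD := rep_irreducible_iso UD irr.
have s0 : submodule (0%VS : {vspace 'cV[F]_(rdim D)}).
  by move=> x u; rewrite memv0 => /eqP ->; rewrite mulmx0 mem0v.
have [||mu [v [_ v0 vmu vi]]] := rel_max_vec alpha_simple we dw (M := fullv) s0.
- by move=> x u _; rewrite memvf.
- by case: irD => d0 _; rewrite subv0 -dimv_eq0 dimvf /dim /= muln1 -lt0n.
exists mu; have := @irr_data_diag D w mu v irD dw; case => //.
- by rewrite -memv0.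
- by move=> l /vi; rewrite memv0 => /eqP.
move=> _ hw dl cl [sl cD]; split => //.
- by exists D, w.
- by rewrite (seq.permP sw).
- split; first by move=> nu; rewrite (perm_mem sw); exact: sl.
  exact: rep_iso_casimir cD.
Qed.

Lemma irr_data_hw U lam v : rep_irreducible U -> v != 0 -> @weight_vector U lam v ->
  (forall l, pos_vec (wt l) -> U (tnth e l) *m v = 0) -> exists s, irr_data U lam s.
Proof.
move=> irr v0 vl vk; have [s [D [w [UD dw sw]]]] := irreducible_has_weights irr v0 vl.
have irD := rep_irreducible_iso UD irr; have [A [A' [AA' A'A AU]]] := UD.
exists (codom w); apply: (irr_data_iso_inv (rep_iso_sym UD)).
apply: (@irr_data_diag D w lam (A *m v) irD dw).
- by apply: contraNneq v0 => Av; rewrite -[v]mul1mx -A'A -mulmxA Av mulmx0.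
- by apply: (weight_vec_cartanP alpha_simple dw) => H; rewrite mulmxA -AU -mulmxA vl -scalemxAr.
- by move=> l wl; rewrite mulmxA -AU -mulmxA vk// mulmx0.
Qed.

Lemma irr_data_vec U lam s : irr_data U lam s -> exists D (w : 'I_(rdim D) -> 'rV[R]_r) j,
  [/\ rep_iso U D, diag_rep iota alpha w, w j = lam
    & forall v, weight_vec w lam v -> forall l, pos_vec (wt l) -> D (tnth e l) *m v = 0].
Proof.
move=> [irr [D [w [UD dw sw]]] dl cl [sl cU]].
have [j wj] : exists j, w j = lam.
  have : lam \in codom w by rewrite -(perm_mem sw) -has_pred1 has_count cl.
  by case/codomP => j ->; exists j.
exists D, w, j; split => // v vl l wl; apply/colP => i; rewrite [RHS]mxE; apply/eqP/negPn/negP => vi.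
have wi := weight_vec_shift alpha_simple dw (@we l) vl vi.
have := sl (w i); rewrite (perm_mem sw) codom_f => /(_ isT); rewrite wi opprD addNKr => nl.
have [wl0 _] := andP wl; have := @nat_vec_pos _ _ (- wt l) nl; rewrite oppr_eq0 => /(_ wl0).
by rewrite pos_vecN.
Qed.

(** In the direct sum, the sum of the two highest weight vectors generates an irreducible submodule.
    Both projections are nonzero on it, hence isomorphisms by Schur's argument. *)
Lemma irr_data_iso U U' lam s s' : irr_data U lam s -> irr_data U' lam s' -> rep_iso U U'.
Proof.
move=> dU dU'; have [irU _ _ _ _] := dU; have [irU' _ _ _ _] := dU'.
have [D [w [j [UD dw wj kD]]]] := irr_data_vec dU; have [D' [w' [j' [UD' dw' wj' kD']]]] := irr_data_vec dU'.
apply: (rep_iso_trans UD); apply: rep_iso_trans (rep_iso_sym UD').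
have irD := rep_irreducible_iso UD irU; have irD' := rep_irreducible_iso UD' irU'.
move: irD irD' => [d0 irD] [d0' irD'] {dU dU' irU irU' UD UD'}.
pose S := rep_dsum D D'; pose wS (i : 'I_(rdim D + rdim D')) := match fintype.split i with inl j => w j | inr j => w' j end.
have dS : diag_rep iota alpha (V := S) wS.
  move=> H /=; rewrite dw dw' -diag_mx_row; congr diag_mx; apply/rowP => i; rewrite !mxE /wS.
  by case: (fintype.split i) => l; rewrite mxE.
pose v1 : 'cV[F]_(rdim D) := delta_mx j 0; pose v2 : 'cV[F]_(rdim D') := delta_mx j' 0.
pose v : 'cV[F]_(rdim S) := col_mx v1 v2.
have v10 : v1 != 0 by apply/eqP => /colP/(_ j)/eqP; rewrite !mxE !eqxx oner_eq0.
have v20 : v2 != 0 by apply/eqP => /colP/(_ j')/eqP; rewrite !mxE !eqxx oner_eq0.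
have v1l : weight_vec w lam v1.
  by move=> l; rewrite mxE; have [->//|_] := eqVneq l _; rewrite /= mulr0n eqxx.
have v2l : weight_vec w' lam v2.
  by move=> l; rewrite mxE; have [->//|_] := eqVneq l _; rewrite /= mulr0n eqxx.
have v0 : v != 0 by apply: contraNneq v10 => /(congr1 (fun u : 'cV_(rdim D + rdim D') => usubmx u)); rewrite /v col_mxKu linear0 => ->.
have vl : weight_vec (V := S) wS lam v.
  move=> i; rewrite /wS /v; case: (split_ordP i) => l ->; rewrite ?(unsplitK (inl l)) ?(unsplitK (inr l)) ?col_mxEu ?col_mxEd.
    exact: v1l.
  exact: v2l.
have [|K [sK vK irK _ _]] := max_vec_gen g_simple h_cartan alpha_simple be we wint ey yw eE yE Bsym BE Bpos rho_dom dS v0 vl.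
  by move=> l wl; rewrite /S /v /= mul_block_col kD// kD'// !mul0mx !addr0 col_mx0.
have [T [Q [Qinj QK QT dT]]] := rep_of_sub sK; have [Td0 irT] := rep_of_sub_irr Qinj QK QT dT irK.
have [c0 vE] : exists c : 'cV_(rdim T), v = Q *m c by apply/QK.
pose Q' : 'M[F]_(rdim D + rdim D', rdim T) := Q.
have QD x : D x *m usubmx Q' = usubmx Q' *m T x /\ D' x *m dsubmx Q' = dsubmx Q' *m T x.
  have := QT x; rewrite /= -[Q]/Q' -{1 2}[Q']vsubmxK mul_block_col mul_col_mx !mul0mx addr0 add0r.
  by case/eq_col_mx.
have iso (E : lierep g) (P : 'M[F]_(rdim E, rdim T)) u : (forall x, E x *m P = P *m T x) -> P *m c0 = u -> u != 0 ->
    (forall M : {vspace 'cV[F]_(rdim E)}, submodule M -> M = 0%VS \/ M = fullv) -> rep_iso T E.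
  move=> EP Pu u0 irE; pose f : 'Hom('cV[F]_(rdim T), 'cV[F]_(rdim E)) := linfun (mulmx P).
  have fE c : f c = P *m c by rewrite lfunE.
  have fc0 : f c0 != 0 by rewrite fE Pu.
  apply: (@rep_iso_bij _ _ T E P) => [x||]; first by rewrite EP.
    apply: col_surjP => u'; have [|i0|iF] := irE (limg f) => //.
    - move=> x _ /memv_imgP[c _ ->]; apply/memv_imgP; exists (T x *m c); first exact: memvf.
      by rewrite !fE !mulmxA EP.
    - by have := memv_img f (memvf c0); rewrite i0 memv0 (negPf fc0).
    - have : u' \in limg f by rewrite iF memvf.
      by case/memv_imgP => c _ ->; exists c; rewrite fE.
  apply: col_injP => c Pc; have [|k0|kF] := irT (lker f) => //.
  - by move=> x c'; rewrite !memv_ker !fE mulmxA -EP -mulmxA => /eqP ->; rewrite mulmx0.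
  - by apply/eqP; rewrite -memv0 -k0 memv_ker fE Pc.
  - by move: (memvf c0); rewrite -kF memv_ker (negPf fc0).
have iD : rep_iso T D.
  apply: (iso D (usubmx Q') v1) => //; first by move=> x; have [] := QD x.
  by rewrite mul_usub_mx -[Q']/Q -vE /v col_mxKu.
have iD' : rep_iso T D'.
  apply: (iso D' (dsubmx Q') v2) => //; first by move=> x; have [] := QD x.
  by rewrite mul_dsub_mx -[Q']/Q -vE /v col_mxKd.
exact: rep_iso_trans (rep_iso_sym iD) iD'.
Qed.

Lemma irr_data_lam U U' lam lam' s s' : irr_data U lam s -> irr_data U' lam' s' -> rep_iso U U' -> lam = lam'.
Proof.
move=> [_ hU _ cl [sl _]] [_ hU' _ cl' [sl' _]] UU'.
have ss' := has_weights_uniq alpha_simple (has_weights_iso UU' hU) hU'.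
have ls : lam \in s by rewrite -has_pred1 has_count cl.
have ls' : lam' \in s' by rewrite -has_pred1 has_count cl'.
have n1 : nat_vec (lam' - lam) by apply: sl'; rewrite -(perm_mem ss').
have n2 : nat_vec (lam - lam') by apply: sl; rewrite (perm_mem ss').
apply/rowP => b; have [k] := n1 b; have [l] := n2 b; rewrite !mxE => El Ek.
apply/le_anti/andP; split; rewrite -subr_ge0; [by rewrite Ek ler0n|by rewrite El ler0n].
Qed.

(** Induction on the dimension: [splitting] removes one irreducible summand, and its complement
    again has a weight list. *)
Lemma decomposition_exists V s : hasw V s -> exists S, rep_decomposition V S.
Proof.
have [k] := ubnP (rdim V); elim: k V s => // k IH V s dk hV.
have [d0|d0] := posnP (rdim V).
  by exists [::]; split => //=; exact: rep_zero0_iso.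
have [D [w [VD dw sw]]] := hV.
have dD : (0 < rdim D)%N by rewrite -(rep_iso_dim VD).
have [U [M [sU sM irU UM UM0]]] := splitting g_simple h_cartan alpha_simple be we wint ey yw eE yE Bsym BE Bpos rho_dom dw dD.
have [SU [SM [DS irS dM]]] := split_iso sU sM irU UM UM0.
have VS := rep_iso_trans VD DS.
have [_ [t hM]] := has_weights_summand (has_weights_iso VS hV).
have [|S [Sirr SMS]] := IH SM t _ hM.
  by rewrite -ltnS; apply: leq_ltn_trans dM _; rewrite -(rep_iso_dim VD).
exists (SU :: S); split; first by rewrite /= Sirr andbT; apply/asboolP.
apply: (rep_iso_trans VS); apply: rep_iso_dsum => //; exact: rep_iso_refl.
Qed.

Lemma decomposition_data V s S : hasw V s -> rep_decomposition V S ->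
  exists L : seq (lierep g * 'rV[R]_r * seq 'rV[R]_r),
    [/\ S = [seq p.1.1 | p <- L], perm_eq s (flatten [seq p.2 | p <- L])
      & forall p, List.In p L -> irr_data p.1.1 p.1.2 p.2].
Proof.
elim: S V s => [|U S IH] V s hV [/= Sirr VS].
  exists [::]; split => //=; have := has_weights_size (has_weights_iso VS hV).
  by rewrite /= => /eqP/nilP ->.
move: Sirr => /andP[/asboolP irU Sirr].
have hS := has_weights_iso VS hV; have [[t1 h1] [t2 h2]] := has_weights_summand hS.
have [|L [SE pL HL]] := IH _ t2 h2; first by split => //; exact: rep_iso_refl.
have [lam dU] := irr_data_exists irU h1; exists ((U, lam, t1) :: L); split => /=.
- by rewrite SE.
- apply: perm_trans (has_weights_uniq alpha_simple hS (has_weights_dsum h1 h2)) _.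
  by rewrite perm_cat2l.
- by move=> p [<-|/HL].
Qed.

End Irreducibles.

Lemma count_codom_card (T : eqType) d (w : 'I_d -> T) (mu : T) :
  count_mem mu (codom w) = #|[pred j | w j == mu]|.
Proof.
rewrite count_codom -sum1_card [RHS]big_mkcond; apply: eq_bigr => i _.
by rewrite /= inE; case: eqP.
Qed.

(** * Multiplicities and dimensions *)

Section AffineProducts.
Context {R : realFieldType} {r : nat}.
Variable B : 'M[R]_r.
Implicit Types (S : seq 'rV[R]_r) (ls : seq (R * 'rV[R]_r)).
Local Notation aff ls := (fun x => \prod_(p <- ls) (p.1 + bform B x p.2)).

Lemma dsum_aff_cons c a ls S : uniq S -> dsum S (aff ((c, a) :: ls)) = c * dsum S (aff ls) +
  \sum_(b <- S) 2^-1 * bform B b a *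
    (dsum (rem b S) (aff [seq (p.1 + bform B (2^-1 *: b) p.2, p.2) | p <- ls]) +
     dsum (rem b S) (aff [seq (p.1 - bform B (2^-1 *: b) p.2, p.2) | p <- ls])).
Proof.
move=> uS; rewrite (eq_dsum _ (q' := fun x => c * aff ls x + bform B x a * aff ls x)); last first.
  by move=> x; rewrite big_cons mulrDl.
rewrite dsumD dsumMl (dsum_leibniz (l := fun x => bform B x a))//; last by move=> x z; rewrite bformDl.
congr (_ + _); apply: eq_bigr => b _; congr (_ * (_ + _)); apply: eq_dsum => x; rewrite big_map; apply: eq_bigr => p _ /=.
  by rewrite bformDl; ring.
by rewrite bformDl bformNl; ring.
Qed.

(** A signed sum over [S] is an iterated difference of order [size S], which annihilates polynomials
    of smaller degree. *)
Lemma dsum_aff_small ls S : uniq S -> (size ls < size S)%N -> dsum S (aff ls) = 0.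
Proof.
have [k] := ubnP (size ls); elim: k ls S => // k IH [|[c a] ls] S sk uS sz.
  case: S uS sz => // b S _ _ /=; rewrite (eq_dsum _ (q' := fun=> 1)); last by move=> x; rewrite big_nil.
  by rewrite [X in _ - X](eq_dsum _ (q' := fun=> 1)) ?subrr// => x; rewrite big_nil.
have sr b : b \in S -> (size ls < size (rem b S))%N.
  by move=> bS; rewrite size_rem//; move: sz; rewrite /=; case: (size S).
rewrite dsum_aff_cons// IH ?mulr0 ?add0r//; last exact: ltnW sz.
by rewrite big_seq big1// => b bS; rewrite !IH ?addr0 ?mulr0 ?rem_uniq ?size_map ?sr.
Qed.

(** In degree [size S] only the leading part survives the differences, so the constant terms of the
    affine factors do not matter. *)
Lemma dsum_aff_top ls ls' S : uniq S -> size ls = size S -> map snd ls = map snd ls' ->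
  dsum S (aff ls) = dsum S (aff ls').
Proof.
have [k] := ubnP (size ls); elim: k ls ls' S => // k IH [|[c a] ls] [|[c' a'] ls']// S sk uS sz [<- E].
have sz' : size ls' = size ls by rewrite -[LHS](size_map snd) -E size_map.
have dz d : d * dsum S (aff ls) = 0 by rewrite dsum_aff_small ?mulr0// -sz.
have dz' d : d * dsum S (aff ls') = 0 by rewrite dsum_aff_small ?mulr0// sz' -sz.
have E2 (f f' : R * 'rV[R]_r -> R) : map snd [seq (f p, p.2) | p <- ls] = map snd [seq (f' p, p.2) | p <- ls'].
  by rewrite -!map_comp; exact: E.
rewrite !dsum_aff_cons// dz dz' !add0r; apply: eq_big_seq => b bS; congr (_ * (_ + _)).
  by apply: IH; rewrite ?rem_uniq ?size_map ?size_rem// -sz.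
by apply: IH; rewrite ?rem_uniq ?size_map ?size_rem// -sz.
Qed.

(* root_prod has degree size Pos, so the signed difference of order size Pos is translation invariant. *)
Lemma dsum_root_prod (Pos : seq 'rV[R]_r) v : uniq Pos ->
  dsum Pos (fun x => root_prod B Pos (v + x)) = dsum Pos (root_prod B Pos).
Proof.
move=> uP; transitivity (dsum Pos (aff [seq (bform B v a, a) | a <- Pos])).
  by apply: eq_dsum => x; rewrite big_map /root_prod; apply: eq_bigr => a _; rewrite bformDl.
transitivity (dsum Pos (aff [seq (0, a) | a <- Pos])).
  by apply: dsum_aff_top; rewrite ?size_map// -!map_comp.
by apply: eq_dsum => x; rewrite big_map /root_prod; apply: eq_bigr => a _; rewrite add0r.
Qed.

End AffineProducts.

(** * Character and dimension formulas *)

Section Characters.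
Context {R : realFieldType} {F : fieldType} {iota : {rmorphism R -> F}}
  {g : lieAlgebraType F} {h : {vspace g}} {r : nat}.
Variable alpha : r.-tuple (cartan_dual h).
Hypothesis g_simple : simple_lie_algebra g.
Hypothesis h_cartan : cartan_subalgebra h.
Hypothesis alpha_simple : simple_roots alpha.
Local Notation n := (\dim {:g}).
Local Notation rc := (rcomb iota alpha).
Local Notation kd a := (killing_dual (rc a)).
Variables (e : n.-tuple g) (wt : 'I_n -> 'rV[R]_r).
Hypothesis be : basis_of fullv e.
Hypothesis we : forall i, in_root_space (rc (wt i)) (tnth e i).
Hypothesis wint : forall i, nat_vec (wt i) \/ nat_vec (- wt i).
Variable y : 'I_n -> g.
Hypothesis ey : forall i j : 'I_n, killing (tnth e i) (y j) = (i == j)%:R.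
Hypothesis yw : forall j, in_root_space (rc (- wt j)) (y j).
Hypothesis eE : forall z, z = \sum_(i < n) killing z (y i) *: tnth e i.
Hypothesis yE : forall z, z = \sum_(i < n) killing z (tnth e i) *: y i.
Variable B : 'M[R]_r.
Hypothesis Bsym : B^T = B.
Hypothesis BE : forall a b, rc a (kd b) = iota (bform B a b) :> F.
Hypothesis Bpos : forall a, a != 0 -> 0 < bform B a a.
Implicit Types (U V W : lierep g) (s t : seq 'rV[R]_r) (lam mu : 'rV[R]_r).
Local Notation hasw := (has_weights iota alpha).
Local Notation sr b := (delta_mx 0 b : 'rV[R]_r).

Definition pos_roots := [seq wt i | i <- enum 'I_n & pos_vec (wt i)].
Local Notation Pos := pos_roots.
Local Notation rho := (half_sum Pos).

Lemma pos_rootsP x : reflect (exists2 i, pos_vec (wt i) & x = wt i) (x \in Pos).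
Proof.
apply: (iffP mapP) => hx; case: hx => i wi ->.
  by move: wi; rewrite mem_filter => /andP[wi _]; exists i.
by exists i; rewrite // mem_filter wi mem_enum.
Qed.

Lemma sr_neq0 b : sr b != 0.
Proof. by apply/eqP => /rowP/(_ b)/eqP; rewrite !mxE !eqxx oner_eq0. Qed.

Lemma pos_vec_neq0 (x : 'rV[R]_r) : pos_vec x -> x != 0. Proof. by case/andP. Qed.

Lemma sum_pos_roots (A : nmodType) (f : 'rV[R]_r -> A) :
  \sum_(a <- Pos) f a = \sum_(i | pos_vec (wt i)) f (wt i).
Proof. by rewrite big_map big_filter big_enum_cond; apply: eq_bigl. Qed.

Lemma pos_roots_uniq : uniq Pos.
Proof.
rewrite map_inj_in_uniq; first exact: filter_uniq (enum_uniq _).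
move=> i j; rewrite !mem_filter => /andP[wi _] _ E.
exact: (root_mult1 g_simple h_cartan alpha_simple be we ey yw BE Bpos (pos_vec_neq0 wi) E).
Qed.

Lemma pos_roots_neq0 x : x \in Pos -> x != 0.
Proof. by case/pos_rootsP => i wi ->; exact: pos_vec_neq0. Qed.

Lemma pos_roots_ge0 x b : x \in Pos -> 0 <= x 0 b.
Proof. by case/pos_rootsP => i /andP[_ /forallP wi] ->. Qed.

Lemma simple_pos_roots b : sr b \in Pos.
Proof.
have [i wi] := simple_wt alpha_simple be we b; apply/pos_rootsP; exists i; rewrite wi//.
by rewrite /pos_vec sr_neq0; apply/forallP => c; rewrite mxE; case: (_ && _).
Qed.

(** The reflection changes only the coordinate [b]. A positive root other than [sr b] has another
    nonzero coordinate, since otherwise it would be a multiple excluded by [root_multiple]; that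
    coordinate keeps its sign, so the image is positive. *)
Lemma refl_pos_roots b x : x \in Pos -> x != sr b -> refl B b x \in Pos.
Proof.
case/pos_rootsP => i wi -> xb; have wi0 := pos_vec_neq0 wi.
have [l wl] := simple_wt alpha_simple be we b.
have wl0 : wt l != 0 by rewrite wl sr_neq0.
have [j wj] : exists j, wt j = refl B b (wt i).
  have := weight_count_refl g_simple h_cartan alpha_simple be we ey yw BE Bpos
    (adjoint_diag be we) (wt i) wl0.
  rewrite (cardD1 i [pred j | wt j == wt i]) inE eqxx /= => E.
  have /card_gt0P[j] : (0 < #|[pred j | wt j == refl_root B (wt l) (wt i)]|)%N by rewrite E.
  by rewrite inE => /eqP wj; exists j; rewrite wj /refl_root wl.
have wc c : c != b -> wt j 0 c = wt i 0 c.
  by move=> cb; rewrite wj !mxE eqxx (negPf cb) /= mulr0 subr0.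
have [k wik] := pos_wt_nat wint wi b.
have bad : (forall c, c != b -> wt i 0 c = 0) -> False.
  move=> w0; have wE : wt i = wt l *+ k.
    apply/rowP => c; rewrite wl mulmxnE !mxE eqxx /=; have [->|/w0 ->] := eqVneq c b; first by rewrite wik.
    by rewrite mul0rn.
  have := root_multiple g_simple h_cartan alpha_simple be we ey yw BE Bpos wl0 wE.
  case: k wE {wik} => [|[|k]]// wE _; first by rewrite wE mulr0n eqxx in wi0.
  by move/eqP: xb; rewrite wE mulr1n wl.
have /andP[_ /forallP wi_ge0] := wi.
apply/pos_rootsP; exists j => //; case: (wt_trichotomy wint j) => [w0|//|wn].
  by case: bad => c /wc <-; rewrite w0 mxE.
case: bad => c cb; have := wc c cb; have /andP[_ /forallP/(_ c)] := wn; rewrite mxE oppr_ge0 => w1 w2.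
by apply/le_anti; rewrite wi_ge0 -w2 w1.
Qed.

Lemma pos_roots_int b x : x \in Pos ->
  exists z : int, 2 * bform B x (sr b) / bform B (sr b) (sr b) = z%:~R.
Proof.
case/pos_rootsP => i wi ->; have [l wl] := simple_wt alpha_simple be we b.
have wl0 : wt l != 0 by rewrite wl sr_neq0.
have [z] := weight_integral alpha_simple (adjoint_diag be we) i wl0 (@we l) (@yw l)
   (lie_dual_root g_simple h_cartan alpha_simple be we ey yw l).
rewrite !BE wl -[z%:~R](rmorph_int iota) -(rmorph_nat iota 2) -fmorphV -!rmorphM => /fmorph_inj ->.
exists z; field; by rewrite gt_eqF// Bpos// sr_neq0.
Qed.

Lemma two_rho_pos_roots : two_rho wt = 2 *: rho.
Proof. by rewrite /half_sum scalerA mulfV ?pnatr_eq0// scale1r sum_pos_roots. Qed.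

Let p1 := Bsym. Let p2 := Bpos. Let p3 := pos_roots_uniq. Let p4 := pos_roots_ge0.
Let p5 := simple_pos_roots. Let p6 := refl_pos_roots. Let p7 := pos_roots_int. Let p8 := pos_roots_neq0.

Lemma rho_simple_pos b : bform B rho (sr b) = bform B (sr b) (sr b) / 2.
Proof. exact: rho_simple. Qed.

Lemma two_rho_dom b : 0 <= bform B (two_rho wt) (sr b).
Proof.
rewrite two_rho_pos_roots bformZl rho_simple_pos mulrC divfK ?pnatr_eq0// ltW// Bpos//.
exact: sr_neq0.
Qed.

Lemma casE lam : cas wt B lam + bform B rho rho = bform B (lam + rho) (lam + rho).
Proof.
rewrite /cas two_rho_pos_roots; move: (half_sum _) => q.
by rewrite !(bformDl, bformDr, bformZr) (bformC q lam)//; ring.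
Qed.

Local Notation irrd := (irr_data (iota := iota) alpha wt B).

Lemma weight_count_simple V s b mu : hasw V s -> count_mem (refl B b mu) s = count_mem mu s.
Proof.
move=> [D [w [VD dw sw]]]; rewrite !(seq.permP sw) !count_codom_card.
have [l wl] := simple_wt alpha_simple be we b.
have wl0 : wt l != 0 by rewrite wl sr_neq0.
by rewrite -(weight_count_refl g_simple h_cartan alpha_simple be we ey yw BE Bpos dw mu wl0) /refl_root wl.
Qed.

Lemma alt_sum_weights_antisym V s : hasw V s -> antisym B (alt_sum Pos (fun x => (count_mem x s)%:R)).
Proof.
move=> hV; apply: alt_sum_antisym => // b x; by rewrite (weight_count_simple _ _ hV).
Qed.

(** Descending recursion on the height: above the weights of the module the trace is 0, and
    [weight_trace_commutator] changes it by real amounts. This brings the Freudenthal identities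
    down to the ordered field. *)
Lemma weight_trace_real D (w : 'I_(rdim D) -> 'rV[R]_r) i mu : diag_rep iota alpha w -> pos_vec (wt i) ->
  exists k : R, iota k = weight_trace w (D (tnth e i) *m D (y i)) mu.
Proof.
move=> dw wi; have [k] := ubnP #|[pred j | height mu <= height (w j)]|.
elim: k mu => // k IH mu ck.
have [j /eqP wj|nj] := pickP [pred j | w j == mu]; last first.
  by exists 0; rewrite rmorph0 /weight_trace big_pred0.
have := weight_trace_commutator g_simple h_cartan alpha_simple be we ey yw BE dw i mu.
have hl : height mu < height (mu + wt i) by rewrite heightD ltrDl height_pos.
have [|k' <-] := IH (mu + wt i).
  apply: (@leq_trans #|[pred j | height mu <= height (w j)]|); last by rewrite -ltnS.
  apply/proper_card/properP; split.
    by apply/fintype.subsetP => l; rewrite !inE; apply: le_trans; exact: ltW.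
  by exists j; rewrite !inE wj ?lexx// -ltNge.
move/eqP; rewrite subr_eq => /eqP ->.
by exists (bform B mu (wt i) * #|[pred j | w j == mu]|%:R + k'); rewrite rmorphD rmorphM rmorph_nat.
Qed.

(** The Weyl character formula on the open chamber: the eigenvalue equation of [alt_sum_freudenthal]
    forces a strictly dominant point of the support to be [lam + rho], and there the value is the
    multiplicity of [lam], which is 1. *)
Lemma irr_data_alt_sum U lam s x : irrd U lam s -> sdom B x ->
  alt_sum Pos (fun z => (count_mem z s)%:R) x = (x == lam + rho)%:R.
Proof.
move=> [irr [D [w [UD dw sw]]] dl cl [sl cU]] sx.
pose m z : R := (count_mem z s)%:R.
have mE z : m z = #|[pred j | w j == z]|%:R by rewrite /m (seq.permP sw) count_codom_card.
have mlam z : m z != 0 -> forall b, z 0 b <= lam 0 b.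
  rewrite pnatr_eq0 -lt0n -has_count has_pred1 => /sl nz b.
  by have [k] := nz b; rewrite !mxE => E; rewrite -subr_ge0 E ler0n.
have dom_lam : dom B lam.
  move=> b; have [k kE] := dl b; have := ler0n R k; rewrite -kE.
  by rewrite pmulr_lge0 ?invr_gt0 ?Bpos ?sr_neq0// pmulr_rge0.
have [->|xl] := eqVneq x (lam + rho).
  by rewrite (alt_sum_top p8 p4 (m := m) mlam) /m cl.
apply/eqP/negPn/negP => ax; move/eqP: xl; apply.
apply: (alt_sum_sdom p1 p2 p3 p4 p5 p6 dom_lam mlam _ sx ax) => z.
have [T TE] : exists T : 'I_n -> 'rV[R]_r -> R, forall i mu, pos_vec (wt i) ->
    iota (T i mu) = weight_trace w (D (tnth e i) *m D (y i)) mu.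
  exists (fun i mu => xget 0 [set k | iota k = weight_trace w (D (tnth e i) *m D (y i)) mu]) => i mu wi.
  exact: (@xgetPex _ 0 [set k | iota k = _] (weight_trace_real mu dw wi)).
(* Traces are indexed by basis vectors, the recursion by roots; root spaces being lines, the root
   determines the index. *)
pose T' a mu := if [pick i | pos_vec (wt i) && (wt i == a)] is Some i then T i mu else 0.
have T'E i mu : pos_vec (wt i) -> T' (wt i) mu = T i mu.
  move=> wi; rewrite /T'; case: pickP => [j /andP[wj /eqP wij]|/(_ i)]; last by rewrite wi eqxx.
  by rewrite (root_mult1 g_simple h_cartan alpha_simple be we ey yw BE Bpos (pos_vec_neq0 wj) wij).
have inat k : iota (k%:R) = k%:R by exact: rmorph_nat.
rewrite -casE; apply: (alt_sum_freudenthal p1 p2 p3 p4 p5 p6 p7 (T := T')) => [a mu /pos_rootsP[i wi ->]|mu].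
  rewrite !T'E// mE; apply: (fmorph_inj iota); rewrite rmorphB rmorphM inat !TE//.
  exact: (weight_trace_commutator g_simple h_cartan alpha_simple be we ey yw BE dw).
rewrite sum_pos_roots mE; apply: (fmorph_inj iota); rewrite rmorphD !rmorphM inat rmorph_sum /=.
under eq_bigr => i wi do rewrite !T'E// rmorphD !TE//.
rewrite -(weight_trace_casimir g_simple h_cartan alpha_simple be we wint ey yw eE yE BE dw).
rewrite (rep_iso_casimir (rep_iso_sym UD) cU) /weight_trace (eq_bigr (fun=> iota (cas wt B lam))).
  by rewrite sumr_const mulr_natr.
by move=> j _; rewrite mxE eqxx.
Qed.

(** Pair the convolution with [root_prod]. By translation invariance of its signed sum each weight
    contributes the same amount, so the dimension comes out as a factor. *)
Lemma alt_sum_dim (s U : seq 'rV[R]_r) : uniq U ->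
  (forall v z, v \in s -> z \in dpts Pos -> v + z \in U) ->
  (size s)%:R * dsum Pos (root_prod B Pos) =
  \sum_(x <- U) alt_sum Pos (fun z => (count_mem z s)%:R) x * root_prod B Pos x.
Proof.
move=> uU sU; rewrite -(alt_sum_pairing _ uU sU).
under eq_bigr do rewrite (dsum_root_prod _ _ p3).
by rewrite big_const_seq count_predT iter_addr_0 mulr_natl.
Qed.

Lemma weyl_denomE x : weyl_denom Pos x = alt_sum Pos (fun z => (count_mem z [:: 0])%:R) x.
Proof.
by apply: eq_dsum => z; rewrite /= addn0 eq_sym.
Qed.

(** The Weyl dimension formula: apply [alt_sum_dim] to the module and to the trivial weight list.
    Both sides are orbit sizes times values of [root_prod], and the two orbit sizes agree by
    [supp_size_le]. *)
Lemma irr_data_dim U lam s : irrd U lam s ->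
  (rdim U)%:R = root_prod B Pos (lam + rho) / root_prod B Pos rho.
Proof.
move=> dU; have [irr hU dl cl [sl cU]] := dU.
pose S := undup [seq v + z | v <- s, z <- dpts Pos].
pose u := alt_sum Pos (fun z => (count_mem z s)%:R).
have mem_dsum t (x : 'rV[R]_r) : alt_sum Pos (fun z => (count_mem z t)%:R : R) x != 0 -> x \in [seq v + z | v <- t, z <- dpts Pos].
  apply: contraR => xS; rewrite /alt_sum (eq_dsum_pts (q' := fun=> 0)) ?dsum0// => z zP.
  apply/eqP; rewrite pnatr_eq0 -leqn0 leqNgt -has_count has_pred1; apply: contra xS => xs.
  by rewrite -[x](subrK z); exact: allpairs_f.
have dom_lam b : 0 <= bform B lam (sr b).
  have [k kE] := dl b; have := ler0n R k; rewrite -kE.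
  by rewrite pmulr_lge0 ?invr_gt0 ?Bpos ?sr_neq0// pmulr_rge0.
have rs : sdom B rho by move=> b; rewrite rho_simple_pos divr_gt0 ?Bpos ?sr_neq0.
have lrs : sdom B (lam + rho) by move=> b; rewrite bformDl ltr_wpDl// rs.
have ua : antisym B u := alt_sum_weights_antisym hU.
have u1 : u (lam + rho) = 1 by rewrite /u (irr_data_alt_sum dU)// eqxx.
have uu x : u x != 0 -> sdom B x -> x = lam + rho.
  by move=> ux sx; apply/eqP; move: ux; rewrite /u (irr_data_alt_sum dU)// pnatr_eq0; case: (x == _).
have uS z : u z != 0 -> z \in S by move=> uz; rewrite mem_undup mem_dsum.
pose S' := undup (dpts Pos); pose d := weyl_denom Pos.
have da : antisym B d by exact: weyl_denom_antisym.
have d1 : d rho = 1 by exact: (weyl_denom_rho p8 p4).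
have dS z : d z != 0 -> z \in S' by rewrite mem_undup; exact: weyl_denom_dpts.
have du x : d x != 0 -> sdom B x -> x = rho by exact: weyl_denom_sdom.
have c0 : root_prod B Pos rho != 0 by rewrite gt_eqF// root_prod_gt0.
have E1 := alt_sum_dim (s := s) (undup_uniq _ : uniq S).
have E2 := alt_sum_dim (s := [:: 0]) (undup_uniq _ : uniq S').
have pa : antisym B (root_prod B Pos) by exact: root_prod_antisym.
have {}E1 : (rdim U)%:R * dsum Pos (root_prod B Pos) = (count (fun x => u x != 0) S)%:R * root_prod B Pos (lam + rho).
  rewrite -(has_weights_size hU) E1; last by move=> v z vs zP; rewrite mem_undup; exact: allpairs_f.
  by apply: (pairing_antisym p2 ua uS u1 uu pa); exact: undup_uniq.
have {}E2 : dsum Pos (root_prod B Pos) = (count (fun x => d x != 0) S')%:R * root_prod B Pos rho.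
  rewrite -[LHS]mul1r [LHS]E2; last by move=> v z; rewrite inE => /eqP ->; rewrite add0r mem_undup.
  under eq_bigr do rewrite -weyl_denomE.
  by apply: (pairing_antisym p2 da dS d1 du pa); exact: undup_uniq.
have cE : count (fun x => u x != 0) S = count (fun x => d x != 0) S'.
  apply/eqP; rewrite eqn_leq.
  by rewrite (supp_size_le p1 p2 p8 p4 p5 p6 ua da (undup_uniq _) uS dS lrs rs u1 d1 uu du)
     (supp_size_le p1 p2 p8 p4 p5 p6 da ua (undup_uniq _) dS uS rs lrs d1 u1 du uu).
have k0 : (count (fun x => d x != 0) S')%:R != 0 :> R.
  rewrite pnatr_eq0 -lt0n -has_count; apply/hasP; exists rho; last by rewrite d1 oner_eq0.
  by apply: dS; rewrite d1 oner_eq0.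
apply: (mulIf k0); apply: (mulIf c0); move: E1; rewrite E2 cE mulrA => ->.
by field.
Qed.

Let decd := decomposition_data g_simple h_cartan alpha_simple be we wint ey yw eE yE p1 BE p2 two_rho_dom.
Let dece := decomposition_exists g_simple h_cartan alpha_simple be we wint ey yw eE yE p1 BE p2 two_rho_dom.
Let isod := irr_data_iso g_simple h_cartan alpha_simple be we wint ey yw eE yE p1 BE p2 two_rho_dom.

Lemma dominant_shift lam : dominant B lam -> sdom B (lam + rho).
Proof.
move=> dl b; rewrite bformDl rho_simple_pos ltr_wpDl ?divr_gt0 ?Bpos ?sr_neq0//.
have [k kE] := dl b; have := ler0n R k; rewrite -kE.
by rewrite pmulr_lge0 ?invr_gt0 ?Bpos ?sr_neq0// pmulr_rge0.
Qed.

Lemma alt_sum_flatten (L : seq (lierep g * 'rV[R]_r * seq 'rV[R]_r)) x : sdom B x ->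
  (forall p, List.In p L -> irrd p.1.1 p.1.2 p.2) ->
  alt_sum Pos (fun z => (count_mem z (flatten [seq p.2 | p <- L]))%:R) x =
  (count (fun p => x == p.1.2 + rho) L)%:R.
Proof.
move=> sx; elim: L => [_|p L IH HL] /=; first exact: dsum0.
rewrite /alt_sum (eq_dsum _ (q' := fun z => (count_mem (x - z) p.2)%:R + (count_mem (x - z) (flatten [seq p.2 | p <- L]))%:R)).
  rewrite dsumD natrD [X in _ + X]IH ?[X in X + _](irr_data_alt_sum (HL p (or_introl erefl)) sx)//.
  by move=> q qL; apply: HL; right.
by move=> z; rewrite count_cat natrD.
Qed.

(** Every decomposition has a weight list that is the union of those of its summands, and a summand
    contributes at [lam + rho] exactly when its highest weight is [lam]. So whichever count [xget]
    picks equals the alternating sum. *)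
Lemma multiplicity_alt_sum W t U lam s : hasw W t -> irrd U lam s ->
  (multiplicity U W)%:R = alt_sum Pos (fun z => (count_mem z t)%:R) (lam + rho).
Proof.
move=> hW dU; have [irr hU dl cl _] := dU.
have [S0 dS0] := dece hW.
have [S decS ->] : exists2 S, rep_decomposition W S & multiplicity U W = count (fun U' => `[< rep_iso U' U >]) S.
  exact: (@xgetPex _ 0%N [set k | exists2 s, rep_decomposition W s &
    k = count (fun U' => `[< rep_iso U' U >]) s] (ex_intro _ _ (ex_intro2 _ _ S0 dS0 erefl))).
have [L [-> tL HL]] := decd hW decS.
rewrite /alt_sum (eq_dsum _ (q' := fun z => (count_mem (lam + rho - z) (flatten [seq p.2 | p <- L]))%:R)); last first.
  by move=> z; rewrite (seq.permP tL).
rewrite [RHS](alt_sum_flatten (dominant_shift dl) HL) count_map; congr (_%:R).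
elim: L HL {tL} => //= p L IH HL; rewrite IH; last by move=> q qL; apply: HL; right.
have dp := HL p (or_introl erefl).
congr (_ + _)%N; congr nat_of_bool; rewrite (inj_eq (addIr _)); apply/asboolP/eqP.
  by move=> pU; rewrite (irr_data_lam alpha_simple dp dU pU).
by move=> E; apply: (isod dp); rewrite -E; exact: dU.
Qed.

Lemma alt_sum_component W t x : hasw W t -> sdom B x ->
  alt_sum Pos (fun z => (count_mem z t)%:R) x != 0 ->
  exists U lam s, [/\ irrd U lam s, x = lam + rho & (0 < multiplicity U W)%N].
Proof.
move=> hW sx ax; have [S decS] := dece hW.
have [L [SE tL HL]] := decd hW decS.
have aL : alt_sum Pos (fun z => (count_mem z t)%:R) x = (count (fun p => x == p.1.2 + rho) L)%:R.
  rewrite -(alt_sum_flatten sx HL); apply: eq_dsum => z; by rewrite (seq.permP tL).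
have [p pL xp] : exists2 p, List.In p L & x = p.1.2 + rho.
  have := ax; rewrite aL pnatr_eq0 -lt0n -has_count.
  elim: L {HL SE tL aL} => //= p L IH /orP[/eqP ->|/IH[q qL xq]]; first by exists p; [left|].
  by exists q; [right|].
exists p.1.1, p.1.2, p.2; have dp := HL p pL; split => //.
by rewrite lt0n -(pnatr_eq0 R) (multiplicity_alt_sum hW dp) -xp.
Qed.

(** The second moment is the trace form on h, which is kappa times the Killing form. Taking the
    trace of the Casimir element gives dim U times its scalar equal to kappa dim g, which fixes
    kappa. *)
Lemma irr_data_trace U lam s a : irrd U lam s ->
  \sum_(mu <- s) bform B mu a ^+ 2 = (rdim U)%:R * cas wt B lam / n%:R * bform B a a.
Proof.
move=> [irr [D [w [UD dw sw]]] dl cl [sl cU]].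
have cD := rep_iso_casimir (rep_iso_sym UD) cU.
rewrite (perm_big _ sw) /= codomE big_map big_enum /=.
have [kappa kE] := trace_form g_simple h_cartan alpha_simple be we ey yw yE BE Bpos dw.
have n0 : n%:R != 0 :> R.
  rewrite pnatr_eq0; have [[x [z xz]] _] := g_simple; rewrite dimv_eq0.
  apply/eqP => F0; have : x \in fullv by exact: memvf.
  by rewrite F0 memv0 => /eqP x0; move/eqP: xz; rewrite x0 lie0l.
apply: (fmorph_inj iota).
have E1 : iota (\sum_i bform B (w i) a ^+ 2) = kappa * iota (bform B a a).
  rewrite -BE -(killing_kd g_simple h_cartan alpha_simple be we) -kE !dw.
  rewrite rmorph_sum mulmx_diag mxtrace_diag; apply: eq_bigr => i _.
  by rewrite !mxE !BE rmorphXn.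
have E2 : (rdim U)%:R * iota (cas wt B lam) = kappa * n%:R.
  have := congr1 mxtrace cD; rewrite mxtrace_scalar (casimir_dual ey) linear_sum /=.
  rewrite (eq_bigr (fun=> kappa)); last by move=> i _; rewrite kE ey eqxx mulr1.
  by rewrite sumr_const card_ord mulr_natr (rep_iso_dim UD) mulr_natl => ->.
rewrite E1 !rmorphM fmorphV !rmorph_nat E2.
by rewrite mulfK// -(rmorph_nat iota) fmorph_eq0.
Qed.

(** The dual vector of a simple root is a bracket, and a commutator has trace 0. *)
Lemma has_weights_sum V s a : hasw V s -> \sum_(mu <- s) bform B mu a = 0.
Proof.
move=> [D [w [UD dw sw]]]; rewrite (perm_big _ sw) /= codomE big_map big_enum /=.
rewrite -bform_suml [a]row_sum_delta bform_sumr big1// => b _; rewrite bformZr.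
have [l wl] := simple_wt alpha_simple be we b; rewrite -wl bform_suml.
apply/eqP; rewrite mulf_eq0; apply/orP; right; apply/eqP/(fmorph_inj iota); rewrite rmorph0 rmorph_sum.
under eq_bigr do rewrite -BE.
transitivity (\tr (D (vsval (kd (wt l))))).
  by rewrite dw mxtrace_diag; apply: eq_bigr => i _; rewrite mxE.
by rewrite -(lie_dual_root g_simple h_cartan alpha_simple be we ey yw) rmx_lie linearB /= mxtrace_mulC subrr.
Qed.

Lemma cas_ge0 lam : dominant B lam -> 0 <= cas wt B lam.
Proof.
move=> dl; rewrite /cas two_rho_pos_roots bformDr bformZr addr_ge0//.
  by have [->|/Bpos/ltW//] := eqVneq lam 0; rewrite bform0l.
rewrite mulr_ge0// bformC//; apply: (dominant_ge0 Bsym Bpos dl) => b.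
by rewrite /half_sum mxE summxE mulr_ge0 ?invr_ge0// big_seq sumr_ge0// => a aP; exact: pos_roots_ge0.
Qed.

Lemma cas_gt0 lam : dominant B lam -> lam != 0 -> 0 < cas wt B lam.
Proof.
move=> dl l0; rewrite /cas two_rho_pos_roots bformDr bformZr ltr_wpDr// ?Bpos//.
rewrite mulr_ge0// bformC//; apply: (dominant_ge0 Bsym Bpos dl) => b.
by rewrite /half_sum mxE summxE mulr_ge0 ?invr_ge0// big_seq sumr_ge0// => a aP; exact: pos_roots_ge0.
Qed.

End Characters.

(** * The Plancherel measure *)

Section TensorWeights.
Context {R : realFieldType} {F : fieldType} {iota : {rmorphism R -> F}} {g : lieAlgebraType F} {h : {vspace g}} {r : nat}.
Variable alpha : r.-tuple (cartan_dual h).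
Local Notation hasw := (has_weights iota alpha).

(** Weight lists add under tensor products, so every multiplicative function has multiplicative sums
    over them. The ring [A] is free because the sums are later evaluated at complex exponentials. *)
Lemma has_weights_tensor (A : comPzRingType) m (V : 'I_m -> lierep g) (s : 'I_m -> seq 'rV[R]_r) (N : 'I_m -> nat) :
  (forall k, hasw (V k) (s k)) -> exists t : seq 'rV[R]_r, [/\ hasw (rep_tensor V N) t,
    forall f : 'rV[R]_r -> A, {morph f : x y / x + y >-> x * y} -> f 0 = 1 ->
      \sum_(v <- t) f v = \prod_k (\sum_(v <- s k) f v) ^+ N k
  & size t = (\prod_k size (s k) ^ N k)%N].
Proof.
move=> hV; rewrite /rep_tensor.
have tens_sum (s1 s2 : seq 'rV[R]_r) (f : 'rV[R]_r -> A) : {morph f : x y / x + y >-> x * y} ->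
    \sum_(v <- [seq a + b | a <- s1, b <- s2]) f v = (\sum_(v <- s1) f v) * (\sum_(v <- s2) f v).
  move=> fD; rewrite big_allpairs_dep /= mulr_suml; apply: eq_bigr => a _.
  by rewrite mulr_sumr; apply: eq_bigr => b _; rewrite fD.
have it n V0 s0 : hasw V0 s0 -> exists t : seq 'rV[R]_r, [/\ hasw (iter n (rep_tens V0) (rep_zero 1)) t,
    forall f : 'rV[R]_r -> A, {morph f : x y / x + y >-> x * y} -> f 0 = 1 -> \sum_(v <- t) f v = (\sum_(v <- s0) f v) ^+ n
    & size t = (size s0 ^ n)%N].
  move=> h0; elim: n => [|n [t [ht ft st]]].
    exists [:: 0]; split => //; first exact: (has_weights_zero iota alpha 1).
    by move=> f _ f0; rewrite big_seq1 f0 expr0.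
  exists [seq a + b | a <- s0, b <- t]; split; first exact: has_weights_tens.
    by move=> f fD f0; rewrite tens_sum// ft// exprS.
  by rewrite size_allpairs st expnS.
elim: (index_enum _) => [|k l [t [ht ft st]]].
  exists [:: 0]; split; first by rewrite big_nil; exact: (has_weights_zero iota alpha 1).
    by move=> f _ f0; rewrite big_seq1 f0 big_nil.
  by rewrite big_nil.
have [t1 [h1 f1 s1]] := it (N k) _ _ (hV k).
exists [seq a + b | a <- t1, b <- t]; split; first by rewrite big_cons; exact: has_weights_tens.
  by move=> f fD f0; rewrite tens_sum// big_cons f1// ft.
by rewrite size_allpairs big_cons s1 st.
Qed.

End TensorWeights.

(** * The complex case and the limit theorem *)

Section ComplexLie.
Context {R : realType} {g : lieAlgebraType R[i]} {h : {vspace g}} {r : nat}.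
Variable alpha : r.-tuple (cartan_dual h).
Local Notation io := (real_complex R : {rmorphism R -> R[i]}).
Hypothesis g_simple : simple_lie_algebra g.
Hypothesis h_cartan : cartan_subalgebra h.
Hypothesis alpha_simple : simple_roots alpha.
Local Notation n := (\dim {:g}).
Local Notation rc := (rcomb io alpha).
Local Notation kd a := (killing_dual (rc a)).
Variables (e : n.-tuple g) (wt : 'I_n -> 'rV[R]_r).
Hypothesis be : basis_of fullv e.
Hypothesis we : forall i, in_root_space (rc (wt i)) (tnth e i).
Hypothesis wint : forall i, nat_vec (wt i) \/ nat_vec (- wt i).
Variable y : 'I_n -> g.
Hypothesis ey : forall i j : 'I_n, killing (tnth e i) (y j) = (i == j)%:R.
Hypothesis yw : forall j, in_root_space (rc (- wt j)) (y j).
Hypothesis eE : forall z, z = \sum_(i < n) killing z (y i) *: tnth e i.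
Hypothesis yE : forall z, z = \sum_(i < n) killing z (tnth e i) *: y i.
Variable B : 'M[R]_r.
Hypothesis Bsym : B^T = B.
Hypothesis BE : forall a b, rc a (kd b) = io (bform B a b) :> R[i].
Hypothesis Bpos : forall a : 'rV[R]_r, a != 0 -> 0 < bform B a a.
Implicit Types (U W : lierep g) (s t : seq 'rV[R]_r) (lam : 'rV[R]_r).
Local Notation hasw := (has_weights io alpha).
Local Notation Pos := (pos_roots wt).
Local Notation rho := (half_sum Pos).
Local Notation irrd := (irr_data (iota := io) alpha wt B).

Let rho_dom := two_rho_dom g_simple h_cartan alpha_simple be we wint ey yw Bsym BE Bpos.
Let P1 := pos_roots_uniq g_simple h_cartan alpha_simple be we ey yw BE Bpos.

Lemma formE a b : Defs.form alpha a b = bform B a b.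
Proof.
rewrite /Defs.form /dual_form (killing_dualP (iota := io) g_simple h_cartan alpha_simple be we).
by rewrite [X in complex.Re X](BE a b).
Qed.

Lemma gramE : gram alpha = B.
Proof.
apply/matrixP => b c; rewrite mxE formE /bform /simple_coord -rowE trmx_delta -colE !mxE //.
Qed.

Lemma positive_rootsE : positive_roots alpha = [set` Pos].
Proof.
apply/seteqP; split => a /=.
  move=> [/(is_root_wt (iota := io) be we)[i ai wi] a0]; apply/pos_rootsP.
  have aw : a = wt i by apply: (rcomb_inj (iota := io) alpha_simple).
  by exists i => //; rewrite /pos_vec wi; apply/forallP => b; rewrite -aw.
move=> /pos_rootsP[i /andP[wi /forallP w0] ->]; split => //; split.
  apply: contra_neq wi => w0'; apply: (rcomb_inj (iota := io) alpha_simple).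
  by rewrite [LHS]w0' rcomb0.
exists (tnth e i); last exact: we.
apply/eqP => /(congr1 (coord e i)); rewrite coord_tnth ?(basis_free be)// linear0 eqxx => /eqP.
by rewrite oner_eq0.
Qed.

Lemma rhoE : Defs.rho alpha = rho.
Proof. by rewrite /Defs.rho positive_rootsE -fsbig_seq. Qed.

Lemma dominant_integralP lam : dominant_integral alpha lam <-> dominant B lam.
Proof.
split=> dl b; first by have := dl b; rewrite !formE => /natrP[k ->]; exists k.
by rewrite !formE; have [k ->] := dl b; exact: natr_nat.
Qed.

Lemma dominant_chamberE : dominant_chamber alpha = [set x | dom B x].
Proof. by apply/seteqP; split => a /= da b; have := da b; rewrite formE. Qed.

Lemma dominant_dom lam : dominant B lam -> dom B lam.
Proof.
move=> dl b; have [k kE] := dl b; have := ler0n R k; rewrite -kE.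
have b0 : 0 < bform B (delta_mx 0 b) (delta_mx 0 b).
  by apply: Bpos; apply/eqP => /rowP/(_ b)/eqP; rewrite !mxE !eqxx oner_eq0.
by rewrite pmulr_lge0 ?invr_gt0// pmulr_rge0.
Qed.

Lemma highest_weight_data U lam : rep_irreducible U -> highest_weight alpha U lam -> exists s, irrd U lam s.
Proof.
move=> irr [v [v0 vH vk]].
apply: (irr_data_hw g_simple h_cartan alpha_simple be we wint ey yw eE yE Bsym BE Bpos rho_dom irr v0 vH) => l wl.
apply: (vk (wt l)); last exact: we.
by rewrite positive_rootsE; apply/pos_rootsP; exists l.
Qed.

Lemma limit_densityE a : limit_density alpha a = dens B Pos a.
Proof.
rewrite /limit_density /dens gramE positive_rootsE rhoE -fsbig_seq; last exact: P1.
have -> : (2 * pi) `^ (r%:R / 2) = Num.sqrt (2 * pi) ^+ r :> R.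
  by rewrite [r%:R / 2]mulrC powRrM powR_mulrn ?powR_ge0// powR12_sqrt// mulr_ge0// pi_ge0.
have -> : \prod_(b <- Pos) (Defs.form alpha a b ^+ 2 / Defs.form alpha rho b) = root_prod B Pos a ^+ 2 / root_prod B Pos rho.
  rewrite big_split /= prodfV /root_prod -prodrXl; congr (_ * _^-1).
    by apply: eq_bigr => b _; rewrite formE.
  by apply: eq_bigr => b _; rewrite formE.
have -> : \sum_b \sum_c a 0 b * B b c * a 0 c = bform B a a by rewrite bformE.
by rewrite /gaussB /gauss_const mulNr invfM invf_div; ring.
Qed.

Section Multiplicities.
Variable V : 'rV[R]_r -> lierep g.
Hypothesis V_hw : forall lam, dominant_integral alpha lam -> rep_irreducible (V lam) /\ highest_weight alpha (V lam) lam.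

Lemma V_data lam : dominant B lam -> exists s, irrd (V lam) lam s.
Proof. by move=> /dominant_integralP/V_hw[irr hw]; exact: highest_weight_data. Qed.

Local Notation mult t x := (alt_sum Pos (fun z => (count_mem z t)%:R : R) x).
Let mult_alt W t U lam s := @multiplicity_alt_sum _ _ io _ _ _ alpha g_simple h_cartan alpha_simple e wt be we wint y ey yw eE yE B Bsym BE Bpos W t U lam s.

(** By uniqueness of the irreducible module of given highest weight, positivity of a multiplicity
    can be read on the alternating sum at [lam + rho]. *)
Lemma component_weightsP W t lam : hasw W t ->
  component_weights alpha W lam <-> dominant B lam /\ mult t (lam + rho) != 0.
Proof.
move=> hW; split=> [[U [irr hw m0]]|[dl m0]].
  have [s dU] := highest_weight_data irr hw; have [_ _ dl _ _] := dU; split => //.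
  by rewrite -(mult_alt hW dU) pnatr_eq0 -lt0n.
have [s dU] := V_data dl; have [irr hw] := V_hw ((dominant_integralP lam).2 dl).
by exists (V lam); split => //; rewrite lt0n -(pnatr_eq0 R) (mult_alt hW dU).
Qed.

Lemma mult_component W t x : hasw W t -> sdom B x -> mult t x != 0 -> exists2 lam, dominant B lam & x = lam + rho.
Proof.
move=> hW sx m0; have [U [lam [s [[_ _ dl _ _] xE _]]]] :=
  alt_sum_component g_simple h_cartan alpha_simple be we wint ey yw eE yE Bsym BE Bpos hW sx m0.
by exists lam.
Qed.

Lemma mult_ge0 W t x : hasw W t -> sdom B x -> 0 <= mult t x.
Proof.
move=> hW sx; have [->//|m0] := eqVneq (mult t x) 0.
have [lam dl ->] := mult_component hW sx m0; have [s dU] := V_data dl.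
by rewrite -(mult_alt hW dU).
Qed.

(** The sum of multiplicity times dimension over the irreducible components is the total dimension;
    with the dimension formula this says that the Plancherel masses add up to 1. *)
Lemma mult_mass W t (S : seq 'rV[R]_r) : hasw W t -> uniq S -> (forall x, mult t x != 0 -> x \in S) ->
  \sum_(x <- S | `[< sdom B x >]) mult t x * root_prod B Pos x = root_prod B Pos rho * (size t)%:R.
Proof.
move=> hW uS SP.
have [S0 dS0] := decomposition_exists g_simple h_cartan alpha_simple be we wint ey yw eE yE Bsym BE Bpos rho_dom hW.
have [L [_ tL HL]] := decomposition_data g_simple h_cartan alpha_simple be we wint ey yw eE yE Bsym BE Bpos rho_dom hW dS0.
have mE x : sdom B x -> mult t x = (count (fun p => x == p.1.2 + rho) L)%:R.
  move=> sx; rewrite -(alt_sum_flatten g_simple h_cartan alpha_simple be we wint ey yw eE yE Bsym BE Bpos sx HL).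
  by apply: eq_dsum => z; rewrite (seq.permP tL).
have shift lam : dominant B lam -> sdom B (lam + rho).
  exact: (dominant_shift g_simple h_cartan alpha_simple be we wint ey yw Bsym BE Bpos).
have LS p : List.In p L -> p.1.2 + rho \in S.
  move=> pL; have [_ _ dl _ _] := HL p pL; apply: SP; rewrite mE; last exact: shift.
  rewrite pnatr_eq0 -lt0n -has_count; elim: (L) pL => //= q L' IH [->|/IH ->]; first by rewrite eqxx.
  by rewrite orbT.
rewrite (perm_size tL); under eq_bigr => x /asboolP sx do rewrite mE//.
have p0 : root_prod B Pos rho != 0.
  rewrite gt_eqF// /root_prod big_seq prodr_gt0// => b bP.
  apply: (sdom_Pos_gt0 Bsym (@pos_roots_neq0 _ _ _ _ wt) (@pos_roots_ge0 _ _ _ _ wt) _ bP).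
  apply: (rho_sdom Bsym Bpos P1 (@pos_roots_ge0 _ _ _ _ wt) (simple_pos_roots alpha_simple be we)).
  exact: (refl_pos_roots g_simple h_cartan alpha_simple be we wint ey yw BE Bpos).
elim: L HL LS {tL mE} => [_ _|p L IH HL LS] /=.
  by rewrite big1 ?mulr0// => x _; rewrite mul0r.
have dp := HL p (or_introl erefl); have [_ hU dl _ _] := dp.
under eq_bigr do rewrite natrD mulrDl.
rewrite big_split /= IH; last 2 first.
- by move=> q qL; apply: HL; right.
- by move=> q qL; apply: LS; right.
rewrite size_cat natrD mulrDr; congr (_ + _).
rewrite (has_weights_size hU) (irr_data_dim g_simple h_cartan alpha_simple be we wint ey yw eE yE Bsym BE Bpos dp).
rewrite [RHS]mulrCA mulfV// mulr1 big_mkcond (bigD1_seq (p.1.2 + rho)) //=; last by apply: LS; left.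
rewrite eqxx mul1r asboolT; last exact: shift.
by rewrite big1 ?addr0// => x xp; rewrite (negPf xp) mul0r if_same.
Qed.

Lemma casimir_scalarE U lam s : irrd U lam s -> casimir_scalar U = io (cas wt B lam).
Proof.
move=> [[d0 _] _ _ _ [_ cU]]; rewrite /casimir_scalar.
have := @xgetPex _ 0 [set k | casimir U = k%:M] (ex_intro _ _ cU); rewrite /= cU => /matrixP/(_ (Ordinal d0) (Ordinal d0)).
by rewrite !mxE eqxx !mulr1n.
Qed.

Lemma dimg_gt0 : 0 < n%:R :> R.
Proof.
rewrite ltr0n lt0n; have [[x [z xz]] _] := g_simple; rewrite dimv_eq0.
apply/eqP => F0; have : x \in fullv by exact: memvf.
by rewrite F0 memv0 => /eqP x0; move/eqP: xz; rewrite x0 lie0l.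
Qed.

Section Limit.
Variables (m : nat) (nu : 'I_m -> 'rV[R]_r) (tau : 'I_m -> R) (xx : R) (eps : nat -> R) (N : nat -> 'I_m -> nat).
Hypothesis nu_dom : forall k, dominant B (nu k).
Hypothesis xE : xx = \sum_k tau k * (cas wt B (nu k) / n%:R).
Hypothesis xx_gt0 : 0 < xx.
Hypothesis eps_gt0 : forall n, 0 < eps n.
Hypothesis eps0 : eps @ \oo --> (0 : R).
Hypothesis NE : forall n k, (N n k)%:R = tau k / eps n.

Lemma plancherel_limit : \int[lebesgue_rV r]_(a in [set z | dom B z]) dens B Pos a = 1 /\
  forall (f : 'rV[R]_r -> R) (M : R), {within [set z | dom B z], continuous f} -> (forall a, dom B a -> `|f a| <= M) ->
  (fun n => \sum_(lam \in component_weights alpha (rep_tensor (V \o nu) (N n)))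
     f (Num.sqrt (eps n / xx) *: lam) * plancherel V nu (N n) lam) @ \oo -->
  \int[lebesgue_rV r]_(a in [set z | dom B z]) (f a * dens B Pos a).
Proof.
have [s sP] := choice (fun k => V_data (nu_dom k)).
have hs k : hasw ((V \o nu) k) (s k) by have [] := sP k.
have s_size k : size (s k) = rdim (V (nu k)) by exact: (has_weights_size (hs k)).
have [t tP] := choice (fun l => has_weights_tensor R[i] (N l) hs).
have ht l : hasw (rep_tensor (V \o nu) (N l)) (t l) by have [] := tP l.
have t_char l (f : 'rV[R]_r -> R[i]) : {morph f : x z / x + z >-> x * z} -> f 0 = 1 ->
    \sum_(v <- t l) f v = \prod_k (\sum_(v <- s k) f v) ^+ N l k by have [_ + _] := tP l; apply.
have t_size l : size (t l) = (\prod_k size (s k) ^ N l k)%N by have [] := tP l.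
have s_gt0 k : (0 < size (s k))%N by rewrite s_size; have [[]] := sP k.
have s_mean k a : \sum_(v <- s k) bform B v a = 0.
  exact: (has_weights_sum g_simple h_cartan alpha_simple be we ey yw BE a (hs k)).
have s_var k a : \sum_(v <- s k) bform B v a ^+ 2 = (size (s k))%:R * (cas wt B (nu k) / n%:R) * bform B a a.
  by rewrite s_size mulrA (irr_data_trace g_simple h_cartan alpha_simple be we ey yw yE BE Bpos a (sP k)).
have t_refl l b x : count_mem (refl B b x) (t l) = count_mem x (t l).
  exact: (weight_count_simple g_simple h_cartan alpha_simple be we ey yw BE Bpos b x (ht l)).
have supp l x : mult (t l) x != 0 -> x \in omega_supp Pos t l by exact: mult_u_supp.
have u_ge0 l x : sdom B x -> 0 <= mult_u Pos t l x by exact: (mult_ge0 (ht l)).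
have u_dom l x : sdom B x -> mult_u Pos t l x != 0 -> dom B (x - rho).
  by move=> sx /(mult_component (ht l) sx)[lam dl ->]; rewrite addrK; exact: dominant_dom.
have u_mass l : \sum_(x <- omega_supp Pos t l | `[< sdom B x >]) mult_u Pos t l x * root_prod B Pos x =
    root_prod B Pos rho * (size (t l))%:R.
  exact: (mult_mass (ht l) (undup_uniq _) (@supp l)).
have P2 := @pos_roots_neq0 _ _ _ _ wt; have P3 := @pos_roots_ge0 _ _ _ _ wt; have P4 := simple_pos_roots alpha_simple be we.
have P5 := refl_pos_roots g_simple h_cartan alpha_simple be we wint ey yw BE Bpos.
have P6 := pos_roots_int g_simple h_cartan alpha_simple be we ey yw BE Bpos.
split; first exact: (chamber_dens1 Bsym Bpos P1 P2 P3 P4 P5 P6 s_gt0 s_mean s_var xE xx_gt0 eps_gt0 eps0 NE t_char t_size t_refl u_ge0 u_mass).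
move=> f M cf fM.
have lim := chamber_limit Bsym Bpos P1 P2 P3 P4 P5 P6 s_gt0 s_mean s_var xE xx_gt0 eps_gt0 eps0 NE t_char t_size t_refl u_ge0 u_dom u_mass cf fM.
rewrite (_ : (fun l => _) = (fun l => chamber_sum B Pos t l (fun x => f (delta xx eps l *: (x - rho)))))//.
apply/funext => l; set W := rep_tensor _ _.
(* Translation by [rho] matches the highest weights of the components with the points of the open
   chamber where the alternating sum is nonzero. *)
have -> : component_weights alpha W = [set` [seq x - rho | x <- omega_supp Pos t l & `[< sdom B x >] && (mult (t l) x != 0)]].
  apply/seteqP; split => lam /=.
    move=> /(component_weightsP _ (ht l))[dl m0]; apply/mapP; exists (lam + rho); last by rewrite addrK.
    rewrite mem_filter m0 supp// andbT; apply/andP; split => //; apply/asboolP.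
    exact: (dominant_shift g_simple h_cartan alpha_simple be we wint ey yw Bsym BE Bpos).
  move=> /mapP[x]; rewrite mem_filter => /andP[/andP[/asboolP sx m0] _] ->.
  have [lam' dl xE'] := mult_component (ht l) sx m0.
  by apply/(component_weightsP _ (ht l)); rewrite xE' addrK -xE'.
rewrite -fsbig_seq; last by rewrite map_inj_uniq ?filter_uniq ?undup_uniq//; exact: addIr.
rewrite big_map big_filter /chamber_sum big_mkcond [RHS]big_mkcond /=; apply: eq_bigr => x _.
case: asboolP => //= sx; have [m0|m0] := eqVneq (mult (t l) x) 0; first by rewrite /chamber_mass /mult_u m0 !mul0r.
have [lam dl xE'] := mult_component (ht l) sx m0; have [s' dU] := V_data dl.
rewrite mulrC; congr (_ * _); rewrite /plancherel /chamber_mass /mult_u xE' addrK.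
rewrite (mult_alt (ht l) dU) (irr_data_dim g_simple h_cartan alpha_simple be we wint ey yw eE yE Bsym BE Bpos dU).
have -> : (size (t l))%:R = \prod_k (rdim (V (nu k)))%:R ^+ N l k :> R.
  by rewrite t_size natr_prod; apply: eq_bigr => k _; rewrite natrX s_size.
by rewrite invfM !mulrA.
Qed.

End Limit.

End Multiplicities.
End ComplexLie.

Theorem theorem3 (R : realType) (g : lieAlgebraType R[i])
  (g_simple : simple_lie_algebra g)
  (h : {vspace g}) (h_cartan : cartan_subalgebra h)
  (r : nat) (alpha : r.-tuple (cartan_dual h))
  (alpha_simple : simple_roots alpha)
  (V : 'rV[R]_r -> lierep g)
  (V_hw : forall lam, dominant_integral alpha lam ->
     rep_irreducible (V lam) /\ highest_weight alpha (V lam) lam)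
  (m : nat) (nu : 'I_m -> 'rV[R]_r)
  (nu_dom : forall k, dominant_integral alpha (nu k))
  (tau : 'I_m -> R) (tau_ge0 : forall k, 0 <= tau k)
  (tau_nu : exists k, 0 < tau k /\ nu k != 0)
  (x : R)
  (x_def : x = (\dim {:g})%:R^-1 *
     \sum_(k < m) tau k * complex.Re (casimir_scalar (V (nu k)))) :
  [/\ forall a, dominant_chamber alpha a -> 0 <= limit_density alpha a,
      (\int[lebesgue_rV r]_(a in dominant_chamber alpha)
         (limit_density alpha a)%:E = 1)%E
    & forall (f : 'rV[R]_r -> R) (eps : nat -> R) (N : nat -> 'I_m -> nat),
        {within dominant_chamber alpha, continuous f} ->
        (exists M : R, forall a, dominant_chamber alpha a -> `|f a| <= M) ->
        (forall n, 0 < eps n) ->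
        eps @ \oo --> (0 : R) ->
        (forall n k, (N n k)%:R = tau k / eps n) ->
        (fun n => \sum_(lam \in component_weights alpha
                                  (rep_tensor (V \o nu) (N n)))
           f (Num.sqrt (eps n / x) *: lam) * plancherel V nu (N n) lam)
        @ \oo -->
        \int[lebesgue_rV r]_(a in dominant_chamber alpha)
          (f a * limit_density alpha a)].
Proof.
have [e [wt [be we wint]]] := real_root_basis (iota := (real_complex R : {rmorphism R -> R[i]})) h_cartan alpha_simple.
have [y [ey yw eE yE]] := dual_root_basis g_simple h_cartan alpha_simple be we.
have [B [Bsym BE Bpos]] := root_gram g_simple h_cartan alpha_simple be we ey yw.
have domE := dominant_chamberE g_simple h_cartan alpha_simple be we BE.
have densE := limit_densityE g_simple h_cartan alpha_simple be we ey yw BE Bpos.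
have nuB k : dominant B (nu k) by apply/(dominant_integralP g_simple h_cartan alpha_simple be we BE).
have nE := dimg_gt0 g_simple.
have lim := plancherel_limit g_simple h_cartan alpha_simple be we wint ey yw eE yE Bsym BE Bpos V_hw.
have xE : x = \sum_k tau k * (cas wt B (nu k) / (\dim {:g})%:R).
  rewrite x_def mulr_sumr; apply: eq_bigr => k _.
  have [s dU] := V_data g_simple h_cartan alpha_simple be we wint ey yw eE yE Bsym BE Bpos V_hw (nuB k).
  by rewrite (casimir_scalarE dU) /= mulrCA [_^-1 * _]mulrC.
have x_gt0 : 0 < x.
  rewrite xE; have [k [tk nk]] := tau_nu; rewrite (bigD1 k)//= ltr_pwDl//.
    by rewrite mulr_gt0// divr_gt0// (cas_gt0 wt Bsym Bpos (nuB k) nk).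
  by apply: sumr_ge0 => l _; rewrite mulr_ge0// divr_ge0 ?(ltW nE)// (cas_ge0 wt Bsym Bpos (nuB l)).
split.
- move=> a _; rewrite densE.
  apply: (dens_ge0 Bsym Bpos (pos_roots_uniq g_simple h_cartan alpha_simple be we ey yw BE Bpos)
    (@pos_roots_neq0 _ _ _ _ wt) (@pos_roots_ge0 _ _ _ _ wt) (simple_pos_roots alpha_simple be we)).
  exact: (refl_pos_roots g_simple h_cartan alpha_simple be we wint ey yw BE Bpos).
(* The given [tau] may admit no sequence with integral exponents. The normalization does not depend
   on [tau], so it is obtained from the powers of one nontrivial module, with tau = 1, eps = 1/(l+1)
   and N = l+1. *)
- have [k [_ nk]] := tau_nu.
  have c_gt0 : 0 < cas wt B (nu k) / (\dim {:g})%:R by rewrite divr_gt0// (cas_gt0 wt Bsym Bpos (nuB k) nk).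
  have [||||||int1 _] := lim 1%N (fun=> nu k) (fun=> 1) (cas wt B (nu k) / (\dim {:g})%:R) (fun l => l.+1%:R^-1) (fun l _ => l.+1).
  + by move=> _; exact: nuB.
  + by rewrite big_ord1 mul1r.
  + exact: c_gt0.
  + by move=> l; rewrite invr_gt0.
  + exact: cvg_harmonic.
  + by move=> l _; rewrite invrK mul1r.
  move: int1; rewrite domE /Rintegral; under eq_integral do rewrite -densE.
  (* An infinite integral would have real part 0 by convention, which differs from 1. *)
  by case: (integral _ _ _) => /= [v ->//|/eqP|/eqP]; rewrite eq_sym oner_eq0.
- move=> f eps N; rewrite domE => cf [M fM] eps_gt0 eps0 NE.
  have [_ /(_ f M cf fM)] := lim m nu tau x eps N nuB xE x_gt0 eps_gt0 eps0 NE.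
  by under [X in _ -> _ --> X]eq_Rintegral do rewrite densE.
Qed.
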